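(* Let $N\ge1$ be an integer, $\alpha>0$ and $\gamma$ be such that $0<\gamma<N$ and $\gamma<2/\alpha$. Let $q_c(\gamma)=\frac{N\alpha}{2-\gamma\alpha}$. Consider the integral equation on $\mathbb R^N$ $$u(t)=e^{t\Delta}u_0+\int_0^te^{(t-\sigma)\Delta}\big[|u(\sigma)|^\alpha u(\sigma)\big]\,d\sigma .\qquad(\ast)$$ (i) If $\gamma(\alpha+1)<N$ and $q$ is such that $q>\frac{N(\alpha+1)}{N-\gamma(\alpha+1)}$, $q>q_c(\gamma)$ and $q\le\infty$, then $(\ast)$ is locally well-posed in $L^q_\gamma(\mathbb R^N)$. More precisely, given $u_0\in L^q_\gamma(\mathbb R^N)$, there exist $T>0$ and a unique solution $u\in C([0,T];L^q_\gamma(\mathbb R^N))$ of $(\ast)$ (if $q=\infty$, $[0,T]$ is replaced by $(0,T]$ and $u$ satisfies $\lim_{t\to0}\|u(t)-e^{t\Delta}u_0\|_{L^\infty_\gamma}=0$). Moreover, $u$ can be extended to a maximal interval $[0,T_{\max})$ such that either $T_{\max}=\infty$, or $T_{\max}<\infty$ and $\lim_{t\to T_{\max}}\|u(t)\|_{L^q_\gamma}=\infty$. (ii) Assume that $q>q_c(\gamma)$ and $\frac N{N-\gamma}<q\le\infty$. Then, given $u_0\in L^q_\gamma(\mathbb R^N)$, there exist $T>0$ and a solution $u\in C([0,T];L^q_\gamma(\mathbb R^N))$ of $(\ast)$, which is unique among the functions $u\in C([0,T];L^q_\gamma(\mathbb R^N))$ for which moreover $t^{\frac N2\left(\frac1q-\frac1r\right)+\frac{\nu\alpha}2}\|u(t)\|_{L^r_\nu}$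 is bounded on $(0,T]$, where $r=(\alpha+1)q$ and $\nu(\alpha+1)=\gamma$ (if $q=\infty$, $[0,T]$ is replaced by $(0,T]$ and $u$ satisfies $\lim_{t\to0}\|u(t)-e^{t\Delta}u_0\|_{L^\infty_\gamma}=0$). Moreover, $u$ can be extended to a maximal interval $[0,T_{\max})$ such that either $T_{\max}=\infty$, or $T_{\max}<\infty$ and $\lim_{t\to T_{\max}}\|u(t)\|_{L^q_\gamma}=\infty$. Furthermore, in the case $T_{\max}<\infty$, $$\|u(t)\|_{L^q_\gamma}\ \ge\ C\,(T_{\max}-t)^{\frac N{2q}-\frac{2-\gamma\alpha}{2\alpha}},\qquad\forall\,t\in[0,T_{\max}),$$ where $C$ is a positive constant.
   Context: For $\gamma\geq 0$ and $1\le q\le\infty$, $L^q_\gamma(\mathbb R^N)$ is the space of measurable $f:\mathbb R^N\to\mathbb R$ with $|\cdot|^\gamma f\in L^q(\mathbb R^N)$, normed by $\|f\|_{L^q_\gamma}=\||\cdot|^\gamma f\|_{L^q(\mathbb R^N)}$. $e^{t\Delta}$ is the heat semigroup on $\mathbb R^N$; $1/\infty=0$, and $r=\infty$ if $q=\infty$. *)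

(* Defs.v *)
From HB Require Import structures.
From mathcomp Require Import all_boot all_order all_algebra.
From mathcomp Require Import all_classical all_reals all_analysis.

Set Implicit Arguments.
Unset Strict Implicit.
Unset Printing Implicit Defensive.

Import Order.TTheory GRing.Theory Num.Theory.
Import numFieldNormedType.Exports.

Local Open Scope classical_set_scope.
Local Open Scope ring_scope.

(* The library equips n-tuples with the product sigma-algebra; here it is the
   Borel sigma-algebra of R^n. *)
Notation Rn R n := (n.-tuple (measurableTypeR R)).

Section lebesgue_measure_Rn.
Context {R : realType}.
Local Open Scope ereal_scope.

Definition Rn_cons n (p : measurableTypeR R * Rn R n) : Rn R n.+1 :=
  [tuple of p.1 :: p.2].

Lemma measurable_Rn_cons n : measurable_fun [set: _] (@Rn_cons n).
Proof. exact: measurable_cons. Qed.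

Lemma Rn_consK n (a : measurableTypeR R) (x : Rn R n) :
  (thead (Rn_cons (a, x)) = a) * ([tuple of behead (Rn_cons (a, x))] = x).
Proof. by split; [rewrite /thead tnth0|exact: val_inj]. Qed.

Section successor.
Variables (n : nat) (mu : {sigma_finite_measure set (Rn R n) -> \bar R}).

Definition lebesgue_cons : set (Rn R n.+1) -> \bar R :=
  pushforward (@lebesgue_measure R \x mu) (@Rn_cons n).

Let mpre A : measurable A -> measurable (@Rn_cons n @^-1` A).
Proof. by move=> mA; rewrite -[X in measurable X]setTI; exact: measurable_Rn_cons. Qed.

Let lebesgue_cons0 : lebesgue_cons set0 = 0.
Proof. by rewrite /lebesgue_cons /pushforward preimage_set0 measure0. Qed.

Let lebesgue_cons_ge0 A : 0 <= lebesgue_cons A.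
Proof. by rewrite /lebesgue_cons /pushforward measure_ge0. Qed.

Let lebesgue_cons_sigma_additive : semi_sigma_additive lebesgue_cons.
Proof.
move=> F mF tF mUF; rewrite /lebesgue_cons /pushforward preimage_bigcup.
apply: measure_semi_sigma_additive.
- by move=> k; exact: mpre.
- apply/trivIsetP => /= i j _ _ ij; rewrite -preimage_setI.
  by move/trivIsetP : tF => /(_ _ _ _ _ ij) ->//; rewrite preimage_set0.
- by rewrite -preimage_bigcup; exact: mpre.
Qed.

HB.instance Definition _ := isMeasure.Build _ _ _ lebesgue_cons
  lebesgue_cons0 lebesgue_cons_ge0 lebesgue_cons_sigma_additive.

Let lebesgue_cons_sigma_finite : sigma_finite setT lebesgue_cons.
Proof.
have /sigma_finiteP[F [TF ndF Foo]] := sigma_finiteT (@lebesgue_measure R).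
have /sigma_finiteP[G [TG ndG Goo]] := sigma_finiteT mu.
exists (fun k => [set x | F k (thead x) /\ G k [tuple of behead x]]).
  apply/esym; rewrite -subTset => x _.
  have /= [i _ Fi] : (\bigcup_i F i) (thead x) by rewrite -TF.
  have /= [j _ Gj] : (\bigcup_i G i) [tuple of behead x] by rewrite -TG.
  exists (maxn i j) => //; split.
    by move: Fi; apply/subsetPset/ndF; rewrite leq_maxl.
  by move: Gj; apply/subsetPset/ndG; rewrite leq_maxr.
move=> k; have [mF Fk] := Foo k; have [mG Gk] := Goo k; split.
  apply: measurableI.
    by rewrite -[X in measurable X]setTI; exact: measurable_tnth.
  by rewrite -[X in measurable X]setTI; exact: measurable_behead.
rewrite /lebesgue_cons /pushforward.
rewrite (_ : _ @^-1` _ = F k `*` G k).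
  by rewrite product_measure1E// lte_mul_pinfty// ge0_fin_numE.
apply/seteqP; split => -[a x] [h1 h2]; have [e1 e2] := Rn_consK a x;
  by split; move: h1 h2; rewrite /= ?e1 ?e2.
Qed.

HB.instance Definition _ := @Measure_isSigmaFinite.Build _ _ _
  lebesgue_cons lebesgue_cons_sigma_finite.

End successor.

Definition lebesgue_nil : {sigma_finite_measure set (Rn R 0) -> \bar R} :=
  dirac [tuple].

Fixpoint lebesgue_Rn n : {sigma_finite_measure set (Rn R n) -> \bar R} :=
  match n with
  | 0 => lebesgue_nil
  | n'.+1 => lebesgue_cons (lebesgue_Rn n')
  end.

Lemma lebesgue_Rn_box n (A : 'I_n -> set R) : (forall i, measurable (A i)) ->
  lebesgue_Rn n [set x : Rn R n | forall i, A i (tnth x i)]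
  = \prod_(i < n) @lebesgue_measure R (A i).
Proof.
elim: n A => [|n ih] A mA.
  rewrite big_ord0 /= diracE.
  by rewrite (_ : _ \in _ = true)//; apply/mem_set => -[].
rewrite big_ord_recl -ih; last by move=> i; exact: mA.
rewrite /= /lebesgue_cons /pushforward.
rewrite -product_measure1E//; last first.
  have -> : [set x : Rn R n | forall i, A (lift ord0 i) (tnth x i)]
      = \bigcap_(i in [set: 'I_n]) ((@tnth n _)^~ i @^-1` A (lift ord0 i)).
    by apply/seteqP; split => [x h i _|x h i]; [exact: (h i)|exact: (h i I)].
  apply: fin_bigcap_measurable => // i _.
  by rewrite -[X in measurable X]setTI; apply: measurable_tnth => //; exact: mA.
  exact: mA.
congr (_ _); apply/seteqP; split => -[a x] /= h.
  split; first by have := h ord0; rewrite tnth0.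
  by move=> i; have := h (lift ord0 i); rewrite tnthS.
by move=> i; case: (unliftP ord0 i) => [j|] ->; rewrite ?tnthS ?tnth0; apply h.
Qed.

End lebesgue_measure_Rn.

Section weighted_lebesgue_spaces.
Context {R : realType} {N : nat}.
Implicit Types (f : Rn R N -> R) (x : Rn R N) (gamma : R) (q : \bar R).

Definition euclidean_norm x : R := Num.sqrt (\sum_(i < N) (tnth x i : R) ^+ 2).

Definition weighted_norm gamma q f : \bar R :=
  'N[lebesgue_Rn N]_q[EFin \o (fun x => euclidean_norm x `^ gamma * f x)].

(* Elements are functions; they are identified below when equal a.e. *)
Definition weighted_Lq gamma q : set (Rn R N -> R) :=
  [set f | measurable_fun [set: Rn R N] f /\ (weighted_norm gamma q f < +oo)%E].

End weighted_lebesgue_spaces.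

Section heat_semigroup.
Context {R : realType} {N : nat}.

Definition heat_kernel (t : R) (x y : Rn R N) : R :=
  (4 * pi * t) `^ (- (N%:R / 2)) *
  expR (- (\sum_(i < N) ((tnth x i : R) - (tnth y i : R)) ^+ 2) / (4 * t)).

Definition heat (t : R) (f : Rn R N -> R) : Rn R N -> R := fun x =>
  if t == 0 then f x
  else \int[lebesgue_Rn N]_y (heat_kernel t x y * f y).

End heat_semigroup.

Section mild_solutions.
Context {R : realType} {N : nat}.
Variables (alpha gamma : R) (q : \bar R).
Implicit Types (u w : R -> Rn R N -> R) (J : set R).

Definition nonlinearity (f : Rn R N -> R) : Rn R N -> R :=
  fun x => `|f x| `^ alpha * f x.

Definition duhamel u (t : R) : Rn R N -> R := fun x =>
  \int[lebesgue_measure]_(s in `[0, t]) heat (t - s) (nonlinearity (u s)) x.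

(* The L^q_gamma-valued time integral is evaluated at almost every point x, where
   the integrals in space and time are required to converge absolutely.
   At t = 0 the equation reads u(0) = u0. *)
Definition integral_equation (u0 : Rn R N -> R) J u : Prop :=
  forall t, J t -> {ae lebesgue_Rn N, forall x,
    [/\ {ae lebesgue_measure, forall s : R, 0 < s < t ->
          (lebesgue_Rn N).-integrable [set: Rn R N] (fun y =>
            (heat_kernel (t - s) x y * nonlinearity (u s) y)%:E)},
        lebesgue_measure.-integrable `[0, t] (fun s =>
            (heat (t - s) (nonlinearity (u s)) x)%:E)
      & u t x = heat t u0 x + duhamel u t x]}.

Definition continuous_in_weighted_Lq J u : Prop :=
  (forall t, J t -> weighted_Lq gamma q (u t)) /\
  (forall s, J s ->
    weighted_norm gamma q (u t \- u s) @[t --> within J (nbhs s)] --> 0%E).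

(* J is [0, T] or [0, T[.  For q = oo, continuity is not asked at time 0, where
   instead u(t) - e^(t Delta) u0 vanishes in norm. *)
Definition solution (u0 : Rn R N -> R) J u : Prop :=
  [/\ continuous_in_weighted_Lq (if q == +oo%E then J `\ 0 else J) u,
      q = +oo%E ->
        weighted_norm gamma q (u t \- heat t u0) @[t --> 0^'+] --> 0%E
    & integral_equation u0 J u].

(* Boundedness on ]0, T'] for every T' in J: for J = [0, T] this is boundedness on
   ]0, T], for J = [0, T[ it is local. *)
Definition auxiliary_bound J u : Prop :=
  let r := ((alpha + 1)%:E * q)%E in
  let nu := gamma / (alpha + 1) in
  let e := N%:R / 2 * (fine q^-1%E - fine r^-1%E) + nu * alpha / 2 in
  forall T', J T' -> exists M : R, forall t, 0 < t <= T' ->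
    ((t `^ e)%:E * weighted_norm nu r (u t) <= M%:E)%E.

Definition bounded_solution (u0 : Rn R N -> R) J u : Prop :=
  solution u0 J u /\ auxiliary_bound J u.

Definition eq_on J u w : Prop :=
  forall t, J t -> {ae lebesgue_Rn N, forall x, u t x = w t x}.

Definition interval_to (Tmax : \bar R) : set R :=
  [set t | 0 <= t /\ (t%:E < Tmax)%E].

(* w extends u from [0, T] to [0, Tmax[ and has itself no extension, both within
   the class P of functions on time intervals. *)
Definition maximal_extension (P : set R -> (R -> Rn R N -> R) -> Prop)
    (T : R) u (Tmax : \bar R) w : Prop :=
  [/\ (T%:E < Tmax)%E, P (interval_to Tmax) w, eq_on `[0, T] w u
    & forall (T' : R) v, (Tmax <= T'%:E)%E -> P `[0, T']%classic v ->
        ~ eq_on (interval_to Tmax) v w].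

Definition blowup_alternative (Tmax : \bar R) w : Prop :=
  Tmax = +oo%E \/
  exists2 T : R, Tmax = T%:E &
    weighted_norm gamma q (w t) @[t --> T^'-] --> +oo%E.

End mild_solutions.

(* Main.v *)
Require Import Defs.
From HB Require Import structures.
From mathcomp Require Import all_boot all_order all_algebra.
From mathcomp Require Import all_classical all_reals all_analysis.
From mathcomp Require Import measurable_realfun ess_sup_inf normal_distribution.
From mathcomp Require Import ring lra.

Set Implicit Arguments.
Unset Strict Implicit.
Unset Printing Implicit Defensive.

Import Order.TTheory GRing.Theory Num.Theory.
Import numFieldNormedType.Exports.

Local Open Scope classical_set_scope.
Local Open Scope ring_scope.

(** The weight [|y|^-a], [0 <= a < N], is heat-bounded: [|x|^b \int K_t(x,y) |y|^-a dy] is at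
    most [C t^(-(a-b)/2)] for [0 <= b <= a]. With Jensen's inequality this yields the
    smoothing estimate of [e^(t Delta)] from [L^q_g] to [L^(kq)_nu], [nu <= g], [k >= 1], for
    [q > N/(N-g)]. Taking [k = alpha + 1] and [nu = g/(alpha + 1)], the source [|u|^alpha u]
    lies in [L^q_g] when [u] lies in [L^(kq)_nu], and subcriticality [q > q_c] says that
    [b = a (alpha + 1) < 1], where [t^-a] is the smoothing rate. Picard iteration in the space
    with norm [sup t^a |u(t)|] then converges on [[0, T]] as soon as
    [T^(1-b) |u_0|^alpha <= c], which gives existence, the blow-up alternative and the
    lower bound on the blow-up rate at once. Continuity in [L^q_g] comes from the Hoelder
    continuity of [u(t) - e^(t Delta) u_0] and, for [q < oo], from strong continuity of the
    semigroup at 0, which reduces by density to indicator functions. Joint measurability of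
    the Duhamel integrand, which a solution does not provide, follows from the continuity of
    [e^(t Delta) f] in space and the measurability in time contained in the equation. *)

(** All time singularities are governed by [b = alpha g / 2 + N alpha / (2 q)]. It equals
    [a (alpha + 1)] for the auxiliary norm, and it is also the smoothing exponent from the weight
    [g (alpha + 1)] and the exponent [q / (alpha + 1)] to [L^q_g]. Hence [q > q_c] serves both kinds
    of uniqueness; the stronger lower bound on [q] in (i) says that the heat flow acts on that
    second source space, while existence in (i) is that of (ii). The existence time depends on the
    data only through their norm, so a restart at time [t] gives the exponent [-(1 - b) / alpha = N
    / (2 q) - (2 - g alpha) / (2 alpha)] of the lower bound, and blow-up as a limit, not merely an
    upper limit. The obstacle is that a solution is a family of slices which satisfy the equation,
    at each time, at almost every point only. Estimates are therefore made on the extended-valued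
    [heat_abs] before any integrability is known, and identities of the heat flow are proved at
    every point of space, so that no null set depends on time. *)

Lemma eqW d (T : porderType d) (x y : T) : x = y -> (x <= y)%O.
Proof. by move=> ->. Qed.

Lemma gt0_powRD (R : realType) (t c d : R) : 0 < t -> t `^ (c + d) = t `^ c * t `^ d.
Proof. by move=> t0; rewrite powRD// (gt_eqF t0) implybT. Qed.

(** Young's inequality for the factors [g / l] and 1. The right-hand side is affine in [g ^ p], with
    equality at [g = l]: it is a tangent of the concave function [y ^ (1 / p)], in a form that can
    be integrated against a weight. *)
Lemma ler_powR_tangent (R : realType) (g p l : R) : 0 <= g -> 1 < p -> 0 < l ->
  g <= l / (p * l `^ p) * g `^ p + (1 - p^-1) * l.
Proof.
move=> g0 p1 l0; have p0 : 0 < p by lra.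
have q0 : 0 < p / (p - 1) by rewrite divr_gt0// subr_gt0.
have pq : p^-1 + (p / (p - 1))^-1 = 1 by field; rewrite ?gt_eqF//; lra.
have := conjugate_powR (divr_ge0 g0 (ltW l0)) ler01 p0 q0 pq.
rewrite mulr1 powR1 -(ler_pM2l l0) mulrCA divff ?gt_eqF// mulr1 => /le_trans; apply.
rewrite powRM ?invr_ge0// ?(ltW l0)// -(powR_inv1 (ltW l0)) -powRrM mulN1r powRN.
have lp : 0 < l `^ p by exact: powR_gt0.
apply: eqW; field; rewrite ?gt_eqF//=; lra.
Qed.

(** * Monotonicity of integrals and Jensen's inequality *)

Section integral_tools.
Context d (T : measurableType d) (R : realType).
Variable mu : {measure set T -> \bar R}.
Local Open Scope ereal_scope.
Implicit Types (D : set T) (f g : T -> \bar R).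

(** The integral of a nonnegative function is the supremum over the simple functions below it, so
    monotonicity extends to functions that may fail to be measurable. *)
Lemma le_integral_nonneg D f g : (forall x, D x -> 0 <= f x) ->
  (forall x, D x -> f x <= g x) -> \int[mu]_(x in D) f x <= \int[mu]_(x in D) g x.
Proof.
move=> f0 fg; have g0 x : D x -> 0 <= g x by move=> Dx; exact: le_trans (f0 _ Dx) (fg _ Dx).
rewrite integral_mkcond [leRHS]integral_mkcond !ge0_integralTE//.
- apply: ub_ereal_sup => _ [h hf <-]; apply: ereal_sup_ubound; exists h => //= x.
  apply: le_trans (hf x) _; rewrite !patchE.
  by case: ifPn => // /set_mem/fg.
- by move=> x; rewrite patchE; case: ifPn => // /set_mem /g0.
- by move=> x; rewrite patchE; case: ifPn => // /set_mem /f0.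
Qed.

(** The weight has mass at most [A] instead of 1, which costs the factor [A ^ (p - 1)]. The tangent
    inequality is integrated against [w] at the optimal point of tangency [l]; infinite values of
    [g] obey the same inequality in the extended reals. *)
Lemma weighted_jensen D g w (p A : R) : measurable D ->
  (1 <= p)%R -> (0 < A)%R -> measurable_fun D g -> measurable_fun D w ->
  (forall x, D x -> 0 <= g x) -> (forall x, D x -> 0 <= w x) ->
  \int[mu]_(x in D) w x <= A%:E ->
  (\int[mu]_(x in D) (g x * w x)) `^ p <=
    (A `^ (p - 1))%:E * \int[mu]_(x in D) (g x `^ p * w x).
Proof.
move=> mD; rewrite le_eqVlt => /predU1P[<- A0 mg mw g0 w0 wA|p1 A0 mg mw g0 w0 wA].
  rewrite subrr powRr0 mul1e poweRe1//; last by apply: integral_ge0 => x Dx; rewrite mule_ge0 ?g0 ?w0.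
  by apply: le_integral_nonneg => x Dx; rewrite ?mule_ge0 ?g0 ?w0 ?poweRe1 ?g0.
have p0 : (0 < p)%R by lra.
have mgp : measurable_fun D (fun x => g x `^ p).
  exact: (measurableT_comp (measurable_poweR _)).
have gp0 x : D x -> 0 <= g x `^ p * w x by move=> Dx; rewrite mule_ge0 ?poweR_ge0 ?w0.
have mgw : measurable_fun D (fun x => g x `^ p * w x) by exact: emeasurable_funM.
set B := \int[mu]_(x in D) (g x `^ p * w x).
have B0 : 0 <= B by apply: integral_ge0 => x Dx; exact: gp0.
have [->|Bfin] := eqVneq B +oo.
  by rewrite gt0_muley ?leey// lte_fin powR_gt0.
have Bf : B \is a fin_num by rewrite ge0_fin_numE// lt_neqAle Bfin leey.
rewrite -(fineK Bf) -EFinM; apply/lee_addgt0Pr => eps eps0.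
(* The point of tangency must be positive while [B] may vanish, so [B] is raised by [eta]; the
   resulting excess [A ^ (p - 1) * eta] is exactly [eps]. *)
set eta := (eps / A `^ (p - 1))%R.
have Ap0 : (0 < A `^ (p - 1))%R by exact: powR_gt0.
have eta0 : (0 < eta)%R by rewrite divr_gt0.
have b0 : (0 <= fine B)%R by exact: fine_ge0.
(* Up to [eta], [l ^ p] is the mean of [g ^ p] for a weight of mass [A]. *)
set l := (((fine B + eta) / A) `^ p^-1)%R.
have c0 : (0 < (fine B + eta) / A)%R by rewrite divr_gt0//; lra.
have l0 : (0 < l)%R by exact: powR_gt0.
have lp : (l `^ p = (fine B + eta) / A)%R.
  by rewrite -powRrM mulVf ?gt_eqF// powRr1// ltW.
have key : \int[mu]_(x in D) (g x * w x) <= (A * l)%:E.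
  set c := (l / (p * l `^ p))%R.
  have c_ge0 : (0 <= c)%R by rewrite divr_ge0 ?mulr_ge0 ?powR_ge0// ltW.
  have k0 : (0 <= (1 - p^-1) * l)%R.
    by rewrite mulr_ge0 ?(ltW l0)// subr_ge0 invf_le1// ltW.
  apply: (@le_trans _ _ (\int[mu]_(x in D) (c%:E * (g x `^ p * w x) + ((1 - p^-1) * l)%:E * w x))).
    apply: le_integral_nonneg => x Dx; first by rewrite mule_ge0 ?g0 ?w0.
    rewrite muleA -ge0_muleDl ?lee_fin ?mule_ge0 ?poweR_ge0//.
    apply: lee_wpmul2r; first exact: w0.
    have := g0 _ Dx; case: (g x) => [r||] // r0.
      by rewrite poweR_EFin -EFinM -EFinD lee_fin ler_powR_tangent.
    rewrite poweRyr ?gt_eqF// gt0_muley ?addye// lte_fin.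
    by rewrite divr_gt0 ?mulr_gt0 ?powR_gt0.
  rewrite ge0_integralD//; last 4 first.
  - by move=> x Dx; rewrite mule_ge0 ?lee_fin// gp0.
  - exact: measurable_funeM.
  - by move=> x Dx; rewrite mule_ge0 ?lee_fin// w0.
  - exact: measurable_funeM.
  rewrite !ge0_integralZl_EFin// -/B -(fineK Bf).
  apply: le_trans (leeD (lexx _) (lee_wpmul2l _ wA)) _; first by rewrite lee_fin.
  rewrite -!EFinM -EFinD lee_fin.
  apply: (@le_trans _ _ (c * (A * l `^ p) + (1 - p^-1) * l * A)%R).
    rewrite lerD2r ler_wpM2l// lp mulrCA divff ?gt_eqF//; lra.
  have lp0 : (0 < l `^ p)%R by exact: powR_gt0.
  by apply: eqW; rewrite /c; field; rewrite !gt_eqF//.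
apply: (@le_trans _ _ ((A * l)%:E `^ p)).
  apply: gt0_ler_poweR => //; first exact: ltW.
  - rewrite in_itv/= leey andbT; apply: integral_ge0 => x Dx.
    by rewrite mule_ge0 ?g0 ?w0.
  - by rewrite in_itv/= leey andbT lee_fin mulr_ge0// ltW.
rewrite poweR_EFin -EFinD lee_fin powRM ?(ltW A0) ?(ltW l0)// lp.
rewrite (_ : A `^ p = A * A `^ (p - 1))%R; last by rewrite mulr_powRB1// ltW.
by apply: eqW; rewrite /eta; field; rewrite !gt_eqF//.
Qed.

End integral_tools.

(** * Integrals of powers over time intervals *)

Section time_integrals.
Context {R : realType}.
Local Notation leb := (@lebesgue_measure R).
Implicit Types (a b c s t : R).

Let powR_continuous c s : 0 < s -> {for s, continuous (@powR R ^~ c)}.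
Proof.
move=> s0; apply: differentiable_continuous; apply/derivable1_diffP.
by apply: derivable_powR; rewrite in_itv/= s0.
Qed.

Let integral_powR_cc b a t : b < 1 -> 0 < a -> a < t ->
  (\int[leb]_(s in `[a, t]) (s `^ (- b))%:E =
   (t `^ (1 - b) / (1 - b))%:E - (a `^ (1 - b) / (1 - b))%:E)%E.
Proof.
move=> b1 a0 at_; have b1' : 1 - b != 0 by rewrite subr_eq0 gt_eqF.
rewrite (@continuous_FTC2 _ _ (fun s => s `^ (1 - b) / (1 - b)) _ _ at_)//.
- apply: continuous_in_subspaceT => s; rewrite inE/= in_itv/= => /andP[as_ _].
  by apply: powR_continuous; exact: lt_le_trans as_.
- have cF s : 0 < s -> {for s, continuous (fun s => s `^ (1 - b) / (1 - b) : R)}.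
    move=> s0; apply: (@cvgMl _ R); exact: powR_continuous.
  split.
  + move=> s; rewrite in_itv/= => /andP[as_ _]; apply: derivableM => //.
    by apply: derivable_powR; rewrite in_itv/= (lt_trans a0).
  + by apply: cvg_at_right_filter; exact: cF.
  + by apply: cvg_at_left_filter; apply: cF; exact: lt_trans at_.
- move=> s; rewrite in_itv/= => /andP[as_ _].
  have s0 : 0 < s by exact: lt_trans as_.
  have sI : s \in `]0, +oo[ by rewrite in_itv/= s0.
  have D : derivable (@powR R ^~ (1 - b)) s 1 by exact: derivable_powR.
  rewrite (_ : (fun s => _) = (1 - b)^-1 *: (@powR R ^~ (1 - b))); last first.
    by apply/funext => u; rewrite /= mulrC.
  rewrite derive1E deriveZ// -derive1E (powR_derive1 _ sI).
  by rewrite scalerA mulVf// scale1r (_ : 1 - b - 1 = - b)//; lra.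
Qed.

Let measurable_powRN b D : measurable_fun D (fun s => (s `^ b)%:E).
Proof. by apply/measurable_EFinP; apply: measurable_funTS; exact: measurable_powR. Qed.

Lemma le_integral_powR b t : b < 1 -> 0 <= t ->
  (\int[leb]_(s in `]0%R, t[) (s `^ (- b))%:E <= (t `^ (1 - b) / (1 - b))%:E)%E.
Proof.
move=> b1; rewrite le_eqVlt => /predU1P[<-|t0].
  by rewrite set_itvoo0 integral_set0 lee_fin divr_ge0 ?powR_ge0//; lra.
rewrite -(integral_itv_bndoo false false)//.
(* With [n.+2] the left end stays strictly below [t], so that the fundamental theorem applies on
   each interval; monotone convergence then reaches 0. *)
pose F (n : nat) := `[t / n.+2%:R, t]%classic.
have FU : `]0%R, t]%classic = \bigcup_n F n.
  apply/seteqP; split => [s|s [n _]]; rewrite /F /= !in_itv/=; last first.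
    by move=> /andP[ns ->]; rewrite andbT (lt_le_trans _ ns)// divr_gt0.
  move=> /andP[s0 st]; exists (Num.truncn (t / s)) => //; rewrite /= in_itv/= st andbT.
  rewrite ler_pdivrMr// mulrC -ler_pdivrMr//.
  rewrite (le_trans (ltW (truncnS_gt _)))// ler_nat.
  by [].
have cvgF : (\int[leb]_(s in F n) (s `^ (- b))%:E)%E @[n --> \oo] -->
    (\int[leb]_(s in `]0%R, t]) (s `^ (- b))%:E)%E.
  rewrite FU; apply: (@ge0_nondecreasing_set_cvg_integral _ (measurableTypeR R)) => //.
  - move=> m n mn; apply/subsetPset => s; rewrite /F/= !in_itv/= => /andP[ms ->].
    rewrite andbT (le_trans _ ms)// ler_pM2l// lef_pV2 ?posrE// ler_nat.
    by rewrite ltnS.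
  - by move=> n; exact: measurable_itv.
  - by move=> n; exact: measurable_powRN.
  - by move=> n s _; rewrite lee_fin powR_ge0.
rewrite -(cvg_lim _ cvgF)//; apply: lime_le; first by apply/cvg_ex; eexists; exact: cvgF.
near=> n; rewrite integral_powR_cc ?divr_gt0//; last first.
  by rewrite ltr_pdivrMr// ltr_pMr// ltr1n.
by rewrite -EFinB lee_fin gerBl divr_ge0 ?powR_ge0//; lra.
Unshelve. all: by end_near. Qed.

(** The image of Lebesgue measure under a translation has the same values on half-open intervals,
    which determine it. *)
Lemma integral_shift c D (f : R -> \bar R) : measurable D ->
  measurable_fun D f -> (forall s, D s -> 0 <= f s)%E ->
  (\int[leb]_(s in (fun s => s + c)%R @^-1` D) f (s + c)%R = \int[leb]_(s in D) f s)%E.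
Proof.
move=> mD mf f0.
have mp : measurable_fun [set: measurableTypeR R] (fun s : measurableTypeR R => (s + c : measurableTypeR R)).
  exact: measurable_funD.
rewrite -(@ge0_integral_pushforward _ _ (measurableTypeR R) (measurableTypeR R) R _ mp leb D f)//.
  apply: eq_measure_integral => A mA _ /=; apply/esym.
  apply: lebesgue_measure_unique => // _ [[u v]] _ <-.
  rewrite [RHS](_ : _ = leb `]u - c, v - c]%classic); last first.
    congr (leb _).
    by apply/seteqP; split => s; rewrite /= !in_itv/= ltrBlDr lerBrDr.
  rewrite !lebesgue_measure_itv/= !lte_fin ltrD2r.
  by case: ifPn => // _; rewrite -!EFinB; congr (_%:E); ring.
by move=> s /set_mem; exact: f0.
Qed.

Lemma integral_reflect c D (f : R -> \bar R) : measurable D ->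
  measurable_fun D f -> (forall s, D s -> 0 <= f s)%E ->
  (\int[leb]_(s in (fun s => c - s)%R @^-1` D) f (c - s)%R = \int[leb]_(s in D) f s)%E.
Proof.
move=> mD mf f0.
have mp : measurable_fun [set: measurableTypeR R] (fun s : measurableTypeR R => (c - s : measurableTypeR R)).
  exact: measurable_funB.
rewrite -(@ge0_integral_pushforward _ _ (measurableTypeR R) (measurableTypeR R) R _ mp leb D f)//.
  apply: eq_measure_integral => A mA _ /=; apply/esym.
  apply: lebesgue_measure_unique => // _ [[u v]] _ <-.
  rewrite [RHS](_ : _ = leb `[c - v, c - u[%classic); last first.
    congr (leb _).
    apply/seteqP; split => s; rewrite /= !in_itv/=; lra.
  rewrite !lebesgue_measure_itv/= !lte_fin ltrD2l ltrN2.
  by case: ifPn => // _; rewrite -!EFinB; congr (_%:E); ring.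
by move=> s /set_mem; exact: f0.
Qed.

(* [(t - s)^-a s^-b <= (t/2)^-a s^-b + (t/2)^-b (t - s)^-a], since one of [s],
   [t - s] is at least [t/2] *)
Lemma le_integral_beta a b : 0 <= a < 1 -> 0 <= b < 1 ->
  exists2 C : R, 0 < C & forall t, 0 < t ->
  (\int[leb]_(s in `]0%R, t[) ((t - s) `^ (- a) * s `^ (- b))%:E <=
    (C * t `^ (1 - a - b))%:E)%E.
Proof.
move=> /andP[a0 a1] /andP[b0 b1].
have C0 : 0 < 2 `^ a / (1 - b) + 2 `^ b / (1 - a).
  by rewrite addr_gt0// divr_gt0 ?powR_gt0//; lra.
exists (2 `^ a / (1 - b) + 2 `^ b / (1 - a)) => // t t0.
have mt : measurable_fun `]0, t[%classic (fun s : R => ((t - s) `^ (- a))%:E).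
  apply/measurable_EFinP; apply: (@measurableT_comp _ _ _ _ _ _ (@powR R ^~ (-a))).
    exact: measurable_powR.
  by apply: measurable_funTS; exact: measurable_funB.
apply: (@le_trans _ _ (\int[leb]_(s in `]0%R, t[) (((t / 2) `^ (- a))%:E * (s `^ (- b))%:E
     + ((t / 2) `^ (- b))%:E * ((t - s) `^ (- a))%:E)))%E.
  apply: le_integral_nonneg => s; first by rewrite lee_fin mulr_ge0 ?powR_ge0.
  rewrite /= in_itv/= => /andP[s0 st]; rewrite -!EFinM -EFinD lee_fin.
  have ler c u v : 0 <= c -> 0 < u <= v -> v `^ (- c) <= u `^ (- c).
    move=> c0 /andP[u0 uv]; rewrite !powRN lef_pV2 ?posrE ?powR_gt0//; last exact: lt_le_trans uv.
    by rewrite ge0_ler_powR// nnegrE ?(ltW u0)// (le_trans (ltW u0)).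
  have [h|h] := leP s (t / 2).
    rewrite -[leLHS]addr0 lerD ?mulr_ge0 ?powR_ge0// ler_wpM2r ?powR_ge0//.
    by apply: ler => //; lra.
  rewrite -[leLHS]add0r lerD ?mulr_ge0 ?powR_ge0// mulrC ler_wpM2r ?powR_ge0//.
  by apply: ler => //; lra.
rewrite ge0_integralD//=; last 4 first.
- by move=> s _; rewrite -EFinM lee_fin mulr_ge0 ?powR_ge0.
- by apply: measurable_funeM; exact: measurable_powRN.
- by move=> s _; rewrite -EFinM lee_fin mulr_ge0 ?powR_ge0.
- by apply: measurable_funeM; exact: mt.
rewrite ge0_integralZl_EFin ?powR_ge0//; [|by move=> s _; rewrite lee_fin powR_ge0|exact: measurable_powRN].
rewrite ge0_integralZl_EFin ?powR_ge0//; last by move=> s _; rewrite lee_fin powR_ge0.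
have -> : (\int[leb]_(s in `]0%R, t[) ((t - s) `^ (- a))%:E =
    \int[leb]_(s in `]0%R, t[) (s `^ (- a))%:E)%E.
  rewrite -(@integral_reflect t `]0, t[%classic (fun s => (s `^ (- a))%:E))//; last first.
    by move=> s _; rewrite lee_fin powR_ge0.
  congr (integral _ _ _); apply/seteqP; split => s; rewrite /= !in_itv/=; lra.
have Ib := le_integral_powR b1 (ltW t0); have Ia := le_integral_powR a1 (ltW t0).
apply: le_trans (leeD (lee_wpmul2l _ Ib) (lee_wpmul2l _ Ia)) _; rewrite ?lee_fin ?powR_ge0//.
have tE c : (t / 2) `^ (- c) = 2 `^ c * t `^ (- c).
  by rewrite powRM ?(ltW t0)// -powR_inv1// -powRrM mulN1r opprK mulrC.
have tM c d : t `^ c * t `^ d = t `^ (c + d).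
  by rewrite gt0_powRD.
rewrite !tE !mulrDl; apply: lerD; apply: eqW.
  rewrite (_ : 1 - a - b = - a + (1 - b)); last by ring.
  by rewrite -(tM (- a)); ring.
rewrite (_ : 1 - a - b = - b + (1 - a)); last by ring.
by rewrite -(tM (- b)); ring.
Qed.

End time_integrals.

(** * Heat kernel *)

Section measurability.
Context {R : realType} {N : nat}.
Context d (T : measurableType d).

(** Inversion is reduced to the measurable power map by [x^-1 = x * (x^2)^(-1)]: the square makes
    the base nonnegative, and both sides are 0 at [x = 0]. *)
Lemma measurable_inv (f : T -> R) (D : set T) :
  measurable_fun D f -> measurable_fun D (fun x => (f x)^-1).
Proof.
move=> mf; rewrite (_ : (fun x => _) = (fun x => f x * ((f x) ^+ 2) `^ (-1))); last first.
  apply/funext => x; rewrite powR_inv1 ?sqr_ge0//.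
  by have [->|fx] := eqVneq (f x) 0; [rewrite invr0 mul0r|field].
apply: measurable_funM => //; apply: (@measurableT_comp _ _ _ _ _ _ (@powR R ^~ (-1))).
  exact: measurable_powR.
exact: measurable_funX.
Qed.

Lemma measurable_div (f g : T -> R) (D : set T) :
  measurable_fun D f -> measurable_fun D g -> measurable_fun D (fun x => f x / g x).
Proof. by move=> mf mg; apply: measurable_funM => //; exact: measurable_inv. Qed.

Lemma measurable_tnth_comp (f : T -> Rn R N) (D : set T) i :
  measurable_fun D f -> measurable_fun D (fun x => tnth (f x) i : R).
Proof.
by move=> mf; apply: (@measurableT_comp _ _ _ _ _ _ (fun x : Rn R N => tnth x i)) => //; exact: measurable_tnth.
Qed.

Lemma euclidean_normE (x : Rn R N) (a : R) :
  euclidean_norm x `^ a = (\sum_(i < N) (tnth x i : R) ^+ 2) `^ (a / 2).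
Proof.
rewrite /euclidean_norm -powR12_sqrt ?sumr_ge0// => [|i _]; last exact: sqr_ge0.
by rewrite -powRrM mulrC.
Qed.

Lemma measurable_euclidean_norm (f : T -> Rn R N) (a : R) (D : set T) :
  measurable_fun D f -> measurable_fun D (fun x => euclidean_norm (f x) `^ a).
Proof.
move=> mf; under eq_fun do rewrite euclidean_normE.
apply: (@measurableT_comp _ _ _ _ _ _ (@powR R ^~ (a / 2))); first exact: measurable_powR.
by apply: measurable_sum => i; apply: measurable_funX; exact: measurable_tnth_comp.
Qed.

Lemma measurable_heat_kernel (ft : T -> R) (fx fy : T -> Rn R N) (D : set T) :
  measurable_fun D ft -> measurable_fun D fx -> measurable_fun D fy ->
  measurable_fun D (fun z => heat_kernel (ft z) (fx z) (fy z)).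
Proof.
move=> mt mx my; apply: measurable_funM.
  apply: (@measurableT_comp _ _ _ _ _ _ (@powR R ^~ _)); first exact: measurable_powR.
  exact: measurable_funM.
apply: measurableT_comp => //; apply: measurable_div; last exact: measurable_funM.
apply: measurableT_comp => //; apply: measurable_sum => i; apply: measurable_funX.
by apply: measurable_funB; exact: measurable_tnth_comp.
Qed.

End measurability.

Section lebesgue_Rn_integral.
Context {R : realType}.
Local Notation leb := (@lebesgue_measure R).
Local Notation mu n := (@lebesgue_Rn R n).

#[global] Instance ae_filter_Rn n : Filter (almost_everywhere (mu n)).
Proof. exact: ae_filter_ringOfSetsType. Qed.

Lemma integral_Rn_cons n (f : Rn R n.+1 -> \bar R) :
  measurable_fun [set: _] f -> (forall x, 0 <= f x)%E ->
  (\int[mu n.+1]_x f x = \int[leb]_a \int[mu n]_x f (Rn_cons (a, x)))%E.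
Proof.
move=> mf f0; rewrite -(@fubini_tonelli1 _ _ _ _ R leb (mu n) (fun p => f (Rn_cons p)))//; last first.
  by apply: measurableT_comp => //; exact: measurable_Rn_cons.
transitivity (\int[pushforward (leb \x mu n)%E (@Rn_cons R n)]_x f x)%E => //.
by rewrite ge0_integral_pushforward//; exact: measurable_Rn_cons.
Qed.

(** The heat kernel and the majorant of a singular weight are both products over the coordinates, so
    their integrals reduce to dimension one. *)
Lemma integral_Rn_prod n (g : 'I_n -> R -> R) :
  (forall i, measurable_fun [set: R] (g i)) -> (forall i s, 0 <= g i s) ->
  (\int[mu n]_x (\prod_(i < n) g i (tnth x i))%:E =
    \prod_(i < n) \int[leb]_s (g i s)%:E)%E.
Proof.
elim: n g => [|n ih] g mg g0.
  under eq_integral do rewrite big_ord0.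
  by rewrite big_ord0 integral_cst//= diracE mem_set// mule1.
have mG m (h : 'I_m -> R -> R) : (forall i, measurable_fun [set: R] (h i)) ->
    measurable_fun [set: Rn R m] (fun x => (\prod_(i < m) h i (tnth x i))%:E).
  move=> mh; apply/measurable_EFinP; apply: measurable_prod => i _.
  by apply: (@measurableT_comp _ _ _ _ _ _ (h i)) => //; exact: measurable_tnth.
rewrite integral_Rn_cons; [|exact: mG|by move=> x; rewrite lee_fin prodr_ge0].
rewrite big_ord_recl -(ih (fun i => g (lift ord0 i)))//.
rewrite -ge0_integralZr//; last 3 first.
- by apply/measurable_EFinP; exact: mg.
- by move=> s _; rewrite lee_fin.
- by apply: integral_ge0 => x _; rewrite lee_fin prodr_ge0.
apply: eq_integral => a _; rewrite -ge0_integralZl//; last 3 first.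
- by apply: (mG _ (fun i => g (lift ord0 i))) => i; exact: mg.
- by move=> x _; rewrite lee_fin prodr_ge0.
- by rewrite lee_fin.
apply: eq_integral => x _; rewrite big_ord_recl EFinM tnth0.
by congr (_ * (_)%:E)%E; apply: eq_bigr => i _; rewrite tnthS.
Qed.

Lemma hyperplane_negligible n (i : 'I_n) (c : R) :
  (mu n).-negligible [set x : Rn R n | tnth x i = c].
Proof.
exists [set x : Rn R n | tnth x i = c]; split => //.
  rewrite (_ : [set x | _] = (fun x : Rn R n => tnth x i) @^-1` [set c])//.
  by rewrite -[X in measurable X]setTI; exact: measurable_tnth.
pose A (j : 'I_n) : set R := if j == i then [set c] else setT.
rewrite (_ : [set x | _] = [set x : Rn R n | forall j, A j (tnth x j)]); last first.
  apply/seteqP; split => x /=; rewrite /A.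
    by move=> xc j; case: eqP => // ->.
  by move=> /(_ i); rewrite eqxx.
have mA j : measurable (A j) by rewrite /A; case: ifP.
have Ai : @lebesgue_measure R (A i) = 0%E by rewrite /A eqxx lebesgue_measure_set1.
by rewrite (lebesgue_Rn_box mA) (bigD1 i)//= Ai mul0e.
Qed.

Lemma ae_coord_neq0 n : {ae mu n, forall x, forall i : 'I_n, (tnth x i : R) != 0}.
Proof.
apply: filter_forall => i.
apply: negligibleS (hyperplane_negligible i 0) => x /=.
by move=> /negP; rewrite negbK => /eqP.
Qed.

Lemma ae_euclidean_norm_gt0 n : (0 < n)%N ->
  {ae mu n, forall x, 0 < euclidean_norm x}.
Proof.
move=> n0; apply: filterS (ae_coord_neq0 n) => x /(_ (Ordinal n0)) x0.
rewrite sqrtr_gt0 (bigD1 (Ordinal n0))//= ltr_pwDl//.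
  by rewrite lt_neqAle sqr_ge0 eq_sym expf_neq0.
by apply: sumr_ge0 => i _; exact: sqr_ge0.
Qed.

(** The norm of exponent [+oo] unfolds to an essential supremum only once the total mass is known to
    be positive. *)
Lemma lebesgue_Rn_gt0 n : (0 < mu n setT)%E.
Proof.
have := @lebesgue_Rn_box R n (fun=> setT) (fun=> measurableT).
rewrite (_ : [set x : Rn R n | _] = setT); last by apply/seteqP.
move=> ->; elim/big_ind: _ => // [x y x0 y0|i _]; first by rewrite mule_gt0.
apply: (@lt_le_trans _ _ (leb `[0%R, 1%R]%classic)); last by apply: le_measure => //; rewrite inE.
by rewrite lebesgue_measure_itv/= lte_fin ltr01 -EFinB subr0.
Qed.

End lebesgue_Rn_integral.

Section heat_kernel_theory.
Context {R : realType} {N : nat}.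
Local Notation leb := (@lebesgue_measure R).
Local Notation mu := (@lebesgue_Rn R N).
Implicit Types (t s a b : R) (x y z : Rn R N).

Definition sqdist x y : R := \sum_(i < N) ((tnth x i : R) - (tnth y i : R)) ^+ 2.

Lemma sqdist_ge0 x y : 0 <= sqdist x y.
Proof. by apply: sumr_ge0 => i _; exact: sqr_ge0. Qed.

Definition heat_kernel1 t (u v : R) : R :=
  (4 * pi * t) `^ (- 2^-1) * expR (- ((u - v) ^+ 2 / (4 * t))).

Lemma heat_kernel1_ge0 t u v : 0 <= heat_kernel1 t u v.
Proof. by rewrite mulr_ge0 ?powR_ge0 ?expR_ge0. Qed.

Lemma measurable_heat_kernel1 t u : measurable_fun [set: R] (heat_kernel1 t u).
Proof.
apply: measurable_funM => //; apply: measurableT_comp => //.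
apply: measurableT_comp => //; apply: measurable_funM => //.
by apply: measurable_funX; exact: measurable_funB.
Qed.

Lemma heat_kernel1_normal t u v : 0 < t ->
  heat_kernel1 t u v = normal_pdf u (Num.sqrt (2 * t)) v.
Proof.
move=> t0; have s0 : Num.sqrt (2 * t) != 0 by rewrite gt_eqF// sqrtr_gt0 mulr_gt0.
rewrite normal_pdfE// /normal_fun /normal_peak sqr_sqrtr ?mulr_ge0 ?(ltW t0)//.
rewrite /heat_kernel1 powRN powR12_sqrt ?mulr_ge0 ?pi_ge0 ?(ltW t0)//.
congr (_^-1 * expR _); first by congr Num.sqrt; ring.
by field; rewrite gt_eqF.
Qed.

Lemma integral_heat_kernel1 t u : 0 < t ->
  (\int[leb]_v (heat_kernel1 t u v)%:E = 1)%E.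
Proof.
by move=> t0; under eq_integral do rewrite heat_kernel1_normal//; exact: integral_normal_pdf.
Qed.

Lemma heat_kernelE t x y :
  heat_kernel t x y = \prod_(i < N) heat_kernel1 t (tnth x i) (tnth y i).
Proof.
rewrite /heat_kernel big_split/= prodr_const card_ord -powR_mulrn ?powR_ge0//.
rewrite -powRrM (_ : - 2^-1 * N%:R = - (N%:R / 2)); last by ring.
rewrite -expR_sum; congr (_ * expR _).
by rewrite sumrN mulNr big_distrl.
Qed.

Lemma heat_kernel_ge0 t x y : 0 <= heat_kernel t x y.
Proof. by rewrite mulr_ge0 ?powR_ge0 ?expR_ge0. Qed.

Lemma heat_kernelC t x y : heat_kernel t x y = heat_kernel t y x.
Proof.
by rewrite /heat_kernel; under eq_bigr do rewrite -sqrrN opprB.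
Qed.

Lemma heat_kernel_le t x y : 0 < t -> heat_kernel t x y <= (4 * pi * t) `^ (- (N%:R / 2)).
Proof.
move=> t0; rewrite ler_piMr ?powR_ge0// -[leRHS]expR0 ler_expR mulNr oppr_le0.
by rewrite divr_ge0 ?mulr_ge0 ?(ltW t0)// sqdist_ge0.
Qed.

Lemma integral_heat_kernel t x : 0 < t ->
  (\int[mu]_y (heat_kernel t x y)%:E = 1)%E.
Proof.
move=> t0; under eq_integral do rewrite heat_kernelE.
rewrite (@integral_Rn_prod R N (fun i => heat_kernel1 t (tnth x i))); last 2 first.
- by move=> i; exact: measurable_heat_kernel1.
- by move=> i s; exact: heat_kernel1_ge0.
by rewrite big1// => i _; exact: integral_heat_kernel1.
Qed.

(** Completing the square in the middle variable: the product is a Gaussian in [v], centred at a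
    weighted mean of [u] and [w], times a factor free of [v]. Integrating in [v] gives the semigroup
    property. *)
Lemma heat_kernel1_mul t s (u v w : R) : 0 < t -> 0 < s ->
  heat_kernel1 t u v * heat_kernel1 s v w =
  heat_kernel1 (t + s) u w *
    heat_kernel1 (t * s / (t + s)) ((s * u + t * w) / (t + s)) v.
Proof.
move=> t0 s0; have ts0 : 0 < t + s by exact: addr_gt0.
have p0 : 0 < pi :> R by exact: pi_gt0.
rewrite /heat_kernel1 mulrACA [RHS]mulrACA -!expRD -!powRM; last 4 first.
- by rewrite !mulr_ge0 ?(ltW p0) ?(ltW ts0).
- by rewrite !mulr_ge0 ?invr_ge0 ?(ltW p0) ?(ltW t0) ?(ltW s0) ?(ltW ts0).
- by rewrite !mulr_ge0 ?(ltW p0) ?(ltW t0).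
- by rewrite !mulr_ge0 ?(ltW p0) ?(ltW s0).
by congr (_ `^ _ * expR _); field; rewrite !gt_eqF.
Qed.

Lemma heat_kernel_semigroup t s x z : 0 < t -> 0 < s ->
  (\int[mu]_y (heat_kernel t x y * heat_kernel s y z)%:E = (heat_kernel (t + s) x z)%:E)%E.
Proof.
move=> t0 s0; have ts0 : 0 < t * s / (t + s) by rewrite divr_gt0 ?mulr_gt0 ?addr_gt0.
pose g (i : 'I_N) v := heat_kernel1 t (tnth x i) v * heat_kernel1 s v (tnth z i).
have gE (i : 'I_N) v : g i v = heat_kernel1 (t + s) (tnth x i) (tnth z i) *
    heat_kernel1 (t * s / (t + s)) ((s * (tnth x i : R) + t * (tnth z i : R)) / (t + s)) v.
  exact: heat_kernel1_mul.
have mg (i : 'I_N) : measurable_fun [set: R] (g i).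
  rewrite (funext (gE i)); by apply: measurable_funM => //; exact: measurable_heat_kernel1.
under eq_integral do rewrite !heat_kernelE -big_split/=.
rewrite (@integral_Rn_prod R N g)//; last first.
  by move=> i v; rewrite mulr_ge0 ?heat_kernel1_ge0.
rewrite heat_kernelE -prodEFin; apply: eq_bigr => i _.
under eq_integral do rewrite gE EFinM.
rewrite ge0_integralZl_EFin//; last 3 first.
- by move=> v _; rewrite lee_fin heat_kernel1_ge0.
- by apply/measurable_EFinP; exact: measurable_heat_kernel1.
- exact: heat_kernel1_ge0.
by rewrite integral_heat_kernel1// mule1.
Qed.

(** [v / c <= exp (v / c)], raised to the power [c]. *)
Lemma powR_le_expR (c v : R) : 0 <= c -> 0 <= v -> v `^ c <= c `^ c * expR v.
Proof.
rewrite le_eqVlt => /predU1P[<- v0|c0 v0].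
  by rewrite !powRr0 mul1r -expR0 ler_expR.
have -> : expR v = expR (v / c) `^ c by rewrite -expRM divfK ?gt_eqF.
rewrite -powRM ?expR_ge0 ?(ltW c0)// ge0_ler_powR ?(ltW c0)//.
- by rewrite nnegrE mulr_ge0 ?expR_ge0 ?(ltW c0).
- rewrite -ler_pdivrMl// mulrC (le_trans _ (expR_ge1Dx _))//; lra.
Qed.

(** Half of the Gaussian exponent absorbs the power of the distance, by [powR_le_expR] at
    [d / (8 t)]; the other half is the exponent of the kernel at time [2 t]. The factor
    [2 ^ (N / 2)] compensates the normalization at the doubled time. *)
Lemma powR_sqdist_heat_kernel t a x y : 0 < t -> 0 <= a ->
  sqdist x y `^ (a / 2) * heat_kernel t x y <=
  (8 * (a / 2)) `^ (a / 2) * 2 `^ (N%:R / 2) * t `^ (a / 2) * heat_kernel (2 * t) x y.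
Proof.
move=> t0 a0; set c := a / 2; have c0 : 0 <= c by rewrite divr_ge0.
set d := sqdist x y; have d0 : 0 <= d by exact: sqdist_ge0.
have p0 : 0 < pi :> R by exact: pi_gt0.
rewrite /heat_kernel -/(sqdist x y) -/d.
have -> : (4 * pi * (2 * t)) `^ (- (N%:R / 2)) =
    2 `^ (- (N%:R / 2)) * (4 * pi * t) `^ (- (N%:R / 2)).
  by rewrite -powRM ?mulr_ge0 ?(ltW p0) ?(ltW t0)//; congr (_ `^ _); ring.
have -> : expR (- d / (4 * t)) = expR (- d / (4 * (2 * t))) * expR (- (d / (8 * t))).
  by rewrite -expRD; congr expR; field; rewrite gt_eqF.
set A := (4 * pi * t) `^ _; set E := expR (- d / _).
have dE : d = (8 * t) * (d / (8 * t)) by field; rewrite gt_eqF.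
have H : d `^ c * expR (- (d / (8 * t))) <= (8 * c) `^ c * t `^ c.
  rewrite {1}dE powRM ?divr_ge0 ?mulr_ge0 ?(ltW t0)//.
  rewrite expRN -mulrA -ler_pdivlMl ?powR_gt0 ?mulr_gt0//.
  rewrite ler_pdivrMr ?expR_gt0//.
  apply: le_trans (powR_le_expR c0 _) _; first by rewrite divr_ge0 ?mulr_ge0 ?(ltW t0).
  rewrite ler_wpM2r ?expR_ge0// ler_pdivlMl ?powR_gt0 ?mulr_gt0//.
  by rewrite !powRM ?(ltW t0)//; apply: eqW; ring.
have A0 : 0 <= A by exact: powR_ge0.
have E0 : 0 <= E by exact: expR_ge0.
have T0 : 0 < 2 `^ (N%:R / 2) :> R by exact: powR_gt0.
rewrite powRN (_ : _ * (A * _) = A * E * (d `^ c * expR (- (d / (8 * t))))); last by ring.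
apply: le_trans (ler_wpM2l (mulr_ge0 A0 E0) H) _.
by apply: eqW; field; rewrite gt_eqF.
Qed.

End heat_kernel_theory.

(** * Singular weights under the heat kernel *)

Section singular_weights.
Context {R : realType} {N : nat}.
Local Notation leb := (@lebesgue_measure R).
Local Notation mu := (@lebesgue_Rn R N).
Implicit Types (t s a b c : R) (x y : Rn R N).

Lemma ge0_powRN_le (c u v : R) : 0 <= c -> 0 < u <= v -> v `^ (- c) <= u `^ (- c).
Proof.
move=> c0 /andP[u0 uv]; rewrite !powRN lef_pV2 ?posrE ?powR_gt0//; last exact: lt_le_trans uv.
by rewrite ge0_ler_powR// nnegrE ?(ltW u0)// (le_trans (ltW u0)).
Qed.

(** Splitting at the parabolic scale [|s| = sqrt t]: outside, the weight is at most [t ^ (-c / 2)]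
    and the kernel has mass 1; inside, the kernel is at most [(4 pi t) ^ (-1/2)] and the weight is
    integrable because [c < 1]. *)
Lemma integral_heat_kernel1_singular c : 0 < c < 1 ->
  exists2 C : R, 0 < C & forall t (u : R), 0 < t ->
  (\int[leb]_s (heat_kernel1 t u s * `|s| `^ (- c))%:E <= (C * t `^ (- (c / 2)))%:E)%E.
Proof.
move=> /andP[c0 c1]; have p0 : 0 < 4 * pi :> R by rewrite mulr_gt0 ?pi_gt0.
have P0 : 0 < (4 * pi) `^ (- 2^-1) :> R by exact: powR_gt0.
have D0 : 0 < 2 / (1 - c) by rewrite divr_gt0// subr_gt0.
exists (1 + (4 * pi) `^ (- 2^-1) * (2 / (1 - c))); first by rewrite addr_gt0// mulr_gt0.
move=> t u t0; set rho := t `^ 2^-1; have rho0 : 0 < rho by exact: powR_gt0.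
(* [f s] is the weight on positive [s] below [rho], and [f (0 - s)] the weight on the mirror
   interval. *)
pose f : R -> \bar R := (fun s => (s `^ (- c))%:E) \_ `]0, rho[.
have mg D : measurable_fun D (fun s : R => (s `^ (- c))%:E).
  by apply/measurable_EFinP; apply: measurable_funTS; exact: measurable_powR.
have mf : measurable_fun [set: R] f.
  by apply/(measurable_restrictT (fun s => (s `^ (- c))%:E) (measurable_itv `]0, rho[)); exact: mg.
have mf' : measurable_fun [set: R] (fun s => f (0 - s)).
  by apply: (measurableT_comp mf); exact: measurable_funB.
have f0 s : (0 <= f s)%E by rewrite /f patchE; case: ifP => // _; rewrite lee_fin powR_ge0.
have If : (\int[leb]_s f s <= (rho `^ (1 - c) / (1 - c))%:E)%E.
  by rewrite -integral_mkcond; apply: le_integral_powR => //; exact: ltW.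
have If' : (\int[leb]_s f (0 - s)%R <= (rho `^ (1 - c) / (1 - c))%:E)%E.
  by rewrite (@integral_reflect R 0 setT f).
have mk : measurable_fun [set: R] (fun s => (heat_kernel1 t u s)%:E).
  by apply/measurable_EFinP; exact: measurable_heat_kernel1.
have k0 s : (0 <= (heat_kernel1 t u s)%:E)%E by rewrite lee_fin heat_kernel1_ge0.
apply: (@le_trans _ _ (\int[leb]_s (((4 * pi * t) `^ (- 2^-1))%:E * (f s + f (0 - s)%R) +
    (t `^ (- (c / 2)))%:E * (heat_kernel1 t u s)%:E))%E).
  apply: le_integral_nonneg => s _; first by rewrite lee_fin mulr_ge0 ?heat_kernel1_ge0 ?powR_ge0.
  have [h|h] := leP rho `|s|.
    apply: (@le_trans _ _ ((t `^ (- (c / 2)))%:E * (heat_kernel1 t u s)%:E)%E); last first.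
      by rewrite leeDr// mule_ge0 ?lee_fin ?powR_ge0// adde_ge0.
    rewrite -EFinM lee_fin mulrC ler_wpM2r ?heat_kernel1_ge0//.
    rewrite (_ : t `^ _ = rho `^ (- c)); last by rewrite -powRrM; congr (_ `^ _); ring.
    by apply: ge0_powRN_le; rewrite ?(ltW c0)// rho0.
  (* The default value [0 ^ (- c) = 0] makes the integrand vanish at the origin. *)
  have [->|sn0] := eqVneq s 0.
    rewrite normr0 powR0 ?oppr_eq0 ?gt_eqF// mulr0; apply: adde_ge0; apply: mule_ge0;
      rewrite ?lee_fin ?powR_ge0 ?heat_kernel1_ge0//; exact: adde_ge0.
  apply: (@le_trans _ _ (((4 * pi * t) `^ (- 2^-1))%:E * (f s + f (0 - s)%R))%E); last first.
    by rewrite leeDl// mule_ge0 ?lee_fin ?powR_ge0// heat_kernel1_ge0.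
  rewrite EFinM; apply: lee_pmul.
  - by rewrite lee_fin heat_kernel1_ge0.
  - by rewrite lee_fin powR_ge0.
  - rewrite lee_fin ler_piMr ?powR_ge0// -[leRHS]expR0 ler_expR oppr_le0.
    by rewrite divr_ge0 ?sqr_ge0 ?mulr_ge0 ?(ltW t0).
  - have [s0|s0] := ltP 0 s.
      have -> : f s = (s `^ (- c))%:E.
        by rewrite /f patchE mem_set//= in_itv/= s0/=; move: h; rewrite gtr0_norm.
      by rewrite gtr0_norm// leeDl.
    have s0' : s < 0 by rewrite lt_neqAle sn0.
    have -> : f (0 - s) = ((- s) `^ (- c))%:E.
      rewrite /f patchE sub0r mem_set//= in_itv/= oppr_gt0 s0'/=.
      by move: h; rewrite ltr0_norm.
    by rewrite ltr0_norm// leeDr.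
rewrite ge0_integralD//; last 4 first.
- by move=> s _; rewrite mule_ge0 ?lee_fin ?powR_ge0// adde_ge0.
- by apply: measurable_funeM; exact: emeasurable_funD.
- by move=> s _; rewrite mule_ge0 ?lee_fin ?powR_ge0 ?heat_kernel1_ge0.
- exact: measurable_funeM.
rewrite ge0_integralZl_EFin ?powR_ge0//; last 2 first.
- by move=> s _; exact: adde_ge0.
- exact: emeasurable_funD.
rewrite ge0_integralZl_EFin ?powR_ge0// integral_heat_kernel1// mule1.
rewrite ge0_integralD//.
apply: le_trans (leeD (lee_wpmul2l _ (leeD If If')) (lexx _)) _.
  by rewrite lee_fin powR_ge0.
rewrite -EFinD lee_fin.
have -> : t `^ (- (c / 2)) = t `^ (- 2^-1) * t `^ (2^-1 * (1 - c)).
  by rewrite -gt0_powRD//; congr (_ `^ _); field.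
rewrite -[rho `^ _]powRrM powRM ?(ltW p0) ?(ltW t0)//.
by apply: eqW; field; rewrite subr_eq0 gt_eqF.
Qed.

(** Since [|y| >= |y_i|] for every [i], the weight [|y| ^ (- a)] is at most the product of the
    [|y_i| ^ (- a / N)], and [a / N < 1] is the one-dimensional condition. *)
Lemma integral_heat_kernel_singular a : 0 <= a < N%:R ->
  exists2 C : R, 0 < C & forall t x, 0 < t ->
  (\int[mu]_y (heat_kernel t x y * euclidean_norm y `^ (- a))%:E <=
    (C * t `^ (- (a / 2)))%:E)%E.
Proof.
move=> /andP[]; rewrite le_eqVlt => /predU1P[<- _|a0 aN].
  exists 1 => // t x t0; under eq_integral do rewrite oppr0 powRr0 mulr1.
  by rewrite integral_heat_kernel// mul0r oppr0 powRr0 mul1r.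
have N0 : 0 < N%:R :> R by exact: lt_trans aN.
set c := a / N%:R.
have c01 : 0 < c < 1 by rewrite divr_gt0//= ltr_pdivrMr ?mul1r.
have [C C0 HC] := integral_heat_kernel1_singular c01.
have /andP[c0 _] := c01.
exists (C ^+ N); first exact: exprn_gt0.
move=> t x t0; pose g (i : 'I_N) s := heat_kernel1 t (tnth x i) s * `|s| `^ (- c).
have mg (i : 'I_N) : measurable_fun [set: R] (g i).
  apply: measurable_funM; first exact: measurable_heat_kernel1.
  apply: (@measurableT_comp _ _ _ _ _ _ (@powR R ^~ _)); first exact: measurable_powR.
  exact: normr_measurable.
have g0 (i : 'I_N) s : 0 <= g i s by rewrite mulr_ge0 ?powR_ge0 ?heat_kernel1_ge0.
apply: (@le_trans _ _ (\int[mu]_y (\prod_(i < N) g i (tnth y i))%:E)%E).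
  apply: ae_ge0_le_integral => //.
  - by move=> y _; rewrite lee_fin mulr_ge0 ?powR_ge0 ?heat_kernel_ge0.
  - apply/measurable_EFinP; apply: measurable_funM.
      by apply: measurable_heat_kernel => //; exact: measurable_cst.
    exact: measurable_euclidean_norm.
  - by move=> y _; rewrite lee_fin prodr_ge0.
  - apply/measurable_EFinP; apply: measurable_prod => i _.
    by apply: (@measurableT_comp _ _ _ _ _ _ (g i)) => //; exact: measurable_tnth.
  (* The comparison fails on the coordinate hyperplanes, where a factor of the product takes the
     default value 0; they are negligible. *)
  apply: filterS (ae_coord_neq0 N) => y y0 _; rewrite lee_fin heat_kernelE.
  rewrite [leRHS]big_split/= ler_wpM2l ?prodr_ge0// => [i _|]; first exact: heat_kernel1_ge0.
  have -> : euclidean_norm y `^ (- a) = \prod_(i < N) euclidean_norm y `^ (- c).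
    rewrite prodr_const card_ord -powR_mulrn ?powR_ge0// -powRrM; congr (_ `^ _).
    by rewrite /c; field; rewrite gt_eqF.
  apply: ler_prod => i _; rewrite powR_ge0/=; apply: ge0_powRN_le; first exact: ltW.
  rewrite normr_gt0 y0/= -sqrtr_sqr ler_sqrt ?sumr_ge0// => [|j _]; last exact: sqr_ge0.
  by rewrite (bigD1 i)//= lerDl sumr_ge0// => j _; exact: sqr_ge0.
rewrite integral_Rn_prod//.
have -> : C ^+ N * t `^ (- (a / 2)) = \prod_(i < N) (C * t `^ (- (c / 2))).
  rewrite big_split/= !prodr_const card_ord -[_ `^ _ ^+ N]powR_mulrn ?powR_ge0//.
  by rewrite -powRrM; congr (_ * _ `^ _); rewrite /c; field; rewrite gt_eqF.
have : (0 <= \prod_(i < N) \int[leb]_s (g i s)%:E)%E /\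
    (\prod_(i < N) \int[leb]_s (g i s)%:E <= (\prod_(i < N) (C * t `^ (- (c / 2))))%:E)%E.
  elim/big_rec2: _ => // i y1 y2 _ [y0 y12].
  have I0 : (0 <= \int[leb]_s (g i s)%:E)%E.
    by apply: integral_ge0 => s _; rewrite lee_fin.
  split; first exact: mule_ge0.
  by rewrite EFinM lee_pmul//; exact: HC.
by case.
Qed.

(** [|x|^2 <= 2 |x - y|^2 + 2 |y|^2] is at most four times the larger of [|x - y|^2] and [|y|^2];
    passing through the maximum treats every [b >= 0] alike, convex or not. *)
Lemma euclidean_norm_split b x y : 0 <= b ->
  euclidean_norm x `^ b <= 4 `^ (b / 2) * (sqdist x y `^ (b / 2) + euclidean_norm y `^ b).
Proof.
move=> b0; rewrite !euclidean_normE; set c := b / 2.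
have c0 : 0 <= c by rewrite divr_ge0.
set X := \sum_i _; set Y := \sum_i _.
have Y0 : 0 <= Y by apply: sumr_ge0 => i _; exact: sqr_ge0.
have D0 := sqdist_ge0 x y; have X0 : 0 <= X by apply: sumr_ge0 => i _; exact: sqr_ge0.
have XDY : X <= 2 * sqdist x y + 2 * Y.
  rewrite /X /sqdist /Y !mulr_sumr -big_split/=; apply: ler_sum => i _.
  have sq (u v : R) : u ^+ 2 <= 2 * (u - v) ^+ 2 + 2 * v ^+ 2.
    by rewrite -subr_ge0 (_ : _ - _ = (u - 2 * v) ^+ 2) ?sqr_ge0//; ring.
  exact: sq.
have H z : 0 <= z -> X <= 4 * z -> X `^ c <= 4 `^ c * z `^ c.
  by move=> z0 Xz; rewrite -powRM// ge0_ler_powR// nnegrE ?mulr_ge0.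
have [h|h] := leP (sqdist x y) Y.
  apply: le_trans (H Y Y0 _) _; first by lra.
  by rewrite ler_wpM2l ?powR_ge0// lerDr powR_ge0.
apply: le_trans (H _ D0 _) _; first by lra.
by rewrite ler_wpM2l ?powR_ge0// lerDl powR_ge0.
Qed.

(** [|x|^b] is split along [x - y] and [y]. The power of the distance is absorbed by the kernel at
    the cost of [t ^ (b / 2)] and a doubled time, and leaves the weight of order [a]; the power of
    [|y|] lowers that order to [a - b]. Both terms scale like [t ^ (-(a - b) / 2)]. *)
Lemma weighted_heat_kernel_singular a b : 0 <= b <= a -> a < N%:R ->
  exists2 C : R, 0 < C & forall t x, 0 < t ->
  ((euclidean_norm x `^ b)%:E *
   \int[mu]_y (heat_kernel t x y * euclidean_norm y `^ (- a))%:E <=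
    (C * t `^ (- ((a - b) / 2)))%:E)%E.
Proof.
move=> /andP[b0 ba] aN.
have [C1 C10 H1] : exists2 C : R, 0 < C & forall t x, 0 < t ->
    (\int[mu]_y (heat_kernel t x y * euclidean_norm y `^ (- a))%:E <= (C * t `^ (- (a / 2)))%:E)%E.
  by apply: integral_heat_kernel_singular; rewrite aN (le_trans b0).
have [C2 C20 H2] : exists2 C : R, 0 < C & forall t x, 0 < t ->
    (\int[mu]_y (heat_kernel t x y * euclidean_norm y `^ (- (a - b)))%:E <= (C * t `^ (- ((a - b) / 2)))%:E)%E.
  by apply: integral_heat_kernel_singular; apply/andP; split; lra.
have B0 : 0 < 4 `^ (b / 2) :> R by exact: powR_gt0.
set D : R := (8 * (b / 2)) `^ (b / 2) * 2 `^ (N%:R / 2).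
have D0 : 0 <= D by rewrite mulr_ge0 ?powR_ge0.
have T0 : 0 < 2 `^ (- (a / 2)) :> R by exact: powR_gt0.
exists (4 `^ (b / 2) * (D * (C1 * 2 `^ (- (a / 2))) + C2)).
  by rewrite mulr_gt0// ltr_wpDl// mulr_ge0// mulr_ge0 ?(ltW C10) ?(ltW T0).
move=> t x t0.
have mK a' t' : measurable_fun [set: Rn R N] (fun y => (heat_kernel t' x y * euclidean_norm y `^ (- a'))%:E).
  apply/measurable_EFinP; apply: measurable_funM.
    by apply: measurable_heat_kernel => //; exact: measurable_cst.
  exact: measurable_euclidean_norm.
have K0 t' a' y : (0 <= (heat_kernel t' x y * euclidean_norm y `^ (- a'))%:E)%E.
  by rewrite lee_fin mulr_ge0 ?heat_kernel_ge0 ?powR_ge0.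
rewrite -ge0_integralZl_EFin ?powR_ge0//.
apply: (@le_trans _ _ (\int[mu]_y ((4 `^ (b / 2) * (D * t `^ (b / 2)))%:E *
    (heat_kernel (2 * t) x y * euclidean_norm y `^ (- a))%:E +
    (4 `^ (b / 2))%:E * (heat_kernel t x y * euclidean_norm y `^ (- (a - b)))%:E))%E).
  apply: le_integral_nonneg => y _; first by rewrite mule_ge0 ?lee_fin ?powR_ge0 ?mulr_ge0 ?heat_kernel_ge0 ?powR_ge0.
  rewrite -!EFinM -EFinD lee_fin.
  have k0 := heat_kernel_ge0 t x y.
  have w0 : 0 <= euclidean_norm y `^ (- a) by exact: powR_ge0.
  apply: le_trans (ler_wpM2r (mulr_ge0 k0 w0) (euclidean_norm_split x y b0)) _.
  have E1 := powR_sqdist_heat_kernel x y t0 b0.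
  have E2 : euclidean_norm y `^ b * euclidean_norm y `^ (- a) <= euclidean_norm y `^ (- (a - b)).
    (* Adding exponents is not allowed at [y = 0]: there the left side is 0 by default when [a] is
       nonzero, and [a = 0] forces [b = 0]. *)
    have [y0|y0] := eqVneq (euclidean_norm y) 0; last first.
      by rewrite -powRD ?y0 ?implybT//; apply: eqW; congr (_ `^ _); ring.
    have [a0|a0] := eqVneq a 0; last by rewrite y0 [0 `^ (- a)]powR0 ?oppr_eq0// mulr0 powR_ge0.
    by rewrite (_ : b = 0) ?a0 ?subrr ?oppr0 ?powRr0 ?mulr1//; apply/eqP; rewrite eq_le b0 -a0 ba.
  rewrite -mulrA [leRHS](_ : _ = 4 `^ (b / 2) * (D * t `^ (b / 2) * heat_kernel (2 * t) x y * euclidean_norm y `^ (- a) +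
     heat_kernel t x y * euclidean_norm y `^ (- (a - b)))); last by ring.
  rewrite ler_wpM2l ?(ltW B0)// mulrDl lerD//.
    by rewrite mulrA ler_wpM2r.
  by rewrite mulrCA ler_wpM2l.
rewrite ge0_integralD//; last 4 first.
- by move=> y _; rewrite mule_ge0// lee_fin !mulr_ge0 ?powR_ge0.
- exact: measurable_funeM.
- by move=> y _; rewrite mule_ge0// lee_fin powR_ge0.
- exact: measurable_funeM.
rewrite !ge0_integralZl_EFin// ?mulr_ge0 ?powR_ge0//.
have t20 : 0 < 2 * t by rewrite mulr_gt0.
apply: le_trans (leeD (lee_wpmul2l _ (H1 _ x t20)) (lee_wpmul2l _ (H2 _ x t0))) _; rewrite ?lee_fin ?mulr_ge0 ?powR_ge0//.
have -> : (2 * t) `^ (- (a / 2)) = 2 `^ (- (a / 2)) * t `^ (- (a / 2)) by rewrite powRM ?(ltW t0).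
have -> : t `^ (- ((a - b) / 2)) = t `^ (b / 2) * t `^ (- (a / 2)).
  by rewrite -gt0_powRD//; congr (_ `^ _); ring.
by apply: eqW; ring.
Qed.

End singular_weights.

(** * Weighted norms *)

Lemma ge0_le_poweR (R : realType) (p : R) (x y : \bar R) :
  0 <= p -> (0 <= x -> x <= y -> x `^ p <= y `^ p)%E.
Proof.
move=> p0 x0 xy; apply: gt0_ler_poweR => //; rewrite in_itv/= leey andbT//.
exact: le_trans xy.
Qed.

Section parametric_integrals.
Context d1 d2 (T1 : measurableType d1) (T2 : measurableType d2) (R : realType).
Variables (m1 : {sigma_finite_measure set T1 -> \bar R}).
Variables (m2 : {sigma_finite_measure set T2 -> \bar R}).
Local Open Scope ereal_scope.

Lemma measurable_integral_param (D : set T2) (F : T1 * T2 -> \bar R) : measurable D ->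
  measurable_fun ([set: T1] `*` D) F -> (forall x y, D y -> 0 <= F (x, y)) ->
  measurable_fun [set: T1] (fun x => \int[m2]_(y in D) F (x, y)).
Proof.
move=> mD mF F0; under eq_fun do rewrite integral_mkcond.
have := @measurable_fun_fubini_tonelli_F _ _ T1 T2 R m2 (F \_ ([set: T1] `*` D)).
rewrite (_ : fubini_F m2 _ = (fun x => \int[m2]_y ((fun y => F (x, y)) \_ D) y)); last first.
  apply/funext => x; apply: eq_integral => y _; rewrite !patchE.
  by congr (if _ then _ else _); apply/idP/idP; rewrite !inE => // -[].
apply.
- by apply/(measurable_restrictT _ (measurableX measurableT mD)).
- by move=> [x y]; rewrite patchE; case: ifPn => //; rewrite inE => -[_ Dy]; exact: F0.
Qed.

Lemma fubini_tonelli_dom (D : set T1) (F : T1 * T2 -> \bar R) : measurable D ->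
  measurable_fun (D `*` [set: T2]) F -> (forall x y, D x -> 0 <= F (x, y)) ->
  \int[m1]_(x in D) \int[m2]_y F (x, y) = \int[m2]_y \int[m1]_(x in D) F (x, y).
Proof.
move=> mD mF F0.
pose G := F \_ (D `*` [set: T2]).
have G0 z : 0 <= G z.
  by case: z => x y; rewrite /G patchE; case: ifPn => //; rewrite inE => -[Dx _]; exact: F0.
have mG : measurable_fun [set: T1 * T2] G.
  by apply/(measurable_restrictT _ (measurableX mD measurableT)).
have GE x y : G (x, y) = if x \in D then F (x, y) else 0.
  by rewrite /G patchE; congr (if _ then _ else _); apply/idP/idP; rewrite !inE => // -[].
rewrite integral_mkcond; transitivity (\int[m1]_x \int[m2]_y G (x, y)).
  apply: eq_integral => x _; rewrite patchE; case: ifPn => xD.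
    by apply: eq_integral => y _; rewrite GE xD.
  by under eq_integral do rewrite GE (negbTE xD); rewrite integral0.
rewrite (fubini_tonelli G mG G0); apply: eq_integral => y _; rewrite [RHS]integral_mkcond.
by apply: eq_integral => x _; rewrite GE patchE.
Qed.

Lemma measurable_Rintegral_param (D : set T2) (F : T1 * T2 -> R) : measurable D ->
  measurable_fun ([set: T1] `*` D) F ->
  measurable_fun [set: T1] (fun x => (\int[m2]_(y in D) F (x, y))%R).
Proof.
move=> mD mF; apply: (@measurableT_comp _ _ _ _ _ _ fine) => //.
have mE : measurable_fun ([set: T1] `*` D) (EFin \o F) by exact/measurable_EFinP.
have Hp := @measurable_integral_param D (EFin \o F)^\+ mD (measurable_funepos mE) (fun x y _ => funepos_ge0 _ _).
have Hn := @measurable_integral_param D (EFin \o F)^\- mD (measurable_funeneg mE) (fun x y _ => funeneg_ge0 _ _).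
rewrite (_ : (fun x => _) = (fun x => \int[m2]_(y in D) (EFin \o F)^\+ (x, y) -
    \int[m2]_(y in D) (EFin \o F)^\- (x, y))); first exact: emeasurable_funB.
apply/funext => x; rewrite [LHS]integralE; congr (_ - _); apply: eq_integral => y _.
- by rewrite !funeposE.
- by rewrite !funenegE.
Qed.

End parametric_integrals.

Section weighted_norms.
Context {R : realType} {N : nat}.
Local Notation mu := (@lebesgue_Rn R N).
Local Open Scope ereal_scope.
Implicit Types (g nu M L c : R) (q : \bar R) (f h : Rn R N -> \bar R).

(** The weighted norm for extended-valued functions, so that integrals and series can be estimated
    before they are known to converge. On [EFin \o f] it is convertible to [weighted_norm g q f]. *)
Definition wnorm g q f : \bar R :=
  'N[mu]_q[(fun x => (euclidean_norm x `^ g)%:E * f x)].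

Lemma wnorm_finP g p M f : (0 < p)%R -> (0 <= M)%R ->
  wnorm g p%:E f <= M%:E <->
  \int[mu]_x ((euclidean_norm x `^ g)%:E * `|f x|) `^ p <= (M `^ p)%:E.
Proof.
move=> p0 M0; rewrite /wnorm unlock.
rewrite (_ : \int[mu]_x _ = \int[mu]_x ((euclidean_norm x `^ g)%:E * `|f x|) `^ p); last first.
  by apply: eq_integral => x _; rewrite abseM abse_EFin ger0_norm ?powR_ge0.
set I := integral _ _ _; have I0 : 0 <= I by apply: integral_ge0 => x _; exact: poweR_ge0.
have pV0 : (0 < p^-1)%R by rewrite invr_gt0.
split => H.
  have := ge0_le_poweR (ltW p0) (poweR_ge0 _ _) H.
  by rewrite -poweRrM mulVf ?gt_eqF// poweRe1// poweR_EFin.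
have := ge0_le_poweR (ltW pV0) I0 H.
by rewrite poweR_EFin -powRrM mulfV ?gt_eqF// powRr1.
Qed.

Lemma wnorm_inftyP g M f : wnorm g +oo f <= M%:E <->
  {ae mu, forall x, (euclidean_norm x `^ g)%:E * `|f x| <= M%:E}.
Proof.
rewrite /wnorm unlock lebesgue_Rn_gt0; split.
  move/ess_supP; apply: filterS => x /=.
  by rewrite abseM abse_EFin ger0_norm ?powR_ge0.
move=> H; apply/ess_supP; apply: filterS H => x /=.
by rewrite abseM abse_EFin ger0_norm ?powR_ge0.
Qed.

Lemma measurable_weight g : measurable_fun [set: Rn R N] (fun x => (euclidean_norm x `^ g)%:E).
Proof. by apply/measurable_EFinP; exact: measurable_euclidean_norm. Qed.

Lemma wnorm_ge0 g q f : 0 <= wnorm g q f.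
Proof. exact: Lnorm_ge0. Qed.

Lemma le_wnorm g q f h : 1 <= q -> (forall x, `|f x| <= `|h x|) ->
  wnorm g q f <= wnorm g q h.
Proof.
move=> q1 fh; case: q q1 => [p| |]//; rewrite ?lee_fin => p1.
- have p0 : (0 < p)%R by exact: lt_le_trans p1.
  have [->|hfin] := eqVneq (wnorm g p%:E h) +oo; first by rewrite leey.
  have hf : wnorm g p%:E h \is a fin_num by rewrite ge0_fin_numE ?wnorm_ge0// lt_neqAle hfin leey.
  have h0 : (0 <= fine (wnorm g p%:E h))%R by rewrite fine_ge0 ?wnorm_ge0.
  rewrite -[leRHS](fineK hf); apply/wnorm_finP => //.
  apply: (@le_trans _ _ (\int[mu]_x ((euclidean_norm x `^ g)%:E * `|h x|) `^ p)).
    apply: le_integral_nonneg => x _; first exact: poweR_ge0.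
    apply: ge0_le_poweR; [exact: ltW|by rewrite mule_ge0 ?lee_fin ?powR_ge0|].
    by apply: lee_wpmul2l; [rewrite lee_fin powR_ge0|exact: fh].
  by apply/(wnorm_finP g h p0 h0); rewrite fineK.
- rewrite /wnorm unlock lebesgue_Rn_gt0; apply: le_ess_sup; apply: aeW => x /=.
  by rewrite !abseM lee_wpmul2l.
Qed.

Lemma eq_wnorm_ae g q f h : 1 <= q -> measurable_fun [set: _] f -> measurable_fun [set: _] h ->
  {ae mu, forall x, f x = h x} -> wnorm g q f = wnorm g q h.
Proof.
move=> q1 mf mh fh; case: q q1 => [p| |]//; rewrite ?lee_fin => p1.
- rewrite /wnorm unlock; congr (_ `^ _); apply: ge0_ae_eq_integral => //.
  + apply: (measurableT_comp (measurable_poweR _)); apply: measurableT_comp => //.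
    by apply: emeasurable_funM => //; exact: measurable_weight.
  + apply: (measurableT_comp (measurable_poweR _)); apply: measurableT_comp => //.
    by apply: emeasurable_funM => //; exact: measurable_weight.
  + by move=> x _; exact: poweR_ge0.
  + by move=> x _; exact: poweR_ge0.
  + by apply: filterS fh => x -> _.
- rewrite /wnorm unlock lebesgue_Rn_gt0; apply: eq_ess_sup.
  by apply: filterS fh => x /= ->.
Qed.

Lemma wnormZ g q M c f : 1 <= q -> (0 < c)%R -> (0 <= M)%R ->
  measurable_fun [set: _] f ->
  wnorm g q f <= M%:E -> wnorm g q (fun x => c%:E * f x) <= (c * M)%:E.
Proof.
move=> q1 c0 M0 mf; case: q q1 => [p| |]//; rewrite ?lee_fin => p1.
- have p0 : (0 < p)%R by exact: lt_le_trans p1.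
  move=> /(wnorm_finP g f p0 M0) H; apply/wnorm_finP => //; first by rewrite mulr_ge0// ltW.
  under eq_integral => x _.
    rewrite abseM abse_EFin gtr0_norm// muleCA poweRM ?lee_fin ?(ltW c0)//; last first.
      by rewrite mule_ge0 ?lee_fin ?powR_ge0.
    over.
  rewrite poweR_EFin ge0_integralZl_EFin ?powR_ge0//.
  + by rewrite powRM ?(ltW c0)// EFinM lee_wpmul2l// lee_fin powR_ge0.
  + by move=> x _; exact: poweR_ge0.
  + apply: (measurableT_comp (measurable_poweR _)); apply: emeasurable_funM.
      exact: measurable_weight.
    exact: measurableT_comp.
- move=> /wnorm_inftyP H; apply/wnorm_inftyP; apply: filterS H => x H.
  by rewrite abseM abse_EFin gtr0_norm// muleCA EFinM lee_wpmul2l// lee_fin ltW.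
Qed.

(* Minkowski's integral inequality: Jensen's inequality for the weight [m],
   integrated in [x]. *)
Lemma wnorm_integral d (S : measurableType d) (lam : {sigma_finite_measure set S -> \bar R})
    (D : set S) (h : S -> Rn R N -> \bar R) (m : S -> R) g q L : 1 <= q -> measurable D ->
  measurable_fun (D `*` [set: Rn R N]) (fun z => h z.1 z.2) ->
  (forall s x, D s -> 0 <= h s x) ->
  measurable_fun D m -> (forall s, D s -> 0 < m s)%R ->
  (forall s, D s -> wnorm g q (h s) <= (m s)%:E) ->
  (0 < L)%R -> \int[lam]_(s in D) (m s)%:E <= L%:E ->
  wnorm g q (fun x => \int[lam]_(s in D) h s x) <= L%:E.
Proof.
move=> q1 mD mh h0 mm m0 hm L0 mL.
have mDT : measurable (D `*` [set: Rn R N]) by exact: measurableX.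
have mwt : measurable_fun (D `*` [set: Rn R N]) (fun z => (euclidean_norm z.2 `^ g)%:E).
  by apply/measurable_EFinP; apply: measurable_euclidean_norm; apply: measurable_funTS; exact: measurable_snd.
have mm1 : measurable_fun (D `*` [set: Rn R N]) (fun z => m z.1).
  apply: (measurable_comp mD) => //; first by move=> _ [z [Dz _] <-].
  by apply: measurable_funTS; exact: measurable_fst.
have mhx x : measurable_fun D (fun s => h s x).
  apply: (measurable_comp mDT (g := fun s => (s, x)) (f := fun z => h z.1 z.2)) => //.
    by move=> _ [s Ds <-].
  by apply: measurable_funTS; exact: pair2_measurable.
have mhs s : D s -> measurable_fun [set: Rn R N] (h s).
  move=> Ds; apply: (measurable_comp mDT (g := fun x => (s, x)) (f := fun z => h z.1 z.2)) => //.
    by move=> _ [y _ <-].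
  exact: pair1_measurable.
have mwh : measurable_fun (D `*` [set: Rn R N]) (fun z => (euclidean_norm z.2 `^ g)%:E * h z.1 z.2).
  exact: emeasurable_funM.
pose H s x := (euclidean_norm x `^ g)%:E * h s x.
have H0 s x : D s -> 0 <= H s x by move=> Ds; rewrite mule_ge0 ?lee_fin ?powR_ge0 ?h0.
have HI x : (euclidean_norm x `^ g)%:E * `|\int[lam]_(s in D) h s x| = \int[lam]_(s in D) H s x.
  rewrite gee0_abs; last by apply: integral_ge0 => s; exact: h0.
  by rewrite -ge0_integralZl_EFin ?powR_ge0// => s; exact: h0.
have mHx x : measurable_fun D (fun s => H s x) by exact: measurable_funeM.
case: q q1 hm => [p| |]//; rewrite ?lee_fin => p1 hm.
- have p0 : (0 < p)%R by exact: lt_le_trans p1.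
  apply/(wnorm_finP _ _ p0 (ltW L0)); under eq_integral do rewrite HI.
  (* [H] is written as [(H / m) * m]: Jensen's inequality applies with the density [m], and the
     function [H / m] has norm at most 1. *)
  pose J s x := ((m s)^-1%:E * H s x) `^ p * (m s)%:E.
  have J0 s x : D s -> 0 <= J s x by move=> Ds; rewrite mule_ge0 ?poweR_ge0// lee_fin ltW ?m0.
  have mJ : measurable_fun (D `*` [set: Rn R N]) (fun z => J z.1 z.2).
    apply: emeasurable_funM; last exact/measurable_EFinP.
    apply: (measurableT_comp (measurable_poweR _)); apply: emeasurable_funM => //.
    by apply/measurable_EFinP; exact: measurable_inv.
  apply: (@le_trans _ _ (\int[mu]_x ((L `^ (p - 1))%:E * \int[lam]_(s in D) J s x))).
    apply: le_integral_nonneg => x _; first exact: poweR_ge0.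
    rewrite (_ : \int[lam]_(s in D) H s x = \int[lam]_(s in D) (((m s)^-1%:E * H s x) * (m s)%:E)); last first.
      apply: eq_integral => s /set_mem Ds.
      by rewrite muleAC -EFinM mulVf ?mul1e// gt_eqF ?m0.
    apply: weighted_jensen => //.
    + apply: emeasurable_funM => //; apply/measurable_EFinP; exact: measurable_inv.
    + exact/measurable_EFinP.
    + by move=> s Ds; rewrite mule_ge0 ?H0// lee_fin invr_ge0 ltW ?m0.
    + by move=> s Ds; rewrite lee_fin ltW ?m0.
  rewrite ge0_integralZl_EFin ?powR_ge0//; last 2 first.
  + by move=> x _; apply: integral_ge0 => s; exact: J0.
  + apply: (@measurable_integral_param _ _ _ _ _ lam D (fun z => J z.2 z.1)) => // [|x s Ds]; last exact: J0.
    apply: (measurable_comp mDT (g := fun z : Rn R N * S => (z.2, z.1)) (f := fun z => J z.1 z.2)) => //.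
      by move=> _ [z [_ Dz] <-].
    by apply: measurable_funTS; exact: measurable_swap.
  rewrite -(@fubini_tonelli_dom _ _ _ _ _ lam mu D (fun z => J z.1 z.2))//=.
  apply: (@le_trans _ _ ((L `^ (p - 1))%:E * \int[lam]_(s in D) (m s)%:E)).
    apply: lee_wpmul2l; first by rewrite lee_fin powR_ge0.
    apply: le_integral_nonneg => s Ds.
      by apply: integral_ge0 => x _; exact: J0.
    have ms0 := m0 _ Ds; have mi0 : (0 <= (m s)^-1)%R by rewrite invr_ge0 ltW.
    have ip : (0 <= ((m s)^-1 `^ p))%R by exact: powR_ge0.
    have mHs : measurable_fun [set: Rn R N] (fun x => H s x `^ p).
      apply: (measurableT_comp (measurable_poweR _)); apply: emeasurable_funM; last exact: mhs.
      exact: measurable_weight.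
    rewrite (_ : \int[mu]_x J s x = \int[mu]_x (((m s)^-1 `^ p * m s)%:E * H s x `^ p)); last first.
      apply: eq_integral => x _; rewrite /J poweRM; [|by rewrite lee_fin|exact: H0].
      by rewrite poweR_EFin muleAC -EFinM.
    rewrite ge0_integralZl_EFin ?mulr_ge0 ?(ltW ms0)//; last by move=> x _; exact: poweR_ge0.
    have := (wnorm_finP g (h s) p0 (ltW ms0)).1 (hm _ Ds).
    rewrite (_ : integral _ _ _ = \int[mu]_x H s x `^ p); last first.
      by apply: eq_integral => x _; rewrite gee0_abs ?h0.
    move=> /(lee_wpmul2l _)-/(_ ((m s)^-1 `^ p * m s)%:E) Hle.
    apply: le_trans (Hle _) _; first by rewrite lee_fin mulr_ge0// ltW.
    rewrite -EFinM lee_fin mulrAC -powRM ?(ltW ms0)// mulVf ?gt_eqF// powR1 mul1r.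
    exact: lexx.
  apply: le_trans (lee_wpmul2l _ mL) _; first by rewrite lee_fin powR_ge0.
  by rewrite -EFinM lee_fin mulrC mulr_powRB1// ltW.
- apply/wnorm_inftyP.
  (* The bound [H s x <= m s] holds off a null set that depends on [s]. Tonelli's theorem for the
     excess [phi] produces one null set of points [x], off which the excess integrates to 0 in
     time. *)
  pose phi s x := maxe (H s x - (m s)%:E) 0.
  have mphi : measurable_fun (D `*` [set: Rn R N]) (fun z => phi z.1 z.2).
    apply: measurable_maxe => //; apply: emeasurable_funB => //; exact/measurable_EFinP.
  have phi0 s x : 0 <= phi s x by rewrite le_max lexx orbT.
  have : \int[mu]_x `|\int[lam]_(s in D) phi s x| = 0.
    under eq_integral do rewrite gee0_abs ?integral_ge0//.
    rewrite -(@fubini_tonelli_dom _ _ _ _ _ lam mu D (fun z => phi z.1 z.2))//=.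
    rewrite -[RHS](integral0 lam D); apply: eq_integral => s /set_mem Ds.
    have /wnorm_inftyP Hs := hm _ Ds.
    rewrite -[RHS](integral0 mu setT); apply: ge0_ae_eq_integral => //.
      apply: (measurable_comp mDT (g := fun x => (s, x)) (f := fun z => phi z.1 z.2)) => //.
        by move=> _ [y _ <-].
      exact: pair1_measurable.
    apply: filterS Hs => x; rewrite gee0_abs ?h0// => Hx _.
    by apply/max_idPr; rewrite sube_le0.
  move=> /ae_eq_integral_abs-/(_ measurableT) ae0.
  have : ae_eq mu setT (fun x => \int[lam]_(s in D) phi s x) (cst 0).
    apply: ae0; apply: (@measurable_integral_param _ _ _ _ _ lam D (fun z => phi z.2 z.1)) => //.
    apply: (measurable_comp mDT (g := fun z : Rn R N * S => (z.2, z.1)) (f := fun z => phi z.1 z.2)) => //.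
      by move=> _ [z [_ Dz] <-].
    by apply: measurable_funTS; exact: measurable_swap.
  apply: filterS => x /(_ I) phix; rewrite HI.
  have mphix : measurable_fun D (fun s => phi s x).
    apply: (measurable_comp mDT (g := fun s => (s, x)) (f := fun z => phi z.1 z.2)) => //.
      by move=> _ [s Ds <-].
    by apply: measurable_funTS; exact: pair2_measurable.
  apply: (@le_trans _ _ (\int[lam]_(s in D) ((m s)%:E + phi s x))).
    apply: le_integral_nonneg => s Ds; first exact: H0.
    by rewrite -leeBlDl// /phi le_max lexx.
  rewrite ge0_integralD//.
  + by rewrite phix adde0.
  + by move=> s Ds; rewrite lee_fin ltW ?m0.
  + exact/measurable_EFinP.
Qed.

End weighted_norms.

Section nat_counting.
Context {R : realType}.

(** A named copy of the counting measure that carries a sigma-finite structure, as [wnorm_integral]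
    requires; sums then become integrals. *)
Definition nat_counting : set nat -> \bar R := @counting nat R.

HB.instance Definition _ := Measure.on nat_counting.

HB.instance Definition _ := @Measure_isSigmaFinite.Build _ nat R nat_counting
  (@sigma_finite_counting R).

End nat_counting.

Section wnorm_sums.
Context {R : realType} {N : nat}.
Local Notation mu := (@lebesgue_Rn R N).
Local Open Scope ereal_scope.
Implicit Types (g nu M L c : R) (q : \bar R) (f h k : Rn R N -> \bar R).

Lemma measurable_fun_nat d (T : measurableType d) (h : nat -> T -> \bar R) :
  (forall n, measurable_fun [set: T] (h n)) ->
  measurable_fun [set: nat * T] (fun z => h z.1 z.2).
Proof.
move=> mh _ Y mY; rewrite setTI.
rewrite (_ : _ @^-1` Y = \bigcup_n ([set n] `*` (h n @^-1` Y))).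
  apply: bigcup_measurable => n _; apply: measurableX => //.
  by rewrite -[X in measurable X]setTI; exact: mh.
apply/seteqP; split => [[n x] /= Yx|[n x] [m _ [/= -> ]]]; last by [].
by exists n.
Qed.

Lemma wnorm_nneseries g q (h : nat -> Rn R N -> \bar R) (m : nat -> R) L : 1 <= q ->
  (forall n, measurable_fun [set: _] (h n)) -> (forall n x, 0 <= h n x) ->
  (forall n, 0 < m n)%R -> (forall n, wnorm g q (h n) <= (m n)%:E) ->
  (0 < L)%R -> \sum_(n <oo) (m n)%:E <= L%:E ->
  wnorm g q (fun x => \sum_(n <oo) h n x) <= L%:E.
Proof.
move=> q1 mh h0 m0 hm L0 mL.
rewrite (_ : (fun x => _) = (fun x => \int[@nat_counting R]_n h n x)); last first.
  by apply/funext => x; rewrite ge0_integral_count.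
apply: (@wnorm_integral R N _ nat (@nat_counting R) setT h m g q L) => //.
- by apply: measurable_funTS; exact: measurable_fun_nat.
- by rewrite ge0_integral_count// => n; rewrite lee_fin ltW.
Qed.

(** Minkowski's integral inequality over the two points of [I_2]. The bounds are positive because
    they become the values of the density [m]. *)
Let wnormD_pos g q M L f h : 1 <= q -> (0 < M)%R -> (0 < L)%R ->
  measurable_fun [set: _] f -> measurable_fun [set: _] h ->
  (forall x, 0 <= f x) -> (forall x, 0 <= h x) ->
  wnorm g q f <= M%:E -> wnorm g q h <= L%:E ->
  wnorm g q (fun x => f x + h x) <= (M + L)%:E.
Proof.
move=> q1 M0 L0 mf mh f0 h0 fM hL.
have I2 (a b : \bar R) : 0 <= a -> 0 <= b ->
    \int[@nat_counting R]_(n in `I_2) (if n == 0%N then a else b) = a + b.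
  move=> a0 b0; rewrite integral_mkcond ge0_integral_count; last first.
    by move=> n; rewrite patchE; case: ifP => // _; case: ifP.
  have c0 n : 0 <= ((fun n => if n == 0%N then a else b) \_ `I_2) n.
    by rewrite patchE; case: ifP => // _; case: ifP.
  rewrite (nneseries_split 0 2)// ereal_series_cond eseries0 ?adde0; last first.
    by move=> i _; rewrite andbT add0n => i2; rewrite patchE memNset//= ltnNge i2.
  by rewrite add0n big_mkord 2!big_ord_recr /= big_ord0 add0e !patchE !mem_set.
rewrite (_ : (fun x => _) = (fun x => \int[@nat_counting R]_(n in `I_2) (if n == 0%N then f x else h x))); last first.
  by apply/funext => x; rewrite I2.
apply: (@wnorm_integral R N _ nat (@nat_counting R) `I_2 (fun n x => if n == 0%N then f x else h x)
   (fun n => if n == 0%N then M else L) g q (M + L)) => //.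
- apply: measurable_funTS; apply: (measurable_fun_nat (h := fun n x => if n == 0%N then f x else h x)).
  by case.
- by case=> [|n] x _ /=.
- by case.
- by case.
- by rewrite addr_gt0.
under eq_integral do rewrite (fun_if EFin).
by rewrite I2 ?lee_fin ?(ltW M0) ?(ltW L0).
Qed.

(** The triangle inequality in the form used throughout: bounds in, bounds out, for any [k]
    dominated by the sum. Zero bounds are reached by adding [e / 2] to each. *)
Lemma wnorm_le_add g q M L f h k : 1 <= q -> (0 <= M)%R -> (0 <= L)%R ->
  measurable_fun [set: _] f -> measurable_fun [set: _] h ->
  (forall x, `|k x| <= `|f x| + `|h x|) ->
  wnorm g q f <= M%:E -> wnorm g q h <= L%:E -> wnorm g q k <= (M + L)%:E.
Proof.
move=> q1 M0 L0 mf mh kfh fM hL; apply/lee_addgt0Pr => e e0.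
apply: (@le_trans _ _ (wnorm g q (fun x => `|f x| + `|h x|))).
  by apply: le_wnorm => // x; rewrite [leRHS]gee0_abs ?adde_ge0.
rewrite -EFinD (_ : M + L + e = (M + e / 2) + (L + e / 2))%R; last by field.
have e20 : (0 < e / 2)%R by rewrite divr_gt0.
apply: wnormD_pos => //.
- by rewrite ltr_wpDl.
- by rewrite ltr_wpDl.
- exact: measurableT_comp.
- exact: measurableT_comp.
- apply: le_trans (_ : M%:E <= _); last by rewrite lee_fin lerDl ltW.
  by apply: le_trans fM; apply: le_wnorm => // x; rewrite abse_id.
- apply: le_trans (_ : L%:E <= _); last by rewrite lee_fin lerDl ltW.
  by apply: le_trans hL; apply: le_wnorm => // x; rewrite abse_id.
Qed.

Lemma wnorm_eq0 g q f : (0 < N)%N -> 1 <= q -> measurable_fun [set: _] f ->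
  wnorm g q f <= 0 -> {ae mu, forall x, f x = 0}.
Proof.
move=> N0 q1 mf f0.
have := @Lnorm_eq0_eq0 _ _ R mu (fun x => (euclidean_norm x `^ g)%:E * f x) q.
move=> /(_ _ _ _) H.
have : (fun x => (euclidean_norm x `^ g)%:E * f x) = \0 %[ae mu].
  apply: H; first by apply: emeasurable_funM => //; exact: measurable_weight.
  - exact: lt_le_trans q1.
  - by apply/eqP; rewrite eq_le f0 wnorm_ge0.
apply: filterS2 (ae_euclidean_norm_gt0 N0) => x x0 /(_ I) /= /eqP.
rewrite mule_eq0 => /orP[|/eqP//].
by rewrite eqe gt_eqF// powR_gt0.
Qed.

(** An infinite value, multiplied by a weight that is positive almost everywhere, would make the
    norm infinite. This turns norm bounds on time integrals and series into convergence at almost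
    every point. *)
Lemma wnorm_lty_ae g q M f : (0 < N)%N -> 1 <= q -> (0 <= M)%R -> measurable_fun [set: _] f ->
  wnorm g q f <= M%:E -> {ae mu, forall x, f x \is a fin_num}.
Proof.
move=> N0 q1 M0 mf; case: q q1 => [p| |]//; rewrite ?lee_fin => p1.
- have p0 : (0 < p)%R by exact: lt_le_trans p1.
  move=> /(wnorm_finP g f p0 M0) H.
  have mF : measurable_fun [set: Rn R N] (fun x => ((euclidean_norm x `^ g)%:E * `|f x|) `^ p).
    apply: (measurableT_comp (measurable_poweR _)); apply: emeasurable_funM.
      exact: measurable_weight.
    exact: measurableT_comp.
  have : mu.-integrable setT (fun x => ((euclidean_norm x `^ g)%:E * `|f x|) `^ p).
    apply/integrableP; split => //.
    under eq_integral do rewrite gee0_abs ?poweR_ge0//.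
    by apply: le_lt_trans H _; rewrite ltry.
  move=> /integrable_ae-/(_ measurableT).
  apply: filterS2 (ae_euclidean_norm_gt0 N0) => x x0 /(_ I).
  apply: contraTT; rewrite fin_numE negb_and !negbK => /orP[] /eqP ->;
    by rewrite /= gt0_muley ?lte_fin ?powR_gt0// poweRyr ?gt_eqF.
- move=> /wnorm_inftyP; apply: filterS2 (ae_euclidean_norm_gt0 N0) => x x0.
  apply: contraTT; rewrite fin_numE negb_and !negbK => /orP[] /eqP ->;
    by rewrite /= gt0_muley ?lte_fin ?powR_gt0// -ltNge ltry.
Qed.

End wnorm_sums.

(** * The power nonlinearity in weighted spaces *)

Section nonlinear_estimates.
Context {R : realType} {N : nat}.
Local Notation mu := (@lebesgue_Rn R N).

(** For [|v| <= |u|] the difference is [|u|^alpha (u - v) + (|u|^alpha - |v|^alpha) v]. With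
    [th = |v| / |u|], the second term reduces to a Bernoulli inequality for [1 - th ^ alpha], valid
    for every [alpha > 0]. *)
Lemma nonlinearity_lipschitz (alpha : R) : 0 < alpha ->
  exists2 C : R, 0 < C & forall u v : R,
  `| `|u| `^ alpha * u - `|v| `^ alpha * v| <= C * ((`|u| `^ alpha + `|v| `^ alpha) * `|u - v|).
Proof.
(* An integer above [alpha]: for [th] in [[0, 1]] one has [th ^ m <= th ^ alpha], and
   [1 - th ^ m <= m (1 - th)] follows by induction. *)
move=> a0; set m := (Num.truncn alpha).+1.
have am : alpha <= m%:R by rewrite ltW// truncnS_gt.
have bern (th : R) : 0 <= th <= 1 -> (1 - th `^ alpha) <= m%:R * (1 - th).
  move=> /andP[th0 th1].
  apply: (@le_trans _ _ (1 - th ^+ m)).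
    rewrite lerD2l lerN2; move: th0; rewrite le_eqVlt => /predU1P[<-|th0].
      by rewrite expr0n powR_ge0.
    by rewrite -powR_mulrn ?(ltW th0)// ger_powR// th0.
  elim: m {am} => [|k ih]; first by rewrite expr0 subrr mul0r.
  rewrite exprS -natr1 mulrDl mul1r.
  have thk : th ^+ k <= 1 by rewrite exprn_ile1.
  have thk0 : 0 <= th ^+ k by rewrite exprn_ge0.
  nra.
have C0 : 0 < 1 + m%:R :> R by rewrite addr_gt0// ltr0n.
exists (1 + m%:R) => // u v.
wlog uv : u v / `|v| <= `|u|.
  move=> H; have [/H//|/ltW/H] := leP `|v| `|u|.
  by rewrite distrC [X in X * `|v - u|]addrC (distrC v).
have x0 := normr_ge0 u; have y0 := normr_ge0 v.
have -> : `|u| `^ alpha * u - `|v| `^ alpha * v =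
    `|u| `^ alpha * (u - v) + (`|u| `^ alpha - `|v| `^ alpha) * v by ring.
apply: le_trans (ler_normD _ _) _; rewrite !normrM ger0_norm ?powR_ge0//.
have pm : `|v| `^ alpha <= `|u| `^ alpha by rewrite ge0_ler_powR ?(ltW a0).
rewrite (ger0_norm (_ : 0 <= `|u| `^ alpha - _)) ?subr_ge0//.
have key : (`|u| `^ alpha - `|v| `^ alpha) * `|v| <= m%:R * (`|u| `^ alpha * `|u - v|).
  have [u0|u0] := eqVneq `|u| 0.
    have -> : `|v| = 0 by apply: le_anti; rewrite y0 andbT (le_trans uv)// u0.
    by rewrite mulr0 !mulr_ge0 ?powR_ge0.
  have u0' : 0 < `|u| by rewrite lt_neqAle eq_sym u0.
  have th01 : 0 <= `|v| / `|u| <= 1 by rewrite divr_ge0//= ler_pdivrMr// mul1r.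
  have -> : `|v| `^ alpha = `|u| `^ alpha * (`|v| / `|u|) `^ alpha.
    by rewrite -powRM ?divr_ge0// mulrC divfK.
  have B := bern _ th01; have P0 : 0 <= `|u| `^ alpha by exact: powR_ge0.
  have tri : `|u| - `|v| <= `|u - v| by exact: lerB_dist.
  rewrite [leRHS]mulrCA (_ : _ * `|v| = `|u| `^ alpha * ((1 - (`|v| / `|u|) `^ alpha) * `|v|)); last by ring.
  rewrite ler_wpM2l//.
  apply: (@le_trans _ _ (m%:R * (1 - `|v| / `|u|) * `|u|)).
    have /andP[th0 th1] := th01.
    apply: ler_pM => //; rewrite subr_ge0.
    by have := ge0_ler_powR (ltW a0) th0 ler01 th1; rewrite powR1.
  by rewrite -mulrA mulrBl mul1r divfK// ler_wpM2l.
have Pv : 0 <= `|v| `^ alpha * `|u - v| by rewrite mulr_ge0 ?powR_ge0.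
have Pu : 0 <= m%:R * (`|v| `^ alpha * `|u - v|) by rewrite mulr_ge0.
nra.
Qed.

(** Hoelder's inequality with exponents [(alpha + 1) / alpha] and [alpha + 1]. The weight splits
    accordingly, [|x|^g = (|x|^nu)^alpha |x|^nu], because [g = (alpha + 1) nu]. It is proved by
    Young's inequality for the functions divided by [A] and [B]. *)
Lemma wnorm_nonlinear (alpha g A B : R) (q : \bar R) (a b : Rn R N -> R) :
  0 < alpha -> (1 <= q)%E -> 0 < A -> 0 < B ->
  measurable_fun [set: _] a -> measurable_fun [set: _] b ->
  let r := ((alpha + 1)%:E * q)%E in let nu := g / (alpha + 1) in
  (wnorm nu r (fun x => (a x)%:E) <= A%:E)%E ->
  (wnorm nu r (fun x => (b x)%:E) <= B%:E)%E ->
  (wnorm g q (fun x => (`|a x| `^ alpha * `|b x|)%:E) <= (A `^ alpha * B)%:E)%E.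
Proof.
move=> a0 q1 A0 B0 ma mb /=; have a10 : 0 < alpha + 1 by rewrite addr_gt0.
have a1n : alpha + 1 != 0 by rewrite gt_eqF.
set nu := g / (alpha + 1).
have wtE (x : Rn R N) : euclidean_norm x `^ g = (euclidean_norm x `^ nu) `^ alpha * euclidean_norm x `^ nu.
  have [e0|e0] := eqVneq (euclidean_norm x) 0; last first.
    by rewrite -powRrM -powRD ?e0 ?implybT//; congr (_ `^ _); rewrite /nu; field.
  have [g0|g0] := eqVneq g 0; first by rewrite /nu g0 mul0r !powRr0 powR1 mulr1.
  have nu0 : nu != 0 by rewrite /nu mulf_neq0 ?invr_eq0.
  by rewrite e0 (powR0 g0) (powR0 nu0) mulr0.
pose X x := euclidean_norm x `^ nu * `|a x|; pose Y x := euclidean_norm x `^ nu * `|b x|.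
have X0 x : 0 <= X x by rewrite mulr_ge0 ?powR_ge0.
have Y0 x : 0 <= Y x by rewrite mulr_ge0 ?powR_ge0.
have XY x : ((euclidean_norm x `^ g)%:E * `| (`|a x| `^ alpha * `|b x|)%:E | = (X x `^ alpha * Y x)%:E)%E.
  rewrite abse_EFin ger0_norm ?mulr_ge0 ?powR_ge0// -EFinM; congr (_%:E).
  by rewrite wtE /X /Y powRM ?powR_ge0//; ring.
case: q q1 => [p| |]//; rewrite ?lee_fin => p1; last first.
  rewrite gt0_muley ?lte_fin// => /wnorm_inftyP HA /wnorm_inftyP HB; apply/wnorm_inftyP.
  apply: filterS2 HA HB => x; rewrite XY !abse_EFin -!EFinM !lee_fin => HA HB.
  rewrite ler_pM ?powR_ge0//.
  by rewrite ge0_ler_powR ?nnegrE ?(ltW a0) ?(ltW A0)//; exact: X0.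
have p0 : 0 < p by exact: lt_le_trans p1.
have r0 : 0 < (alpha + 1) * p by rewrite mulr_gt0.
have mX : measurable_fun [set: Rn R N] X.
  by apply: measurable_funM; [exact: measurable_euclidean_norm|exact: measurableT_comp].
have mY : measurable_fun [set: Rn R N] Y.
  by apply: measurable_funM; [exact: measurable_euclidean_norm|exact: measurableT_comp].
have mP (Z : Rn R N -> R) c : measurable_fun setT Z -> measurable_fun setT (fun x => (Z x `^ c)%:E).
  by move=> mZ; apply/measurable_EFinP; apply: (measurableT_comp (measurable_powR _)).
rewrite -EFinM => /(wnorm_finP _ _ r0 (ltW A0)) HA /(wnorm_finP _ _ r0 (ltW B0)) HB.
have AB0 : 0 <= A `^ alpha * B by rewrite mulr_ge0 ?powR_ge0 ?ltW.
apply/wnorm_finP => //.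
set r := (alpha + 1) * p in HA HB r0 *.
have HA' : (\int[mu]_x (X x `^ r)%:E <= (A `^ r)%:E)%E.
  by apply: le_trans HA; apply: eqW; apply: eq_integral => x _; rewrite abse_EFin -EFinM poweR_EFin.
have HB' : (\int[mu]_x (Y x `^ r)%:E <= (B `^ r)%:E)%E.
  by apply: le_trans HB; apply: eqW; apply: eq_integral => x _; rewrite abse_EFin -EFinM poweR_EFin.
(* The coefficients of Young's inequality after undoing the normalization; against the two integral
   bounds they add up to [(A ^ alpha * B) ^ p]. *)
pose c1 := (A `^ alpha * B) `^ p * (alpha / (alpha + 1)) / A `^ r.
pose c2 := (A `^ alpha * B) `^ p * (alpha + 1)^-1 / B `^ r.
have Ar0 : 0 < A `^ r by exact: powR_gt0.
have Br0 : 0 < B `^ r by exact: powR_gt0.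
have c10 : 0 <= c1 by rewrite !mulr_ge0 ?powR_ge0 ?invr_ge0 ?powR_ge0 ?(ltW a0) ?(ltW a10).
have c20 : 0 <= c2 by rewrite !mulr_ge0 ?powR_ge0 ?invr_ge0 ?powR_ge0 ?(ltW a10).
apply: (@le_trans _ _ (\int[mu]_x (c1%:E * (X x `^ r)%:E + c2%:E * (Y x `^ r)%:E))%E).
  apply: le_integral_nonneg => x _; first exact: poweR_ge0.
  rewrite XY poweR_EFin -!EFinM -EFinD lee_fin.
  have pq : ((alpha + 1) / alpha)^-1 + (alpha + 1)^-1 = 1.
    by field; rewrite !gt_eqF.
  have := @conjugate_powR R ((X x / A) `^ (alpha * p)) ((Y x / B) `^ p) ((alpha + 1) / alpha) (alpha + 1)
    (powR_ge0 _ _) (powR_ge0 _ _) (divr_gt0 a10 a0) a10 pq.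
  rewrite -!powRrM (_ : alpha * p * _ = r); last by rewrite /r; field; rewrite gt_eqF.
  rewrite (_ : p * (alpha + 1) = r); last by rewrite mulrC.
  have ABp : 0 < (A `^ alpha * B) `^ p by rewrite powR_gt0 ?mulr_gt0 ?powR_gt0.
  move=> /(ler_wpM2l (ltW ABp)) H; apply: le_trans (le_trans _ H) _; apply: eqW.
    rewrite [(X x / A) `^ _]powRrM -!powRM ?mulr_ge0 ?powR_ge0 ?divr_ge0 ?invr_ge0 ?(ltW A0) ?(ltW B0) ?X0 ?Y0//.
    congr (_ `^ _); rewrite [(X x / A) `^ _]powRM ?invr_ge0 ?(ltW A0)// -(powR_inv1 (ltW A0)) -powRrM mulN1r powRN.
    by field; rewrite !gt_eqF// powR_gt0.
  have XA : (X x / A) `^ r = X x `^ r / A `^ r.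
    by rewrite powRM ?invr_ge0 ?(ltW A0)// -(powR_inv1 (ltW A0)) -powRrM mulN1r powRN.
  have YB : (Y x / B) `^ r = Y x `^ r / B `^ r.
    by rewrite powRM ?invr_ge0 ?(ltW B0)// -(powR_inv1 (ltW B0)) -powRrM mulN1r powRN.
  rewrite XA YB /c1 /c2; set Z := (A `^ alpha * B) `^ p.
  by field; rewrite !gt_eqF.
rewrite ge0_integralD//; last 4 first.
- by move=> x _; rewrite mule_ge0 ?lee_fin ?powR_ge0.
- by apply: measurable_funeM; exact: mP.
- by move=> x _; rewrite mule_ge0 ?lee_fin ?powR_ge0.
- by apply: measurable_funeM; exact: mP.
rewrite !ge0_integralZl_EFin//; [|by move=> x _; rewrite lee_fin powR_ge0|exact: mP|by move=> x _; rewrite lee_fin powR_ge0|exact: mP].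
apply: le_trans (leeD (lee_wpmul2l _ HA') (lee_wpmul2l _ HB')) _; rewrite ?lee_fin//.
by apply: eqW; rewrite /c1 /c2; field; rewrite !gt_eqF.
Qed.

End nonlinear_estimates.

(** * Smoothing estimates *)

Section heat_estimates.
Context {R : realType} {N : nat}.
Local Notation mu := (@lebesgue_Rn R N).
Local Open Scope ereal_scope.
Implicit Types (g nu M t : R) (q : \bar R) (f h : Rn R N -> \bar R).

(** The flow applied to [|f|] and kept extended-valued: it always makes sense, and its finiteness at
    a point is the integrability that [heat] needs there. *)
Definition heat_abs t f (x : Rn R N) : \bar R :=
  \int[mu]_y ((heat_kernel t x y)%:E * `|f y|).

Lemma heat_abs_ge0 t f x : 0 <= heat_abs t f x.
Proof. by apply: integral_ge0 => y _; rewrite mule_ge0 ?lee_fin ?heat_kernel_ge0. Qed.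

Lemma measurable_kernel t x : measurable_fun [set: Rn R N] (fun y => (heat_kernel t x y)%:E).
Proof. by apply/measurable_EFinP; apply: measurable_heat_kernel => //; exact: measurable_cst. Qed.

Lemma measurable_heat_abs_param d (T : measurableType d) (ft : T -> R) (fx : T -> Rn R N)
    (F : T -> Rn R N -> \bar R) :
  measurable_fun [set: T] ft -> measurable_fun [set: T] fx ->
  measurable_fun [set: T * Rn R N] (fun z => F z.1 z.2) ->
  measurable_fun [set: T] (fun z => heat_abs (ft z) (F z) (fx z)).
Proof.
move=> mt mx mF.
apply: (@measurable_integral_param _ _ T _ R mu setT
  (fun z => (heat_kernel (ft z.1) (fx z.1) z.2)%:E * `|F z.1 z.2|)) => //.
  apply: measurable_funTS; apply: emeasurable_funM; last exact: measurableT_comp.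
  apply/measurable_EFinP; apply: measurable_heat_kernel => //.
    exact: (measurableT_comp mt).
  exact: (measurableT_comp mx).
by move=> z y _; rewrite mule_ge0 ?lee_fin ?heat_kernel_ge0.
Qed.

Lemma measurable_heat_abs t f : measurable_fun [set: _] f ->
  measurable_fun [set: Rn R N] (heat_abs t f).
Proof.
move=> mf; apply: (@measurable_heat_abs_param _ _ (fun=> t) id (fun _ => f)) => //.
exact: (measurableT_comp mf).
Qed.

(** Removing the origin makes [|y|^c |y|^(-c) = 1], which the default value of powers at 0 spoils,
    available under the integral. *)
Lemma integral_nonzero (F : Rn R N -> \bar R) : (0 < N)%N ->
  measurable_fun [set: _] F -> (forall y, 0 <= F y) ->
  \int[mu]_y F y = \int[mu]_(y in [set y | (0 < euclidean_norm y)%R]) F y.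
Proof.
move=> N0 mF F0; set D0 := [set y | _]; rewrite [RHS]integral_mkcond.
have mD0 : measurable D0.
  have := @measurable_euclidean_norm R N _ _ id 1 setT (@measurable_id _ _ _).
  move=> /(_ measurableT `]0%R, +oo[%classic (measurable_itv _)).
  rewrite setTI; congr measurable; apply/seteqP; split => y;
    rewrite /D0 /= in_itv/= andbT powRr1 ?sqrtr_ge0//.
apply: ge0_ae_eq_integral => //.
- by apply/(measurable_restrictT _ mD0); exact: measurable_funTS.
- by move=> y _; rewrite patchE; case: ifP.
- by apply: filterS (ae_euclidean_norm_gt0 N0) => y y0 _; rewrite patchE mem_set.
Qed.

(* Jensen's inequality for the measure [K_t(x,y) |y|^-a dy], whose mass is bounded by
   [weighted_heat_kernel_singular]; the exponent [a = g p'] comes from the splitting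
   [|f| = |y|^-g (|y|^g |f|)]. *)
Lemma heat_abs_pointwise g nu p : (0 < N)%N -> (1 < p)%R -> (0 <= nu <= g)%R ->
  (g * p < N%:R * (p - 1))%R ->
  exists2 C : R, (0 < C)%R & forall t f x, (0 < t)%R -> measurable_fun [set: _] f ->
  (0 < euclidean_norm x)%R \/ nu = 0%R ->
  ((euclidean_norm x `^ nu)%:E * heat_abs t f x) `^ p <=
  ((C * t `^ (- ((g - nu) / 2))) `^ p)%:E *
   \int[mu]_y ((heat_kernel t x y)%:E * ((euclidean_norm y `^ g)%:E * `|f y|) `^ p).
Proof.
move=> N0 p1 /andP[nu0 nug] gpN; have p0 : (0 < p)%R by exact: lt_trans p1.
have pm0 : (0 < p - 1)%R by rewrite subr_gt0.
set p' := (p / (p - 1))%R; have p'0 : (0 < p')%R by exact: divr_gt0.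
(* Jensen's inequality turns the weight [|y|^-a] and the function [|y|^a |f|] into
   [|y|^(a (p - 1)) |f|^p], and [a (p - 1) = g p]. In the same way [b (p - 1) = nu p], since the
   mass enters with the power [p - 1]. The condition on [g p] is [a < N]. *)
set a := (g * p')%R; set b := (nu * p')%R.
have g0 : (0 <= g)%R by exact: le_trans nug.
have aN : (a < N%:R)%R by rewrite /a /p' mulrA ltr_pdivrMr.
have ba : (0 <= b <= a)%R by rewrite mulr_ge0 ?(ltW p'0)//= ler_wpM2r ?(ltW p'0).
have [C0 C00 HC0] := weighted_heat_kernel_singular ba aN.
have Cp : (0 < C0 `^ ((p - 1) / p))%R by exact: powR_gt0.
exists (C0 `^ ((p - 1) / p))%R => // t f x t0 mf xnu.
set e := euclidean_norm.
(* This is where the alternative on [x] enters: opposite powers of [|x|] cancel either because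
   [|x| > 0] or because the exponent is 0. *)
have xE c : (e x `^ (c * nu) * e x `^ (- (c * nu)) = 1)%R.
  case: xnu => [x0|->]; last by rewrite mulr0 oppr0 !powRr0 mulr1.
  by rewrite -gt0_powRD// subrr powRr0.
have xpos c : (0 < e x `^ (c * nu))%R.
  by case: xnu => [x0|->]; [exact: powR_gt0|rewrite mulr0 powRr0].
have xpos' c : (0 < e x `^ (- (c * nu)))%R.
  by case: xnu => [x0|->]; [exact: powR_gt0|rewrite mulr0 oppr0 powRr0].
pose w y : \bar R := (heat_kernel t x y * e y `^ (- a))%:E.
pose G y : \bar R := (e y `^ a)%:E * `|f y|.
have mw : measurable_fun [set: Rn R N] w.
  apply/measurable_EFinP; apply: measurable_funM; last exact: measurable_euclidean_norm.
  by apply/measurable_EFinP; exact: measurable_kernel.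
have mG : measurable_fun [set: Rn R N] G.
  by apply: emeasurable_funM; [exact: measurable_weight|exact: measurableT_comp].
have w0 y : 0 <= w y by rewrite lee_fin mulr_ge0 ?heat_kernel_ge0 ?powR_ge0.
have G0 y : 0 <= G y by rewrite mule_ge0 ?lee_fin ?powR_ge0.
have mKf : measurable_fun [set: Rn R N] (fun y => (heat_kernel t x y)%:E * `|f y|).
  by apply: emeasurable_funM; [exact: measurable_kernel|exact: measurableT_comp].
set D0 := [set y : Rn R N | (0 < e y)%R].
have bE : b = (p' * nu)%R by rewrite mulrC.
have eq1 : heat_abs t f x = \int[mu]_(y in D0) (G y * w y).
  rewrite /heat_abs integral_nonzero//; last first.
    by move=> y; rewrite mule_ge0 ?lee_fin ?heat_kernel_ge0.
  apply: eq_integral => y /set_mem y0; rewrite /G /w (EFinM (heat_kernel t x y)).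
  rewrite [(e y `^ a)%:E * _]muleC muleACA -EFinM.
  by rewrite -gt0_powRD// subrr powRr0 mule1 muleC.
set A := (C0 * t `^ (- ((a - b) / 2)) * e x `^ (- (p' * nu)))%R.
have A0 : (0 < A)%R by rewrite !mulr_gt0// powR_gt0.
have mD0 : measurable D0.
  have := @measurable_euclidean_norm R N _ _ id 1 setT (@measurable_id _ _ _).
  move=> /(_ measurableT `]0%R, +oo[%classic (measurable_itv _)).
  rewrite setTI; congr measurable; apply/seteqP; split => y;
    rewrite /D0 /= in_itv/= andbT powRr1 ?sqrtr_ge0//.
have wA : \int[mu]_(y in D0) w y <= A%:E.
  rewrite -integral_nonzero//.
  have := HC0 t x t0; rewrite -/w -/e bE => H.
  have e0 : 0 <= (e x `^ (- (p' * nu)))%:E by rewrite lee_fin ltW.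
  have := lee_wpmul2l e0 H; rewrite muleA -EFinM mulrC xE mul1e => /le_trans; apply.
  by rewrite -EFinM lee_fin /A bE mulrC.
rewrite poweRM ?lee_fin ?powR_ge0 ?heat_abs_ge0// eq1.
have J := @weighted_jensen _ _ R mu D0 G w p A mD0 (ltW p1) A0
  (measurable_funTS mG) (measurable_funTS mw) (fun y _ => G0 y) (fun y _ => w0 y) wA.
apply: le_trans (lee_wpmul2l (poweR_ge0 _ _) J) _.
have cE : (e x `^ nu)%:E `^ p * (A `^ (p - 1))%:E = ((C0 `^ ((p - 1) / p) * t `^ (- ((g - nu) / 2))) `^ p)%:E.
  rewrite poweR_EFin -EFinM; congr (_%:E).
  rewrite -powRrM /A !powRM ?mulr_ge0 ?powR_ge0 ?(ltW C00)// -!powRrM.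
  rewrite (_ : (p - 1) / p * p = p - 1)%R; last by rewrite divfK// gt_eqF.
  rewrite (_ : - (p' * nu) * (p - 1) = - (p * nu))%R; last by rewrite /p'; field; rewrite gt_eqF.
  rewrite (_ : - ((a - b) / 2) * (p - 1) = - ((g - nu) / 2) * p)%R; last first.
    by rewrite /a /b /p'; field; rewrite gt_eqF.
  by rewrite [(nu * p)%R]mulrC mulrCA xE mulr1.
rewrite muleA cE; apply: lee_wpmul2l; first by rewrite lee_fin powR_ge0.
rewrite [leRHS]integral_nonzero//; last 2 first.
- apply: emeasurable_funM; first exact: measurable_kernel.
  apply: (measurableT_comp (measurable_poweR _)); apply: emeasurable_funM.
    exact: measurable_weight.
  exact: measurableT_comp.
- by move=> y; rewrite mule_ge0 ?poweR_ge0 ?lee_fin ?heat_kernel_ge0.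
apply: eqW; apply: eq_integral => y /set_mem y0; rewrite /G /w.
rewrite !poweRM ?lee_fin ?powR_ge0// !poweR_EFin -!powRrM (EFinM (heat_kernel t x y)).
rewrite [X in X * _]muleC muleACA -EFinM -gt0_powRD// muleC [RHS]muleCA; congr ((_ `^ _)%:E * _); last exact: muleC.
by rewrite /a /p'; field; rewrite gt_eqF.
Qed.

(** For finite [q], the [p]-th power of the weighted flow is at most a constant times [H], the heat
    flow of [Phi = (|y|^g |f|)^p]. [H] has integral at most [M ^ p] and supremum at most
    [(4 pi t) ^ (-N/2) M ^ p]; bounding [H ^ k] by [(sup H) ^ (k - 1) H] gives the gain of
    integrability. For [q = +oo] the weighted kernel estimate suffices. *)
Lemma wnorm_heat_abs g nu k q : (0 <= nu <= g)%R -> (g < N%:R)%R -> (1 <= k)%R ->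
  (N%:R / (N%:R - g))%:E < q ->
  exists2 C : R, (0 < C)%R & forall t M f, (0 < t)%R -> (0 < M)%R ->
  measurable_fun [set: _] f -> wnorm g q f <= M%:E ->
  wnorm nu (k%:E * q) (heat_abs t f) <=
    (C * t `^ (- ((g - nu) / 2 + N%:R / 2 * (fine q^-1 - fine (k%:E * q)^-1))) * M)%:E.
Proof.
move=> nug gN k1 qN; have k0 : (0 < k)%R by exact: lt_le_trans k1.
have g0 : (0 <= g)%R by case/andP: nug => /le_trans; exact.
have Ngt : (0 < N%:R :> R)%R by exact: le_lt_trans gN.
have N0 : (0 < N)%N by rewrite -(ltr0n R).
case: q qN => [p| |] //; last first.
  move=> _; have [C C0 HC] := weighted_heat_kernel_singular nug gN.
  exists C => // t M f t0 M0 mf /wnorm_inftyP fM.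
  rewrite gt0_muley ?lte_fin// invey/= subrr mulr0 addr0.
  apply/wnorm_inftyP; apply: aeW => x; rewrite gee0_abs ?heat_abs_ge0//.
  apply: (@le_trans _ _ (M%:E * ((euclidean_norm x `^ nu)%:E *
      \int[mu]_y (heat_kernel t x y * euclidean_norm y `^ (- g))%:E))); last first.
    rewrite [(_ * M)%R]mulrC EFinM lee_wpmul2l//; last exact: HC.
    by rewrite lee_fin ltW.
  rewrite muleCA lee_wpmul2l ?lee_fin ?powR_ge0//.
  rewrite -ge0_integralZl_EFin ?(ltW M0)//; last 2 first.
  - by move=> y _; rewrite lee_fin mulr_ge0 ?heat_kernel_ge0 ?powR_ge0.
  - apply/measurable_EFinP; apply: measurable_funM; last exact: measurable_euclidean_norm.
    by apply/measurable_EFinP; exact: measurable_kernel.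
  apply: ae_ge0_le_integral => //.
  - by move=> y _; rewrite mule_ge0 ?lee_fin ?heat_kernel_ge0.
  - by apply: emeasurable_funM; [exact: measurable_kernel|exact: measurableT_comp].
  - by move=> y _; rewrite mule_ge0 ?lee_fin ?mulr_ge0 ?heat_kernel_ge0 ?powR_ge0// ltW.
  - apply: measurable_funeM; apply/measurable_EFinP; apply: measurable_funM; last exact: measurable_euclidean_norm.
    by apply/measurable_EFinP; exact: measurable_kernel.
  apply: filterS2 fM (ae_euclidean_norm_gt0 N0) => y fy y0 _.
  rewrite (EFinM (heat_kernel t x y)) muleCA lee_wpmul2l ?lee_fin ?heat_kernel_ge0//.
  have e0 : 0 <= (euclidean_norm y `^ (- g))%:E by rewrite lee_fin powR_ge0.
  have := lee_wpmul2l e0 fy.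
  by rewrite muleA -EFinM -gt0_powRD// addNr powRr0 mul1e muleC [leRHS]muleC.
rewrite lte_fin => pN.
have Ng : (0 < N%:R - g)%R by rewrite subr_gt0.
have p1 : (1 < p)%R.
  by apply: le_lt_trans pN; rewrite ler_pdivlMr// mul1r gerBl.
have p0 : (0 < p)%R by exact: lt_trans p1.
have gp : (g * p < N%:R * (p - 1))%R by move: pN; rewrite ltr_pdivrMr//; lra.
have [C C0 HC] := heat_abs_pointwise N0 p1 nug gp.
have P0 : (0 < 4 * pi :> R)%R by rewrite mulr_gt0 ?pi_gt0.
set th := (N%:R / 2 * (p^-1 - (k * p)^-1))%R.
exists (C * (4 * pi) `^ (- th))%R; first by rewrite mulr_gt0 ?powR_gt0.
move=> t M f t0 M0 mf.
have kp0 : (0 < k * p)%R by exact: mulr_gt0.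
have -> : fine (p%:E^-1 : \bar R) = p^-1%R by rewrite inver gt_eqF.
have -> : fine ((k%:E * p%:E)^-1 : \bar R) = (k * p)^-1%R by rewrite -EFinM inver gt_eqF.
rewrite -/th -EFinM => /(wnorm_finP g f p0 (ltW M0)) fM.
have T0 c : (0 < t `^ c)%R by exact: powR_gt0.
have B0 : (0 < C * (4 * pi) `^ (- th) * t `^ (- ((g - nu) / 2 + th)) * M)%R.
  by rewrite !mulr_gt0 ?powR_gt0.
apply/(wnorm_finP _ _ kp0 (ltW B0)).
pose Phi y := ((euclidean_norm y `^ g)%:E * `|f y|) `^ p.
have mPhi : measurable_fun [set: Rn R N] Phi.
  apply: (measurableT_comp (measurable_poweR _)); apply: emeasurable_funM.
    exact: measurable_weight.
  exact: measurableT_comp.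
have Phi0 y : 0 <= Phi y by exact: poweR_ge0.
pose H x := \int[mu]_y ((heat_kernel t x y)%:E * Phi y).
have mKPhi : measurable_fun [set: Rn R N * Rn R N] (fun z => (heat_kernel t z.1 z.2)%:E * Phi z.2).
  apply: emeasurable_funM; last exact: (measurableT_comp mPhi).
  by apply/measurable_EFinP; exact: measurable_heat_kernel.
have KPhi0 (z : Rn R N * Rn R N) : 0 <= (heat_kernel t z.1 z.2)%:E * Phi z.2.
  by rewrite mule_ge0 ?lee_fin ?heat_kernel_ge0.
have mH : measurable_fun [set: Rn R N] H.
  apply: (@measurable_integral_param _ _ _ _ R mu setT
     (fun z => (heat_kernel t z.1 z.2)%:E * Phi z.2)) => //.
  exact: measurable_funTS.
have H0 x : 0 <= H x by apply: integral_ge0 => y _; rewrite mule_ge0 ?lee_fin ?heat_kernel_ge0.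
set kap := ((4 * pi * t) `^ (- (N%:R / 2)))%R.
have kap0 : (0 < kap)%R by rewrite powR_gt0// mulr_gt0.
have Hle x : H x <= (kap * M `^ p)%:E.
  rewrite EFinM; apply: le_trans (lee_wpmul2l _ fM); last by rewrite lee_fin ltW.
  rewrite -ge0_integralZl_EFin ?(ltW kap0)//; last by move=> y _; exact: Phi0.
  apply: le_integral_nonneg => y _; first by rewrite mule_ge0 ?lee_fin ?heat_kernel_ge0.
  by rewrite lee_wpmul2r// lee_fin heat_kernel_le.
have IH : \int[mu]_x H x <= (M `^ p)%:E.
  rewrite /H (fubini_tonelli (fun z : Rn R N * Rn R N => (heat_kernel t z.1 z.2)%:E * Phi z.2))//=.
  apply: le_trans fM; apply: eqW; apply: eq_integral => y _.
  rewrite ge0_integralZr//.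
  - by under eq_integral do rewrite heat_kernelC; rewrite integral_heat_kernel// mul1e.
  - by apply/measurable_EFinP; apply: measurable_heat_kernel => //; exact: measurable_cst.
  - by move=> x _; rewrite lee_fin heat_kernel_ge0.
set c := (C * t `^ (- ((g - nu) / 2)))%R.
have c0 : (0 < c)%R by rewrite mulr_gt0.
have Mp0 : (0 < M `^ p)%R by exact: powR_gt0.
apply: (@le_trans _ _ (\int[mu]_x (((c `^ (p * k)) * (kap * M `^ p) `^ (k - 1))%:E * H x))).
  apply: ae_ge0_le_integral => //.
  - by move=> x _; exact: poweR_ge0.
  - apply: (measurableT_comp (measurable_poweR _)); apply: emeasurable_funM.
      exact: measurable_weight.
    by apply: measurableT_comp => //; exact: measurable_heat_abs.
  - by move=> x _; rewrite mule_ge0// lee_fin mulr_ge0 ?powR_ge0.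
  - exact: measurable_funeM.
  apply: filterS (ae_euclidean_norm_gt0 N0) => x x0 _.
  rewrite gee0_abs ?heat_abs_ge0// [(k * p)%R]mulrC poweRrM.
  have HH := HC t f x t0 mf (or_introl x0).
  have := ge0_le_poweR (ltW k0) (poweR_ge0 _ _) HH; move=> /le_trans; apply.
  rewrite -/(H x) -/c poweRM ?lee_fin ?powR_ge0// poweR_EFin -powRrM EFinM -muleA.
  apply: lee_wpmul2l; first by rewrite lee_fin powR_ge0.
  move: (Hle x) (H0 x); case: (H x) => [r rle r0|h1 _|_ h2]; last 2 first.
  - by move: h1; rewrite leye_eq.
  - by move: h2; rewrite leeNy_eq.
  rewrite poweR_EFin -EFinM lee_fin; move: r0 rle; rewrite !lee_fin => r0 rle.
  rewrite -(mulr_powRB1 r0 k0) mulrC ler_wpM2r// ge0_ler_powR ?subr_ge0//.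
  by rewrite nnegrE mulr_ge0// ltW.
rewrite ge0_integralZl_EFin ?mulr_ge0 ?powR_ge0//.
apply: le_trans (lee_wpmul2l _ IH) _; first by rewrite lee_fin mulr_ge0 ?powR_ge0.
rewrite -EFinM lee_fin; apply: eqW.
rewrite /c /kap; move: P0 {B0 kap kap0 Hle}; set X := (4 * pi)%R => X0; clearbody X.
have pM (u v w : R) : (0 < u)%R -> (0 < v)%R -> ((u * v) `^ w = u `^ w * v `^ w)%R.
  by move=> u0 v0; rewrite powRM// ltW.
rewrite !pM; try by rewrite ?mulr_gt0 ?powR_gt0 ?mulr_gt0.
rewrite -!powRrM.
rewrite [(p * k)%R]mulrC.
have E1 : (M `^ (p * (k - 1)) * M `^ p = M `^ (k * p))%R.
  by rewrite -gt0_powRD//; congr (_ `^ _)%R; ring.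
have E2 : (X `^ (- (N%:R / 2) * (k - 1)) = X `^ (- th * (k * p)))%R.
  by congr (_ `^ _)%R; rewrite /th; field; rewrite !gt_eqF.
have E3 : (t `^ (- ((g - nu) / 2) * (k * p)) * t `^ (- (N%:R / 2) * (k - 1)) =
    t `^ (- ((g - nu) / 2 + th) * (k * p)))%R.
  by rewrite -gt0_powRD//; congr (_ `^ _)%R; rewrite /th; field; rewrite !gt_eqF.
by rewrite -E1 -E2 -E3; ring.
Qed.

End heat_estimates.

Section heat_operator.
Context {R : realType} {N : nat}.
Local Notation mu := (@lebesgue_Rn R N).
Implicit Types (g nu M t s : R) (q : \bar R) (f h : Rn R N -> R) (x y : Rn R N).

(** Finiteness holds at every point, the origin included, because the pointwise estimate with
    [nu = 0] puts no condition on [x]. Continuity in space and the semigroup identities rely on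
    this. *)
Lemma heat_abs_lty g M q t (f : Rn R N -> \bar R) x : 0 <= g < N%:R ->
  ((N%:R / (N%:R - g))%:E < q)%E -> 0 < t -> 0 < M -> measurable_fun [set: _] f ->
  (wnorm g q f <= M%:E)%E -> (heat_abs t f x < +oo)%E.
Proof.
move=> /andP[g0 gN] qN t0 M0 mf fM.
have Ngt : (0 < N%:R :> R) by exact: le_lt_trans gN.
have N0 : (0 < N)%N by rewrite -(ltr0n R).
have nu0 : 0 <= (0:R) <= g by rewrite lexx.
case: q qN fM => [p| |] //; last first.
  move=> _ /wnorm_inftyP fM; have [C C0 HC] := weighted_heat_kernel_singular nu0 gN.
  have := HC t x t0; rewrite powRr0 mul1e => HCx.
  apply: (@le_lt_trans _ _ (M%:E * (C * t `^ (- ((g - 0) / 2)))%:E)%E); last by rewrite ltry.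
  apply: le_trans (lee_wpmul2l _ HCx); last by rewrite lee_fin ltW.
  have mk : measurable_fun [set: Rn R N] (fun y => (heat_kernel t x y * euclidean_norm y `^ (- g))%:E).
    apply/measurable_EFinP; apply: measurable_funM; last exact: measurable_euclidean_norm.
    by apply/measurable_EFinP; exact: measurable_kernel.
  have k0 y : (0 <= (heat_kernel t x y * euclidean_norm y `^ (- g))%:E)%E.
    by rewrite lee_fin mulr_ge0 ?heat_kernel_ge0 ?powR_ge0.
  rewrite -ge0_integralZl_EFin ?(ltW M0)//.
  apply: ae_ge0_le_integral => //.
  - by move=> y _; rewrite mule_ge0 ?lee_fin ?heat_kernel_ge0.
  - by apply: emeasurable_funM; [exact: measurable_kernel|exact: measurableT_comp].
  - by move=> y _; rewrite mule_ge0// lee_fin ltW.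
  - exact: measurable_funeM.
  apply: filterS2 fM (ae_euclidean_norm_gt0 N0) => y fy y0 _.
  rewrite (EFinM (heat_kernel t x y)) muleCA lee_wpmul2l ?lee_fin ?heat_kernel_ge0//.
  have e0 : (0 <= (euclidean_norm y `^ (- g))%:E)%E by rewrite lee_fin powR_ge0.
  have := lee_wpmul2l e0 fy.
  by rewrite muleA -EFinM -gt0_powRD// addNr powRr0 mul1e muleC [leRHS]muleC.
rewrite lte_fin => pN; have Ng : 0 < N%:R - g by rewrite subr_gt0.
have p1 : 1 < p by apply: le_lt_trans pN; rewrite ler_pdivlMr// mul1r gerBl.
have p0 : 0 < p by exact: lt_trans p1.
have gp : g * p < N%:R * (p - 1) by move: pN; rewrite ltr_pdivrMr//; lra.
move=> /(wnorm_finP g f p0 (ltW M0)) fM.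
have [C C0 HC] := heat_abs_pointwise N0 p1 nu0 gp.
have := HC t f x t0 mf (or_intror erefl).
rewrite powRr0 mul1e => H; apply: (@lty_poweRy _ _ p); first by rewrite gt_eqF.
apply: le_lt_trans H _.
apply: (@le_lt_trans _ _ (((C * t `^ (- ((g - 0) / 2))) `^ p)%:E *
   (((4 * pi * t) `^ (- (N%:R / 2)))%:E * (M `^ p)%:E))%E); last by rewrite -!EFinM ltry.
apply: lee_wpmul2l; first by rewrite lee_fin powR_ge0.
apply: le_trans (lee_wpmul2l _ fM); last by rewrite lee_fin powR_ge0.
rewrite -ge0_integralZl_EFin ?powR_ge0//.
- apply: le_integral_nonneg => y _; first by rewrite mule_ge0 ?poweR_ge0 ?lee_fin ?heat_kernel_ge0.
  by rewrite lee_wpmul2r ?poweR_ge0// lee_fin heat_kernel_le.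
- by move=> y _; exact: poweR_ge0.
- apply: (measurableT_comp (measurable_poweR _)); apply: emeasurable_funM.
    exact: measurable_weight.
  exact: measurableT_comp.
Qed.

Lemma heat0 f : heat 0 f = f.
Proof. by apply/funext => x; rewrite /heat eqxx. Qed.

Lemma measurable_heat_integrand t x f : measurable_fun [set: _] f ->
  measurable_fun [set: Rn R N] (fun y => heat_kernel t x y * f y).
Proof.
move=> mf; apply: measurable_funM => //.
by apply: measurable_heat_kernel => //; exact: measurable_cst.
Qed.

Lemma heat_abs_integrableP t x f : measurable_fun [set: _] f ->
  mu.-integrable setT (fun y => (heat_kernel t x y * f y)%:E) <->
  (heat_abs t (EFin \o f) x < +oo)%E.
Proof.
move=> mf; have E : (\int[mu]_y `|(heat_kernel t x y * f y)%:E| = heat_abs t (EFin \o f) x)%E.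
  apply: eq_integral => y _; rewrite !abse_EFin normrM EFinM ger0_norm//.
  exact: heat_kernel_ge0.
split => [/integrableP[_]|H]; first by rewrite E.
apply/integrableP; split; last by rewrite E.
by apply/measurable_EFinP; exact: measurable_heat_integrand.
Qed.

Lemma heat_le_abs t f x : t != 0 -> measurable_fun [set: _] f ->
  (`|heat t f x|%:E <= heat_abs t (EFin \o f) x)%E.
Proof.
move=> t0 mf; rewrite /heat (negbTE t0).
have [fin|] := ltP (heat_abs t (EFin \o f) x) +oo%E; last by rewrite leye_eq => /eqP ->; rewrite leey.
have /heat_abs_integrableP-/(_ mf) ifx := fin.
have := le_normr_Rintegral measurableT ifx => H.
apply: le_trans (_ : ((\int[mu]_y `|heat_kernel t x y * f y|)%R)%:E <= _)%E; first by rewrite lee_fin.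
have E : (\int[mu]_y (`|heat_kernel t x y * f y|)%:E = heat_abs t (EFin \o f) x)%E.
  apply: eq_integral => y _.
  by rewrite normrM EFinM ger0_norm ?heat_kernel_ge0.
by rewrite /Rintegral E fineK// ge0_fin_numE// heat_abs_ge0.
Qed.

Lemma heatB t f h x : measurable_fun [set: _] f -> measurable_fun [set: _] h ->
  (heat_abs t (EFin \o f) x < +oo)%E -> (heat_abs t (EFin \o h) x < +oo)%E ->
  heat t f x - heat t h x = heat t (fun y => f y - h y) x.
Proof.
move=> mf mh /heat_abs_integrableP-/(_ mf) fi /heat_abs_integrableP-/(_ mh) hi.
rewrite /heat; case: ifP => // _; rewrite -RintegralB//.
by apply: eq_Rintegral => y _; rewrite mulrBr.
Qed.

Lemma eq_heat_ae t f h x : t != 0 -> measurable_fun [set: _] f -> measurable_fun [set: _] h ->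
  {ae mu, forall y, f y = h y} -> heat t f x = heat t h x.
Proof.
move=> t0 mf mh fh; rewrite /heat (negbTE t0) /Rintegral; congr fine.
apply: ae_eq_integral => //.
- by apply/measurable_EFinP; exact: measurable_heat_integrand.
- by apply/measurable_EFinP; exact: measurable_heat_integrand.
- by apply: filterS fh => y -> _.
Qed.

Lemma measurable_heat_param d (T : measurableType d) (ft : T -> R) (fx : T -> Rn R N)
    (F : T -> Rn R N -> R) :
  measurable_fun [set: T] ft -> measurable_fun [set: T] fx ->
  measurable_fun [set: T * Rn R N] (fun z => F z.1 z.2) ->
  measurable_fun [set: T] (fun z => heat (ft z) (F z) (fx z)).
Proof.
move=> mt mx mF.
have mFx : measurable_fun [set: T] (fun z => F z (fx z)).
  apply: (@measurableT_comp _ _ _ _ _ _ (fun z => F z.1 z.2) _ (fun z => (z, fx z))) => //.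
  exact: measurable_fun_pair.
have mb : measurable_fun [set: T] (fun z => ft z == 0) by exact: measurable_fun_eqr.
apply: measurable_fun_ifT => //.
apply: (@measurable_Rintegral_param _ _ T _ R mu setT
  (fun z => heat_kernel (ft z.1) (fx z.1) z.2 * F z.1 z.2)) => //.
apply: measurable_funTS; apply: measurable_funM => //.
apply: measurable_heat_kernel => //.
  exact: (measurableT_comp mt).
exact: (measurableT_comp mx).
Qed.

Lemma measurable_heat t f : measurable_fun [set: _] f -> measurable_fun [set: Rn R N] (heat t f).
Proof.
move=> mf; apply: (@measurable_heat_param _ _ (fun=> t) id (fun _ => f)) => //.
exact: (measurableT_comp mf).
Qed.

(** With [h = (t' - t) / t]: for [h > 1] the two kernels are bounded separately and [h ^ th >= 1];
    for [h <= 1] the difference is linear in [h], and [h <= h ^ th]. The exponent is left free: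
    [th = 1] serves the free flow away from time 0, a smaller one keeps the Duhamel integral
    convergent at its upper end. *)
Lemma heat_kernel_time_diff : exists2 C : R, 0 < C &
  forall (th t t' : R) x y, 0 < th <= 1 -> 0 < t < t' ->
  `|heat_kernel t' x y - heat_kernel t x y| <=
  C * ((t' - t) / t) `^ th * (heat_kernel (2 * t') x y + heat_kernel t x y).
Proof.
have T0 : 0 < 2 `^ (N%:R / 2) :> R by exact: powR_gt0.
exists (2 * 2 `^ (N%:R / 2) + N%:R / 2 + 1).
  by rewrite ltr_wpDl// addr_ge0 ?divr_ge0// mulr_ge0// ltW.
move=> th t t' x y /andP[th0 th1] /andP[t0 tt']; have t'0 : 0 < t' by exact: lt_trans tt'.
have p0 : 0 < pi :> R by exact: pi_gt0.
set h := (t' - t) / t; have h0 : 0 < h by rewrite divr_gt0// subr_gt0.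
set K2 := heat_kernel (2 * t') x y; set Kt := heat_kernel t x y; set Kt' := heat_kernel t' x y.
have K20 : 0 <= K2 by exact: heat_kernel_ge0.
have Kt0 : 0 <= Kt by exact: heat_kernel_ge0.
have Kt'0 : 0 <= Kt' by exact: heat_kernel_ge0.
set d := sqdist x y; have d0 : 0 <= d by exact: sqdist_ge0.
have AE : (4 * pi * t') `^ (- (N%:R / 2)) = 2 `^ (N%:R / 2) * (4 * pi * (2 * t')) `^ (- (N%:R / 2)).
  have -> : 4 * pi * (2 * t') = 2 * (4 * pi * t') by ring.
  have X0 : 0 <= 4 * pi * t' by rewrite !mulr_ge0 ?(ltW p0) ?(ltW t'0).
  by rewrite (powRM _ _ X0)// mulrA -gt0_powRD// subrr powRr0 mul1r.
have E2 : K2 = (4 * pi * (2 * t')) `^ (- (N%:R / 2)) * expR (- (d / (4 * (2 * t')))).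
  by rewrite /K2 /heat_kernel -/(sqdist x y) -/d mulNr.
have Et : Kt = (4 * pi * t) `^ (- (N%:R / 2)) * expR (- (d / (4 * t))).
  by rewrite /Kt /heat_kernel -/(sqdist x y) -/d mulNr.
have Et' : Kt' = 2 `^ (N%:R / 2) * (4 * pi * (2 * t')) `^ (- (N%:R / 2)) * expR (- (d / (4 * t'))).
  by rewrite /Kt' /heat_kernel -/(sqdist x y) -/d mulNr AE.
set A2 := (4 * pi * (2 * t')) `^ (- (N%:R / 2)) in AE E2 Et'.
have A20 : 0 <= A2 by exact: powR_ge0.
have S0 : 0 <= K2 + Kt by exact: addr_ge0.
have hth : 0 <= h `^ th by exact: powR_ge0.
have [h1|h1] := ltP 1 h.
  have hth1 : 1 <= h `^ th by rewrite -(powRr0 h) ler_powR ?(ltW h1)// ltW.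
  have B : Kt' <= 2 `^ (N%:R / 2) * K2.
    rewrite Et' E2 -mulrA ler_wpM2l ?(ltW T0)// ler_wpM2l// ler_expR lerN2.
    by rewrite ler_wpM2l// lef_pV2 ?posrE ?mulr_gt0//; lra.
  apply: (@le_trans _ _ ((2 * 2 `^ (N%:R / 2) + N%:R / 2 + 1) * (K2 + Kt))); last first.
    have n0 : 0 <= N%:R / 2 :> R by rewrite divr_ge0.
    rewrite ler_wpM2r// ler_peMr//; lra.
  apply: le_trans (ler_normB _ _) _; rewrite !ger0_norm//.
  have n0 : 0 <= N%:R / 2 :> R by rewrite divr_ge0.
  have := mulr_ge0 n0 S0; have := mulr_ge0 (ltW T0) Kt0; have := mulr_ge0 (ltW T0) K20.
  lra.
suff H : `|Kt' - Kt| <= (2 * 2 `^ (N%:R / 2) * K2 + N%:R / 2 * Kt) * h.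
  have n0 : 0 <= N%:R / 2 :> R by rewrite divr_ge0.
  have hh : h <= h `^ th by rewrite -{1}(powRr1 (ltW h0)) ger_powR// h0.
  have T2 : 0 <= 2 * 2 `^ (N%:R / 2) :> R by rewrite mulr_ge0// ltW.
  have X0 : 0 <= 2 * 2 `^ (N%:R / 2) * K2 + N%:R / 2 * Kt.
    by rewrite addr_ge0// mulr_ge0.
  apply: le_trans H _; rewrite [leRHS]mulrAC; apply: ler_pM => //; first exact: ltW.
  have := mulr_ge0 n0 K20; have := mulr_ge0 T2 Kt0.
  lra.
set b := d / (4 * t); set a := d / (4 * t').
have a0 : 0 <= a by rewrite divr_ge0// mulr_ge0// ltW.
have ba : b - a = a * h by rewrite /b /a /h; field; rewrite !gt_eqF.
have exp_diff : 0 <= expR (- a) - expR (- b) <= a * h * expR (- a).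
  rewrite subr_ge0 ler_expR lerN2 -subr_ge0 ba mulr_ge0 ?(ltW h0)//=.
  have -> : expR (- b) = expR (- a) * expR (- (a * h)) by rewrite -expRD -ba; congr expR; ring.
  rewrite -{1}[expR (- a)]mulr1 -mulrBr mulrC ler_wpM2r ?expR_ge0//.
  by have := expR_ge1Dx (- (a * h)); lra.
(* The factor [a] from the difference of exponentials is absorbed by half of the decay; the
   remaining half is the exponent of the kernel at time [2 t']. *)
have aexp : a * expR (- a) <= 2 * expR (- (d / (4 * (2 * t')))).
  have -> : d / (4 * (2 * t')) = a / 2 by rewrite /a; field; rewrite gt_eqF.
  have -> : expR (- a) = expR (- (a / 2)) * expR (- (a / 2)).
    by rewrite -expRD; congr expR; field.
  rewrite mulrA ler_wpM2r ?expR_ge0// expRN ler_pdivrMr ?expR_gt0//.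
  by have := expR_ge1Dx (a / 2); lra.
(* The ratio of the normalizations is [(1 + h) ^ (-N/2)], which lies between [1 - (N / 2) h] and
   1. *)
have A_diff : 0 <= (4 * pi * t) `^ (- (N%:R / 2)) - 2 `^ (N%:R / 2) * A2 <=
    (4 * pi * t) `^ (- (N%:R / 2)) * (N%:R / 2 * h).
  rewrite -AE.
  have -> : (4 * pi * t') = (4 * pi * t) * (1 + h) by rewrite /h; field; rewrite gt_eqF.
  have X0 : 0 <= 4 * pi * t by rewrite !mulr_ge0 ?(ltW p0) ?(ltW t0).
  have h10 : 0 < 1 + h by rewrite addr_gt0.
  rewrite (powRM _ X0 (ltW h10)); set X := (4 * pi * t) `^ _.
  have XX : 0 <= X by exact: powR_ge0.
  rewrite -{1 3}[X]mulr1 -mulrBr mulr_ge0//=; last first.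
    rewrite subr_ge0 -[leRHS](powRr0 (1 + h)) ler_powR ?oppr_le0 ?divr_ge0//.
    by rewrite lerDl ltW.
  rewrite ler_wpM2l// /powR gt_eqF//.
  have := expR_ge1Dx (- (N%:R / 2) * ln (1 + h)).
  have := ln_sublinear h10; have := @le_ln1Dx R h.
  move=> H _ _; have {}H : ln (1 + h) <= h by apply: H; lra.
  have n0 : 0 <= N%:R / 2 :> R by rewrite divr_ge0.
  have := ler_wpM2l n0 H; have := expR_ge1Dx (- (N%:R / 2) * ln (1 + h)); lra.
have -> : Kt' - Kt = 2 `^ (N%:R / 2) * A2 * (expR (- a) - expR (- b)) -
    ((4 * pi * t) `^ (- (N%:R / 2)) - 2 `^ (N%:R / 2) * A2) * expR (- b).
  by rewrite Et' Et -/a -/b; ring.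
apply: le_trans (ler_normB _ _) _.
case/andP: exp_diff => ed0 ed1; case/andP: A_diff => Ad0 Ad1.
have TA : 0 <= 2 `^ (N%:R / 2) * A2 by rewrite mulr_ge0 ?(ltW T0).
rewrite ger0_norm; last exact: mulr_ge0.
rewrite ger0_norm; last by rewrite mulr_ge0 ?expR_ge0.
rewrite [leRHS]mulrDl; apply: lerD; last first.
  apply: le_trans (ler_wpM2r (expR_ge0 _) Ad1) _.
  by rewrite Et -/b; apply: eqW; ring.
apply: le_trans (ler_wpM2l TA ed1) _.
have := ler_wpM2r (ltW h0) (ler_wpM2l TA aexp) => HH.
rewrite (_ : _ * (a * h * _) = 2 `^ (N%:R / 2) * A2 * (a * expR (- a)) * h); last by ring.
by apply: le_trans HH _; rewrite E2; apply: eqW; ring.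
Qed.

End heat_operator.

(** * Joint measurability *)

Section caratheodory.
Context {R : realType} {N : nat}.
Local Notation mu := (@lebesgue_Rn R N).
Local Notation leb := (@lebesgue_measure R).
Implicit Types (t s : R) (f h : Rn R N -> R) (x y : Rn R N).

Lemma sqdist_triangle x y z : sqdist x z <= 2 * sqdist x y + 2 * sqdist y z.
Proof.
rewrite /sqdist !mulr_sumr -big_split /=; apply: ler_sum => i _.
suff H (a b c : R) : (a - c) ^+ 2 <= 2 * (a - b) ^+ 2 + 2 * (b - c) ^+ 2 by exact: H.
have := sqr_ge0 (a - 2 * b + c); nra.
Qed.

(** [|x - z|^2 <= 2 |x - y|^2 + 2 |y - z|^2]: doubling the time pays for moving the centre. It
    provides the integrable majorant for continuity in space. *)
Lemma heat_kernel_move t x y z : 0 < t ->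
  heat_kernel t y z <= 2 `^ (N%:R / 2) * expR (sqdist x y / (4 * t)) * heat_kernel (2 * t) x z.
Proof.
move=> t0; rewrite /heat_kernel -/(sqdist x z) -/(sqdist y z).
have p0 : 0 <= 4 * pi * t :> R by rewrite !mulr_ge0 ?pi_ge0 ?(ltW t0).
have -> : 4 * pi * (2 * t) = 2 * (4 * pi * t) by ring.
rewrite (powRM _ _ p0)//; set X := (4 * pi * t) `^ _.
have X0 : 0 <= X by exact: powR_ge0.
set T := 2 `^ (N%:R / 2).
have TT : T * 2 `^ (- (N%:R / 2)) = 1 by rewrite -gt0_powRD// subrr powRr0.
rewrite (_ : T * _ * _ = T * 2 `^ (- (N%:R / 2)) * (X *
  (expR (sqdist x y / (4 * t)) * expR (- sqdist x z / (4 * (2 * t)))))); last by ring.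
rewrite TT mul1r ler_wpM2l// -expRD ler_expR.
have := sqdist_triangle x y z; set a := sqdist x z; set b := sqdist x y; set c := sqdist y z => H.
rewrite (_ : b / (4 * t) + - a / (4 * (2 * t)) = (2 * b - a) / (8 * t)); last first.
  by field; rewrite gt_eqF.
rewrite (_ : - c / (4 * t) = (- 2 * c) / (8 * t)); last by field; rewrite gt_eqF.
by rewrite ler_wpM2r// ?invr_ge0 ?mulr_ge0 ?(ltW t0)//; lra.
Qed.

Lemma sqdist_cvg (p : nat -> Rn R N) x y :
  (forall i, (fun m => tnth (p m) i : R) @ \oo --> (tnth x i : R)) ->
  sqdist (p m) y @[m --> \oo] --> sqdist x y.
Proof.
move=> px; rewrite /sqdist; apply: cvg_big => [|i _]; first exact: add_continuous.
by apply: cvgM; apply: cvgB => //; exact: cvg_cst.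
Qed.

Lemma sqdistxx x : sqdist x x = 0.
Proof. by rewrite /sqdist big1// => i _; rewrite subrr expr0n. Qed.

Lemma sqdistC x y : sqdist x y = sqdist y x.
Proof. by apply: eq_bigr => i _; rewrite -sqrrN opprB. Qed.

Lemma heat_cvg t f x (p : nat -> Rn R N) : 0 < t -> measurable_fun [set: _] f ->
  (heat_abs (2 * t) (EFin \o f) x < +oo)%E ->
  (forall i, (fun m => tnth (p m) i : R) @ \oo --> (tnth x i : R)) ->
  heat t f (p m) @[m --> \oo] --> heat t f x.
Proof.
move=> t0 mf fx px.
have dpx : sqdist x (p m) @[m --> \oo] --> (0 : R).
  by under eq_fun do rewrite sqdistC; rewrite -(sqdistxx x); exact: sqdist_cvg.
rewrite /heat gt_eqF//.
have mk m : measurable_fun [set: Rn R N] (fun y => (heat_kernel t (p m) y * f y)%:E).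
  by apply/measurable_EFinP; exact: measurable_heat_integrand.
(* From this index on, the factor [exp (sqdist x (p m) / (4 t))] is at most [exp 1], so one majorant
   serves the whole tail. *)
have [m0 m0P] : exists m0, forall m, (m0 <= m)%N -> sqdist x (p m) <= 4 * t.
  have t4 : 0 < 4 * t by rewrite mulr_gt0.
  have /cvgrPdist_le/(_ _ t4)[m0 _ H] := dpx; exists m0 => m /H/=.
  by rewrite sub0r normrN ger0_norm// sqdist_ge0.
rewrite -(cvg_shiftn m0).
have g_int : mu.-integrable setT (fun y => ((2 `^ (N%:R / 2) * expR 1)%:E * `|(heat_kernel (2 * t) x y * f y)%:E|)%E).
  by apply: integrableZl => //; apply/integrable_abse/heat_abs_integrableP.
have := @dominated_convergence _ _ _ mu setT measurableT
  (fun m y => (heat_kernel t (p (m + m0)%N) y * f y)%:E) (fun y => (heat_kernel t x y * f y)%:E)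
  (fun y => ((2 `^ (N%:R / 2) * expR 1)%:E * `|(heat_kernel (2 * t) x y * f y)%:E|)%E).
case=> //.
- by apply/measurable_EFinP; exact: measurable_heat_integrand.
- apply: aeW => y _; apply: cvg_EFin; first by near=> m.
  rewrite (cvg_shiftn m0 (fun m => heat_kernel t (p m) y * f y)).
  apply: cvgM; last exact: cvg_cst.
  rewrite /heat_kernel; apply: cvgM; first exact: cvg_cst.
  apply: continuous_cvg; first exact: continuous_expR.
  apply: cvgM; last exact: cvg_cst.
  by apply: cvgN; exact: sqdist_cvg.
- apply: aeW => y m _.
  have E s z : `|heat_kernel s z y * f y| = heat_kernel s z y * `|f y|.
    by rewrite normrM ger0_norm// heat_kernel_ge0.
  rewrite !abse_EFin -EFinM lee_fin !E mulrA ler_wpM2r//.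
  apply: le_trans (heat_kernel_move x _ _ t0) _.
  rewrite ler_wpM2r ?heat_kernel_ge0// ler_wpM2l ?powR_ge0// ler_expR.
  by rewrite ler_pdivrMr ?mulr_gt0// mul1r m0P// leq_addl.
move=> i1 _ H.
have ix : mu.-integrable setT (fun y => (heat_kernel t x y * f y)%:E) by [].
rewrite /Rintegral; apply: fine_cvg; rewrite fineK//.
exact: integrable_fin_num.
Unshelve. all: by end_near. Qed.

(* The values [H s] at one point of each grid cell, chosen in the full set where the time
   sections are measurable, converge to [H] by continuity in space. *)
Definition grid_cell m x : N.-tuple int :=
  [tuple Num.floor (m.+1%:R * (tnth x i : R)) | i < N].

Lemma grid_cellE m (k : N.-tuple int) : [set x | grid_cell m x = k] =
  [set x | forall i, [set` `[(tnth k i)%:~R / m.+1%:R, (tnth k i + 1)%:~R / m.+1%:R[] (tnth x i : R)].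
Proof.
have m0 : 0 < m.+1%:R :> R by rewrite ltr0n.
apply/seteqP; split => x /=.
  move=> <- i; rewrite tnth_mktuple in_itv/= ler_pdivrMr// ltr_pdivlMr// mulrC.
  by rewrite floor_le floorD1_gt.
move=> H; apply: eq_from_tnth => i; rewrite tnth_mktuple.
have := H i; rewrite in_itv/= ler_pdivrMr// ltr_pdivlMr// mulrC => /andP[h1 h2].
by apply: floor_def; rewrite h1 h2.
Qed.

Lemma measurable_grid_cell m k : measurable [set x | grid_cell m x = k].
Proof.
rewrite grid_cellE.
rewrite (_ : [set _ | _] = \bigcap_(i in [set: 'I_N]) ((@tnth N _)^~ i @^-1`
  [set` `[(tnth k i)%:~R / m.+1%:R, (tnth k i + 1)%:~R / m.+1%:R[])); last first.
  by apply/seteqP; split => [x h i _|x h i]; [exact: (h i)|exact: (h i I)].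
apply: fin_bigcap_measurable => // i _.
by rewrite -[X in measurable X]setTI; apply: measurable_tnth.
Qed.

Lemma grid_cell_gt0 m k : (0 < mu [set x | grid_cell m x = k])%E.
Proof.
have m0 : 0 < m.+1%:R :> R by rewrite ltr0n.
rewrite grid_cellE.
rewrite (lebesgue_Rn_box (A := fun i => [set` `[(tnth k i)%:~R / m.+1%:R, (tnth k i + 1)%:~R / m.+1%:R[]))//.
elim/big_ind : _ => [|a b a0 b0|i _]; first exact: lte01; first exact: mule_gt0.
rewrite lebesgue_measure_itv/= lte_fin ltr_pM2r ?invr_gt0// ltr_int ltzD1 lexx.
by rewrite lte_fin subr_gt0 ltr_pM2r ?invr_gt0// ltr_int ltzD1 lexx.
Qed.

Lemma grid_cell_dist m x y i : grid_cell m x = grid_cell m y ->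
  `|(tnth x i : R) - (tnth y i : R)| <= m.+1%:R^-1.
Proof.
move=> /(congr1 (fun k => tnth k i)); rewrite !tnth_mktuple => E.
have m0 : 0 < m.+1%:R :> R by rewrite ltr0n.
suff : m.+1%:R * `|(tnth x i : R) - (tnth y i : R)| <= 1.
  by rewrite -ler_pdivlMl// mulr1.
rewrite -{1}(ger0_norm (ltW m0)) -normrM mulrBr.
have := floor_le (m.+1%:R * (tnth x i : R)); have := floorD1_gt (m.+1%:R * (tnth x i : R)).
rewrite E; have := floor_le (m.+1%:R * (tnth y i : R)); have := floorD1_gt (m.+1%:R * (tnth y i : R)).
rewrite intrD; set A := m.+1%:R * _; set B := m.+1%:R * _; rewrite ler_norml; lra.
Qed.


(** A grid cell has positive measure, so it cannot lie in the exceptional null set. *)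
Lemma grid_cell_representative (P : set (Rn R N)) : {ae mu, forall x, P x} ->
  forall m k, exists x, P x /\ grid_cell m x = k.
Proof.
move=> [B [mB B0 PB]] m k; apply: contrapT => /forallNP H.
have := grid_cell_gt0 m k; apply/negP; rewrite -leNgt -B0 le_measure ?inE//.
  exact: measurable_grid_cell.
by move=> x /= kx; apply: PB => Px; exact: (H x).
Qed.

Lemma measurable_caratheodory d (T : measurableType d) (D : set T) (H : T -> Rn R N -> R) :
  measurable D ->
  (forall (s : T) x (p : nat -> Rn R N), D s ->
    (forall i, (fun m => tnth (p m) i : R) @ \oo --> (tnth x i : R)) ->
    H s (p m) @[m --> \oo] --> H s x) ->
  {ae mu, forall x, measurable_fun D (H ^~ x)} ->
  measurable_fun (D `*` [set: Rn R N]) (fun z => H z.1 z.2).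
Proof.
move=> mD cH /grid_cell_representative good.
pose p m k := projT1 (cid (good m k)).
have pP m k : measurable_fun D (H ^~ (p m k)) by rewrite /p; case: cid => x /= [].
have pE m k : grid_cell m (p m k) = k by rewrite /p; case: cid => x /= [].
apply: (measurable_fun_cvg (h := fun m z => H z.1 (p m (grid_cell m z.2)))); last first.
  move=> [s x] /= [Ds _]; apply: cH => // i.
  apply/cvgrPdist_le => e e0; near=> m.
  apply: le_trans (grid_cell_dist i (esym (pE m (grid_cell m x)))) _.
  by apply: ltW; near: m; exact: (near_infty_natSinv_lt (PosNum e0)).
move=> m mDT B mB.
(* The cells of a grid are countable, being indexed by tuples of integers; decoding natural numbers
   makes the preimage a countable union of rectangles. *)
have -> : (D `*` [set: Rn R N]) `&` (fun z => H z.1 (p m (grid_cell m z.2))) @^-1` B =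
  \bigcup_j (if unpickle j is Some k then
     (D `&` (H ^~ (p m k)) @^-1` B) `*` [set x | grid_cell m x = k] else set0).
  apply/seteqP; split => -[s x] /=.
    move=> [[Ds _] HB]; exists (pickle (grid_cell m x)) => //.
    by rewrite pickleK.
  by move=> [j _]; case: unpickle => // k [/= [Ds HB] kE]; split => //; rewrite kE.
apply: bigcupT_measurable => j; case: unpickle => [k|//].
by apply: measurableX; [exact: pP|exact: measurable_grid_cell].
Unshelve. all: by end_near. Qed.

End caratheodory.

(** * Estimates of Duhamel integrals *)

Section duhamel_estimates.
Context {R : realType} {N : nat}.
Local Notation mu := (@lebesgue_Rn R N).
Local Notation leb := (@lebesgue_measure R).
Implicit Types (g nu k t s : R) (q : \bar R) (f h : Rn R N -> R) (x y : Rn R N).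

(** Replacing [|h|] by the maximum of [|f|] and [|h|] makes the domination hold everywhere and
    changes [|h|] on a null set only. *)
Lemma le_wnorm_ae g q (f h : Rn R N -> \bar R) : (1 <= q)%E ->
  measurable_fun [set: _] f -> measurable_fun [set: _] h ->
  {ae mu, forall x, `|f x| <= `|h x|}%E -> (wnorm g q f <= wnorm g q h)%E.
Proof.
move=> q1 mf mh fh.
have mfa : measurable_fun [set: Rn R N] (fun x => `|f x|)%E by exact: measurableT_comp.
have mha : measurable_fun [set: Rn R N] (fun x => `|h x|)%E by exact: measurableT_comp.
apply: (@le_trans _ _ (wnorm g q (fun x => maxe `|f x| `|h x|)%E)).
  apply: le_wnorm => // x; rewrite [leRHS]gee0_abs ?le_max ?lexx//.
  by rewrite abse_ge0.
rewrite (_ : wnorm g q h = wnorm g q (fun x => `|h x|)%E); last first.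
  by apply/eqP; rewrite eq_le !le_wnorm// => x; rewrite abse_id.
rewrite (@eq_wnorm_ae _ _ _ _ (fun x => maxe `|f x| `|h x|)%E (fun x => `|h x|)%E)//.
  exact: measurable_maxe.
by apply: filterS fh => x H; rewrite max_r.
Qed.

Lemma gt1_exponent g q : g < N%:R -> 0 <= g -> ((N%:R / (N%:R - g))%:E < q)%E -> (1 <= q)%E.
Proof.
move=> gN g0 /ltW; apply: le_trans; rewrite lee_fin ler_pdivlMr ?subr_gt0// mul1r.
by rewrite gerBl.
Qed.

Lemma ge1_mule k q : 1 <= k -> (1 <= q)%E -> (1 <= k%:E * q)%E.
Proof.
move=> k1 q1; rewrite -[leLHS]mule1; apply: (@le_trans _ _ (k%:E * 1)%E).
  by rewrite !mule1 lee_fin.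
by rewrite lee_wpmul2l// lee_fin (le_trans ler01).
Qed.

Lemma wnorm_heat g nu k q : 0 <= nu <= g -> g < N%:R -> 1 <= k ->
  ((N%:R / (N%:R - g))%:E < q)%E ->
  exists2 C : R, 0 < C & forall t M f, 0 < t -> 0 < M ->
  measurable_fun [set: _] f -> (wnorm g q (EFin \o f) <= M%:E)%E ->
  (wnorm nu (k%:E * q) (EFin \o heat t f) <=
    (C * t `^ (- ((g - nu) / 2 + N%:R / 2 * (fine q^-1%E - fine (k%:E * q)^-1%E))) * M)%:E)%E.
Proof.
move=> nug gN k1 qN; have [C C0 H] := wnorm_heat_abs nug gN k1 qN.
exists C => // t M f t0 M0 mf fM.
apply: le_trans (H t M (EFin \o f) t0 M0 _ fM); last exact/measurable_EFinP.
case/andP: nug => nu0 /(le_trans nu0) g0.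
apply: le_wnorm => [|x]; first exact/ge1_mule/gt1_exponent/qN.
rewrite [leRHS]gee0_abs ?heat_abs_ge0// abse_EFin.
by apply: heat_le_abs => //; rewrite gt_eqF.
Qed.

Lemma measurable_time_integral (D : set R) (h : R -> Rn R N -> R) : measurable D ->
  measurable_fun (D `*` [set: Rn R N]) (fun z => h z.1 z.2) ->
  measurable_fun [set: Rn R N] (fun x => \int[leb]_(s in D) `|h s x|%:E)%E.
Proof.
move=> mD mh.
have mabs : measurable_fun (D `*` [set: Rn R N]) (fun z => (`|h z.1 z.2|%:E)).
  by apply/measurable_EFinP; exact: measurableT_comp.
apply: (@measurable_integral_param _ _ _ _ R leb D (fun z => `|h z.2 z.1|%:E)) => //.
apply: (@measurable_comp _ _ _ _ _ _ (D `*` [set: Rn R N])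
  (fun z => `|h z.1 z.2|%:E) _ (fun z => (z.2, z.1))) => //.
- exact: measurableX.
- by move=> _ [[x s] [_ /= sD] <-].
- apply: measurable_funTS; exact: (@measurable_swap _ _ (Rn R N) (measurableTypeR R)).
Qed.

Lemma measurable_heat_time_integral t (phi : R -> Rn R N -> R) :
  measurable_fun (`]0, t[ `*` [set: Rn R N]) (fun z => heat (t - z.1) (phi z.1) z.2) ->
  measurable_fun [set: Rn R N]
    (fun x => \int[leb]_(s in `]0%R, t[) `|heat (t - s) (phi s) x|%:E)%E.
Proof. exact: measurable_time_integral. Qed.

(** Minkowski's integral inequality in time, with the smoothing estimate at each source time as
    density. Joint measurability is asked of the evolved source and not of [phi], because this is
    what the integral equation provides. *)
Lemma wnorm_duhamel_abs g nu k q : 0 <= nu <= g -> g < N%:R -> 1 <= k ->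
  ((N%:R / (N%:R - g))%:E < q)%E ->
  exists2 C : R, 0 < C & forall t L (m : R -> R) (phi : R -> Rn R N -> R),
  0 < t -> 0 < L -> measurable_fun `]0, t[ m -> (forall s, 0 < s < t -> 0 < m s) ->
  (forall s, 0 < s < t -> measurable_fun [set: _] (phi s)) ->
  (forall s, 0 < s < t -> (wnorm g q (EFin \o phi s) <= (m s)%:E)%E) ->
  measurable_fun (`]0, t[ `*` [set: Rn R N]) (fun z => heat (t - z.1) (phi z.1) z.2) ->
  (\int[leb]_(s in `]0%R, t[) (C * (t - s) `^
    (- ((g - nu) / 2 + N%:R / 2 * (fine q^-1%E - fine (k%:E * q)^-1%E))) * m s)%:E <= L%:E)%E ->
  (wnorm nu (k%:E * q)
    (fun x => \int[leb]_(s in `]0%R, t[) `|heat (t - s) (phi s) x|%:E) <= L%:E)%E.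
Proof.
move=> nug gN k1 qN; have [C C0 H] := wnorm_heat nug gN k1 qN.
exists C => // t L m phi t0 L0 mm m0 mphi phim mh mL.
have q1 : (1 <= k%:E * q)%E.
  by case/andP: nug => nu0 /(le_trans nu0) g0; exact/ge1_mule/gt1_exponent/qN.
have mabs : measurable_fun (`]0%R, t[ `*` [set: Rn R N])
    (fun z => (`|heat (t - z.1) (phi z.1) z.2|%:E)).
  by apply/measurable_EFinP; exact: measurableT_comp.
have in0t s : `]0%R, t[%classic s -> 0 < s < t by rewrite /= in_itv.
apply: (@wnorm_integral _ _ _ _ leb `]0%R, t[%classic (fun s x => `|heat (t - s) (phi s) x|%:E)
   _ _ _ _ q1 _ mabs _ _ _ _ L0 mL) => //.
- apply: measurable_funM => //; apply: measurable_funM => //.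
  apply: (measurableT_comp (measurable_powR _)).
  by apply: measurable_funB => //; exact: measurable_id.
- by move=> s /in0t/andP[s0 st]; rewrite !mulr_gt0 ?powR_gt0 ?subr_gt0 ?m0 ?s0.
move=> s /in0t st.
have ts0 : 0 < t - s by case/andP: st; rewrite subr_gt0.
apply: le_trans (H _ _ _ ts0 (m0 _ st) (mphi _ st) (phim _ st)).
by apply: le_wnorm => // x; rewrite !abse_EFin normr_id.
Qed.

Lemma wnorm_duhamel g nu k q : 0 <= nu <= g -> g < N%:R -> 1 <= k ->
  ((N%:R / (N%:R - g))%:E < q)%E ->
  exists2 C : R, 0 < C & forall t L (m : R -> R) (phi : R -> Rn R N -> R) (w : Rn R N -> R),
  0 < t -> 0 < L -> measurable_fun `]0, t[ m -> (forall s, 0 < s < t -> 0 < m s) ->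
  (forall s, 0 < s < t -> measurable_fun [set: _] (phi s)) ->
  (forall s, 0 < s < t -> (wnorm g q (EFin \o phi s) <= (m s)%:E)%E) ->
  measurable_fun (`]0, t[ `*` [set: Rn R N]) (fun z => heat (t - z.1) (phi z.1) z.2) ->
  measurable_fun [set: _] w ->
  {ae mu, forall x, (`|w x|%:E <= \int[leb]_(s in `]0%R, t[) `|heat (t - s) (phi s) x|%:E)%E} ->
  (\int[leb]_(s in `]0%R, t[) (C * (t - s) `^
    (- ((g - nu) / 2 + N%:R / 2 * (fine q^-1%E - fine (k%:E * q)^-1%E))) * m s)%:E <= L%:E)%E ->
  (wnorm nu (k%:E * q) (EFin \o w) <= L%:E)%E.
Proof.
move=> nug gN k1 qN; have [C C0 H] := wnorm_duhamel_abs nug gN k1 qN.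
exists C => // t L m phi w t0 L0 mm m0 mphi phim mh mw wle mL.
have q1 : (1 <= k%:E * q)%E.
  by case/andP: nug => nu0 /(le_trans nu0) g0; exact/ge1_mule/gt1_exponent/qN.
apply: le_trans (H t L m phi t0 L0 mm m0 mphi phim mh mL).
apply: le_wnorm_ae => //; first exact/measurable_EFinP.
  exact: measurable_heat_time_integral.
apply: filterS wle => x; rewrite abse_EFin => H1; rewrite gee0_abs//.
by apply: integral_ge0 => s _; rewrite lee_fin.
Qed.

Lemma measurable_heat_source g q t (phi : R -> Rn R N -> R) : 0 <= g < N%:R ->
  ((N%:R / (N%:R - g))%:E < q)%E ->
  (forall s, 0 < s < t -> measurable_fun [set: _] (phi s)) ->
  (forall s, 0 < s < t -> (wnorm g q (EFin \o phi s) < +oo)%E) ->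
  {ae mu, forall x, measurable_fun `]0, t[ (fun s => heat (t - s) (phi s) x)} ->
  measurable_fun (`]0, t[ `*` [set: Rn R N]) (fun z => heat (t - z.1) (phi z.1) z.2).
Proof.
move=> gN qN mphi phioo ms.
apply: (@measurable_caratheodory _ _ _ _ _ (fun s x => heat (t - s) (phi s) x)) => //.
move=> s x p /=; rewrite in_itv/= => st px.
have ts0 : 0 < t - s by case/andP: st; rewrite subr_gt0.
apply: heat_cvg => //; first exact: mphi.
set M := fine (wnorm g q (EFin \o phi s)).
have M0 : 0 <= M by rewrite fine_ge0// wnorm_ge0.
apply: (@heat_abs_lty _ _ g (M + 1) q) => //.
- by rewrite mulr_gt0.
- exact: ltr_wpDl.
- by apply/measurable_EFinP; exact: mphi.
have -> : wnorm g q (EFin \o phi s) = M%:E.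
  by rewrite fineK// ge0_fin_numE ?wnorm_ge0// phioo.
by rewrite lee_fin lerDl.
Qed.

End duhamel_estimates.

Section weighted_beta_integrals.
Context {R : realType}.
Local Notation leb := (@lebesgue_measure R).

Lemma le_integral_beta_scale (a b : R) : 0 <= a < 1 -> 0 <= b < 1 ->
  exists2 C : R, 0 < C & forall c t, 0 <= c -> 0 < t ->
  (\int[leb]_(s in `]0%R, t[) (c * ((t - s) `^ (- a) * s `^ (- b)))%:E <=
    (c * (C * t `^ (1 - a - b)))%:E)%E.
Proof.
move=> a01 b01; have [C C0 H] := le_integral_beta a01 b01; exists C => // c t c0 t0.
under eq_integral do rewrite EFinM.
rewrite ge0_integralZl_EFin//.
- by rewrite EFinM; apply: lee_wpmul2l; [rewrite lee_fin|exact: H].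
- by move=> s _; rewrite lee_fin mulr_ge0 ?powR_ge0.
apply/measurable_EFinP; apply: measurable_funM; apply: (measurableT_comp (measurable_powR _)).
  by apply: measurable_funB => //; exact: measurable_id.
exact: measurable_id.
Qed.

Lemma expRN_le_powR (th v : R) : 0 <= th -> 0 < v -> expR (- v) <= th `^ th * v `^ (- th).
Proof.
move=> th0 v0; rewrite powRN expRN -[leRHS]/(th `^ th / v `^ th) ler_pdivlMr ?powR_gt0//.
by rewrite mulrC ler_pdivrMr ?expR_gt0// powR_le_expR// ltW.
Qed.

(** [exp (lam s) = exp (lam t) exp (- lam (t - s))], and the last factor is at most a constant times
    [(lam (t - s)) ^ (- th)]. A slightly stronger singularity buys the factor [lam ^ (- th)], small
    for large [lam] whatever the length of the interval. *)
Lemma le_integral_beta_exp (a b th : R) : 0 <= a -> 0 < th -> a + th < 1 -> 0 <= b < 1 ->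
  exists2 C : R, 0 < C & forall c lam t, 0 <= c -> 0 < lam -> 0 < t ->
  (\int[leb]_(s in `]0%R, t[) (c * ((t - s) `^ (- a) * s `^ (- b) * expR (lam * s)))%:E <=
    (c * (C * lam `^ (- th) * expR (lam * t) * t `^ (1 - a - th - b)))%:E)%E.
Proof.
move=> a0 th0 ath b01.
have ath01 : 0 <= a + th < 1 by rewrite addr_ge0// ltW.
have [C C0 H] := le_integral_beta_scale ath01 b01.
exists (C * th `^ th); first by rewrite mulr_gt0// powR_gt0.
move=> c lam t c0 lam0 t0.
pose c' := c * (th `^ th * lam `^ (- th) * expR (lam * t)).
have c'0 : 0 <= c' by rewrite /c' !mulr_ge0 ?powR_ge0 ?expR_ge0.
apply: (@le_trans _ _ (\int[leb]_(s in `]0%R, t[) (c' * ((t - s) `^ (- (a + th)) * s `^ (- b)))%:E)%E).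
  apply: le_integral_nonneg => s; rewrite /= in_itv/= => /andP[s0 st].
    by rewrite lee_fin !mulr_ge0 ?powR_ge0 ?expR_ge0.
  have ts0 : 0 < t - s by rewrite subr_gt0.
  have E : expR (lam * s) <= th `^ th * lam `^ (- th) * expR (lam * t) * (t - s) `^ (- th).
    have -> : lam * s = - (lam * (t - s)) + lam * t by ring.
    rewrite expRD.
    have := expRN_le_powR (ltW th0) (mulr_gt0 lam0 ts0).
    rewrite (powRM _ (ltW lam0) (ltW ts0)) => /(ler_wpM2r (expR_ge0 (lam * t))) E.
    by apply: le_trans E _; apply: eqW; ring.
  rewrite lee_fin opprD (gt0_powRD _ _ ts0) /c'.
  apply: (@le_trans _ _ (c * ((t - s) `^ (- a) * s `^ (- b) * (th `^ th * lam `^ (- th) * expR (lam * t) * (t - s) `^ (- th))))).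
    by rewrite ler_wpM2l// ler_wpM2l// mulr_ge0 ?powR_ge0.
  by apply: eqW; ring.
apply: le_trans (H _ _ c'0 t0) _; rewrite lee_fin /c'; apply: eqW.
by rewrite (_ : 1 - (a + th) - b = 1 - a - th - b); [ring|ring].
Qed.

(** The closed interval of the equation is replaced by the open one, on which the estimates live: at
    [s = t] the kernel degenerates, and at [s = 0] the auxiliary bound says nothing. *)
Lemma Rintegral_abs_le_oo (f : R -> R) (t : R) : leb.-integrable `[0, t] (EFin \o f) ->
  (`|\int[leb]_(s in `[0%R, t]) f s|%:E <= \int[leb]_(s in `]0%R, t[) `|f s|%:E)%E.
Proof.
move=> fi.
have mf : measurable_fun `]0, t[ (fun s => `|f s|%:E).
  apply/measurable_EFinP; apply: measurableT_comp => //.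
  have /integrableP[/measurable_EFinP mf _] := fi.
  by apply: measurable_funS mf => //; apply: subset_itv; rewrite bnd_simp.
rewrite -(integral_itv_bndoo true false mf).
apply: (@le_trans _ _ (\int[leb]_(s in `[0%R, t]) `|f s|)%:E).
  by rewrite lee_fin; apply: le_normr_Rintegral.
rewrite /Rintegral fineK//.
exact: (@integrable_fin_num _ _ _ leb _ _ _ (integrable_abse fi)).
Qed.

Lemma lee0_geometric (x : \bar R) (W : R) :
  (forall n, (x <= (W * 2^-1 ^+ n)%:E)%E) -> (x <= 0)%E.
Proof.
move=> xW; have lim : (W * 2^-1 ^+ n) @[n --> \oo] --> (0 : R).
  by rewrite -(mulr0 W); apply: cvgMl_tmp; apply: cvg_expr; rewrite ger0_norm// invf_lt1// ltr1n.
apply/lee_addgt0Pr => e e0; rewrite add0e.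
have /cvgrPdist_le/(_ _ e0)[n _ /(_ n (leqnn n))/=] := lim.
by rewrite sub0r normrN => /(le_trans (ler_norm _)) He; apply: le_trans (xW n) _; rewrite lee_fin.
Qed.

Lemma nneseries_geometric_le (W : R) : 0 <= W ->
  (\sum_(k <oo) (W * 2^-1 ^+ k)%:E <= (2 * W)%:E)%E.
Proof.
move=> W0; apply: lime_le.
  by apply: is_cvg_nneseries => n _ _; rewrite lee_fin mulr_ge0// exprn_ge0.
apply: nearW => n; rewrite sumEFin lee_fin.
rewrite (_ : (\sum_(0 <= k < n) W * 2^-1 ^+ k) = 2 * W - 2 * W * 2^-1 ^+ n).
  by rewrite gerBl !mulr_ge0// exprn_ge0.
elim: n => [|n IH]; first by rewrite big_nil expr0; ring.
by rewrite big_nat_recr//= IH exprS; field.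
Qed.

End weighted_beta_integrals.

Section nonlinear_source.
Context {R : realType} {N : nat}.
Local Notation mu := (@lebesgue_Rn R N).
Implicit Types (g k : R) (q : \bar R) (u v : Rn R N -> R).

Lemma fine_inve_mul k q : 0 < k -> (1 <= q)%E -> fine ((k%:E * q)^-1)%E = fine q^-1%E / k.
Proof.
move=> k0; case: q => [p| |] //; last by rewrite gt0_muley ?lte_fin// invey/= mul0r.
rewrite lee_fin => p1; have p0 : 0 < p by exact: lt_le_trans p1.
by rewrite -EFinM !inver !gt_eqF ?mulr_gt0//= invfM mulrC.
Qed.

Lemma fine_inve_ge0 q : (1 <= q)%E -> 0 <= fine q^-1%E.
Proof.
case: q => [p| |] //.
rewrite lee_fin => p1; have p0 : 0 < p by exact: lt_le_trans p1.
by rewrite inver gt_eqF//= invr_ge0 ltW.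
Qed.

Lemma measurable_nonlinearity (alpha : R) u :
  measurable_fun [set: _] u -> measurable_fun [set: Rn R N] (nonlinearity alpha u).
Proof.
move=> mu_; apply: measurable_funM => //.
by apply: (measurableT_comp (measurable_powR _)); exact: measurableT_comp.
Qed.

Lemma wnorm_nonlinearity (alpha g A : R) q u : 0 < alpha -> (1 <= q)%E -> 0 < A ->
  measurable_fun [set: _] u ->
  (wnorm (g / (alpha + 1)) ((alpha + 1)%:E * q) (EFin \o u) <= A%:E)%E ->
  (wnorm g q (EFin \o nonlinearity alpha u) <= (A `^ (alpha + 1))%:E)%E.
Proof.
move=> al0 q1 A0 mu_ uA; rewrite gt0_powRD// (powRr1 (ltW A0)).
apply: le_trans (wnorm_nonlinear al0 q1 A0 A0 mu_ mu_ uA uA).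
apply: le_wnorm => // x; rewrite !abse_EFin lee_fin !normrM normr_id ler_wpM2l//.
Qed.

Lemma wnorm_nonlinearityB (alpha g : R) q : 0 < alpha -> (1 <= q)%E ->
  exists2 C : R, 0 < C & forall (A B : R) u v, 0 < A -> 0 < B ->
  measurable_fun [set: _] u -> measurable_fun [set: _] v ->
  (wnorm (g / (alpha + 1)) ((alpha + 1)%:E * q) (EFin \o u) <= A%:E)%E ->
  (wnorm (g / (alpha + 1)) ((alpha + 1)%:E * q) (EFin \o v) <= A%:E)%E ->
  (wnorm (g / (alpha + 1)) ((alpha + 1)%:E * q) (EFin \o (fun x => u x - v x)%R) <= B%:E)%E ->
  (wnorm g q (EFin \o (fun x => nonlinearity alpha u x - nonlinearity alpha v x)%R) <=
    (C * (A `^ alpha * B))%:E)%E.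
Proof.
move=> al0 q1; have [C C0 H] := @nonlinearity_lipschitz R alpha al0.
exists (C * 2); first by rewrite mulr_gt0.
move=> A B u v A0 B0 mu_ mv uA vA uvB.
have md : measurable_fun [set: Rn R N] (fun x => u x - v x) by exact: measurable_funB.
have AB0 : 0 <= A `^ alpha * B by rewrite mulr_ge0 ?powR_ge0 ?(ltW B0).
have mprod (f : Rn R N -> R) : measurable_fun [set: _] f ->
    measurable_fun [set: Rn R N] (fun x => (`|f x| `^ alpha * `|u x - v x|)%:E).
  move=> mf; apply/measurable_EFinP; apply: measurable_funM; last exact: measurableT_comp.
  by apply: (measurableT_comp (measurable_powR _)); exact: measurableT_comp.
have Cprod (f : Rn R N -> R) : measurable_fun [set: _] f ->
    (wnorm (g / (alpha + 1)) ((alpha + 1)%:E * q) (EFin \o f) <= A%:E)%E ->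
    (wnorm g q (fun x => C%:E * (`|f x| `^ alpha * `|u x - v x|)%:E) <= (C * (A `^ alpha * B))%:E)%E.
  move=> mf fA; apply: wnormZ => //; first exact: mprod.
  exact: wnorm_nonlinear.
rewrite (_ : C * 2 * _ = C * (A `^ alpha * B) + C * (A `^ alpha * B)); last by ring.
apply: (@wnorm_le_add _ _ _ _ _ _ (fun x => C%:E * (`|u x| `^ alpha * `|u x - v x|)%:E)%E
  (fun x => C%:E * (`|v x| `^ alpha * `|u x - v x|)%:E)%E) => //.
- by rewrite mulr_ge0 ?(ltW C0).
- by rewrite mulr_ge0 ?(ltW C0).
- by apply: measurable_funeM; exact: mprod.
- by apply: measurable_funeM; exact: mprod.
- move=> x; rewrite -!EFinM !abse_EFin -EFinD lee_fin.
  rewrite [X in _ <= X + _]ger0_norm ?mulr_ge0 ?powR_ge0 ?(ltW C0)//.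
  rewrite [X in _ <= _ + X]ger0_norm ?mulr_ge0 ?powR_ge0 ?(ltW C0)//.
  by apply: le_trans (H _ _) _; apply: eqW; ring.
- exact: Cprod.
- exact: Cprod.
Qed.

End nonlinear_source.

(** * Uniqueness *)

Section uniqueness.
Context {R : realType} {N : nat}.
Local Notation mu := (@lebesgue_Rn R N).
Local Notation leb := (@lebesgue_measure R).
Implicit Types (alpha g k t : R) (q : \bar R) (u v : R -> Rn R N -> R).

Lemma heat_abs_lty_norm g q t (f : Rn R N -> R) x : 0 <= g < N%:R ->
  ((N%:R / (N%:R - g))%:E < q)%E -> 0 < t -> measurable_fun [set: _] f ->
  (wnorm g q (EFin \o f) < +oo)%E -> (heat_abs t (EFin \o f) x < +oo)%E.
Proof.
move=> gN qN t0 mf foo; set M := fine (wnorm g q (EFin \o f)).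
have M0 : 0 <= M by rewrite fine_ge0// wnorm_ge0.
apply: (@heat_abs_lty _ _ g (M + 1) q) => //.
- exact: ltr_wpDl.
- exact/measurable_EFinP.
have -> : wnorm g q (EFin \o f) = M%:E by rewrite fineK// ge0_fin_numE ?wnorm_ge0.
by rewrite lee_fin lerDl.
Qed.

Lemma duhamel_difference alpha t u v x :
  (forall s, 0 < s < t -> (heat_abs (t - s) (EFin \o nonlinearity alpha (u s)) x < +oo)%E) ->
  (forall s, 0 < s < t -> (heat_abs (t - s) (EFin \o nonlinearity alpha (v s)) x < +oo)%E) ->
  (forall s, 0 < s < t -> measurable_fun [set: _] (u s)) ->
  (forall s, 0 < s < t -> measurable_fun [set: _] (v s)) ->
  leb.-integrable `[0, t] (fun s => (heat (t - s) (nonlinearity alpha (u s)) x)%:E) ->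
  leb.-integrable `[0, t] (fun s => (heat (t - s) (nonlinearity alpha (v s)) x)%:E) ->
  (`|duhamel alpha u t x - duhamel alpha v t x|%:E <= \int[leb]_(s in `]0%R, t[)
     `|heat (t - s) (fun y => nonlinearity alpha (u s) y - nonlinearity alpha (v s) y) x|%:E)%E.
Proof.
move=> uoo voo mu_ mv iu iv; rewrite /duhamel -RintegralB//.
have iB : leb.-integrable `[0, t] (EFin \o (fun s => heat (t - s) (nonlinearity alpha (u s)) x -
    heat (t - s) (nonlinearity alpha (v s)) x)).
  by have := @integrableB _ _ _ leb _ _ _ _ iu iv; apply.
apply: le_trans (Rintegral_abs_le_oo iB) _.
apply: le_integral_nonneg => s; rewrite /= in_itv/= => st; first by rewrite lee_fin.
by rewrite heatB//; [apply: measurable_nonlinearity; exact: mu_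
  |apply: measurable_nonlinearity; exact: mv|exact: uoo|exact: voo].
Qed.

(** The free terms cancel and the sources subtract inside both integrals, each being absolutely
    convergent. The measurability conclusion comes from the time sections that the two equations
    contain. *)
Lemma mild_difference alpha g q t J (u0 : Rn R N -> R) u v : 0 <= g < N%:R ->
  ((N%:R / (N%:R - g))%:E < q)%E -> 0 < t -> J t ->
  (forall s, 0 < s < t -> measurable_fun [set: _] (u s)) ->
  (forall s, 0 < s < t -> measurable_fun [set: _] (v s)) ->
  (forall s, 0 < s < t -> (wnorm g q (EFin \o nonlinearity alpha (u s)) < +oo)%E) ->
  (forall s, 0 < s < t -> (wnorm g q (EFin \o nonlinearity alpha (v s)) < +oo)%E) ->
  (forall s, 0 < s < t -> (wnorm g q (EFin \o
     (fun y => nonlinearity alpha (u s) y - nonlinearity alpha (v s) y)%R) < +oo)%E) ->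
  integral_equation alpha u0 J u -> integral_equation alpha u0 J v ->
  {ae mu, forall x, (`|u t x - v t x|%:E <= \int[leb]_(s in `]0%R, t[)
     `|heat (t - s) (fun y => nonlinearity alpha (u s) y - nonlinearity alpha (v s) y) x|%:E)%E} /\
  measurable_fun (`]0, t[ `*` [set: Rn R N]) (fun z =>
    heat (t - z.1) (fun y => nonlinearity alpha (u z.1) y - nonlinearity alpha (v z.1) y) z.2).
Proof.
move=> gN qN t0 Jt mu_ mv uoo voo doo ueq veq.
set phi := fun s y => nonlinearity alpha (u s) y - nonlinearity alpha (v s) y.
have mF s : 0 < s < t -> measurable_fun [set: _] (nonlinearity alpha (u s)).
  by move=> /mu_; exact: measurable_nonlinearity.
have mG s : 0 < s < t -> measurable_fun [set: _] (nonlinearity alpha (v s)).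
  by move=> /mv; exact: measurable_nonlinearity.
have phiE s x : 0 < s < t -> heat (t - s) (phi s) x =
    heat (t - s) (nonlinearity alpha (u s)) x - heat (t - s) (nonlinearity alpha (v s)) x.
  move=> st; have ts0 : 0 < t - s by case/andP: st; rewrite subr_gt0.
  rewrite heatB//; [exact: mF|exact: mG| |].
    by apply: (heat_abs_lty_norm _ gN qN) => //; [exact: mF|exact: uoo].
  by apply: (heat_abs_lty_norm _ gN qN) => //; [exact: mG|exact: voo].
split; last first.
  apply: (@measurable_heat_source _ _ g q t phi gN qN) => //.
    by move=> s st; apply: measurable_funB; [exact: mF|exact: mG].
  apply: filterS2 (ueq t Jt) (veq t Jt) => x [_ iu _] [_ iv _].
  have sub : `]0, t[%classic `<=` `[0, t]%classic by apply: subset_itv; rewrite bnd_simp.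
  move: iu iv => /integrableP[/measurable_EFinP iu _] /integrableP[/measurable_EFinP iv _].
  have mB := measurable_funS _ sub (measurable_funB iu iv).
  apply: eq_measurable_fun (mB _) => // s; rewrite inE/= in_itv/= => st.
  by rewrite phiE.
apply: filterS2 (ueq t Jt) (veq t Jt) => x [_ iu ->] [_ iv ->].
rewrite opprD addrACA subrr add0r; apply: duhamel_difference => // s st.
  apply: (heat_abs_lty_norm _ gN qN); [|exact: mF|exact: uoo].
  by case/andP: st; rewrite subr_gt0.
apply: (heat_abs_lty_norm _ gN qN); [|exact: mG|exact: voo].
by case/andP: st; rewrite subr_gt0.
Qed.

Lemma smoothing_exponent_ge0 alpha g q : 0 < alpha -> 0 <= g -> (1 <= q)%E ->
  0 <= (g - g / (alpha + 1)) / 2 +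
    N%:R / 2 * (fine q^-1%E - fine ((alpha + 1)%:E * q)^-1%E).
Proof.
move=> al0 g0 q1; have al10 : 0 < alpha + 1 by lra.
have al1 : 1 <= alpha + 1 by lra.
rewrite addr_ge0 ?divr_ge0 ?subr_ge0 ?ler_pdivrMr ?ler_peMr// mulr_ge0 ?divr_ge0//.
by rewrite subr_ge0 fine_inve_mul// ler_pdivrMr// ler_peMr// fine_inve_ge0.
Qed.

(* In the norm [sup_t t^kap e^(-lam t) |u(t) - v(t)|] with [lam] large, the integral equation
   halves the distance of two solutions, which is therefore at most [2 M / 2^n] for all [n]. *)
Lemma integral_equation_unique alpha g kap T M q (u0 : Rn R N -> R) u v :
  let nu := g / (alpha + 1) in let r := ((alpha + 1)%:E * q)%E in
  let a := (g - nu) / 2 + N%:R / 2 * (fine q^-1%E - fine r^-1%E) in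
  (0 < N)%N -> 0 < alpha -> 0 <= g < N%:R -> ((N%:R / (N%:R - g))%:E < q)%E ->
  0 <= kap -> kap * (alpha + 1) < 1 -> a + kap * alpha < 1 -> 0 < M -> 0 < T ->
  (forall t, 0 < t <= T -> measurable_fun [set: _] (u t)) ->
  (forall t, 0 < t <= T -> measurable_fun [set: _] (v t)) ->
  (forall t, 0 < t <= T -> (wnorm nu r (EFin \o u t) <= (M * t `^ (- kap))%:E)%E) ->
  (forall t, 0 < t <= T -> (wnorm nu r (EFin \o v t) <= (M * t `^ (- kap))%:E)%E) ->
  integral_equation alpha u0 `]0, T] u -> integral_equation alpha u0 `]0, T] v ->
  forall t, 0 < t <= T -> {ae mu, forall x, u t x = v t x}.
Proof.
(* [kap] is the singularity allowed at time 0: the smoothing exponent for solutions with the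
   auxiliary bound, and 0 for uniqueness without it. *)
move=> nu r a N0 al0 /andP[g0 gN] qN kap0 kap1 akap M0 T0 mu_ mv uM vM ueq veq.
have q1 : (1 <= q)%E by exact: gt1_exponent qN.
have al1 : 1 <= alpha + 1 by lra.
have al10 : 0 < alpha + 1 by lra.
have r1 : (1 <= r)%E by exact: ge1_mule.
have nug : 0 <= nu <= g.
  by rewrite /nu divr_ge0 ?(ltW al10)//= ler_pdivrMr// ler_peMr.
have a0 : 0 <= a by exact: smoothing_exponent_ge0.
have [C1 C10 H1] := wnorm_duhamel nug gN al1 qN.
have [C2 C20 H2] := @wnorm_nonlinearityB R N alpha g q al0 q1.
(* Half of the room left by [a + kap alpha < 1]: one half is spent on decay in [lam], and the other
   leaves the power [t ^ (th - kap)], that is, the weight of the norm times a bounded factor. *)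
pose th := (1 - a - kap * alpha) / 2.
have th0 : 0 < th by rewrite divr_gt0// -addrA -opprD subr_gt0.
have ath : a + th < 1.
  have : 0 <= kap * alpha by rewrite mulr_ge0// ltW.
  by rewrite /th; lra.
have [C3 C30 H3] := le_integral_beta_exp a0 th0 ath
  (introT andP (conj (mulr_ge0 kap0 (ltW al10)) kap1)).
(* [Q] collects the constants of one iteration; [lam] is then chosen so that the contraction factor
   [Q * lam ^ (- th) * T ^ th] is exactly one half. *)
pose Q := C1 * C2 * M `^ alpha * C3.
have Q0 : 0 < Q by rewrite !mulr_gt0 ?powR_gt0.
pose lam := (2 * Q) `^ th^-1 * T.
have q20 : 0 < 2 * Q by exact: mulr_gt0.
have lam0 : 0 < lam by apply: mulr_gt0 => //; exact: powR_gt0.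
have lamE : Q * lam `^ (- th) * T `^ th = 2^-1.
  rewrite /lam powRM ?powR_ge0 ?(ltW T0)// -powRrM mulrN mulVf ?gt_eqF//.
  rewrite powR_inv1 ?(ltW q20)// powRN -mulrA -mulrA mulVf ?gt_eqF ?powR_gt0//.
  by field; rewrite gt_eqF.
have step n t : 0 < t <= T ->
    (wnorm nu r (EFin \o (fun x => u t x - v t x)%R) <=
      (2 * M * 2^-1 ^+ n * t `^ (- kap) * expR (lam * t))%:E)%E.
  elim: n t => [|n IH] t tT.
    have t0 : 0 < t by case/andP: tT.
    have B0 : 0 <= M * t `^ (- kap) by rewrite mulr_ge0 ?powR_ge0 ?(ltW M0).
    apply: (@le_trans _ _ (M * t `^ (- kap) + M * t `^ (- kap))%:E).
      apply: (wnorm_le_add r1 B0 B0 _ _ _ (uM t tT) (vM t tT)).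
      - by apply/measurable_EFinP; exact: mu_.
      - by apply/measurable_EFinP; exact: mv.
      - by move=> x; rewrite !abse_EFin -EFinD lee_fin ler_normB.
    rewrite lee_fin expr0 mulr1 (_ : _ + _ = 2 * M * t `^ (- kap) * 1); last by ring.
    rewrite ler_wpM2l ?mulr_ge0 ?powR_ge0 ?(ltW M0)// -expR0 ler_expR mulr_ge0 ?(ltW t0)//.
    exact: ltW.
  case/andP: (tT) => t0 tleT.
  have lt_le s : 0 < s < t -> 0 < s <= T.
    by case/andP => -> st /=; rewrite (le_trans (ltW st)).
  have in_t : `]0, T]%classic t by rewrite /= in_itv.
  pose phi s y := nonlinearity alpha (u s) y - nonlinearity alpha (v s) y.
  pose m s := C2 * ((M * s `^ (- kap)) `^ alpha *
    (2 * M * 2^-1 ^+ n * s `^ (- kap) * expR (lam * s))).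
  have Ms0 s : 0 < s < t -> 0 < M * s `^ (- kap).
    by move=> /andP[s0 _]; rewrite mulr_gt0// powR_gt0.
  have phim s : 0 < s < t -> (wnorm g q (EFin \o phi s) <= (m s)%:E)%E.
    move=> st; have sT := lt_le _ st; case/andP: (st) => s0 _.
    apply: H2 => //; [exact: Ms0| |exact: mu_|exact: mv|exact: uM|exact: vM|exact: IH].
    by rewrite !mulr_gt0 ?powR_gt0 ?expR_gt0 ?exprn_gt0 ?invr_gt0.
  have Foo (w : R -> Rn R N -> R) s : 0 < s < t -> measurable_fun [set: _] (w s) ->
      (wnorm nu r (EFin \o w s) <= (M * s `^ (- kap))%:E)%E ->
      (wnorm g q (EFin \o nonlinearity alpha (w s)) < +oo)%E.
    move=> st mw wM.
    by apply: le_lt_trans (wnorm_nonlinearity al0 q1 (Ms0 _ st) mw wM) _; rewrite ltry.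
  have [] := @mild_difference alpha g q t `]0, T]%classic u0 u v (introT andP (conj g0 gN)) qN t0 in_t
    (fun s st => mu_ s (lt_le s st)) (fun s st => mv s (lt_le s st))
    (fun s st => Foo u s st (mu_ s (lt_le s st)) (uM s (lt_le s st)))
    (fun s st => Foo v s st (mv s (lt_le s st)) (vM s (lt_le s st)))
    (fun s st => le_lt_trans (phim s st) (ltry _)) ueq veq.
  move=> dae mphi.
  apply: (H1 t _ m phi) => //.
  - by rewrite !mulr_gt0 ?powR_gt0 ?expR_gt0 ?exprn_gt0 ?invr_gt0.
  - apply: measurable_funM => //; apply: measurable_funM.
      apply: (measurableT_comp (measurable_powR _)); apply: measurable_funM => //.
      by apply: (measurableT_comp (measurable_powR _)); exact: measurable_id.
    apply: measurable_funM; last first.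
      apply: (measurableT_comp (@measurable_expR R)).
      by apply: measurable_funM => //; exact: measurable_id.
    apply: measurable_funM => //.
    by apply: (measurableT_comp (measurable_powR _)); exact: measurable_id.
  - move=> s st; case/andP: (st) => s0 _.
    by rewrite /m !mulr_gt0 ?powR_gt0 ?Ms0 ?expR_gt0 ?exprn_gt0 ?invr_gt0.
  - move=> s st; apply: measurable_funB; apply: measurable_nonlinearity.
      by apply: mu_; exact: lt_le.
    by apply: mv; exact: lt_le.
  - by apply: measurable_funB; [exact: mu_|exact: mv].
  pose c := C1 * C2 * M `^ alpha * (2 * M * 2^-1 ^+ n).
  have c0 : 0 <= c by rewrite /c !mulr_ge0 ?powR_ge0 ?exprn_ge0 ?ltW.
  apply: (@le_trans _ _ (\int[leb]_(s in `]0%R, t[)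
    (c * ((t - s) `^ (- a) * s `^ (- (kap * (alpha + 1))) * expR (lam * s)))%:E)%E).
    apply: le_integral_nonneg => s; rewrite /= in_itv/= => st.
      case/andP: (st) => s0 st'.
      by rewrite lee_fin /m !mulr_ge0 ?powR_ge0 ?expR_ge0 ?exprn_ge0 ?ltW.
    case/andP: (st) => s0 st'; rewrite lee_fin -/r -/nu -/a /m /c; apply: eqW.
    rewrite powRM ?powR_ge0 ?(ltW M0)// -powRrM.
    have -> : - (kap * (alpha + 1)) = - kap * alpha + - kap by ring.
    by rewrite gt0_powRD//; ring.
  apply: le_trans (H3 _ _ _ c0 lam0 t0) _; rewrite lee_fin.
  have -> : 1 - a - th - kap * (alpha + 1) = th - kap by rewrite /th; field.
  rewrite gt0_powRD// exprS.
  have tth : t `^ th <= T `^ th by rewrite ge0_ler_powR ?nnegrE ?(ltW t0) ?(ltW th0) ?(ltW T0).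
  apply: (@le_trans _ _ (2 * M * 2^-1 ^+ n * t `^ (- kap) * expR (lam * t) *
    (Q * lam `^ (- th) * T `^ th))); last by rewrite lamE; apply: eqW; ring.
  rewrite (_ : c * _ = 2 * M * 2^-1 ^+ n * t `^ (- kap) * expR (lam * t) *
    (Q * lam `^ (- th) * t `^ th)); last by rewrite /c /Q; ring.
  have W0 : 0 <= 2 * M * 2^-1 ^+ n * t `^ (- kap) * expR (lam * t).
    by rewrite !mulr_ge0 ?powR_ge0 ?expR_ge0 ?exprn_ge0 ?(ltW M0).
  apply: (ler_wpM2l W0); apply: ler_wpM2l => //.
  by rewrite mulr_ge0 ?powR_ge0 ?(ltW Q0).
move=> t tT.
have D0 : (wnorm nu r (EFin \o (fun x => u t x - v t x)%R) <= 0)%E.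
  apply: (@lee0_geometric _ _ (2 * M * t `^ (- kap) * expR (lam * t))) => n.
  by apply: le_trans (step n t tT) _; rewrite lee_fin; apply: eqW; ring.
have := wnorm_eq0 N0 r1 _ D0; case.
  by apply/measurable_EFinP; apply: measurable_funB; [exact: mu_|exact: mv].
move=> B [mB B0 sB]; exists B; split => //.
apply: subset_trans sB => x /= h1 h2; apply: h1.
by apply/eqP; rewrite -subr_eq0; apply/eqP; case: h2.
Qed.

End uniqueness.

(** * Local existence *)

Section duhamel_source.
Context {R : realType} {N : nat}.
Local Notation mu := (@lebesgue_Rn R N).
Local Notation leb := (@lebesgue_measure R).
Implicit Types (alpha g k t : R) (q : \bar R) (u v : R -> Rn R N -> R).

(** The Duhamel term is measured in the source space itself, with [k = 1] and [nu = g]: the flow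
    contributes no singularity, and only the source factor [s ^ (- kap (alpha + 1))] is
    integrated. *)
Lemma wnorm_duhamel_source alpha g q kap : 0 < alpha -> 0 <= g < N%:R ->
  ((N%:R / (N%:R - g))%:E < q)%E -> 0 <= kap -> kap * (alpha + 1) < 1 ->
  exists2 C : R, 0 < C & forall t M u, 0 < t -> 0 < M ->
  (forall s, 0 < s < t -> measurable_fun [set: _] (u s)) ->
  (forall s, 0 < s < t ->
    (wnorm (g / (alpha + 1)) ((alpha + 1)%:E * q) (EFin \o u s) <= (M * s `^ (- kap))%:E)%E) ->
  measurable_fun (`]0, t[ `*` [set: Rn R N])
    (fun z => heat (t - z.1) (nonlinearity alpha (u z.1)) z.2) ->
  (wnorm g q (fun x => \int[leb]_(s in `]0%R, t[) `|heat (t - s) (nonlinearity alpha (u s)) x|%:E)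
    <= (M `^ (alpha + 1) * (C * t `^ (1 - kap * (alpha + 1))))%:E)%E.
Proof.
move=> al0 /andP[g0 gN] qN kap0 kap1.
have q1 : (1 <= q)%E by exact: gt1_exponent qN.
have gg : 0 <= g <= g by rewrite g0 lexx.
have [C1 C10 H1] := wnorm_duhamel_abs gg gN (lexx 1) qN.
have al10 : 0 <= alpha + 1 by rewrite addr_ge0 ?ltW.
have z01 : 0 <= (0 : R) < 1 by rewrite lexx ltr01.
have [C2 C20 H2] := le_integral_beta_scale z01 (introT andP (conj (mulr_ge0 kap0 al10) kap1)).
exists (C1 * C2); first exact: mulr_gt0.
move=> t M u t0 M0 mu_ uM mh.
have Ms0 s : 0 < s < t -> 0 < M * s `^ (- kap).
  by move=> /andP[s0 _]; rewrite mulr_gt0// powR_gt0.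
rewrite -[q]mul1e.
apply: (H1 t _ (fun s => (M * s `^ (- kap)) `^ (alpha + 1))) => //.
- by rewrite !mulr_gt0 ?powR_gt0.
- apply: (measurableT_comp (measurable_powR _)); apply: measurable_funM => //.
  by apply: (measurableT_comp (measurable_powR _)); exact: measurable_id.
- by move=> s /Ms0 ?; rewrite powR_gt0.
- by move=> s st; apply: measurable_nonlinearity; exact: mu_.
- by move=> s st; apply: (wnorm_nonlinearity al0 q1 (Ms0 s st)); [exact: mu_|exact: uM].
have c0 : 0 <= C1 * M `^ (alpha + 1) by rewrite mulr_ge0 ?powR_ge0 ?ltW.
apply: (@le_trans _ _ (\int[leb]_(s in `]0%R, t[)
  (C1 * M `^ (alpha + 1) * ((t - s) `^ (- 0) * s `^ (- (kap * (alpha + 1)))))%:E)%E).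
  apply: le_integral_nonneg => s; rewrite /= in_itv/= => /andP[s0 st].
    by rewrite lee_fin !mulr_ge0 ?powR_ge0 ?(ltW C10).
  rewrite lee_fin mul1e !subrr mulr0 mul0r addr0 powRM ?powR_ge0 ?(ltW M0)// -powRrM mulNr.
  by apply: eqW; ring.
apply: le_trans (H2 _ _ c0 t0) _; rewrite lee_fin subr0.
by apply: eqW; ring.
Qed.

Lemma measurable_duhamel_time_section alpha g q t J (u0 : Rn R N -> R) u : 0 <= g < N%:R ->
  ((N%:R / (N%:R - g))%:E < q)%E -> J t ->
  (forall s, 0 < s < t -> measurable_fun [set: _] (u s)) ->
  (forall s, 0 < s < t -> (wnorm g q (EFin \o nonlinearity alpha (u s)) < +oo)%E) ->
  integral_equation alpha u0 J u ->
  measurable_fun (`]0, t[ `*` [set: Rn R N])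
    (fun z => heat (t - z.1) (nonlinearity alpha (u z.1)) z.2).
Proof.
move=> gN qN Jt mu_ uoo ueq.
apply: (@measurable_heat_source _ _ g q t (fun s => nonlinearity alpha (u s)) gN qN) => //.
  by move=> s st; apply: measurable_nonlinearity; exact: mu_.
apply: filterS (ueq t Jt) => x [_ /integrableP[/measurable_EFinP iu _] _].
by apply: measurable_funS iu => //; apply: subset_itv; rewrite bnd_simp.
Qed.

Lemma measurable_heat_jointly alpha u : measurable_fun [set: R * Rn R N] (fun z => u z.1 z.2) ->
  measurable_fun [set: (R * Rn R N) * R]
    (fun z => heat (z.1.1 - z.2) (nonlinearity alpha (u z.2)) z.1.2).
Proof.
move=> mu_.
apply: (@measurable_heat_param _ _ _ ((R * Rn R N) * R)%type (fun z => z.1.1 - z.2)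
  (fun z => z.1.2) (fun z => nonlinearity alpha (u z.2))).
- apply: measurable_funB => //.
  by apply: (measurableT_comp measurable_fst); exact: measurable_fst.
- by apply: (measurableT_comp measurable_snd); exact: measurable_fst.
have mu2 : measurable_fun [set: ((R * Rn R N) * R) * Rn R N] (fun z => u z.1.2 z.2).
  apply: (@measurableT_comp _ _ _ _ _ _ (fun z => u z.1 z.2) _ (fun z => (z.1.2, z.2))) => //.
  apply: measurable_fun_pair; last exact: measurable_snd.
  by apply: (measurableT_comp measurable_snd); exact: measurable_fst.
apply: measurable_funM => //.
by apply: (measurableT_comp (measurable_powR _)); exact: measurableT_comp.
Qed.

Lemma measurable_duhamel alpha u : measurable_fun [set: R * Rn R N] (fun z => u z.1 z.2) ->
  measurable_fun [set: R * Rn R N] (fun z => duhamel alpha u z.1 z.2).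
Proof.
move=> mu_; have mh := measurable_heat_jointly alpha mu_.
(* The domain of integration [[0, t]] moves with the parameter, so it is encoded in the
   integrand. *)
pose F (z : (R * Rn R N) * R) := if (0 <= z.2) && (z.2 <= z.1.1) then
  heat (z.1.1 - z.2) (nonlinearity alpha (u z.2)) z.1.2 else 0.
have mF : measurable_fun [set: (R * Rn R N) * R] F.
  apply: measurable_fun_ifT => //; apply: measurable_and.
    by apply: measurable_fun_ler => //; exact: measurable_snd.
  apply: measurable_fun_ler; first exact: measurable_snd.
  by apply: (measurableT_comp measurable_fst); exact: measurable_fst.
have -> : (fun z : R * Rn R N => duhamel alpha u z.1 z.2) =
    (fun z => \int[leb]_(s in setT) F (z, s)).
  apply/funext => -[t x]; rewrite /duhamel /= Rintegral_mkcond; apply: eq_Rintegral => s _.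
  by rewrite patchE mem_setE in_itv.
by apply: measurable_Rintegral_param => //; rewrite setXTT.
Qed.

End duhamel_source.

Lemma cvg_summable_increments (R : realType) (U : nat -> R) :
  (\sum_(k <oo) `|U k.+1 - U k|%:E < +oo)%E ->
  exists l : R, U @ \oo --> l /\
  forall n, (`|l - U n|%:E <= \sum_(k <oo) `|U (n + k)%N.+1 - U (n + k)%N|%:E)%E.
Proof.
move=> fin; pose D k := `|U k.+1 - U k|.
have D0 k : 0 <= D k by exact: normr_ge0.
have sumE n m : U (n + m)%N - U n = \sum_(k < m) (U (n + k)%N.+1 - U (n + k)%N).
  elim: m => [|m IH]; first by rewrite addn0 subrr big_ord0.
  by rewrite big_ord_recr /= -IH addnS; ring.
have part n m : (`|U (n + m)%N - U n|%:E <= \sum_(k <oo) (D (n + k)%N)%:E)%E.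
  apply: (@le_trans _ _ (\sum_(0 <= k < m) (D (n + k)%N)%:E)%E); last first.
    by apply: nneseries_lim_ge => k _ _; rewrite lee_fin.
  by rewrite sumEFin lee_fin sumE big_mkord; exact: ler_norm_sum.
have cU : cvgn U.
  have cD : cvgn (series D).
    apply: nondecreasing_is_cvgn.
      by apply/nondecreasing_seqP => n; rewrite /series/= big_nat_recr//= lerDl.
    exists (fine (\sum_(k <oo) (D k)%:E)%E) => _ [n _ <-].
    rewrite -lee_fin fineK; last first.
      by rewrite ge0_fin_numE// nneseries_ge0// => k _ _; rewrite lee_fin.
    by rewrite /series/= -sumEFin; apply: nneseries_lim_ge => k _ _; rewrite lee_fin.
  have := @normed_cvg _ R^o (fun k => U k.+1 - U k) cD => cV.
  have -> : U = (fun n => series (fun k => U k.+1 - U k) n + U 0%N).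
    apply/funext => n; rewrite /series/= big_mkord.
    by have := sumE 0%N n; rewrite add0n => H; rewrite -H subrK.
  by apply: is_cvgD => //; exact: is_cvg_cst.
exists (limn U); split => // n.
set T := (\sum_(k <oo) _)%E.
have [Tfin|] := ltP T +oo%E; last by rewrite leye_eq => /eqP ->; rewrite leey.
have T0 : (0 <= T)%E by apply: nneseries_ge0 => k _ _; rewrite lee_fin.
rewrite -(fineK (_ : T \is a fin_num)) ?ge0_fin_numE// lee_fin.
have cv : `|U m - U n| @[m --> \oo] --> `|limn U - U n|.
  by apply: cvg_norm; apply: cvgB => //; exact: cvg_cst.
apply: (closed_cvg (fun x => x <= fine T)) cv; first exact: closed_le.
near=> m; have nm : (n <= m)%N by near: m; exact: nbhs_infty_ge.
have := part n (m - n)%N; rewrite subnKC// -/T -lee_fin fineK// ge0_fin_numE//.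
Unshelve. all: by end_near. Qed.

Section picard.
Context {R : realType} {N : nat}.
Local Notation mu := (@lebesgue_Rn R N).
Local Notation leb := (@lebesgue_measure R).
Implicit Types (alpha g k t : R) (q : \bar R) (u v : R -> Rn R N -> R).

(** Picard iterates inherit this from their integral formula; an arbitrary solution is only known to
    have measurable slices. *)
Definition jointly_measurable u := measurable_fun [set: R * Rn R N] (fun z => u z.1 z.2).

Lemma jointly_measurable_slice u t : jointly_measurable u -> measurable_fun [set: _] (u t).
Proof.
move=> mu_; apply: (@measurableT_comp _ _ _ _ _ _ (fun z => u z.1 z.2) _ (fun x => (t, x))) => //.
exact: pair1_measurable.
Qed.

Lemma jointly_measurable_source alpha u t : jointly_measurable u ->
  measurable_fun [set: R * Rn R N] (fun z => heat (t - z.1) (nonlinearity alpha (u z.1)) z.2).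
Proof.
move=> /(measurable_heat_jointly alpha) mh.
apply: (@measurableT_comp _ _ _ _ _ _ (fun z : (R * Rn R N) * R =>
  heat (z.1.1 - z.2) (nonlinearity alpha (u z.2)) z.1.2) _ (fun z => ((t, z.2), z.1))) => //.
by apply: measurable_fun_pair => //; exact: measurable_fun_pair.
Qed.

(** The extended-valued time integral has finite weighted norm, hence is finite at almost every
    point. *)
Lemma duhamel_integrable alpha g q kap t M u : (0 < N)%N -> 0 < alpha -> 0 <= g < N%:R ->
  ((N%:R / (N%:R - g))%:E < q)%E -> 0 <= kap -> kap * (alpha + 1) < 1 -> 0 < t -> 0 < M ->
  jointly_measurable u ->
  (forall s, 0 < s < t ->
    (wnorm (g / (alpha + 1)) ((alpha + 1)%:E * q) (EFin \o u s) <= (M * s `^ (- kap))%:E)%E) ->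
  {ae mu, forall x, leb.-integrable `[0, t]
    (fun s => (heat (t - s) (nonlinearity alpha (u s)) x)%:E)}.
Proof.
move=> N0 al0 gN qN kap0 kap1 t0 M0 mu_ uM.
have [C C0 H] := wnorm_duhamel_source al0 gN qN kap0 kap1.
have mh := jointly_measurable_source alpha t mu_.
have mh' := measurable_funTS (D := `]0%R, t[ `*` [set: Rn R N]) mh.
have ms s : 0 < s < t -> measurable_fun [set: _] (u s).
  by move=> _; exact: jointly_measurable_slice.
have := H t M u t0 M0 ms uM mh'.
have q1 : (1 <= q)%E by case/andP: gN => g0 gN; exact: gt1_exponent qN.
have L0 : 0 <= M `^ (alpha + 1) * (C * t `^ (1 - kap * (alpha + 1))).
  by rewrite !mulr_ge0 ?powR_ge0 ?(ltW C0).
move=> /(wnorm_lty_ae N0 q1 L0 (measurable_heat_time_integral mh')).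
apply: filterS => x fin.
have mx : measurable_fun [set: R] (fun s => heat (t - s) (nonlinearity alpha (u s)) x).
  by apply: (@measurableT_comp _ _ _ _ _ _ (fun z : R * Rn R N =>
    heat (t - z.1) (nonlinearity alpha (u z.1)) z.2) _ (fun s => (s, x))).
apply/integrableP; split; first exact/measurable_EFinP/measurable_funTS.
rewrite integral_itv_bndoo; last first.
  apply: measurableT_comp => //; exact/measurable_EFinP/measurable_funTS.
by move: fin; rewrite ge0_fin_numE// integral_ge0.
Qed.

End picard.

Section local_existence.
Context {R : realType} {N : nat}.
Local Notation mu := (@lebesgue_Rn R N).
Local Notation leb := (@lebesgue_measure R).
Implicit Types (alpha g k t : R) (q : \bar R) (u v : R -> Rn R N -> R).

(* With [nu (alpha + 1) = g] and [r = (alpha + 1) q], the nonlinearity maps [L^r_nu] to [L^q_g],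
   and the heat semigroup maps back with a factor [(t - s)^-a]. *)
Lemma duhamel_lipschitz alpha g q :
  let nu := g / (alpha + 1) in let r := ((alpha + 1)%:E * q)%E in
  let a := (g - nu) / 2 + N%:R / 2 * (fine q^-1%E - fine r^-1%E) in
  (0 < N)%N -> 0 < alpha -> 0 <= g < N%:R -> ((N%:R / (N%:R - g))%:E < q)%E ->
  a * (alpha + 1) < 1 ->
  exists2 C : R, 0 < C & forall t M B u v, 0 < t -> 0 < M -> 0 < B ->
  jointly_measurable u -> jointly_measurable v ->
  (forall s, 0 < s < t -> (wnorm nu r (EFin \o u s) <= (M * s `^ (- a))%:E)%E) ->
  (forall s, 0 < s < t -> (wnorm nu r (EFin \o v s) <= (M * s `^ (- a))%:E)%E) ->
  (forall s, 0 < s < t ->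
    (wnorm nu r (EFin \o (fun x => u s x - v s x)%R) <= (B * s `^ (- a))%:E)%E) ->
  (wnorm nu r (EFin \o (fun x => duhamel alpha u t x - duhamel alpha v t x)%R) <=
    (C * M `^ alpha * B * t `^ (1 - a * (alpha + 1)) * t `^ (- a))%:E)%E.
Proof.
move=> nu r a N0 al0 gN' qN a1; case/andP: (gN') => g0 gN.
have q1 : (1 <= q)%E by exact: gt1_exponent qN.
have al1 : 1 <= alpha + 1 by lra.
have al10 : 0 < alpha + 1 by lra.
have nug : 0 <= nu <= g.
  by rewrite /nu divr_ge0 ?(ltW al10)//= ler_pdivrMr// ler_peMr.
have a0 : 0 <= a by exact: smoothing_exponent_ge0.
have a01 : 0 <= a < 1.
  by rewrite a0 (le_lt_trans _ a1)// ler_peMr.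
have [C1 C10 H1] := wnorm_duhamel nug gN al1 qN.
have [C2 C20 H2] := @wnorm_nonlinearityB R N alpha g q al0 q1.
have [C3 C30 H3] := le_integral_beta_scale a01
  (introT andP (conj (mulr_ge0 a0 (ltW al10)) a1)).
exists (C1 * C2 * C3); first by rewrite !mulr_gt0.
move=> t M B u v t0 M0 B0 mu_ mv uM vM uvB.
have iu := duhamel_integrable N0 al0 gN' qN a0 a1 t0 M0 mu_ uM.
have iv := duhamel_integrable N0 al0 gN' qN a0 a1 t0 M0 mv vM.
have Ms0 s : 0 < s < t -> 0 < M * s `^ (- a).
  by move=> /andP[s0 _]; rewrite mulr_gt0// powR_gt0.
have Bs0 s : 0 < s < t -> 0 < B * s `^ (- a).
  by move=> /andP[s0 _]; rewrite mulr_gt0// powR_gt0.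
have mus s : measurable_fun [set: _] (u s) by exact: jointly_measurable_slice.
have mvs s : measurable_fun [set: _] (v s) by exact: jointly_measurable_slice.
have Foo (w : R -> Rn R N -> R) s x : 0 < s < t -> measurable_fun [set: _] (w s) ->
    (wnorm nu r (EFin \o w s) <= (M * s `^ (- a))%:E)%E ->
    (heat_abs (t - s) (EFin \o nonlinearity alpha (w s)) x < +oo)%E.
  move=> st mw wM; apply: (heat_abs_lty_norm _ gN' qN).
  - by case/andP: st; rewrite subr_gt0.
  - exact: measurable_nonlinearity.
  by apply: le_lt_trans (wnorm_nonlinearity al0 q1 (Ms0 _ st) mw wM) _; rewrite ltry.
pose phi s y := nonlinearity alpha (u s) y - nonlinearity alpha (v s) y.
pose m s := C2 * ((M * s `^ (- a)) `^ alpha * (B * s `^ (- a))).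
have phiE s x : 0 < s < t -> heat (t - s) (phi s) x =
    heat (t - s) (nonlinearity alpha (u s)) x - heat (t - s) (nonlinearity alpha (v s)) x.
  move=> st; rewrite heatB//; try exact: measurable_nonlinearity.
    by apply: Foo => //; exact: uM.
  by apply: Foo => //; exact: vM.
have mphi : measurable_fun (`]0, t[ `*` [set: Rn R N]) (fun z => heat (t - z.1) (phi z.1) z.2).
  have := measurable_funB (jointly_measurable_source alpha t mu_) (jointly_measurable_source alpha t mv).
  move=> /(measurable_funTS (D := `]0%R, t[ `*` [set: Rn R N])).
  apply: eq_measurable_fun => -[s x]; rewrite inE => -[/= + _].
  by rewrite in_itv/= => st; rewrite phiE.
apply: (H1 t _ m phi) => //.
- by rewrite !mulr_gt0 ?powR_gt0.
- apply: measurable_funM => //; apply: measurable_funM.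
    apply: (measurableT_comp (measurable_powR _)); apply: measurable_funM => //.
    by apply: (measurableT_comp (measurable_powR _)); exact: measurable_id.
  apply: measurable_funM => //.
  by apply: (measurableT_comp (measurable_powR _)); exact: measurable_id.
- by move=> s st; rewrite /m !mulr_gt0 ?powR_gt0 ?Ms0//; case/andP: st.
- by move=> s st; apply: measurable_funB; apply: measurable_nonlinearity.
- move=> s st; apply: H2 => //; [exact: Ms0|exact: Bs0|exact: uM|exact: vM|exact: uvB].
- by apply: measurable_funB; apply: (@jointly_measurable_slice R N (duhamel alpha _));
    exact: measurable_duhamel.
- apply: filterS2 iu iv => x iux ivx; apply: duhamel_difference => // s st.
    by apply: Foo => //; exact: uM.
  by apply: Foo => //; exact: vM.
pose c := C1 * C2 * M `^ alpha * B.
have c0 : 0 <= c by rewrite /c !mulr_ge0 ?powR_ge0 ?ltW.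
apply: (@le_trans _ _ (\int[leb]_(s in `]0%R, t[)
  (c * ((t - s) `^ (- a) * s `^ (- (a * (alpha + 1)))))%:E)%E).
  apply: le_integral_nonneg => s; rewrite /= in_itv/= => /andP[s0 st].
    by rewrite lee_fin /m !mulr_ge0 ?powR_ge0 ?ltW.
  rewrite lee_fin -/r -/nu -/a /m /c; apply: eqW.
  rewrite powRM ?powR_ge0 ?(ltW M0)// -powRrM.
  have -> : - (a * (alpha + 1)) = - a * alpha + - a by ring.
  by rewrite (gt0_powRD _ _ s0); ring.
apply: le_trans (H3 _ _ c0 t0) _; rewrite lee_fin /c.
have -> : 1 - a - a * (alpha + 1) = 1 - a * (alpha + 1) + - a by ring.
by rewrite (gt0_powRD _ _ t0); apply: eqW; ring.
Qed.

Fixpoint picard alpha (u0 : Rn R N -> R) n : R -> Rn R N -> R :=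
  if n is m.+1 then fun t x => heat t u0 x + duhamel alpha (picard alpha u0 m) t x
  else fun _ _ => 0.

Lemma picard_measurable alpha (u0 : Rn R N -> R) n : measurable_fun [set: _] u0 ->
  jointly_measurable (picard alpha u0 n).
Proof.
move=> m0; elim: n => [|n IH]; first exact: measurable_cst.
apply: measurable_funD; last exact: measurable_duhamel.
apply: (@measurable_heat_param _ _ _ (R * Rn R N)%type fst snd (fun _ => u0)) => //.
exact: (measurableT_comp m0).
Qed.

Lemma nonlinearity0 alpha : nonlinearity alpha (fun _ : Rn R N => 0 : R) = (fun _ => 0).
Proof. by apply/funext => x; rewrite /nonlinearity mulr0. Qed.

Lemma heat_cst0 t : heat t (fun _ : Rn R N => 0 : R) = (fun _ => 0).
Proof.
apply/funext => x; rewrite /heat; case: ifP => // _.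
by under eq_Rintegral do rewrite mulr0; rewrite Rintegral_cst// mul0r.
Qed.

Lemma duhamel_zero alpha t : duhamel alpha (fun _ _ => 0 : R) t = (fun _ : Rn R N => 0).
Proof.
apply/funext => x; rewrite /duhamel; under eq_Rintegral do rewrite nonlinearity0 heat_cst0.
by rewrite Rintegral_cst// mul0r.
Qed.

Lemma duhamel_time0 alpha u : duhamel alpha u 0 = (fun _ : Rn R N => 0).
Proof. by apply/funext => x; rewrite /duhamel set_itv1 Rintegral_set1. Qed.

Lemma wnorm_cst0 g q : (1 <= q)%E -> wnorm g q (EFin \o (fun _ : Rn R N => 0 : R)) = 0%E.
Proof.
move=> q1; rewrite -[RHS](@Lnorm0 _ _ _ mu q); last by rewrite gt_eqF// (lt_le_trans _ q1)// lte_fin.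
by congr (Lnorm mu q _); apply/funext => x; rewrite /= mule0.
Qed.


(** Picard iterates stay in the ball of radius [M = 2 C0 A], twice the bound of the free flow in the
    time-weighted norm, and their increments are halved at each step as soon as
    [Cd M ^ alpha T ^ (1 - b) <= 1/2]. This is a condition on [T ^ (1 - b) A ^ alpha] alone. *)
Lemma local_existence alpha g q :
  let nu := g / (alpha + 1) in let r := ((alpha + 1)%:E * q)%E in
  let a := (g - nu) / 2 + N%:R / 2 * (fine q^-1%E - fine r^-1%E) in
  (0 < N)%N -> 0 < alpha -> 0 <= g < N%:R -> ((N%:R / (N%:R - g))%:E < q)%E ->
  a * (alpha + 1) < 1 ->
  exists2 c : R, 0 < c & forall A T (u0 : Rn R N -> R), 0 < A -> 0 < T ->
  measurable_fun [set: _] u0 -> (wnorm g q (EFin \o u0) <= A%:E)%E ->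
  T `^ (1 - a * (alpha + 1)) * A `^ alpha <= c ->
  exists (u : R -> Rn R N -> R) (M : R), [/\ 0 < M, jointly_measurable u,
    forall t, 0 < t <= T -> (wnorm nu r (EFin \o u t) <= (M * t `^ (- a))%:E)%E
  & integral_equation alpha u0 `[0, T] u].
Proof.
move=> nu r a N0 al0 gN' qN a1; case/andP: (gN') => g0 gN.
have q1 : (1 <= q)%E by exact: gt1_exponent qN.
have al1 : 1 <= alpha + 1 by lra.
have al10 : 0 < alpha + 1 by lra.
have r1 : (1 <= r)%E by exact: ge1_mule.
have nug : 0 <= nu <= g.
  by rewrite /nu divr_ge0 ?(ltW al10)//= ler_pdivrMr// ler_peMr.
have a0 : 0 <= a by exact: smoothing_exponent_ge0.
have [C0 C00 H0] := wnorm_heat nug gN al1 qN.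
have [Cd Cd0 Hd] := @duhamel_lipschitz alpha g q N0 al0 gN' qN a1.
(* The value for which the smallness condition reads [Cd M ^ alpha T ^ (1 - b) <= 1/2] with
   [M = 2 C0 A]. *)
exists (2 * Cd * (2 * C0) `^ alpha)^-1; first by rewrite invr_gt0 !mulr_gt0 ?powR_gt0 ?mulr_gt0.
move=> A T u0 A0 T0 mu0 u0A small.
pose M := 2 * C0 * A; have M0 : 0 < M by rewrite !mulr_gt0.
have b0 : 0 <= 1 - a * (alpha + 1) by rewrite subr_ge0 ltW.
have smallt t : 0 < t <= T -> Cd * M `^ alpha * t `^ (1 - a * (alpha + 1)) <= 2^-1.
  move=> /andP[t0 tT].
  have tTb : t `^ (1 - a * (alpha + 1)) <= T `^ (1 - a * (alpha + 1)).
    by rewrite ge0_ler_powR ?nnegrE ?(ltW t0) ?(ltW T0).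
  have X0 : 0 < (2 * C0) `^ alpha by rewrite powR_gt0// mulr_gt0.
  rewrite /M powRM ?(ltW A0) ?mulr_ge0 ?(ltW C00)//.
  have : 2 * Cd * (2 * C0) `^ alpha * (T `^ (1 - a * (alpha + 1)) * A `^ alpha) <= 1.
    by rewrite -ler_pdivlMl ?mulr1// !mulr_gt0.
  have := ler_wpM2l (mulr_ge0 (ltW Cd0) (mulr_ge0 (ltW X0) (powR_ge0 A alpha))) tTb.
  lra.
have heatM t : 0 < t -> (wnorm nu r (EFin \o heat t u0) <= (2^-1 * M * t `^ (- a))%:E)%E.
  move=> t0; apply: le_trans (H0 t A u0 t0 A0 mu0 u0A) _.
  by rewrite lee_fin -/nu -/r -/a /M; apply: eqW; field.
clearbody M => {small}.
pose U := picard alpha u0.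
have US n t x : U n.+1 t x = heat t u0 x + duhamel alpha (U n) t x by [].
have mU n : jointly_measurable (U n) by exact: picard_measurable.
have U0 : U 0%N = (fun _ _ => 0) by [].
clearbody U.
have mUt n t : measurable_fun [set: _] (U n t) by exact: jointly_measurable_slice.
have mDu (w : R -> Rn R N -> R) t : jointly_measurable w ->
    measurable_fun [set: _] (duhamel alpha w t).
  by move=> mw; apply: (@jointly_measurable_slice R N (duhamel alpha w)); exact: measurable_duhamel.
have lt_le t s : t <= T -> 0 < s < t -> 0 < s <= T.
  by move=> tT /andP[-> st] /=; rewrite (le_trans (ltW st)).
have B1 n t : 0 < t <= T -> (wnorm nu r (EFin \o U n t) <= (M * t `^ (- a))%:E)%E.
  elim: n t => [|n IH] t tT.
    by rewrite U0 wnorm_cst0// lee_fin mulr_ge0 ?powR_ge0 ?ltW.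
  case/andP: (tT) => t0 tleT.
  have h0 : 0 <= 2^-1 * M * t `^ (- a) by rewrite !mulr_ge0 ?powR_ge0 ?invr_ge0 ?(ltW M0).
  have Dn : (wnorm nu r (EFin \o (fun x => duhamel alpha (U n) t x -
      duhamel alpha (U 0%N) t x)%R) <= (2^-1 * M * t `^ (- a))%:E)%E.
    apply: le_trans (Hd t M M (U n) (U 0%N) t0 M0 M0 (mU n) (mU 0%N) _ _ _) _.
    - by move=> s /(lt_le _ _ tleT); exact: IH.
    - by move=> s _; rewrite U0 wnorm_cst0// lee_fin mulr_ge0 ?powR_ge0 ?ltW.
    - move=> s /(lt_le _ _ tleT)/IH; congr (_ <= _)%E; congr (wnorm _ _ _).
      by apply/funext => x; rewrite /= U0 subr0.
    rewrite lee_fin ler_wpM2r ?powR_ge0//.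
    by have := ler_wpM2r (ltW M0) (smallt t tT); lra.
  rewrite (_ : M * t `^ (- a) = 2^-1 * M * t `^ (- a) + 2^-1 * M * t `^ (- a)); last by field.
  apply: (wnorm_le_add r1 h0 h0 _ _ _ (heatM t t0) Dn).
  - by apply/measurable_EFinP; exact: measurable_heat.
  - by apply/measurable_EFinP; apply: measurable_funB; [exact: (mDu (U n))|exact: (mDu (U 0%N))].
  by move=> x; rewrite !abse_EFin -EFinD lee_fin /= US U0 duhamel_zero subr0 ler_normD.
have B2 n t : 0 < t <= T ->
    (wnorm nu r (EFin \o (fun x => U n.+1 t x - U n t x)%R) <= (M * 2^-1 ^+ n * t `^ (- a))%:E)%E.
  elim: n t => [|n IH] t tT.
    have := B1 1%N t tT; rewrite expr0 mulr1; congr (_ <= _)%E; congr (wnorm _ _ _).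
    by apply/funext => x; rewrite /= U0 subr0.
  case/andP: (tT) => t0 tleT.
  have Mn0 : 0 < M * 2^-1 ^+ n by rewrite mulr_gt0 ?exprn_gt0 ?invr_gt0.
  have := Hd t M (M * 2^-1 ^+ n) (U n.+1) (U n) t0 M0 Mn0 (mU _) (mU _)
    (fun s st => B1 n.+1 s (lt_le t s tleT st)) (fun s st => B1 n s (lt_le t s tleT st))
    (fun s st => IH s (lt_le t s tleT st)).
  rewrite (_ : (fun x => U n.+2 t x - U n.+1 t x) =
    (fun x => duhamel alpha (U n.+1) t x - duhamel alpha (U n) t x)); last first.
    by apply/funext => x; rewrite !US opprD addrACA subrr add0r.
  move=> /le_trans; apply; rewrite lee_fin ler_wpM2r ?powR_ge0// exprS -/nu -/r -/a.
  by have := ler_wpM2r (ltW Mn0) (smallt t tT); lra.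
(* The upper limit is jointly measurable and defined everywhere; it is the limit wherever the
   increments are summable, that is, at almost every point for each positive time up to [T]. *)
pose u t x := fine (limn_esup (fun n => (U n t x)%:E)).
have mu_ : jointly_measurable u.
  apply: measurableT_comp => //; apply: measurable_fun_limn_esup => n.
  by apply/measurable_EFinP; exact: mU.
have mut t : measurable_fun [set: _] (u t) by exact: jointly_measurable_slice.
have uE t x l : U n t x @[n --> \oo] --> l -> u t x = l.
  move=> Ul; rewrite /u (_ : limn_esup _ = l%:E)//.
  rewrite limn_esup_lim; apply/cvg_lim => //.
  by apply: cvg_esups; apply: cvg_EFin => //; near=> n.
have B3 n t : 0 < t <= T ->
    (wnorm nu r (EFin \o (fun x => u t x - U n t x)%R) <= (2 * M * 2^-1 ^+ n * t `^ (- a))%:E)%E.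
  move=> tT; case/andP: (tT) => t0 tleT.
  pose S (k : nat) (x : Rn R N) : \bar R := (\sum_(j <oo) `|(U (k + j)%N.+1 t x - U (k + j)%N t x)%R|%:E)%E.
  have mD (k : nat) : measurable_fun [set: Rn R N] (fun x => `|U k.+1 t x - U k t x|%:E).
    by apply/measurable_EFinP; apply: measurableT_comp => //; exact: measurable_funB.
  have S0 (k : nat) x : (0 <= S k x)%E by apply: nneseries_ge0 => j _ _; rewrite lee_fin.
  have mS (k : nat) : measurable_fun [set: Rn R N] (S k).
    apply: (@ge0_emeasurable_sum _ _ _ setT (fun j x => `|(U (k + j)%N.+1 t x - U (k + j)%N t x)%R|%:E)%E xpredT) => //.
  have SL (k : nat) : (wnorm nu r (S k) <= (2 * M * 2^-1 ^+ k * t `^ (- a))%:E)%E.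
    apply: (@wnorm_nneseries _ _ _ _ (fun j x => `|(U (k + j)%N.+1 t x - U (k + j)%N t x)%R|%:E)
      (fun j => M * 2^-1 ^+ k * t `^ (- a) * 2^-1 ^+ j)) => //.
    - by move=> j; rewrite !mulr_gt0 ?powR_gt0 ?exprn_gt0 ?invr_gt0.
    - move=> j; have := B2 (k + j)%N t tT.
      rewrite exprD (_ : M * (2^-1 ^+ k * 2^-1 ^+ j) * t `^ (- a) =
         M * 2^-1 ^+ k * t `^ (- a) * 2^-1 ^+ j); last by ring.
      apply: le_trans; apply: le_wnorm => // x.
      by rewrite !abse_EFin normr_id.
    - by rewrite !mulr_gt0 ?powR_gt0 ?exprn_gt0 ?invr_gt0.
    rewrite (_ : 2 * M * 2^-1 ^+ k * t `^ (- a) = 2 * (M * 2^-1 ^+ k * t `^ (- a))); last by ring.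
    apply: nneseries_geometric_le.
    by rewrite !mulr_ge0 ?powR_ge0 ?exprn_ge0 ?invr_ge0 ?(ltW M0).
  apply: le_trans (SL n); apply: le_wnorm_ae => //.
    by apply/measurable_EFinP; exact: measurable_funB.
  have L0 : 0 <= 2 * M * 2^-1 ^+ 0 * t `^ (- a).
    by rewrite !mulr_ge0 ?powR_ge0 ?(ltW M0).
  apply: filterS (wnorm_lty_ae N0 r1 L0 (mS 0%N) (SL 0%N)) => x.
  rewrite ge0_fin_numE// => /cvg_summable_increments[l [Ul lU]].
  by rewrite abse_EFin (uE t x l Ul) [leRHS]gee0_abs//; exact: lU.
have uM t : 0 < t <= T -> (wnorm nu r (EFin \o u t) <= (2 * M * t `^ (- a))%:E)%E.
  move=> tT; have := B3 0%N t tT; rewrite expr0 mulr1; congr (_ <= _)%E; congr (wnorm _ _ _).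
  by apply/funext => x; rewrite /= U0 subr0.
have M20 : 0 < 2 * M by rewrite mulr_gt0.
exists u, (2 * M); split => // t; rewrite /= in_itv/= => /andP[].
rewrite le_eqVlt => /predU1P[<- _|t0 tT].
  apply: aeW => x; split.
  - by apply: aeW => s /andP[s0] /(lt_trans s0); rewrite ltxx.
  - rewrite set_itv1; apply/integrableP; split.
      exact: measurable_fun_set1.
    by rewrite integral_set1.
  (* At time 0 every iterate after the zeroth equals [u0], hence so does the limit. *)
  rewrite heat0 duhamel_time0 addr0; apply: uE.
  apply: cvg_near_cst; exists 1%N => // -[//|n] _.
  by rewrite US heat0 duhamel_time0 addr0.
have t0T : 0 < t <= T by rewrite t0.
have uMt s : 0 < s < t -> (wnorm nu r (EFin \o u s) <= (2 * M * s `^ (- a))%:E)%E.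
  by move=> /(lt_le _ _ tT); exact: uM.
have iu := duhamel_integrable N0 al0 gN' qN a0 a1 t0 M20 mu_ uMt.
(* The defect of the equation is compared with iterates [n] and [n + 1]: its norm is at most
   [W / 2 ^ n] for all [n], hence 0. *)
pose E x := u t x - (heat t u0 x + duhamel alpha u t x).
have mE : measurable_fun [set: Rn R N] E.
  apply: measurable_funB => //; apply: measurable_funD; last exact: mDu.
  exact: measurable_heat.
have E0 : (wnorm nu r (EFin \o E) <= 0)%E.
  pose W := M * t `^ (- a) + Cd * (2 * M) `^ alpha * (2 * M) * t `^ (1 - a * (alpha + 1)) * t `^ (- a).
  apply: (@lee0_geometric _ _ W) => n.
  have Mn0 : 0 < 2 * M * 2^-1 ^+ n by rewrite !mulr_gt0 ?exprn_gt0 ?invr_gt0.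
  have bM s : 0 < s < t -> (wnorm nu r (EFin \o U n s) <= (2 * M * s `^ (- a))%:E)%E.
    move=> /(lt_le _ _ tT)/(B1 n)/le_trans; apply; rewrite lee_fin ler_wpM2r ?powR_ge0//.
    by rewrite ler_peMl ?(ltW M0)// ler1n.
  have Dn := Hd t (2 * M) (2 * M * 2^-1 ^+ n) u (U n) t0 M20 Mn0 mu_ (mU n) uMt bM
    (fun s st => B3 n s (lt_le t s tT st)).
  have Un := B3 n.+1 t t0T.
  apply: le_trans (wnorm_le_add r1 _ _ _ _ _ Un Dn) _.
  - by rewrite !mulr_ge0 ?powR_ge0 ?exprn_ge0 ?invr_ge0 ?(ltW M0).
  - by rewrite !mulr_ge0 ?powR_ge0 ?exprn_ge0 ?invr_ge0 ?(ltW M0) ?(ltW Cd0).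
  - by apply/measurable_EFinP; exact: measurable_funB.
  - by apply/measurable_EFinP; apply: measurable_funB; exact: mDu.
  - move=> x; rewrite !abse_EFin -EFinD lee_fin.
    apply: le_trans (ler_normB _ _); apply: eqW; congr `|_|.
    have ringE (w h d d' : R) : w - (h + d) = w - (h + d') - (d - d') by ring.
    by rewrite /E US; exact: ringE.
  by rewrite lee_fin /W exprS; apply: eqW; field.
have mE' : measurable_fun [set: Rn R N] (EFin \o E) by exact/measurable_EFinP.
apply: filterS2 iu (wnorm_eq0 N0 r1 mE' E0) => x iux [Ex]; split => //.
- apply: aeW => s st; apply/heat_abs_integrableP.
    by apply: measurable_nonlinearity.
  apply: (heat_abs_lty_norm _ gN' qN).
  - by case/andP: st; rewrite subr_gt0.
  - exact: measurable_nonlinearity.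
  have s0 : 0 < 2 * M * s `^ (- a) by rewrite mulr_gt0 ?powR_gt0//; case/andP: st.
  by apply: le_lt_trans (wnorm_nonlinearity al0 q1 s0 (mut s) (uMt s st)) _; rewrite ltry.
by apply/eqP; rewrite -subr_eq0; apply/eqP.
Unshelve. all: by end_near. Qed.

End local_existence.

(** * Strong continuity of the semigroup at time 0 *)

Section strong_continuity.
Context {R : realType} {N : nat}.
Local Notation mu := (@lebesgue_Rn R N).
Implicit Types (g t p : R) (q : \bar R) (f h : Rn R N -> R) (x y : Rn R N) (A B : set (Rn R N)).

Lemma wnorm_dct g p (h : nat -> Rn R N -> R) (H : Rn R N -> R) :
  0 < p -> (forall n, measurable_fun [set: _] (h n)) -> measurable_fun [set: _] H ->
  (wnorm g p%:E (EFin \o H) < +oo)%E -> (forall n x, `|h n x| <= `|H x|) ->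
  {ae mu, forall x, h n x @[n --> \oo] --> (0 : R)} ->
  forall e, 0 < e -> exists n, (wnorm g p%:E (EFin \o h n) <= e%:E)%E.
Proof.
move=> p0 mh mH Hoo hH h0 e e0.
pose w x := euclidean_norm x `^ g.
have w0 x : 0 <= w x by exact: powR_ge0.
have E (f : Rn R N -> R) x : (((w x)%:E * `|(f x)%:E|) `^ p = ((w x * `|f x|) `^ p)%:E)%E.
  by rewrite abse_EFin -EFinM poweR_EFin.
have mw (f : Rn R N -> R) : measurable_fun [set: _] f ->
    measurable_fun [set: Rn R N] (fun x => ((w x * `|f x|) `^ p)%:E).
  move=> mf; apply/measurable_EFinP; apply: (measurableT_comp (measurable_powR _)).
  apply: measurable_funM; last exact: measurableT_comp.
  by apply/measurable_EFinP; exact: measurable_weight.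
set L := fine (wnorm g p%:E (EFin \o H)).
have L0 : 0 <= L by rewrite fine_ge0// wnorm_ge0.
have LE : (wnorm g p%:E (EFin \o H) <= L%:E)%E by rewrite fineK// ge0_fin_numE ?wnorm_ge0.
have iH : mu.-integrable setT (fun x => ((w x * `|H x|) `^ p)%:E).
  apply/integrableP; split; first exact: mw.
  move/(wnorm_finP _ _ p0 L0) : LE => LE.
  apply: le_lt_trans (_ : (L `^ p)%:E < +oo)%E; last by rewrite ltry.
  apply: le_trans LE; apply: le_integral_nonneg => x _; first exact: abse_ge0.
  by rewrite E abse_EFin ger0_norm ?powR_ge0.
have [] := @dominated_convergence _ _ _ mu setT measurableT
  (fun n x => ((w x * `|h n x|) `^ p)%:E) (fun=> 0%E) (fun x => ((w x * `|H x|) `^ p)%:E).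
- by move=> n; exact: mw.
- exact: measurable_cst.
- apply: filterS h0 => x hx _; apply: cvg_EFin; first by near=> n.
  apply/cvgrPdist_le => d d0.
  have dp : 0 < d `^ p^-1 by exact: powR_gt0.
  have : w x * `|h n x| @[n --> \oo] --> (0 : R).
    rewrite -(mulr0 (w x)); apply: cvgM; first exact: cvg_cst.
    by rewrite -(normr0 R); exact: cvg_norm.
  move=> /cvgrPdist_le/(_ _ dp); apply: filterS => n.
  rewrite !sub0r !normrN => hn.
  rewrite ger0_norm ?powR_ge0//.
  rewrite -[leRHS](powRr1 (ltW d0)) -(mulVf (lt0r_neq0 p0)) powRrM.
  rewrite ge0_ler_powR ?nnegrE ?(ltW p0) ?mulr_ge0 ?powR_ge0//.
  exact: le_trans (ler_norm _) hn.
- exact: iH.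
- apply: aeW => n x _; rewrite abse_EFin lee_fin ger0_norm ?powR_ge0//.
  by rewrite ge0_ler_powR ?nnegrE ?(ltW p0) ?mulr_ge0 ?powR_ge0// ler_wpM2l.
move=> _ _; rewrite integral0 => /fine_cvgP[fin /cvgrPdist_le/(_ _ (powR_gt0 p e0)) le].
have [n [fn len]] : exists n, (\int[mu]_x ((w x * `|h n x|) `^ p)%:E)%E \is a fin_num /\
    `|0 - fine (\int[mu]_x ((w x * `|h n x|) `^ p)%:E)%E| <= e `^ p.
  have [n _ Hn] := filterI fin le.
  by exists n; have [] := Hn n (leqnn n).
exists n; apply/(wnorm_finP _ _ p0 (ltW e0)).
under eq_integral do rewrite E.
rewrite -(fineK fn) lee_fin; apply: le_trans len.
by rewrite sub0r normrN ler_norm.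
Unshelve. all: by end_near. Qed.

Lemma wnormZ_le g q M c (f : Rn R N -> R) : (1 <= q)%E -> 0 <= M -> measurable_fun [set: _] f ->
  (wnorm g q (EFin \o f) <= M%:E)%E ->
  (wnorm g q (EFin \o (fun x => c * f x)%R) <= ((`|c| + 1) * M)%:E)%E.
Proof.
move=> q1 M0 mf fM.
have c0 : 0 < `|c| + 1 by rewrite ltr_wpDl.
have mf' : measurable_fun [set: Rn R N] (EFin \o f) by exact/measurable_EFinP.
apply: le_trans (wnormZ q1 c0 M0 mf' fM); apply: le_wnorm => // x.
rewrite !abse_EFin lee_fin !normrM ler_wpM2r// [leRHS]ger0_norm ?lerDl// ltW//.
Qed.

Definition heat_cvg0 g q f := [/\ measurable_fun [set: _] f, (wnorm g q (EFin \o f) < +oo)%E &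
  forall e, 0 < e -> exists2 d, 0 < d & forall t, 0 < t < d ->
    (wnorm g q (EFin \o (fun x => heat t f x - f x)%R) <= e%:E)%E].

Lemma wnorm_lty_bound g q f : (wnorm g q (EFin \o f) < +oo)%E ->
  exists2 M, 0 < M & (wnorm g q (EFin \o f) <= M%:E)%E.
Proof.
move=> foo; have M0 : 0 <= fine (wnorm g q (EFin \o f)) by rewrite fine_ge0// wnorm_ge0.
exists (fine (wnorm g q (EFin \o f)) + 1); first by rewrite ltr_wpDl.
apply: (@le_trans _ _ (fine (wnorm g q (EFin \o f)))%:E).
  by rewrite fineK// ge0_fin_numE ?wnorm_ge0.
by rewrite lee_fin lerDl.
Qed.

Lemma heatZ t c f x : measurable_fun [set: _] f ->
  (heat_abs t (EFin \o f) x < +oo)%E -> heat t (fun y => c * f y) x = c * heat t f x.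
Proof.
move=> mf /heat_abs_integrableP-/(_ mf) fi; rewrite /heat; case: ifP => // _.
by under eq_Rintegral do rewrite mulrCA; rewrite RintegralZl.
Qed.

(** The form [f - c h] covers all linear combinations at once: sums, complements of sets in a box,
    and the difference of positive and negative parts. *)
Lemma heat_cvg0B g q f h c : 0 <= g < N%:R -> ((N%:R / (N%:R - g))%:E < q)%E ->
  heat_cvg0 g q f -> heat_cvg0 g q h -> heat_cvg0 g q (fun x => f x - c * h x).
Proof.
move=> gN qN [mf foo gf] [mh hoo gh].
have q1 : (1 <= q)%E by case/andP: gN => g0 gN; exact: gt1_exponent qN.
have [Mf Mf0 fM] := wnorm_lty_bound foo; have [Mh Mh0 hM] := wnorm_lty_bound hoo.
have mch : measurable_fun [set: Rn R N] (fun x => c * h x) by exact: measurable_funM.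
have c0 : 0 < `|c| + 1 by rewrite ltr_wpDl.
have chM := wnormZ_le c q1 (ltW Mh0) mh hM.
split; first exact: measurable_funB.
  have ch0 : 0 <= (`|c| + 1) * Mh by rewrite mulr_ge0// ltW.
  apply: le_lt_trans (wnorm_le_add q1 (ltW Mf0) ch0 _ _ _ fM chM) (ltry _).
  - exact/measurable_EFinP.
  - exact/measurable_EFinP.
  - by move=> x; rewrite !abse_EFin -EFinD lee_fin ler_normB.
move=> e e0; have e20 : 0 < e / 2 by rewrite divr_gt0.
have ec0 : 0 < e / 2 / (`|c| + 1) by rewrite divr_gt0.
have [df df0 Hf] := gf _ e20; have [dh dh0 Hh] := gh _ ec0.
exists (Num.min df dh); first by rewrite lt_min df0.
move=> t /andP[t0]; rewrite lt_min => /andP[tf th].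
have mDh : measurable_fun [set: Rn R N] (fun x => heat t h x - h x).
  by apply: measurable_funB => //; exact: measurable_heat.
have Hf' := Hf t (introT andP (conj t0 tf)).
have := wnormZ_le c q1 (ltW ec0) mDh (Hh t (introT andP (conj t0 th))).
rewrite mulrC divfK ?gt_eqF// => Hh'.
rewrite [e]splitr; apply: (wnorm_le_add q1 (ltW e20) (ltW e20) _ _ _ Hf' Hh').
- by apply/measurable_EFinP; apply: measurable_funB => //; exact: measurable_heat.
- by apply/measurable_EFinP; exact: measurable_funM.
move=> x; rewrite !abse_EFin -EFinD lee_fin -heatB//; last 2 first.
- exact: (heat_abs_lty_norm _ gN qN).
- by apply: (heat_abs_lty_norm _ gN qN) => //; exact: le_lt_trans chM (ltry _).
rewrite heatZ//; last exact: (heat_abs_lty_norm _ gN qN).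
apply: le_trans (ler_normB _ _); apply: eqW; congr `|_|.
by ring.
Qed.

(** The flow is bounded on [L^q_g] uniformly in time, so convergence passes from approximants to
    their limits. *)
Lemma heat_cvg0_closed g q f : 0 <= g < N%:R -> ((N%:R / (N%:R - g))%:E < q)%E ->
  measurable_fun [set: _] f -> (wnorm g q (EFin \o f) < +oo)%E ->
  (forall e, 0 < e -> exists2 h, heat_cvg0 g q h &
    (wnorm g q (EFin \o (fun x => f x - h x)%R) <= e%:E)%E) -> heat_cvg0 g q f.
Proof.
move=> gN qN mf foo H; case/andP: (gN) => g0 gN'.
have q1 : (1 <= q)%E by exact: gt1_exponent qN.
have gg : 0 <= g <= g by rewrite g0 lexx.
have [C C0 HC] := wnorm_heat gg gN' (lexx 1) qN.
split => // e e0.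
(* Three errors: the flow of [f - h] costs [C], the convergence for [h] and the difference [f - h]
   cost 1 each. *)
have e'0 : 0 < e / (C + 2) by rewrite divr_gt0// addr_gt0.
have [h [mh hoo gh] fh] := H _ e'0; have [d d0 Hd] := gh _ e'0.
exists d => // t td; case/andP: (td) => t0 _.
have mfh : measurable_fun [set: Rn R N] (fun x => f x - h x) by exact: measurable_funB.
have := HC t _ _ t0 e'0 mfh fh; rewrite mul1e !subrr mulr0 mul0r addr0 oppr0 powRr0 mulr1 => H1.
have CE : e = C * (e / (C + 2)) + (e / (C + 2) + e / (C + 2)).
  by field; rewrite gt_eqF// addr_gt0.
rewrite [X in (_ <= X%:E)%E]CE.
have mk (k : Rn R N -> R) : measurable_fun [set: _] k -> measurable_fun [set: Rn R N] (fun x => heat t k x - k x).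
  by move=> mk; apply: measurable_funB => //; exact: measurable_heat.
have H2 : (wnorm g q (EFin \o (fun x => (heat t h x - h x) - (f x - h x))%R) <=
    (e / (C + 2) + e / (C + 2))%:E)%E.
  apply: (wnorm_le_add q1 (ltW e'0) (ltW e'0) _ _ _ (Hd t td) fh).
  - by apply/measurable_EFinP; exact: mk.
  - exact/measurable_EFinP.
  by move=> x; rewrite !abse_EFin -EFinD lee_fin ler_normB.
apply: (wnorm_le_add q1 _ _ _ _ _ H1 H2).
- by rewrite mulr_ge0 ?ltW.
- by rewrite addr_ge0 ?ltW.
- by apply/measurable_EFinP; exact: measurable_heat.
- by apply/measurable_EFinP; apply: measurable_funB => //; exact: mk.
move=> x; rewrite !abse_EFin -EFinD lee_fin -heatB//; last 2 first.
- exact: (heat_abs_lty_norm _ gN qN).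
- exact: (heat_abs_lty_norm _ gN qN).
apply: le_trans (ler_normD _ _); apply: eqW; congr `|_|; ring.
Qed.


Lemma sqdist_heat_kernel t x y : 0 < t ->
  sqdist x y * heat_kernel t x y <= 8 * 2 `^ (N%:R / 2) * t * heat_kernel (2 * t) x y.
Proof.
move=> t0; have := @powR_sqdist_heat_kernel R N t 2 x y t0 (ler0n _ _).
by rewrite divff ?pnatr_eq0// mulr1 !powRr1 ?sqdist_ge0// ltW.
Qed.

Lemma heat_cst t c x : 0 < t -> heat t (fun _ : Rn R N => c) x = c.
Proof.
move=> t0; rewrite /heat gt_eqF//.
have mk : measurable_fun [set: Rn R N] (fun y => heat_kernel t x y).
  by have := @measurable_kernel R N t x => /measurable_EFinP.
have ik : mu.-integrable setT (EFin \o (fun y => heat_kernel t x y)).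
  apply/integrableP; split; first exact/measurable_EFinP.
  under eq_integral do rewrite abse_EFin ger0_norm ?heat_kernel_ge0//.
  by rewrite integral_heat_kernel ?ltry.
rewrite RintegralZr// /Rintegral integral_heat_kernel//= mul1r//.
Qed.

(* Almost every point is at positive distance from [A] or from its complement. These sets form
   a pi-system generating the Borel sets, so that convergence to the initial value extends
   from their indicators to all of [L^p_g]. *)
Definition continuity_set A := measurable A /\
  {ae mu, forall x, exists2 d, 0 < d & forall y, sqdist x y < d -> (A x <-> A y)}.

Lemma continuity_setI A B : continuity_set A -> continuity_set B -> continuity_set (A `&` B).
Proof.
move=> [mA cA] [mB cB]; split; first exact: measurableI.
apply: filterS2 cA cB => x [d d0 dA] [e e0 eB]; exists (Num.min d e); first by rewrite lt_min d0.
by move=> y; rewrite lt_min => /andP[/dA [? ?] /eB [? ?]]; split => -[] ? ?; split; auto.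
Qed.

Lemma continuity_setC A : continuity_set A -> continuity_set (~` A).
Proof.
move=> [mA cA]; split; first exact: measurableC.
apply: filterS cA => x [d d0 dA]; exists d => // y /dA [? ?].
by split => /= H1 H2; apply: H1; auto.
Qed.

Lemma continuity_setT : continuity_set setT.
Proof. by split => //; apply: aeW => x; exists 1. Qed.

Lemma continuity_half_space (i : 'I_N) (c : R) : continuity_set [set x | c < tnth x i].
Proof.
split.
  rewrite (_ : [set x | _] = setT `&` (@tnth N _)^~ i @^-1` `]c, +oo[%classic).
    exact: measurable_tnth.
  by rewrite setTI; apply/seteqP; split => x /=; rewrite in_itv/= andbT.
have [B [mB B0 sB]] := @hyperplane_negligible R N i c.
exists B; split => //; apply: subset_trans sB => x /= H; apply: contrapT => xc; apply: H.
have xc0 : 0 < ((tnth x i : R) - c) ^+ 2.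
  by rewrite lt_neqAle sqr_ge0 andbT eq_sym sqrf_eq0 subr_eq0; apply/eqP.
exists (((tnth x i : R) - c) ^+ 2) => // y xy.
have : ((tnth x i : R) - tnth y i) ^+ 2 < ((tnth x i : R) - c) ^+ 2.
  apply: le_lt_trans xy; rewrite /sqdist (bigD1 i)//= lerDl.
  by apply: sumr_ge0 => j _; exact: sqr_ge0.
suff HH (u v : R) : (u - v) ^+ 2 < (u - c) ^+ 2 -> (c < u <-> c < v) by exact: HH.
by move=> uv; split; nra.
Qed.

Lemma measurable_continuity_setE : @measurable _ (Rn R N) = <<s continuity_set >>.
Proof.
apply/seteqP; split; last first.
  by apply: smallest_sub; [exact: sigma_algebra_measurable|move=> A []].
apply: smallest_sub; first exact: smallest_sigma_algebra.
elim/big_ind : _ => [|A B sA sB|i _]; [by []|by move=> x [/sA|/sB]|].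
have mi : measurable_fun [set: g_sigma_algebraType continuity_set]
    ((fun x => tnth x i) : g_sigma_algebraType continuity_set -> measurableTypeR R).
  apply: (measurability _ (RGenOInfty.measurableE R)) => _ [_ [c ->] <-].
  apply: sub_sigma_algebra; have := continuity_half_space i c; congr continuity_set.
  by rewrite setTI; apply/seteqP; split => x /=; rewrite in_itv/= andbT.
by move=> _ [B mB <-]; exact: mi.
Qed.

(** The half-open cube, written with negated strict inequalities so that it is a finite intersection
    of open half-spaces and of complements of such. *)
Definition box (k : R) : set (Rn R N) := [set x | forall i, - k < (tnth x i : R) /\ ~ k < (tnth x i : R)].

Lemma continuity_box k : continuity_set (box k).
Proof.
have -> : box k = \big[setI/setT]_(i < N)
    ([set x | - k < (tnth x i : R)] `&` ~` [set x | k < (tnth x i : R)]).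
  apply/seteqP; split => x.
    by move=> H; elim/big_ind : _ => // i _; exact: (H i).
  move=> H i; rewrite (bigD1 i)//= in H; by case: H.
elim/big_ind : _ => [|A B|i _]; [exact: continuity_setT|exact: continuity_setI|].
apply: continuity_setI; first exact: continuity_half_space.
by apply: continuity_setC; exact: continuity_half_space.
Qed.

Lemma sqdist_box k x y : ~ box (k + 1) x -> box k y -> 1 <= sqdist x y.
Proof.
move=> /existsNP[i Hx] /(_ i) Hy.
suff : 1 <= ((tnth x i : R) - tnth y i) ^+ 2.
  move/le_trans; apply; rewrite /sqdist (bigD1 i)//= lerDl.
  by apply: sumr_ge0 => j _; exact: sqr_ge0.
move: Hx Hy; set u : R := tnth x i; set v : R := tnth y i => Hx [v1 v2].
have {}v2 : v <= k by rewrite leNgt; apply/negP.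
have [u1|u1] := leP u (- (k + 1)); first by nra.
have u2 : k + 1 < u by apply: contrapT => u2; apply: Hx.
nra.
Qed.

Lemma wnorm_box_lty g p k : 0 < p -> 0 <= g -> 0 < k -> (wnorm g p%:E (EFin \o \1_(box k)) < +oo)%E.
Proof.
move=> p0 g0 k0; have [mB _] := continuity_box k.
pose c := ((N%:R * k ^+ 2) `^ (g / 2)) `^ p; have c0 : 0 <= c by exact: powR_ge0.
have Bfin : (mu (box k) < +oo)%E.
  have -> : box k = [set x | forall i, [set` `]- k, k]] (tnth x i : R)].
    apply/seteqP; split => x /= H i; have := H i; rewrite in_itv/=.
      by move=> [-> /negP]; rewrite -leNgt.
    by move=> /andP[-> ?]; split => //; apply/negP; rewrite -leNgt.
  rewrite (lebesgue_Rn_box (A := fun i => [set` `]- k, k]]))//.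
  rewrite -ge0_fin_numE; last first.
    elim/big_ind : _ => [|a b a0 b0|i _]; [exact: lee01|exact: mule_ge0|exact: measure_ge0].
  elim/big_ind : _ => [|a b a0 b0|i _]; [by []|exact: fin_numM|].
  by rewrite lebesgue_measure_itv/= lte_fin; case: ifP.
set m := fine (mu (box k)).
have mE : mu (box k) = m%:E by rewrite fineK// ge0_fin_numE.
have m0 : 0 <= m by rewrite fine_ge0.
have M0 : 0 <= (c * m) `^ p^-1 by exact: powR_ge0.
suff : (wnorm g p%:E (EFin \o \1_(box k)) <= ((c * m) `^ p^-1)%:E)%E.
  by move/le_lt_trans; apply; rewrite ltry.
apply/(wnorm_finP _ _ p0 M0).
rewrite -powRrM mulVf ?gt_eqF// powRr1 ?mulr_ge0// EFinM -mE.
rewrite -[X in (_ * mu X)%E]setIT -integral_indic// -ge0_integralZl_EFin//.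
apply: le_integral_nonneg => x _; first exact: poweR_ge0.
rewrite /= indicE; case: (boolP (x \in box k)) => [/set_mem xB|_]; last first.
  by rewrite normr0 mulr0 mule0 powR0// gt_eqF.
rewrite normr1 mule1 mulr1 lee_fin.
rewrite ge0_ler_powR ?nnegrE ?powR_ge0 ?(ltW p0)//.
rewrite euclidean_normE ge0_ler_powR ?nnegrE ?divr_ge0//.
- by apply: sumr_ge0 => i _; exact: sqr_ge0.
- by rewrite mulr_ge0 ?sqr_ge0.
rewrite (_ : N%:R * k ^+ 2 = \sum_(i < N) k ^+ 2); last by rewrite sumr_const card_ord mulr_natl.
apply: ler_sum => i _; have [h1 h2] := xB i.
move: h1 h2; set v : R := tnth x i => h1 /negP; rewrite -leNgt => h2; nra.
apply/measurable_EFinP; exact: measurable_indic.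
Qed.

(** A Chebyshev estimate: the indicator is constant within squared distance [d] of [x], and beyond
    it the kernel is at most [sqdist / d] times itself, which costs [t / d] and a doubled time. *)
Lemma heat_indic_cvg A : continuity_set A -> {ae mu, forall x,
  exists2 c, 0 < c & forall t, 0 < t -> `|heat t \1_A x - \1_A x| <= c * t}.
Proof.
move=> [mA]; apply: filterS => x [d d0 dA].
have T0 : 0 < 2 `^ (N%:R / 2) :> R by exact: powR_gt0.
exists (8 * 2 `^ (N%:R / 2) / d); first by rewrite !mulr_gt0 ?invr_gt0.
move=> t t0.
have m1 : measurable_fun [set: Rn R N] (\1_A : Rn R N -> R) by exact: measurable_indic.
have bound (f : Rn R N -> R) : measurable_fun [set: _] f -> (forall y, `|f y| <= 1) ->
    (heat_abs t (EFin \o f) x < +oo)%E.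
  move=> mf f1; apply: le_lt_trans (_ : 1 < +oo)%E; last by rewrite ltry.
  rewrite -(integral_heat_kernel x t0); apply: le_integral_nonneg => y _.
    by rewrite mule_ge0 ?abse_ge0// lee_fin heat_kernel_ge0.
  by rewrite abse_EFin -EFinM lee_fin ler_piMr ?heat_kernel_ge0.
have b1 y : `|\1_A y : R| <= 1.
  by rewrite indicE; case: (_ \in _); rewrite ?normr1 ?normr0.
have bc y : `|(fun _ : Rn R N => \1_A x : R) y| <= 1 by exact: b1.
have mc : measurable_fun [set: Rn R N] (fun _ : Rn R N => \1_A x : R) by exact: measurable_cst.
rewrite -(heat_cst (\1_A x) x t0) heatB//; try exact: bound.
have mfc : measurable_fun [set: Rn R N] (fun y => \1_A y - \1_A x : R) by exact: measurable_funB.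
have ct0 : 0 <= 8 * 2 `^ (N%:R / 2) / d * t.
  by rewrite !mulr_ge0 ?invr_ge0 ?(ltW T0) ?(ltW d0) ?(ltW t0).
rewrite -lee_fin; apply: le_trans (heat_le_abs _ _ mfc) _; first by rewrite gt_eqF.
apply: (@le_trans _ _ (\int[mu]_y ((8 * 2 `^ (N%:R / 2) / d * t)%:E * (heat_kernel (2 * t) x y)%:E))%E).
  apply: le_integral_nonneg => y _.
    by rewrite mule_ge0 ?abse_ge0// lee_fin heat_kernel_ge0.
  rewrite abse_EFin -!EFinM lee_fin.
  have K0 := heat_kernel_ge0 t x y; have K20 := heat_kernel_ge0 (2 * t) x y.
  have R0 : 0 <= 8 * 2 `^ (N%:R / 2) / d * t * heat_kernel (2 * t) x y.
    exact: mulr_ge0 ct0 K20.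
  have [xy|xy] := ltP (sqdist x y) d.
    have -> : \1_A y = \1_A x :> R.
      have [H1 H2] := dA y xy; rewrite !indicE; congr (nat_of_bool _)%:R.
      by apply/idP/idP => /set_mem H; apply/mem_set; auto.
    by rewrite subrr normr0 mulr0.
  apply: (@le_trans _ _ (heat_kernel t x y * (sqdist x y / d))).
    rewrite ler_wpM2l//; apply: (@le_trans _ _ 1); last by rewrite ler_pdivlMr// mul1r.
    rewrite !indicE; case: (_ \in _); case: (_ \in _); rewrite ?subrr ?subr0 ?sub0r ?normrN ?normr0 ?normr1//.
  have dV0 : 0 <= d^-1 by rewrite invr_ge0 ltW.
  have := ler_wpM2r dV0 (sqdist_heat_kernel x y t0).
  have ringE (a b c K2 K e : R) : a * K * e <= c * b * K2 * e -> K * (a * e) <= c * e * b * K2.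
    have -> : K * (a * e) = a * K * e by ring.
    by have -> : c * e * b * K2 = c * b * K2 * e by ring.
  exact: (ringE (sqdist x y) t (8 * 2 `^ (N%:R / 2)) (heat_kernel (2 * t) x y) (heat_kernel t x y) d^-1).
rewrite ge0_integralZl_EFin//.
- by rewrite integral_heat_kernel ?mulr_gt0// mule1.
- by move=> y _; rewrite lee_fin heat_kernel_ge0.
- by apply: measurable_kernel.
Qed.

Lemma le_wnorm_indic g q A B : (1 <= q)%E -> A `<=` B ->
  (wnorm g q (EFin \o \1_A) <= wnorm g q (EFin \o \1_B))%E.
Proof.
move=> q1 AB; apply: le_wnorm => // x; rewrite !abse_EFin lee_fin !indicE.
case: (boolP (x \in A)) => [/set_mem/AB/mem_set -> //|_].
by rewrite normr0.
Qed.

(** On a box larger by 1, dominated convergence applies. Outside that box, points are at squared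
    distance at least 1 from [A], so the flow of the indicator at time [t] is at most a constant
    times [t] times the flow at time [2 t], which is bounded in norm. *)
Lemma heat_cvg0_indic g p A k : 0 <= g < N%:R -> ((N%:R / (N%:R - g))%:E < p%:E)%E -> 0 < k ->
  continuity_set A -> A `<=` box k -> heat_cvg0 g p%:E \1_A.
Proof.
move=> gN qN k0 cA Ak; case/andP: (gN) => g0 gN'.
have q1 : (1 <= p%:E)%E by exact: gt1_exponent qN.
have p0 : 0 < p by move: q1; rewrite lee_fin; exact: lt_le_trans.
have mA : measurable A by case: cA.
have m1 : measurable_fun [set: Rn R N] (\1_A : Rn R N -> R) by exact: measurable_indic.
have Aoo : (wnorm g p%:E (EFin \o \1_A) < +oo)%E.
  exact: le_lt_trans (le_wnorm_indic g q1 Ak) (wnorm_box_lty p0 g0 k0).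
split => // e e0.
(* Dominated convergence works along sequences, so a failure is used to choose times [t n] tending
   to 0. *)
apply: contrapT => H.
have {}H d : 0 < d -> exists t, 0 < t < d /\
    ~ (wnorm g p%:E (EFin \o (fun x => heat t \1_A x - \1_A x)%R) <= e%:E)%E.
  move=> d0; apply: contrapT => /forallNP H'; apply: H; exists d => // t td.
  by apply: contrapT => H2; apply: (H' t).
have gg : 0 <= g <= g by rewrite g0 lexx.
have [C C0 HC] := wnorm_heat gg gN' (lexx 1) qN.
have [M M0 AM] := wnorm_lty_bound Aoo.
pose c := 8 * 2 `^ (N%:R / 2) : R; have c0 : 0 < c by rewrite mulr_gt0 ?powR_gt0.
have e20 : 0 < e / 2 by rewrite divr_gt0.
pose d0 := e / 2 / ((c + 1) * (C * M)).
have d00 : 0 < d0 by rewrite divr_gt0// !mulr_gt0// addr_gt0.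
have dn0 n : 0 < Num.min (n.+1%:R^-1) d0 by rewrite lt_min invr_gt0 ltr0n.
pose t n := projT1 (cid (H _ (dn0 n))).
have tP n : 0 < t n < Num.min (n.+1%:R^-1) d0 /\
    ~ (wnorm g p%:E (EFin \o (fun x => heat (t n) \1_A x - \1_A x)%R) <= e%:E)%E.
  by rewrite /t; case: cid.
pose h n x : R := \1_(box (k + 1)) x * (heat (t n) \1_A x - \1_A x).
have [mB _] := continuity_box (k + 1).
have mh0 n : measurable_fun [set: Rn R N] (fun x => heat (t n) \1_A x - \1_A x : R).
  by apply: measurable_funB => //; exact: measurable_heat.
have mh n : measurable_fun [set: Rn R N] (h n).
  by apply: measurable_funM => //; exact: measurable_indic.
have t0 n : 0 < t n by have [/andP[]] := tP n.
have mH : measurable_fun [set: Rn R N] (fun x => 2 * \1_(box (k + 1)) x : R).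
  by apply: measurable_funM => //; exact: measurable_indic.
have k10 : 0 < k + 1 by rewrite addr_gt0.
have Hoo : (wnorm g p%:E (EFin \o (fun x => 2 * \1_(box (k + 1)) x)%R) < +oo)%E.
  have [L L0 BL] := wnorm_lty_bound (wnorm_box_lty p0 g0 k10).
  apply: le_lt_trans (wnormZ_le 2 q1 (ltW L0) _ BL) (ltry _).
  exact: measurable_indic.
have hH n x : `|h n x| <= `|2 * \1_(box (k + 1)) x|.
  rewrite /h mulrC normrM [leRHS]normrM ler_wpM2r//.
  apply: le_trans (ler_normB _ _) _; rewrite ger0_norm// (_ : 2 = 1 + 1)//; apply: lerD.
    rewrite -lee_fin; apply: le_trans (heat_le_abs _ _ m1) _; first by rewrite gt_eqF.
    rewrite -(integral_heat_kernel x (t0 n)); apply: le_integral_nonneg => y _.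
      by rewrite mule_ge0 ?abse_ge0// lee_fin heat_kernel_ge0.
    rewrite abse_EFin -EFinM lee_fin ler_piMr ?heat_kernel_ge0//.
    by rewrite indicE; case: (_ \in _); rewrite ?normr1 ?normr0.
  by rewrite indicE; case: (_ \in _); rewrite ?normr1 ?normr0.
have h0 : {ae mu, forall x, h n x @[n --> \oo] --> (0 : R)}.
  apply: filterS (heat_indic_cvg cA) => x [a a0 Ha].
  apply/cvgrPdist_le => d d0'.
  have ad0 : 0 < d / a by rewrite divr_gt0.
  near=> n.
  rewrite sub0r normrN /h normrM; apply: (@le_trans _ _ (1 * (a * t n))).
    apply: ler_pM => //; last exact: Ha.
    by rewrite indicE; case: (_ \in _); rewrite ?normr1 ?normr0.
  rewrite mul1r -ler_pdivlMl// mulrC.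
  have [/andP[_ +] _] := tP n; rewrite lt_min => /andP[/ltW tn _]; apply: le_trans tn _.
  by apply: ltW; near: n; exact: (near_infty_natSinv_lt (PosNum ad0)).
have [n hn] := wnorm_dct p0 mh mH Hoo hH h0 e20.
have [/andP[_]] := tP n; rewrite lt_min => /andP[_ td] []; move: td => td.
have t20 : 0 < 2 * t n by rewrite mulr_gt0.
have := HC (2 * t n) M _ t20 M0 m1 AM; rewrite mul1e !subrr mulr0 mul0r addr0 oppr0 powRr0 mulr1 => H2M.
have m2 : measurable_fun [set: Rn R N] (heat (2 * t n) \1_A) by exact: measurable_heat.
have CM0 : 0 < C * M by rewrite mulr_gt0.
have m2' : measurable_fun [set: Rn R N] (EFin \o heat (2 * t n) \1_A) by exact/measurable_EFinP.
have ct0 : 0 < c * t n by rewrite mulr_gt0.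
have H2' : (wnorm g p%:E (EFin \o (fun x => c * t n * heat (2 * t n) \1_A x)%R) <= (e / 2)%:E)%E.
  apply: le_trans (wnormZ q1 ct0 (ltW CM0) m2' H2M) _; rewrite lee_fin.
  move: td; rewrite /d0 ltr_pdivlMr ?mulr_gt0// ?addr_gt0// => td.
  apply/ltW/(le_lt_trans _ td).
  have := mulr_gt0 (t0 n) CM0; set z := C * M; lra.
rewrite [e]splitr; apply: (wnorm_le_add q1 (ltW e20) (ltW e20) _ _ _ hn H2').
- exact/measurable_EFinP.
- by apply/measurable_EFinP; exact: measurable_funM.
move=> x; rewrite !abse_EFin -EFinD lee_fin /h [\1_(box _) x]indicE.
case: (boolP (x \in box (k + 1))) => [_|/negP xB].
  by rewrite mul1r lerDl.
rewrite mul0r normr0 add0r.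
have xA : x \notin A.
  apply/negP => /set_mem/Ak xk; apply: xB; apply/mem_set => i; have [h1 h2] := xk i.
  move/negP : h2; rewrite -leNgt => h2.
  by split; [lra|apply/negP; rewrite -leNgt; lra].
rewrite [\1_A x]indicE (negbTE xA) subr0 [leRHS]ger0_norm; last first.
  rewrite mulr_ge0 ?(ltW ct0)// /heat gt_eqF//; apply: Rintegral_ge0 => y _.
  by rewrite mulr_ge0 ?heat_kernel_ge0 ?indicE.
have E2 : heat_abs (2 * t n) (EFin \o \1_A) x = (heat (2 * t n) \1_A x)%:E.
  rewrite /heat gt_eqF// /Rintegral fineK.
    by apply: eq_integral => y _; rewrite abse_EFin EFinM ger0_norm// indicE.
  have : (heat_abs (2 * t n) (EFin \o \1_A) x < +oo)%E by exact: (heat_abs_lty_norm _ gN qN).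
  by move=> /heat_abs_integrableP-/(_ m1); exact: integrable_fin_num.
rewrite -lee_fin EFinM -E2; apply: le_trans (heat_le_abs _ _ m1) _; first by rewrite gt_eqF.
rewrite -ge0_integralZl_EFin ?(ltW ct0)//; last first.
- by apply: emeasurable_funM; [exact: measurable_kernel|exact/measurableT_comp/measurable_EFinP].
- by move=> y _; rewrite mule_ge0 ?abse_ge0// lee_fin heat_kernel_ge0.
apply: le_integral_nonneg => y _; first by rewrite mule_ge0 ?abse_ge0// lee_fin heat_kernel_ge0.
rewrite abse_EFin -!EFinM lee_fin indicE.
have [yA|_] := boolP (y \in A); last by rewrite normr0 !mulr0.
rewrite normr1 !mulr1; apply: le_trans (sqdist_heat_kernel x y (t0 n)).
rewrite ler_peMl ?heat_kernel_ge0//; apply: (@sqdist_box k); last by apply: Ak; exact/set_mem.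
by move=> xb; apply: xB; apply/mem_set.
Unshelve. all: by end_near. Qed.

Lemma heat_cvg0_cst0 g q : (1 <= q)%E -> heat_cvg0 g q (fun _ : Rn R N => 0).
Proof.
move=> q1; split; [exact: measurable_cst|by rewrite wnorm_cst0// ltry|].
move=> e e0; exists 1 => // t _; rewrite heat_cst0.
rewrite (_ : (fun _ => 0 - 0) = (fun _ : Rn R N => 0)).
  by rewrite wnorm_cst0// lee_fin; exact: ltW.
by apply/funext => x; rewrite subr0.
Qed.

(** Dynkin's induction from the continuity sets. Intersecting with a fixed box keeps every norm
    finite, so that complements and countable disjoint unions do not leave the class. *)
Lemma heat_cvg0_measurable_indic g p S k : 0 <= g < N%:R -> ((N%:R / (N%:R - g))%:E < p%:E)%E ->
  0 < k -> measurable S -> heat_cvg0 g p%:E \1_(S `&` box k).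
Proof.
move=> gN qN k0 mS; case/andP: (gN) => g0 gN'.
have q1 : (1 <= p%:E)%E by exact: gt1_exponent qN.
have p0 : 0 < p by move: q1; rewrite lee_fin; exact: lt_le_trans.
have cB := continuity_box k; have mB : measurable (box k) by case: cB.
apply: (dynkin_induction measurable_continuity_setE (P := fun S => heat_cvg0 g p%:E \1_(S `&` box k))).
- exact: continuity_setI.
- by rewrite setTI; apply: (heat_cvg0_indic gN qN k0 cB).
- by move=> A cA; apply: (heat_cvg0_indic gN qN k0); [exact: continuity_setI|exact: subIsetr].
- move=> A mA gA.
  have := heat_cvg0B 1 gN qN (heat_cvg0_indic gN qN k0 cB (@subset_refl _ _)) gA.
  congr heat_cvg0; apply/funext => x; rewrite !indicE mul1r !in_setI in_setC.
  by case: (x \in A); case: (x \in box k); rewrite ?subr0 ?subrr.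
- move=> F mF tF gF.
  have mU : measurable (\bigcup_k0 F k0) by exact: bigcupT_measurable.
  have Uoo : (wnorm g p%:E (EFin \o \1_(\bigcup_k0 F k0 `&` box k)) < +oo)%E.
    apply: le_lt_trans (le_wnorm_indic g q1 _) (wnorm_box_lty p0 g0 k0).
    exact: subIsetr.
  apply: heat_cvg0_closed => //; first by apply: measurable_indic; exact: measurableI.
  move=> e e0.
  (* By disjointness the partial sums are indicators of the finite unions, dominated by the
     indicator of the whole union. *)
  pose s n x : R := \sum_(j < n) \1_(F j `&` box k) x.
  have gs n : heat_cvg0 g p%:E (s n).
    elim: n => [|n IH].
      have := heat_cvg0_cst0 g q1; congr heat_cvg0; apply/funext => x.
      by rewrite /s big_ord0.
    have := heat_cvg0B (-1) gN qN IH (gF n); congr heat_cvg0; apply/funext => x.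
    by rewrite /s big_ord_recr /= mulN1r opprK.
  have sE n x : s n x = \1_((\big[setU/set0]_(j < n) F j) `&` box k) x.
    elim: n => [|n IH]; first by rewrite /s !big_ord0 set0I indic0.
    rewrite /s !big_ord_recr /= -/(s n x) IH !indicE !in_setI in_setU.
    case: (boolP (x \in box k)) => _; rewrite ?andbF ?addr0// !andbT.
    case: (boolP (x \in F n)) => [/set_mem xn|_]; rewrite ?orbF ?addr0// orbT.
    rewrite memNset ?add0r// => xj.
    move: xj; rewrite -bigcup_mkord => -[j /= jn xj].
    have jE : j = n by apply: tF => //; exists x.
    by rewrite jE ltnn in jn.
  have [] := @wnorm_dct g p (fun n x => \1_(\bigcup_k0 F k0 `&` box k) x - s n x)
    (\1_(\bigcup_k0 F k0 `&` box k)) p0 _ _ Uoo _ _ e e0.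
  - move=> n; apply: measurable_funB; last by case: (gs n).
    by apply: measurable_indic; exact: measurableI.
  - by apply: measurable_indic; exact: measurableI.
  - move=> n x; rewrite sE !indicE !in_setI.
    case: (boolP (x \in box k)) => _; rewrite ?andbF ?subr0 ?normr0// !andbT.
    case: (boolP (x \in \bigcup_k0 F k0)) => [_|/negP xU].
      by case: (x \in _); rewrite ?subr0 ?subrr ?normr0 ?normr1.
    rewrite memNset ?subr0// => xj; apply: xU; apply/mem_set.
    by move: xj; rewrite -bigcup_mkord => -[j /= _ xj]; exists j.
  - apply: aeW => x.
    apply: cvg_near_cst.
    have [[[j _ Fj] kx]|nU] := pselect ((\bigcup_k0 F k0 `&` box k) x); last first.
      near=> n; rewrite sE !indicE memNset// memNset ?subr0// => -[xj kx]; apply: nU.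
      by split => //; move: xj; rewrite -bigcup_mkord => -[j /= _ xj]; exists j.
    exists j.+1 => // n /= jn; rewrite sE !indicE mem_set; last by split => //; exists j.
    rewrite mem_set ?subrr//; split => //.
    by rewrite -bigcup_mkord; exists j.
  by move=> n Hn; exists (s n).
by rewrite -measurable_continuity_setE.
Unshelve. all: by end_near. Qed.

Import HBSimple HBNNSimple.

Lemma strong_continuity_at0 g p f : 0 <= g < N%:R -> ((N%:R / (N%:R - g))%:E < p%:E)%E ->
  measurable_fun [set: _] f -> (wnorm g p%:E (EFin \o f) < +oo)%E -> heat_cvg0 g p%:E f.
Proof.
move=> gN qN; case/andP: (gN) => g0 gN'.
have q1 : (1 <= p%:E)%E by exact: gt1_exponent qN.
have p0 : 0 < p by move: q1; rewrite lee_fin; exact: lt_le_trans.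
have nneg (h : Rn R N -> R) : measurable_fun [set: _] h -> (forall x, 0 <= h x) ->
    (wnorm g p%:E (EFin \o h) < +oo)%E -> heat_cvg0 g p%:E h.
  move=> mh h0 hoo; apply: heat_cvg0_closed => // e e0.
  have mh' : measurable_fun [set: Rn R N] (EFin \o h) by exact/measurable_EFinP.
  pose a := nnsfun_approx measurableT mh'.
  (* The simple functions are cut to growing boxes, since the previous step covers indicators of
     sets in a box. *)
  pose s n x : R := a n x * \1_(box n.+1%:R) x.
  have a_cvg x : a n x @[n --> \oo] --> h x.
    have /fine_cvgP[_] := @cvg_nnsfun_approx _ _ _ setT measurableT (EFin \o h) mh' (fun x _ => h0 x) x I.
    exact.
  have ah n x : 0 <= a n x <= h x.
    apply/andP; split; first exact: fun_ge0.
    have nd : nondecreasing_seq (a ^~ x).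
      by move=> i j ij; have /lefP := @nd_nnsfun_approx _ _ _ setT measurableT (EFin \o h) mh' i j ij; apply.
    rewrite -(cvg_lim _ (a_cvg x))//; apply: nondecreasing_cvgn_le => //.
    by apply/cvg_ex; exists (h x).
  have gs n : heat_cvg0 g p%:E (s n).
    pose S : seq R := finmap.enum_fset (fset_set (range (a n))).
    have k0 : 0 < n.+1%:R :> R by rewrite ltr0n.
    have gj m : heat_cvg0 g p%:E (fun x => \sum_(i < m) S`_i * \1_(a n @^-1` [set S`_i] `&` box n.+1%:R) x).
      elim: m => [|m IH].
        by have := heat_cvg0_cst0 g q1; congr heat_cvg0; apply/funext => x; rewrite big_ord0.
      have mi : measurable (a n @^-1` [set S`_m]) by rewrite -[X in measurable X]setTI; exact: measurable_funP.
      have := heat_cvg0B (- S`_m) gN qN IH (heat_cvg0_measurable_indic gN qN k0 mi).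
      by congr heat_cvg0; apply/funext => x; rewrite big_ord_recr /= mulNr opprK.
    have := gj (size S); congr heat_cvg0; apply/funext => x.
    rewrite /s fimfunEord mulr_suml; apply: eq_bigr => i _.
    by rewrite -mulrA indicI.
  have [] := @wnorm_dct g p (fun n x => h x - s n x) h p0 _ _ hoo _ _ e e0 => //.
  - by move=> n; apply: measurable_funB => //; case: (gs n).
  - move=> n x; have /andP[a0 ale] := ah n x.
    rewrite /s indicE; case: (_ \in _); rewrite ?mulr1 ?mulr0 ?subr0//.
    by rewrite !ger0_norm ?subr_ge0 ?gerBl.
  - apply: aeW => x; rewrite -(subrr (h x)); apply: cvgB; first exact: cvg_cst.
    rewrite -[X in _ --> X]mulr1; apply: cvgM; first exact: a_cvg.
    apply: cvg_near_cst; near=> n.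
    rewrite indicE mem_set// => i.
    suff H : `|(tnth x i : R)| < n.+1%:R.
      move: H; rewrite ltr_norml => /andP[h1 h2]; split => //.
      by apply/negP; rewrite -leNgt ltW.
    have : \sum_(j < N) `|(tnth x j : R)| < n.+1%:R.
      near: n; exists (Num.bound (\sum_(j < N) `|(tnth x j : R)|)) => // n /= Hn.
      apply: lt_le_trans (archi_boundP _) _; first exact: sumr_ge0.
      by rewrite ler_nat (leq_trans Hn).
    by apply: le_lt_trans; rewrite (bigD1 i)//= lerDl sumr_ge0.
  by move=> n Hn; exists (s n).
move=> mf foo.
have mp : measurable_fun [set: Rn R N] (fun x => Num.max (f x) 0) by exact: measurable_maxr.
have mn : measurable_fun [set: Rn R N] (fun x => Num.max (- f x) 0).
  by apply: measurable_maxr => //; exact: measurableT_comp.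
have le_f (h : Rn R N -> R) : (forall x, `|h x| <= `|f x|) -> (wnorm g p%:E (EFin \o h) < +oo)%E.
  move=> hf; apply: le_lt_trans foo; apply: le_wnorm => // x; exact: hf.
have H1 : heat_cvg0 g p%:E (fun x => Num.max (f x) 0).
  apply: (nneg _ mp) => [x|]; last apply: le_f => x; first by rewrite le_max lexx orbT.
  by case: (leP (f x) 0) => fx; rewrite ?normr0.
have H2 : heat_cvg0 g p%:E (fun x => Num.max (- f x) 0).
  apply: (nneg _ mn) => [x|]; last apply: le_f => x; first by rewrite le_max lexx orbT.
  by case: (leP (- f x) 0) => fx; rewrite ?normr0 ?normrN.
have := heat_cvg0B 1 gN qN H1 H2; congr heat_cvg0; apply/funext => x.
rewrite mul1r; case: (leP (f x) 0) => fx.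
  by rewrite max_l ?oppr_ge0// sub0r opprK.
by rewrite max_r ?subr0// oppr_le0 ltW.
Unshelve. all: by end_near. Qed.

End strong_continuity.

(** * Regularity in time *)

Section time_regularity.
Context {R : realType} {N : nat}.
Local Notation mu := (@lebesgue_Rn R N).
Local Notation leb := (@lebesgue_measure R).
Implicit Types (alpha g t : R) (q : \bar R) (u v : R -> Rn R N -> R).

Lemma heat_abs_time_diff : exists2 C : R, 0 < C &
  forall th t t' (f : Rn R N -> R) x, 0 < th <= 1 -> 0 < t < t' -> measurable_fun [set: _] f ->
  (heat_abs t (EFin \o f) x < +oo)%E -> (heat_abs t' (EFin \o f) x < +oo)%E ->
  (`|heat t' f x - heat t f x|%:E <= (C * ((t' - t) / t) `^ th)%:E *
     (heat_abs (2 * t') (EFin \o f) x + heat_abs t (EFin \o f) x))%E.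
Proof.
have [C C0 HC] := @heat_kernel_time_diff R N; exists C => //.
move=> th t t' f x th01 tt mf ft ft'; case/andP: (tt) => t0 t_lt; have t'0 := lt_trans t0 t_lt.
have it := (heat_abs_integrableP t x mf).2 ft; have it' := (heat_abs_integrableP t' x mf).2 ft'.
rewrite /heat !gt_eqF// -RintegralB//.
have iB : mu.-integrable setT (EFin \o (fun y => heat_kernel t' x y * f y - heat_kernel t x y * f y)).
  by have := @integrableB _ _ _ mu _ _ _ _ it' it; apply.
apply: (@le_trans _ _ (\int[mu]_y `|heat_kernel t' x y * f y - heat_kernel t x y * f y|%:E)%E).
  apply: (@le_trans _ _ (\int[mu]_y `|heat_kernel t' x y * f y - heat_kernel t x y * f y|)%:E).
    by rewrite lee_fin; apply: le_normr_Rintegral.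
  by rewrite /Rintegral fineK//; exact: (@integrable_fin_num _ _ _ mu _ _ _ (integrable_abse iB)).
have c0 : 0 <= C * ((t' - t) / t) `^ th by rewrite mulr_ge0 ?powR_ge0 ?(ltW C0).
have mK s : measurable_fun [set: Rn R N] (fun y => (heat_kernel s x y)%:E * `|(EFin \o f) y|)%E.
  by apply: emeasurable_funM; [exact: measurable_kernel|exact/measurableT_comp/measurable_EFinP].
have K0 s y : (0 <= (heat_kernel s x y)%:E * `|(EFin \o f) y|)%E.
  by rewrite mule_ge0 ?abse_ge0// lee_fin heat_kernel_ge0.
rewrite /heat_abs -ge0_integralD// -ge0_integralZl_EFin//; last 2 first.
- by move=> y _; rewrite adde_ge0.
- exact: emeasurable_funD.
apply: le_integral_nonneg => y _; first by rewrite lee_fin.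
have HK := HC th t t' x y th01 tt.
have : `|heat_kernel t' x y * f y - heat_kernel t x y * f y| <= C * ((t' - t) / t) `^ th *
    (heat_kernel (2 * t') x y * `|f y| + heat_kernel t x y * `|f y|).
  by rewrite -mulrBl normrM -mulrDl mulrA ler_wpM2r.
exact.
Qed.

Lemma wnorm_heat_time_diff g q : 0 <= g < N%:R -> ((N%:R / (N%:R - g))%:E < q)%E ->
  exists2 C : R, 0 < C & forall th t t' M (f : Rn R N -> R), 0 < th <= 1 -> 0 < t < t' -> 0 < M ->
  measurable_fun [set: _] f -> (wnorm g q (EFin \o f) <= M%:E)%E ->
  (wnorm g q (EFin \o (fun x => heat t' f x - heat t f x)%R) <= (C * ((t' - t) / t) `^ th * M)%:E)%E.
Proof.
move=> gN qN; case/andP: (gN) => g0 gN'.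
have q1 : (1 <= q)%E by exact: gt1_exponent qN.
have gg : 0 <= g <= g by rewrite g0 lexx.
have [C1 C10 H1] := heat_abs_time_diff.
have [C2 C20 H2] := wnorm_heat_abs gg gN' (lexx 1) qN.
exists (C1 * (2 * C2)); first by rewrite !mulr_gt0.
move=> th t t' M f th01 tt M0 mf fM; case/andP: (tt) => t0 t_lt; have t'0 := lt_trans t0 t_lt.
have t2 : 0 < 2 * t' by rewrite mulr_gt0.
have mf' : measurable_fun [set: Rn R N] (EFin \o f) by exact/measurable_EFinP.
have B s : 0 < s -> (wnorm g q (heat_abs s (EFin \o f)) <= (C2 * M)%:E)%E.
  move=> s0; have := H2 s M _ s0 M0 mf' fM.
  by rewrite mul1e !subrr mulr0 mul0r addr0 oppr0 powRr0 mulr1.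
have CM0 : 0 <= C2 * M by rewrite mulr_ge0 ?ltW.
have mh s : measurable_fun [set: Rn R N] (heat_abs s (EFin \o f)) by exact: measurable_heat_abs.
have c0 : 0 < C1 * ((t' - t) / t) `^ th by rewrite mulr_gt0 ?powR_gt0 ?divr_gt0 ?subr_gt0.
have := wnorm_le_add (k := fun x => heat_abs (2 * t') (EFin \o f) x + heat_abs t (EFin \o f) x)%E
  q1 CM0 CM0 (mh _) (mh _) _ (B _ t2) (B _ t0).
move=> H3; have {}H3 : (wnorm g q (fun x => heat_abs (2 * t') (EFin \o f) x + heat_abs t (EFin \o f) x)
    <= (C2 * M + C2 * M)%:E)%E.
  by apply: H3 => x; exact: lee_abs_add.
have mS : measurable_fun [set: Rn R N] (fun x => heat_abs (2 * t') (EFin \o f) x + heat_abs t (EFin \o f) x)%E.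
  exact: emeasurable_funD.
have := wnormZ q1 c0 (addr_ge0 CM0 CM0) mS H3.
rewrite (_ : C1 * _ * (C2 * M + C2 * M) = C1 * (2 * C2) * ((t' - t) / t) `^ th * M); last by ring.
apply: le_trans; apply: le_wnorm => // x.
rewrite [leRHS]gee0_abs; last first.
  by apply: mule_ge0; [rewrite lee_fin ltW|rewrite adde_ge0 ?heat_abs_ge0].
rewrite abse_EFin; have foo : (wnorm g q (EFin \o f) < +oo)%E by apply: le_lt_trans fM (ltry _).
apply: H1 => //; exact: (heat_abs_lty_norm _ gN qN).
Qed.

Lemma cvg_ereal0 (T : Type) (F : set_system T) (FF : Filter F) (phi : T -> \bar R) :
  (forall x, 0 <= phi x)%E ->
  (forall e : R, 0 < e -> \forall x \near F, (phi x <= e%:E)%E) -> phi x @[x --> F] --> 0%E.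
Proof.
move=> phi0 H; apply/fine_cvgP; split.
  apply: filterS (H 1 ltr01) => x px; rewrite ge0_fin_numE//; exact: le_lt_trans px (ltry _).
apply/cvgrPdist_le => e e0; apply: filterS (H e e0) => x px.
rewrite sub0r normrN ger0_norm ?fine_ge0//.
rewrite -lee_fin fineK// ge0_fin_numE//; exact: le_lt_trans px (ltry _).
Qed.

(** [u(t) - e^(t Delta) u_0] is the Duhamel term, which vanishes like [t ^ (1 - b)]. It gives the
    initial condition in norm for [q = +oo], where the free flow itself may be discontinuous at
    0. *)
Lemma wnorm_mild_part alpha g q :
  let nu := g / (alpha + 1) in let r := ((alpha + 1)%:E * q)%E in
  let a := (g - nu) / 2 + N%:R / 2 * (fine q^-1%E - fine r^-1%E) in
  let b := a * (alpha + 1) in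
  0 < alpha -> 0 <= g < N%:R -> ((N%:R / (N%:R - g))%:E < q)%E -> b < 1 ->
  exists2 C : R, 0 < C & forall t M J (u0 : Rn R N -> R) u, 0 < t -> 0 < M -> J t ->
  measurable_fun [set: _] u0 ->
  (forall s, 0 < s <= t -> measurable_fun [set: _] (u s)) ->
  (forall s, 0 < s <= t -> (wnorm nu r (EFin \o u s) <= (M * s `^ (- a))%:E)%E) ->
  integral_equation alpha u0 J u ->
  (wnorm g q (EFin \o (fun x => u t x - heat t u0 x)%R) <= (M `^ (alpha + 1) * (C * t `^ (1 - b)))%:E)%E.
Proof.
move=> nu r a b al0 gN qN b1; case/andP: (gN) => g0 gN'.
have q1 : (1 <= q)%E by exact: gt1_exponent qN.
have a0 : 0 <= a by exact: smoothing_exponent_ge0.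
have [C C0 H] := wnorm_duhamel_source al0 gN qN a0 b1.
exists C => // t M J u0 u t0 M0 Jt mu0 mu_ uM ueq.
have lt_le s : 0 < s < t -> 0 < s <= t by move=> /andP[-> /ltW].
have Ms0 s : 0 < s < t -> 0 < M * s `^ (- a).
  by move=> /andP[s0 _]; rewrite mulr_gt0// powR_gt0.
have ms s (st : 0 < s < t) := mu_ s (lt_le s st).
have us s (st : 0 < s < t) := uM s (lt_le s st).
have mh : measurable_fun (`]0, t[ `*` [set: Rn R N])
    (fun z => heat (t - z.1) (nonlinearity alpha (u z.1)) z.2).
  apply: (measurable_duhamel_time_section gN qN Jt ms _ ueq) => s st.
  by apply: le_lt_trans (wnorm_nonlinearity al0 q1 (Ms0 _ st) (ms s st) (us s st)) _; rewrite ltry.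
apply: le_trans (H t M u t0 M0 ms us mh).
have mut : measurable_fun [set: Rn R N] (u t) by apply: mu_; rewrite t0 lexx.
apply: le_wnorm_ae => //.
- by apply/measurable_EFinP; apply: measurable_funB => //; exact: measurable_heat.
- exact: measurable_heat_time_integral.
apply: filterS (ueq t Jt) => x [_ iu ux].
rewrite abse_EFin ux addrC addKr [leRHS]gee0_abs; first exact: Rintegral_abs_le_oo.
by apply: integral_ge0 => s _; rewrite lee_fin.
Qed.

Lemma Rintegral_difference (f h : R -> R) (t t' : R) : 0 < t < t' ->
  leb.-integrable `[0, t'] (EFin \o f) -> leb.-integrable `[0, t] (EFin \o h) ->
  (`|\int[leb]_(s in `[0%R, t']) f s - \int[leb]_(s in `[0%R, t]) h s|%:E <=
    \int[leb]_(s in `]0%R, t[) `|f s - h s|%:E + \int[leb]_(s in `]t, t'[) `|f s|%:E)%E.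
Proof.
move=> /andP[t0 tt'] fi hi.
have fi0 : leb.-integrable `[0, t] (EFin \o f).
  by apply: integrableS fi => //; apply: subset_itv; rewrite bnd_simp// ltW.
have fi1 : leb.-integrable `]t, t'] (EFin \o f).
  by apply: integrableS fi => //; apply: subset_itv; rewrite bnd_simp// ltW.
have iB : leb.-integrable `[0, t] (EFin \o (fun s => f s - h s)).
  by have := @integrableB _ _ _ leb _ _ _ _ fi0 hi; apply.
have -> : \int[leb]_(s in `[0%R, t']) f s - \int[leb]_(s in `[0%R, t]) h s =
    \int[leb]_(s in `[0%R, t]) (f s - h s) + \int[leb]_(s in `]t, t']) f s.
  rewrite RintegralB// -(Rintegral_itvB fi); [ring| |]; by rewrite bnd_simp ltW.
apply: (@le_trans _ _ (`|\int[leb]_(s in `[0%R, t]) (f s - h s)|%:E + `|\int[leb]_(s in `]t, t']) f s|%:E)%E).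
  by rewrite -EFinD lee_fin ler_normD.
apply: leeD; first exact: Rintegral_abs_le_oo.
have mf : measurable_fun `]t, t'[ (fun s => `|f s|%:E).
  apply/measurable_EFinP; apply: measurableT_comp => //.
  have /integrableP[/measurable_EFinP mf _] := fi1.
  by apply: measurable_funS mf => //; apply: subset_itv; rewrite bnd_simp.
rewrite -(integral_itv_bndoo false false mf).
apply: (@le_trans _ _ (\int[leb]_(s in `]t, t']) `|f s|)%:E).
  by rewrite lee_fin; apply: le_normr_Rintegral.
rewrite /Rintegral fineK//.
exact: (@integrable_fin_num _ _ _ leb _ _ _ (integrable_abse fi1)).
Qed.

Lemma le_integral_powR_shift (b t t' : R) : b < 1 -> t < t' ->
  (\int[leb]_(s in `]t, t'[) ((s - t) `^ (- b))%:E <= ((t' - t) `^ (1 - b) / (1 - b))%:E)%E.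
Proof.
move=> b1 tt'.
have mp : measurable_fun `]t, t'[ (fun s => ((s - t) `^ (- b))%:E).
  apply/measurable_EFinP; apply: (measurableT_comp (measurable_powR _)).
  by apply: measurable_funB => //; exact: measurable_id.
have p0 s : `]t, t'[%classic s -> (0 <= ((s - t) `^ (- b))%:E)%E by rewrite lee_fin powR_ge0.
rewrite -(integral_shift t (measurable_itv _) mp p0).
have -> : (fun s => s + t) @^-1` `]t, t'[ = `]0, (t' - t)[%classic.
  by apply/seteqP; split => s /=; rewrite !in_itv/= => /andP[? ?]; apply/andP; split; lra.
under eq_integral do rewrite addrK.
by apply: le_integral_powR => //; rewrite subr_ge0 ltW.
Qed.

(** The Duhamel integral up to [t'] is split at [t]. Before [t], the flows for [t' - s] and [t - s]
    are compared by [wnorm_heat_time_diff]; after [t], the source is integrated directly. Both parts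
    are of order [(t' - t) ^ (1 - b)]. *)
Lemma mild_part_holder alpha g q :
  let nu := g / (alpha + 1) in let r := ((alpha + 1)%:E * q)%E in
  let a := (g - nu) / 2 + N%:R / 2 * (fine q^-1%E - fine r^-1%E) in
  let b := a * (alpha + 1) in
  0 < alpha -> 0 <= g < N%:R -> ((N%:R / (N%:R - g))%:E < q)%E -> 0 < b < 1 ->
  exists2 C : R, 0 < C & forall t t' M J (u0 : Rn R N -> R) u, 0 < t < t' -> 0 < M -> J t -> J t' ->
  measurable_fun [set: _] u0 ->
  (forall s, 0 < s <= t' -> measurable_fun [set: _] (u s)) ->
  (forall s, 0 < s <= t' -> (wnorm nu r (EFin \o u s) <= (M * s `^ (- a))%:E)%E) ->
  integral_equation alpha u0 J u ->
  (wnorm g q (EFin \o (fun x => (u t' x - heat t' u0 x) - (u t x - heat t u0 x))%R) <=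
    (M `^ (alpha + 1) * (C * (t' - t) `^ (1 - b)))%:E)%E.
Proof.
move=> nu r a b al0 gN qN /andP[b0 b1]; case/andP: (gN) => g0 gN'.
have q1 : (1 <= q)%E by exact: gt1_exponent qN.
have gg : 0 <= g <= g by rewrite g0 lexx.
have a0 : 0 <= a by exact: smoothing_exponent_ge0.
have [C1 C10 H1] := wnorm_heat_time_diff gN qN.
have [C2 C20 H2] := wnorm_heat gg gN' (lexx 1) qN.
(* With this exponent the integral of [(t - s) ^ (- th) s ^ (- b)] over []0, t[] is scale invariant,
   hence bounded uniformly in [t]. *)
pose th := 1 - b.
have th01 : 0 < th <= 1 by rewrite /th subr_gt0 b1 gerBl ltW.
have th01' : 0 <= th < 1 by rewrite /th subr_ge0 (ltW b1) gtrBl.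
have b01 : 0 <= b < 1 by rewrite (ltW b0).
have [C3 C30 H3] := le_integral_beta_scale th01' b01.
exists (C1 * C3 + C2 / (1 - b)); first by rewrite addr_gt0// ?divr_gt0 ?mulr_gt0 ?subr_gt0.
move=> t t' M J u0 u tt M0 Jt Jt' mu0 mu_ uM ueq; case/andP: (tt) => t0 tt'.
have t'0 := lt_trans t0 tt'; have tt0 : 0 < t' - t by rewrite subr_gt0.
have P0 : 0 < M `^ (alpha + 1) by exact: powR_gt0.
have Ms0 s : 0 < s -> 0 < M * s `^ (- a) by move=> s0; rewrite mulr_gt0// powR_gt0.
have FM s : 0 < s < t' ->
    (wnorm g q (EFin \o nonlinearity alpha (u s)) <= (M `^ (alpha + 1) * s `^ (- b))%:E)%E.
  move=> /andP[s0 st]; have st' : 0 < s <= t' by rewrite s0 ltW.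
  have := wnorm_nonlinearity al0 q1 (Ms0 s s0) (mu_ s st') (uM s st').
  by rewrite powRM ?powR_ge0 ?(ltW M0)// -powRrM mulNr.
have Foo s : 0 < s < t' -> (wnorm g q (EFin \o nonlinearity alpha (u s)) < +oo)%E.
  by move=> /FM/le_lt_trans; apply; rewrite ltry.
have mF s : 0 < s < t' -> measurable_fun [set: _] (nonlinearity alpha (u s)).
  by move=> /andP[s0 st]; apply: measurable_nonlinearity; apply: mu_; rewrite s0 ltW.
have ms s : 0 < s < t' -> measurable_fun [set: _] (u s).
  by move=> /andP[s0 st]; apply: mu_; rewrite s0 ltW.
have mh' := measurable_duhamel_time_section gN qN Jt' ms Foo ueq.
have tlt s : 0 < s < t -> 0 < s < t' by move=> /andP[-> st] /=; exact: lt_trans tt'.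
have mh := measurable_duhamel_time_section gN qN Jt (fun s st => ms s (tlt s st))
  (fun s st => Foo s (tlt s st)) ueq.
have sub0 : `]0, t[ `*` [set: Rn R N] `<=` `]0, t'[ `*` [set: Rn R N].
  by move=> [s x] [/=]; rewrite !in_itv/= => /tlt ->.
have sub1 : `]t, t'[ `*` [set: Rn R N] `<=` `]0, t'[ `*` [set: Rn R N].
  by move=> [s x] [/=]; rewrite !in_itv/= => /andP[ts ->]; rewrite (lt_trans t0 ts).
have mD0 : measurable (`]0%R, t'[ `*` [set: Rn R N]) by exact: measurableX.
pose h s x := heat (t' - s) (nonlinearity alpha (u s)) x - heat (t - s) (nonlinearity alpha (u s)) x.
have mh1 : measurable_fun (`]0, t[ `*` [set: Rn R N]) (fun z => h z.1 z.2).
  by apply: measurable_funB; [exact: measurable_funS mD0 sub0 mh'|exact: mh].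
have mh2 : measurable_fun (`]t, t'[ `*` [set: Rn R N])
    (fun z => heat (t' - z.1) (nonlinearity alpha (u z.1)) z.2).
  exact: measurable_funS mh'.
pose G1 x := (\int[leb]_(s in `]0%R, t[) `|h s x|%:E)%E.
pose G2 x := (\int[leb]_(s in `]t, t'[) `|heat (t' - s) (nonlinearity alpha (u s)) x|%:E)%E.
have mG1 : measurable_fun [set: Rn R N] G1 by exact: measurable_time_integral.
have mG2 : measurable_fun [set: Rn R N] G2.
  exact: (@measurable_time_integral _ _ _ (fun s => heat (t' - s) (nonlinearity alpha (u s)))).
pose L1 := M `^ (alpha + 1) * (C1 * C3 * (t' - t) `^ (1 - b)).
pose L2 := M `^ (alpha + 1) * (C2 / (1 - b) * (t' - t) `^ (1 - b)).
have L10 : 0 < L1 by rewrite !mulr_gt0 ?powR_gt0.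
have L20 : 0 < L2 by rewrite !mulr_gt0 ?powR_gt0 ?invr_gt0 ?subr_gt0.
have E1 : (wnorm g q G1 <= L1%:E)%E.
  apply: (@wnorm_integral _ _ _ _ leb `]0%R, t[%classic (fun s x => `|h s x|%:E)
    (fun s => C1 * ((t' - t) / (t - s)) `^ th * (M `^ (alpha + 1) * s `^ (- b))) _ _ _ q1) => //.
  - by apply/measurable_EFinP; exact: measurableT_comp.
  - apply: measurable_funM; last first.
      by apply: measurable_funM => //; apply: (measurableT_comp (measurable_powR _)); exact: measurable_id.
    apply: measurable_funM => //; apply: (measurableT_comp (measurable_powR _)).
    by apply: measurable_div => //; apply: measurable_funB => //; exact: measurable_id.
  - move=> s /=; rewrite in_itv/= => /andP[s0 st].
    by rewrite !mulr_gt0 ?powR_gt0 ?divr_gt0 ?subr_gt0.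
  - move=> s /=; rewrite in_itv/= => st; case/andP: (st) => s0 st'.
    have ts : 0 < t - s < t' - s by rewrite subr_gt0 st' ltrD2r.
    have Ps0 : 0 < M `^ (alpha + 1) * s `^ (- b) by rewrite mulr_gt0 ?powR_gt0.
    have := H1 th _ _ _ _ th01 ts Ps0 (mF s (tlt s st)) (FM s (tlt s st)).
    rewrite (_ : t' - s - (t - s) = t' - t); last by ring.
    by apply: le_trans; apply: le_wnorm => // x; rewrite !abse_EFin normr_id.
  pose c := C1 * (t' - t) `^ th * M `^ (alpha + 1).
  have c0 : 0 <= c by rewrite !mulr_ge0 ?powR_ge0 ?(ltW C10).
  apply: (@le_trans _ _ (\int[leb]_(s in `]0%R, t[) (c * ((t - s) `^ (- th) * s `^ (- b)))%:E)%E).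
    apply: le_integral_nonneg => s; rewrite /= in_itv/= => /andP[s0 st].
      by rewrite lee_fin !mulr_ge0 ?powR_ge0 ?(ltW C10).
    have ts0 : 0 < t - s by rewrite subr_gt0.
    rewrite lee_fin powRM ?invr_ge0 ?(ltW tt0) ?(ltW ts0)//.
    rewrite -powR_inv1 ?(ltW ts0)// -powRrM mulN1r /c; apply: eqW; ring.
  apply: le_trans (H3 _ _ c0 t0) _; rewrite lee_fin /c /L1.
  rewrite (_ : 1 - th - b = 0); last by rewrite /th; ring.
  by rewrite powRr0 /th; apply: eqW; ring.
have E2 : (wnorm g q G2 <= L2%:E)%E.
  apply: (@wnorm_integral _ _ _ _ leb `]t, t'[%classic
    (fun s x => `|heat (t' - s) (nonlinearity alpha (u s)) x|%:E)
    (fun s => C2 * (M `^ (alpha + 1) * s `^ (- b))) _ _ _ q1) => //.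
  - by apply/measurable_EFinP; exact: measurableT_comp.
  - apply: measurable_funM => //; apply: measurable_funM => //.
    by apply: (measurableT_comp (measurable_powR _)); exact: measurable_id.
  - move=> s /=; rewrite in_itv/= => /andP[ts st].
    by rewrite !mulr_gt0 ?powR_gt0 ?(lt_trans t0 ts).
  - move=> s /=; rewrite in_itv/= => /andP[ts st].
    have s0 := lt_trans t0 ts; have st' : 0 < s < t' by rewrite s0.
    have Ps0 : 0 < M `^ (alpha + 1) * s `^ (- b) by rewrite mulr_gt0 ?powR_gt0.
    have ts0 : 0 < t' - s by rewrite subr_gt0.
    have := H2 _ _ _ ts0 Ps0 (mF s st') (FM s st').
    rewrite mul1e !subrr mulr0 mul0r addr0 oppr0 powRr0 mulr1.
    by apply: le_trans; apply: le_wnorm => // x; rewrite !abse_EFin normr_id.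
  pose c := C2 * M `^ (alpha + 1).
  have c0 : 0 <= c by rewrite !mulr_ge0 ?powR_ge0 ?(ltW C20).
  apply: (@le_trans _ _ (\int[leb]_(s in `]t, t'[) (c%:E * ((s - t) `^ (- b))%:E))%E).
    apply: le_integral_nonneg => s; rewrite /= in_itv/= => /andP[ts st].
      by rewrite lee_fin !mulr_ge0 ?powR_ge0 ?(ltW C20).
    (* [s - t <= s], so the singularity is moved to [t] and the resulting bound depends on [t' - t]
       only. *)
    rewrite -EFinM lee_fin mulrA -/c ler_wpM2l// ge0_powRN_le// ?(ltW b0)//.
    by rewrite subr_gt0 ts gerBl ltW.
  rewrite ge0_integralZl_EFin//; last 2 first.
  - by move=> s _; rewrite lee_fin powR_ge0.
  - apply/measurable_EFinP; apply: (measurableT_comp (measurable_powR _)).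
    by apply: measurable_funB => //; exact: measurable_id.
  apply: le_trans (lee_wpmul2l _ (le_integral_powR_shift b1 tt')) _; first by rewrite lee_fin.
  by rewrite -EFinM lee_fin /c /L2; apply: eqW; ring.
have -> : M `^ (alpha + 1) * ((C1 * C3 + C2 / (1 - b)) * (t' - t) `^ (1 - b)) = L1 + L2.
  by rewrite /L1 /L2; ring.
have G10 x : (0 <= G1 x)%E by apply: integral_ge0 => s _; rewrite lee_fin.
have G20 x : (0 <= G2 x)%E by apply: integral_ge0 => s _; rewrite lee_fin.
apply: (@le_trans _ _ (wnorm g q (fun x => G1 x + G2 x)%E)); last first.
  apply: (wnorm_le_add q1 (ltW L10) (ltW L20) mG1 mG2 _ E1 E2) => x; exact: lee_abs_add.
have mw s : 0 < s <= t' -> measurable_fun [set: Rn R N] (fun x => u s x - heat s u0 x).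
  by move=> st; apply: measurable_funB; [exact: mu_|exact: measurable_heat].
apply: le_wnorm_ae => //.
- apply/measurable_EFinP; apply: measurable_funB; apply: mw; first by rewrite t'0 lexx.
  by rewrite t0 ltW.
- exact: emeasurable_funD.
apply: filterS2 (ueq t Jt) (ueq t' Jt') => x [_ iu ut] [_ iu' ut'].
rewrite abse_EFin ut ut' [leRHS](gee0_abs (adde_ge0 (G10 x) (G20 x))).
have cancelE (k k' d d' : R) : (k' + d' - k') - (k + d - k) = d' - d by ring.
rewrite cancelE; exact: Rintegral_difference.
Qed.

End time_regularity.

Lemma powR_small (R : realType) (K th e : R) : 0 < K -> 0 < th -> 0 < e ->
  exists2 d : R, 0 < d & forall x, 0 <= x <= d -> K * x `^ th <= e.
Proof.
move=> K0 th0 e0; exists ((e / K) `^ th^-1); first by rewrite powR_gt0// divr_gt0.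
move=> x /andP[x0 xd]; rewrite mulrC -ler_pdivlMr//.
have eK0 : 0 <= e / K by rewrite divr_ge0 ?ltW.
rewrite -[leRHS](powRr1 eK0) -(mulVf (lt0r_neq0 th0)) powRrM.
by rewrite ge0_ler_powR ?nnegrE ?powR_ge0 ?(ltW th0).
Qed.

Section regularity.
Context {R : realType} {N : nat}.
Local Notation mu := (@lebesgue_Rn R N).
Local Notation leb := (@lebesgue_measure R).
Implicit Types (alpha g t : R) (q : \bar R) (u v : R -> Rn R N -> R).

(** [g - nu = nu alpha]: the power of time in the auxiliary bound is exactly the smoothing
    exponent. *)
Lemma auxiliary_exponentE alpha g (x : R) : 0 < alpha ->
  x + g / (alpha + 1) * alpha / 2 = (g - g / (alpha + 1)) / 2 + x.
Proof. by move=> al0; field; rewrite gt_eqF// addr_gt0. Qed.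

(** From the time-weighted bound to continuity in [L^q_g]. At positive times the free flow is
    Lipschitz away from 0 and the Duhamel term is Hoelder continuous. The time set is any interval
    starting at 0, so the statement serves [[0, T]] and [[0, Tmax[] alike. *)
Lemma mild_bounded_solution alpha g q (J : set R) (T0 : R) (u0 : Rn R N -> R) u :
  let nu := g / (alpha + 1) in let r := ((alpha + 1)%:E * q)%E in
  let a := (g - nu) / 2 + N%:R / 2 * (fine q^-1%E - fine r^-1%E) in
  0 < alpha -> 0 < g < N%:R -> ((N%:R / (N%:R - g))%:E < q)%E -> a * (alpha + 1) < 1 ->
  (forall t, J t -> 0 <= t) -> (forall s t, 0 <= s <= t -> J t -> J s) -> J T0 -> 0 < T0 ->
  weighted_Lq g q u0 -> (forall t, J t -> measurable_fun [set: _] (u t)) ->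
  (forall T, J T -> 0 < T -> exists2 M : R, 0 < M & forall t, 0 < t <= T ->
    (wnorm nu r (EFin \o u t) <= (M * t `^ (- a))%:E)%E) ->
  integral_equation alpha u0 J u -> bounded_solution alpha g q u0 J u.
Proof.
move=> nu r a al0 /andP[g0 gN'] qN b1 Jge Jdown JT0 T00 [mu0 u0oo] mu_ uM ueq.
have gN : 0 <= g < N%:R by rewrite (ltW g0).
have gg : 0 <= g <= g by rewrite (ltW g0) lexx.
have q1 : (1 <= q)%E by apply: gt1_exponent qN => //; exact: ltW.
have al10 : 0 < alpha + 1 by rewrite addr_gt0.
have a0 : 0 < a.
  rewrite /a ltr_pwDl//; first by rewrite divr_gt0// subr_gt0 /nu gtr_pMr// invf_lt1// ltrDr.
  rewrite mulr_ge0 ?divr_ge0// subr_ge0 fine_inve_mul// ler_pdivrMr// ler_peMr ?fine_inve_ge0//.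
  by rewrite lerDr ltW.
have b01 : 0 < a * (alpha + 1) < 1 by rewrite mulr_gt0.
have th0 : 0 < 1 - a * (alpha + 1) by rewrite subr_gt0.
have [A A0 u0A] := wnorm_lty_bound u0oo.
have [Cm Cm0 Hm] := @wnorm_mild_part R N alpha g q al0 gN qN b1.
have [Ch Ch0 Hh] := @mild_part_holder R N alpha g q al0 gN qN b01.
have [Cd Cd0 Hd] := @wnorm_heat_time_diff R N g q gN qN.
have [Ck Ck0 Hk] := @wnorm_heat R N g g 1 q gg gN' (lexx 1) qN.
have heatA t : 0 < t -> (wnorm g q (EFin \o heat t u0) <= (Ck * A)%:E)%E.
  move=> t0; have := Hk t A u0 t0 A0 mu0 u0A.
  by rewrite mul1e !subrr mulr0 mul0r addr0 oppr0 powRr0 mulr1.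
have mh t : measurable_fun [set: Rn R N] (heat t u0) by exact: measurable_heat.
have Jm t T : J T -> 0 < t <= T -> measurable_fun [set: _] (u t).
  by move=> JT /andP[t0 tT]; apply: mu_; apply: Jdown JT; rewrite (ltW t0).
have mild T : J T -> 0 < T -> exists2 K, 0 < K & forall t, 0 < t <= T ->
    (wnorm g q (EFin \o (fun x => u t x - heat t u0 x)%R) <= (K * t `^ (1 - a * (alpha + 1)))%:E)%E.
  move=> JT TT0; have [M M0 HM] := uM T JT TT0.
  exists (M `^ (alpha + 1) * Cm); first by rewrite mulr_gt0 ?powR_gt0.
  move=> t tT; case/andP: (tT) => t0 tT'.
  have Jt : J t by apply: Jdown JT; rewrite (ltW t0).
  have := Hm t M J u0 u t0 M0 Jt mu0 (fun s => Jm s t Jt) _ ueq; rewrite mulrA; apply => s /andP[s0 st].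
  by apply: HM; rewrite s0 (le_trans st).
have ae0 : J 0 -> {ae mu, forall x, u 0 x = u0 x}.
  by move=> J0; apply: filterS (ueq 0 J0) => x [_ _ ->]; rewrite heat0 duhamel_time0 addr0.
have J0 : J 0 by apply: Jdown JT0; rewrite lexx ltW.
have uLq t : J t -> weighted_Lq g q (u t).
  move=> Jt; split; first exact: mu_.
  have := Jge t Jt; rewrite le_eqVlt => /predU1P[t0|t0].
    rewrite (_ : weighted_norm g q (u t) = weighted_norm g q u0)//.
    apply: (@eq_wnorm_ae _ _ g q (EFin \o u t) (EFin \o u0)) => //.
    - by apply/measurable_EFinP; exact: mu_.
    - exact/measurable_EFinP.
    by rewrite -t0; apply: filterS (ae0 J0) => x /= ->.
  have [K K0 HK] := mild t Jt t0.
  have tt : 0 < t <= t by rewrite t0 lexx.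
  have B0 : 0 <= K * t `^ (1 - a * (alpha + 1)) by rewrite mulr_ge0 ?powR_ge0 ?(ltW K0).
  have B1 : 0 <= Ck * A by rewrite mulr_ge0 ?ltW.
  suff : (wnorm g q (EFin \o u t) < +oo)%E by [].
  apply: le_lt_trans (wnorm_le_add q1 B0 B1 _ _ _ (HK t tt) (heatA t t0)) (ltry _).
  - by apply/measurable_EFinP; apply: measurable_funB => //; exact: mu_.
  - exact/measurable_EFinP.
  move=> x; rewrite !abse_EFin -EFinD lee_fin.
  by rewrite -{1}(subrK (heat t u0 x) (u t x)) ler_normD.
have diff T : J T -> 0 < T -> exists2 K, 0 < K & forall t t', 0 < t < t' -> t' <= T ->
    (wnorm g q (EFin \o (fun x => u t' x - u t x)%R) <=
      (Cd * A * ((t' - t) / t) + K * (t' - t) `^ (1 - a * (alpha + 1)))%:E)%E.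
  move=> JT TT0; have [M M0 HM] := uM T JT TT0.
  exists (M `^ (alpha + 1) * Ch); first by rewrite mulr_gt0 ?powR_gt0.
  move=> t t' tt t'T; case/andP: (tt) => t0 tt'; have t'0 := lt_trans t0 tt'.
  have Jt' : J t' by apply: Jdown JT; rewrite (ltW t'0).
  have Jt : J t by apply: Jdown Jt'; rewrite (ltW t0) ltW.
  have H1 := Hh t t' M J u0 u tt M0 Jt Jt' mu0 (fun s => Jm s t' Jt') _ ueq.
  have one : 0 < (1 : R) <= 1 by rewrite ltr01 lexx.
  have H2 := Hd 1 t t' A u0 one tt A0 mu0 u0A.
  have quot0 : 0 <= (t' - t) / t by rewrite divr_ge0 ?subr_ge0 ?(ltW t0) ?(ltW tt').
  rewrite (powRr1 quot0) in H2.
  rewrite [Cd * _ * A]mulrAC in H2.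
  have B2 : 0 <= Cd * A * ((t' - t) / t).
    by rewrite !mulr_ge0 ?invr_ge0 ?subr_ge0 ?(ltW Cd0) ?(ltW A0) ?(ltW tt') ?(ltW t0).
  have B1 : 0 <= M `^ (alpha + 1) * Ch * (t' - t) `^ (1 - a * (alpha + 1)).
    by rewrite !mulr_ge0 ?powR_ge0 ?(ltW Ch0).
  have {}H1 : (wnorm g q (EFin \o (fun x => u t' x - heat t' u0 x - (u t x - heat t u0 x))%R) <=
      (M `^ (alpha + 1) * Ch * (t' - t) `^ (1 - a * (alpha + 1)))%:E)%E.
    rewrite -mulrA; apply: H1 => s /andP[s0 st]; apply: HM.
    by rewrite s0 (le_trans st).
  apply: (wnorm_le_add q1 B2 B1 _ _ _ H2 H1).
  - by apply/measurable_EFinP; exact: measurable_funB.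
  - by apply/measurable_EFinP; apply: measurable_funB; apply: measurable_funB => //; exact: mu_.
  move=> x; rewrite !abse_EFin -EFinD lee_fin.
  have cancelE (p k p' k' : R) : p' - p = k' - k + (p' - k' - (p - k)) by ring.
  by rewrite {1}(cancelE (u t x) (heat t u0 x) (u t' x) (heat t' u0 x)) ler_normD.
have contpos s : J s -> 0 < s -> forall e, 0 < e -> exists2 d, 0 < d &
    forall t, J t -> `|s - t| < d -> (wnorm g q (EFin \o (fun x => u t x - u s x)%R) <= e%:E)%E.
  move=> Js s0 e e0.
  (* A time of [J] that bounds all times of [J] close to [s]: one beyond [s] if there is any,
     otherwise [s] itself. *)
  have [T [JT sT [d1 d10 Hd1]]] : exists T, [/\ J T, s <= T &
      exists2 d, 0 < d & forall t, J t -> `|s - t| < d -> t <= T].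
    have [[T [JT sT]]|H] := pselect (exists T, J T /\ s < T).
      exists T; split => //; first exact: ltW.
      exists (T - s); first by rewrite subr_gt0.
      by move=> t _; rewrite ltr_distlC => /andP[_]; rewrite addrC subrK => /ltW.
    exists s; split => //; exists 1 => // t Jt _; rewrite leNgt; apply/negP => st.
    by apply: H; exists t.
  have TT0 : 0 < T by exact: lt_le_trans sT.
  have [K K0 HK] := diff T JT TT0.
  have e20 : 0 < e / 2 by rewrite divr_gt0.
  have [d2 d20 Hd2] := powR_small K0 th0 e20.
  pose d3 := e / 2 / (Cd * A / (s / 2)).
  have CA0 : 0 < Cd * A / (s / 2) by rewrite !mulr_gt0 ?invr_gt0 ?divr_gt0.
  have d30 : 0 < d3 by rewrite divr_gt0.
  have pair t t' : 0 < t < t' -> s / 2 <= t -> t' <= T -> t' - t <= d2 -> t' - t <= d3 ->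
      (wnorm g q (EFin \o (fun x => u t' x - u t x)%R) <= e%:E)%E.
    move=> tt st t'T h2 h3; apply: le_trans (HK t t' tt t'T) _.
    case/andP: tt => t0 tt'; rewrite lee_fin [leRHS]splitr; apply: lerD; last first.
      by apply: Hd2; rewrite subr_ge0 (ltW tt').
    apply: (@le_trans _ _ (Cd * A / (s / 2) * d3)); last by rewrite /d3 mulrC divfK ?gt_eqF.
    rewrite -[leRHS]mulrA; apply: ler_wpM2l; first by rewrite mulr_ge0 ?ltW.
    rewrite mulrC; apply: ler_pM => //; rewrite ?invr_ge0 ?subr_ge0 ?(ltW t0) ?(ltW tt')//.
    by rewrite lef_pV2 ?posrE ?divr_gt0.
  exists (Num.min (Num.min d1 d2) (Num.min d3 (s / 2))).
    by rewrite !lt_min d10 d20 d30 divr_gt0.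
  move=> t Jt; rewrite !lt_min => /andP[/andP[h1 h2] /andP[h3 h4]].
  have tT := Hd1 t Jt h1.
  have st2 : s / 2 <= t by move: h4; rewrite ltr_distlC => /andP[h _]; move: h; lra.
  have t0 : 0 < t by apply: lt_le_trans st2; rewrite divr_gt0.
  have [ts|ts|->] := ltgtP t s; last 1 first.
  - rewrite (_ : (fun x => u s x - u s x) = (fun _ => 0)); last by apply/funext => x; rewrite subrr.
    by rewrite wnorm_cst0// lee_fin ltW.
  - rewrite ger0_norm ?subr_ge0 ?(ltW ts)// in h2 h3.
    have := pair t s; rewrite t0 ts st2 sT (ltW h2) (ltW h3) => /(_ isT isT isT isT isT).
    by apply: le_trans; apply: le_wnorm => // x; rewrite !abse_EFin distrC.
  - rewrite ler0_norm ?subr_le0 ?(ltW ts)// opprB in h2 h3.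
    apply: pair; rewrite ?s0 ?ts ?(ltW h2) ?(ltW h3)//.
    by rewrite ler_pdivrMr// ler_peMr// ?(ltW s0)// ler1n.
(* At time 0 the free flow is continuous by [strong_continuity_at0], which asks for a finite
   exponent; for [q = +oo] time 0 is excluded from the claim. *)
have cont0 : q != +oo%E -> forall e, 0 < e -> exists2 d, 0 < d &
    forall t, J t -> `|0 - t| < d -> (wnorm g q (EFin \o (fun x => u t x - u 0 x)%R) <= e%:E)%E.
  case: q qN q1 @r @a b1 uM a0 b01 th0 u0oo u0A Hm Hh Hd Hk heatA mild uLq diff contpos => [p| |]//.
  move=> qN q1 r a b1 uM a0 b01 th0 u0oo u0A _ _ _ _ _ mild uLq _ _ _ e e0.
  have e20 : 0 < e / 2 by rewrite divr_gt0.
  have [_ _ /(_ _ e20)[d1 d10 Hd1]] := strong_continuity_at0 gN qN mu0 u0oo.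
  have [K K0 HK] := mild T0 JT0 T00.
  have [d2 d20 Hd2] := powR_small K0 th0 e20.
  exists (Num.min d1 (Num.min d2 T0)); first by rewrite !lt_min d10 d20.
  move=> t Jt; have t0 := Jge t Jt; rewrite sub0r normrN ger0_norm// !lt_min => /andP[h1 /andP[h2 h3]].
  have [->|tn0] := eqVneq t 0.
    rewrite (_ : (fun x => u 0 x - u 0 x) = (fun _ => 0)); last by apply/funext => x; rewrite subrr.
    by rewrite wnorm_cst0// lee_fin ltW.
  have {tn0}t0' : 0 < t by rewrite lt_neqAle eq_sym tn0.
  have H1 : (wnorm g p%:E (EFin \o (fun x => heat t u0 x - u0 x)%R) <= (e / 2)%:E)%E.
    by apply: Hd1; rewrite t0' h1.
  have H2 : (wnorm g p%:E (EFin \o (fun x => u t x - heat t u0 x)%R) <= (e / 2)%:E)%E.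
    apply: le_trans (HK t _) _; first by rewrite t0' ltW.
    by rewrite lee_fin; apply: Hd2; rewrite t0 ltW.
  rewrite (@eq_wnorm_ae _ _ _ _ _ (EFin \o (fun x => u t x - u0 x)%R))//; last 3 first.
  - by apply/measurable_EFinP; apply: measurable_funB; exact: mu_.
  - by apply/measurable_EFinP; apply: measurable_funB => //; exact: mu_.
  - by apply: filterS (ae0 J0) => x /= ->.
  rewrite [e]splitr; apply: (wnorm_le_add q1 (ltW e20) (ltW e20) _ _ _ H2 H1).
  - by apply/measurable_EFinP; apply: measurable_funB => //; exact: mu_.
  - by apply/measurable_EFinP; exact: measurable_funB.
  move=> x; rewrite !abse_EFin -EFinD lee_fin.
  have cancelE (k k' k'' : R) : k - k'' = k - k' + (k' - k'') by ring.
  by rewrite {1}(cancelE _ (heat t u0 x)) ler_normD.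
split; last first.
  move=> T JT; have [TT0|TT0] := ltP 0 T; last first.
    by exists 0 => t /andP[t0 /(lt_le_trans t0)]; rewrite ltNge TT0.
  have [M M0 HM] := uM T JT TT0; exists M => t tT; have t0 : 0 < t by case/andP: tT.
  rewrite auxiliary_exponentE// -/nu -/r -/a.
  apply: le_trans (lee_wpmul2l _ (HM t tT)) _; first by rewrite lee_fin powR_ge0.
  by rewrite -EFinM lee_fin mulrCA -gt0_powRD// subrr powRr0 mulr1.
have sub t : (if q == +oo%E then J `\ 0 else J) t -> J t by case: ifP => // _ [].
split => //.
  split => [t /sub|s Js]; first exact: uLq.
  apply: cvg_ereal0 => [x|e e0]; first exact: Lnorm_ge0.
  have Js' := sub s Js.
  have [d d0 Hd'] : exists2 d, 0 < d & forall t, J t -> `|s - t| < d ->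
      (wnorm g q (EFin \o (fun x => u t x - u s x)%R) <= e%:E)%E.
    have := Jge s Js'; rewrite le_eqVlt => /predU1P[s0|s0]; last exact: contpos.
    rewrite -s0 in Js *; apply: cont0 => //.
    by apply/eqP => qoo; move: Js; rewrite qoo eqxx => -[_ /=]; apply.
  apply/nbhs_ballP; exists d => // t /= st Jt; exact: Hd' (sub t Jt) st.
move=> _; apply: cvg_ereal0 => [x|e e0]; first exact: Lnorm_ge0.
have [K K0 HK] := mild T0 JT0 T00.
have [d d0 Hd'] := powR_small K0 th0 e0.
near=> t; apply: le_trans (HK t _) _.
  by apply/andP; split; near: t; [exact: nbhs_right_gt|exact: nbhs_right_le].
rewrite lee_fin; apply: Hd'; apply/andP; split; near: t; [exact: nbhs_right_ge|exact: nbhs_right_le].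
Unshelve. all: by end_near. Qed.

End regularity.

(** * Restart and maximal solutions *)

(** Fubini's theorem where absolute convergence is known in one order, for a function measurable
    over [D] only and extended by 0. Integrability of the inner integral is part of the conclusion,
    since a restarted equation must also converge absolutely. *)
Lemma Rintegral_exchange d1 d2 (T1 : measurableType d1) (T2 : measurableType d2) (R : realType)
    (m1 : {sigma_finite_measure set T1 -> \bar R}) (m2 : {sigma_finite_measure set T2 -> \bar R})
    (D : set T1) (F : T1 * T2 -> R) : measurable D ->
  measurable_fun (D `*` [set: T2]) F ->
  (\int[m2]_y \int[m1]_(x in D) `|F (x, y)|%:E < +oo)%E ->
  (forall x, D x -> m2.-integrable setT (fun y => (F (x, y))%:E)) ->
  m1.-integrable D (fun x => (\int[m2]_y F (x, y))%:E) /\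
  \int[m1]_(x in D) \int[m2]_y F (x, y) = \int[m2]_y \int[m1]_(x in D) F (x, y).
Proof.
move=> mD mF Foo Fi.
have mDT : measurable (D `*` [set: T2]) by exact: measurableX.
pose f := (EFin \o F) \_ (D `*` [set: T2]).
have mf : measurable_fun [set: T1 * T2] f.
  by apply/(measurable_restrictT _ mDT)/measurable_EFinP.
have fE x y : f (x, y) = if x \in D then (F (x, y))%:E else 0%E.
  by rewrite /f patchE in_setX in_setT andbT.
have fi : (m1 \x m2)%E.-integrable setT f.
  apply/integrable21ltyP; [exact: mf|apply: le_lt_trans Foo].
  apply: le_integral_nonneg => y _.
    by apply: integral_ge0.
  rewrite [leRHS]integral_mkcond; apply: le_integral_nonneg => x _; first exact: abse_ge0.
  by rewrite fE patchE; case: ifP => _ //; rewrite abse0.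
have FE x : D x -> (\int[m2]_y f (x, y) = (\int[m2]_y F (x, y))%:E)%E.
  move=> Dx; rewrite /Rintegral fineK; last exact: (@integrable_fin_num _ _ _ m2 _ _ _ (Fi x Dx)).
  by apply: eq_integral => y _; rewrite fE mem_set.
have Fmk : (fun x => \int[m2]_y f (x, y))%E = (fun x => (\int[m2]_y F (x, y))%:E) \_ D.
  apply/funext => x; rewrite patchE; case: ifPn => [/set_mem/FE//|xD].
  by rewrite integral0_eq// => y _; rewrite fE (negbTE xD).
have iF : m1.-integrable D (fun x => (\int[m2]_y F (x, y))%:E).
  by apply/integrable_mkcond => //; rewrite -Fmk; exact: integrable_fubini_F.
split => //.
have GE : {ae m2, forall y, (\int[m1]_x f (x, y))%E = (\int[m1]_(x in D) F (x, y))%:E}.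
  apply: filterS (ae_integrable2 fi) => y iy.
  have fyE : (fun x => f (x, y)) = (fun x => (F (x, y))%:E) \_ D.
    by apply/funext => x; rewrite fE patchE.
  rewrite fyE -integral_mkcond /Rintegral fineK//.
  apply: (@integrable_fin_num _ _ _ m1) => //.
  by apply/integrable_mkcond => //; rewrite -fyE.
have mG : measurable_fun [set: T2] (fun y => (\int[m1]_(x in D) F (x, y))%:E).
  apply/measurable_EFinP.
  apply: (@measurable_Rintegral_param _ _ _ _ _ m1 D (fun z => F (z.2, z.1))) => //.
  apply: (@measurable_comp _ _ _ _ _ _ (D `*` [set: T2]) F _ (fun z => (z.2, z.1))) => //.
  - by move=> _ [[y x] [_ /= xD] <-].
  - by apply: measurable_funTS; exact: measurable_swap.
rewrite /Rintegral; congr fine.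
transitivity (\int[m1]_x \int[m2]_y f (x, y))%E.
  by rewrite Fmk -integral_mkcond.
rewrite Fubini//; apply: ae_eq_integral => //.
- exact: (measurable_fubini_G fi).
- by apply: filterS GE => y + _.
Qed.

Section restart.
Context {R : realType} {N : nat}.
Local Notation mu := (@lebesgue_Rn R N).
Local Notation leb := (@lebesgue_measure R).
Implicit Types (alpha g t s : R) (q : \bar R) (u v : R -> Rn R N -> R).

(** The semigroup property of the kernel combined with Fubini's theorem. It holds at every [x],
    because [heat_abs] is finite everywhere on [L^q_g]. *)
Lemma heat_heat g q t s (f : Rn R N -> R) x : 0 <= g < N%:R -> ((N%:R / (N%:R - g))%:E < q)%E ->
  0 < t -> 0 < s -> measurable_fun [set: _] f -> (wnorm g q (EFin \o f) < +oo)%E ->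
  heat s (heat t f) x = heat (t + s) f x.
Proof.
move=> gN qN t0 s0 mf foo; case/andP: (gN) => g0 gN'.
have gg : 0 <= g <= g by rewrite g0 lexx.
have mf' : measurable_fun [set: Rn R N] (EFin \o f) by exact/measurable_EFinP.
have mk r y : measurable_fun [set: Rn R N] (fun z => heat_kernel r y z).
  by have /measurable_EFinP := @measurable_kernel R N r y.
have foot y : (heat_abs t (EFin \o f) y < +oo)%E by exact: (heat_abs_lty_norm _ gN qN).
pose F (z : Rn R N * Rn R N) := heat_kernel s x z.2 * (heat_kernel t z.2 z.1 * f z.1).
have mF : measurable_fun [set: Rn R N * Rn R N] F.
  apply: measurable_funM; first exact: (measurableT_comp (mk s x)).
  apply: measurable_funM; last exact: (measurableT_comp mf).
  by apply: measurable_heat_kernel => //; exact: measurable_cst.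
have absF z y : `|F (z, y)| = heat_kernel s x y * (heat_kernel t y z * `|f z|).
  rewrite /F/= normrM (ger0_norm (heat_kernel_ge0 _ _ _)) normrM.
  by rewrite (ger0_norm (heat_kernel_ge0 _ _ _)).
have [A A0 fA] := wnorm_lty_bound foo.
have oo : (\int[mu]_y \int[mu]_z `|F (z, y)|%:E < +oo)%E.
  have [C C0 HC] := wnorm_heat_abs gg gN' (lexx 1) qN.
  have H1 : (heat_abs s (heat_abs t (EFin \o f)) x < +oo)%E.
    have := HC t A _ t0 A0 mf' fA; rewrite mul1e !subrr mulr0 mul0r addr0 oppr0 powRr0 mulr1.
    by apply: (heat_abs_lty _ gN qN s0); rewrite ?mulr_gt0//; exact: measurable_heat_abs.
  apply: le_lt_trans H1; apply: le_integral_nonneg => y _; first exact: integral_ge0.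
  rewrite gee0_abs ?heat_abs_ge0// -ge0_integralZl_EFin ?heat_kernel_ge0//.
  - apply: le_integral_nonneg => z _; first by rewrite lee_fin.
    by rewrite absF.
  - by move=> z _; rewrite mule_ge0 ?abse_ge0// lee_fin heat_kernel_ge0.
  - by apply: emeasurable_funM; [exact: measurable_kernel|exact: measurableT_comp].
have innerE z : (\int[mu]_y `|(F (z, y))%:E| = (heat_kernel (t + s) x z * `|f z|)%:E)%E.
  transitivity (\int[mu]_y ((heat_kernel s x y * heat_kernel t y z)%:E * `|f z|%:E))%E.
    by apply: eq_integral => y _; rewrite abse_EFin -EFinM absF mulrA.
  rewrite ge0_integralZr ?lee_fin//.
  - by rewrite heat_kernel_semigroup// addrC EFinM.
  - apply/measurable_EFinP; apply: measurable_funM => //.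
    by apply: measurable_heat_kernel => //; exact: measurable_cst.
  - by move=> y _; rewrite lee_fin mulr_ge0 ?heat_kernel_ge0.
have Fi z : [set: Rn R N] z -> mu.-integrable setT (fun y => (F (z, y))%:E).
  move=> _; apply/integrableP; split; last by rewrite innerE ltry.
  by apply/measurable_EFinP; exact: (measurableT_comp mF (pair1_measurable z)).
have := @Rintegral_exchange _ _ _ _ R mu mu setT F measurableT _ oo Fi.
rewrite setXTT => /(_ mF)[_ E].
rewrite /heat !gt_eqF ?addr_gt0//.
transitivity (\int[mu]_y \int[mu]_z F (z, y)).
  apply: eq_Rintegral => y _; rewrite -RintegralZl//.
  exact/heat_abs_integrableP.
rewrite -E; apply: eq_Rintegral => z _.
have ik : mu.-integrable setT (EFin \o (fun y => heat_kernel s x y * heat_kernel t y z)).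
  apply/integrableP; split.
    apply/measurable_EFinP; apply: measurable_funM => //.
    by apply: measurable_heat_kernel => //; exact: measurable_cst.
  under eq_integral do
    rewrite abse_EFin (ger0_norm (mulr_ge0 (heat_kernel_ge0 _ _ _) (heat_kernel_ge0 _ _ _))).
  by rewrite heat_kernel_semigroup// ltry.
transitivity (\int[mu]_y (heat_kernel s x y * heat_kernel t y z * f z)).
  by apply: eq_Rintegral => y _; rewrite /F mulrA.
by rewrite RintegralZr// /Rintegral heat_kernel_semigroup//= addrC.
Qed.

(** The flow [e^(s Delta)] is carried under the time integral of the equation at [t], where it
    extends each [e^((t - z) Delta)] to [e^((t + s - z) Delta)]. The equation for [u t] holds almost
    everywhere only, but the kernel ignores null sets, so the result holds at every [x]. *)
Lemma heat_restart alpha g q t s M J (u0 : Rn R N -> R) u :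
  let nu := g / (alpha + 1) in let r := ((alpha + 1)%:E * q)%E in
  let a := (g - nu) / 2 + N%:R / 2 * (fine q^-1%E - fine r^-1%E) in
  0 < alpha -> 0 <= g < N%:R -> ((N%:R / (N%:R - g))%:E < q)%E -> a * (alpha + 1) < 1 ->
  0 < t -> 0 < s -> 0 < M -> J t -> weighted_Lq g q u0 ->
  (forall s, 0 < s <= t -> measurable_fun [set: _] (u s)) ->
  (forall s, 0 < s <= t -> (wnorm nu r (EFin \o u s) <= (M * s `^ (- a))%:E)%E) ->
  (wnorm g q (EFin \o u t) < +oo)%E ->
  integral_equation alpha u0 J u -> forall x,
  leb.-integrable `]0, t[ (fun z => (heat (t + s - z) (nonlinearity alpha (u z)) x)%:E) /\
  heat s (u t) x = heat (t + s) u0 x +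
    \int[leb]_(z in `]0, t[) heat (t + s - z) (nonlinearity alpha (u z)) x.
Proof.
move=> nu r a al0 gN qN b1 t0 s0 M0 Jt [mu0 u0oo] mu_ uM utoo ueq x; case/andP: (gN) => g0 gN'.
have q1 : (1 <= q)%E by exact: gt1_exponent qN.
have gg : 0 <= g <= g by rewrite g0 lexx.
have a0 : 0 <= a by exact: smoothing_exponent_ge0.
have lt_le z : 0 < z < t -> 0 < z <= t by move=> /andP[-> /ltW].
have Ms0 z : 0 < z < t -> 0 < M * z `^ (- a).
  by move=> /andP[z0 _]; rewrite mulr_gt0// powR_gt0.
have ms z (zt : 0 < z < t) := mu_ z (lt_le z zt).
have us z (zt : 0 < z < t) := uM z (lt_le z zt).
have Foo z : 0 < z < t -> (wnorm g q (EFin \o nonlinearity alpha (u z)) < +oo)%E.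
  by move=> zt; apply: le_lt_trans (wnorm_nonlinearity al0 q1 (Ms0 _ zt) (ms z zt) (us z zt)) (ltry _).
have mF z : 0 < z < t -> measurable_fun [set: _] (nonlinearity alpha (u z)).
  by move=> zt; apply: measurable_nonlinearity; exact: ms.
have mh := measurable_duhamel_time_section gN qN Jt ms Foo ueq.
pose h z y := heat (t - z) (nonlinearity alpha (u z)) y.
pose G y := (\int[leb]_(z in `]0%R, t[) `|h z y|%:E)%E.
have mG : measurable_fun [set: Rn R N] G by exact: measurable_heat_time_integral.
have [C C0 HC] := wnorm_duhamel_source al0 gN qN a0 b1.
have GL := HC t M u t0 M0 ms us mh.
have Goo : (heat_abs s G x < +oo)%E.
  apply: (heat_abs_lty _ gN qN s0 _ mG GL).
  by rewrite !mulr_gt0 ?powR_gt0.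
have hoo z y : 0 < z < t -> heat s (h z) y = heat (t + s - z) (nonlinearity alpha (u z)) y.
  move=> zt; have tz0 : 0 < t - z by case/andP: zt; rewrite subr_gt0.
  by rewrite (heat_heat _ gN qN tz0 s0 (mF z zt) (Foo z zt)) addrAC.
have hfin z : 0 < z < t -> (wnorm g q (EFin \o h z) < +oo)%E.
  move=> zt; have tz0 : 0 < t - z by case/andP: zt; rewrite subr_gt0.
  have [A A0 FA] := wnorm_lty_bound (Foo z zt).
  have [Ck Ck0 Hk] := wnorm_heat gg gN' (lexx 1) qN.
  have := Hk (t - z) A _ tz0 A0 (mF z zt) FA; rewrite mul1e => /le_lt_trans; apply.
  by rewrite ltry.
have mhz z : 0 < z < t -> measurable_fun [set: _] (h z).
  by move=> zt; apply: measurable_heat; exact: mF.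
pose F (w : R * Rn R N) := heat_kernel s x w.2 * h w.1 w.2.
have mk : measurable_fun [set: Rn R N] (fun z => heat_kernel s x z).
  by have /measurable_EFinP := @measurable_kernel R N s x.
have mFF : measurable_fun (`]0, t[ `*` [set: Rn R N]) F.
  apply: measurable_funM => //; apply: measurable_funTS.
  exact: (measurableT_comp mk).
have absF z y : `|F (z, y)| = heat_kernel s x y * `|h z y|.
  by rewrite /F/= normrM (ger0_norm (heat_kernel_ge0 _ _ _)).
have oo : (\int[mu]_y \int[leb]_(z in `]0%R, t[) `|F (z, y)|%:E < +oo)%E.
  apply: le_lt_trans Goo; apply: le_integral_nonneg => y _; first exact: integral_ge0.
  have G0 : (0 <= G y)%E by apply: integral_ge0 => z _; rewrite lee_fin.
  rewrite (gee0_abs G0) -ge0_integralZl_EFin ?heat_kernel_ge0//.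
    by apply: le_integral_nonneg => z _; [rewrite lee_fin|rewrite absF].
  apply/measurable_EFinP; apply: measurableT_comp => //.
  apply: (@measurable_comp _ _ _ _ _ _ (`]0%R, t[ `*` [set: Rn R N])
    (fun w => heat (t - w.1) (nonlinearity alpha (u w.1)) w.2) _ (fun z => (z, y))) => //.
  - exact: measurableX.
  - by move=> _ [z zt <-].
  - by apply: measurable_funTS; exact: (@pair2_measurable _ _ (measurableTypeR R) (Rn R N)).
have Fi z : `]0%R, t[%classic z -> mu.-integrable setT (fun y => (F (z, y))%:E).
  rewrite /= in_itv/= => zt; apply/heat_abs_integrableP; first exact: mhz.
  by apply: (heat_abs_lty_norm _ gN qN s0); [exact: mhz|exact: hfin].
have [iF E] := @Rintegral_exchange _ _ _ _ R leb mu `]0%R, t[%classic F (measurable_itv _) mFF oo Fi.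
have innerE z : 0 < z < t -> \int[mu]_y F (z, y) = heat (t + s - z) (nonlinearity alpha (u z)) x.
  by move=> zt; rewrite -hoo// /heat gt_eqF.
split.
  apply: eq_integrable iF => // z; rewrite inE/= in_itv/= => zt.
  by rewrite innerE.
have mut : measurable_fun [set: _] (u t) by apply: mu_; rewrite t0 lexx.
pose Dt y := u t y - heat t u0 y.
have mheat0 : measurable_fun [set: Rn R N] (heat t u0) by exact: measurable_heat.
have mDt : measurable_fun [set: Rn R N] Dt by exact: measurable_funB.
have h0oo : (wnorm g q (EFin \o heat t u0) < +oo)%E.
  have [A A0 FA] := wnorm_lty_bound u0oo.
  have [Ck Ck0 Hk] := wnorm_heat gg gN' (lexx 1) qN.
  have := Hk t A _ t0 A0 mu0 FA; rewrite mul1e => /le_lt_trans; apply.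
  by rewrite ltry.
have HD : heat s (u t) x = heat (t + s) u0 x + heat s Dt x.
  rewrite -heatB//; [|exact: (heat_abs_lty_norm _ gN qN)|exact: (heat_abs_lty_norm _ gN qN)].
  by rewrite (heat_heat _ gN qN)// addrC subrK.
rewrite HD; congr (_ + _).
have -> : \int[leb]_(z in `]0%R, t[) heat (t + s - z) (nonlinearity alpha (u z)) x =
    \int[leb]_(z in `]0%R, t[) \int[mu]_y F (z, y).
  by apply: eq_Rintegral => z; rewrite inE/= in_itv/= => zt; rewrite innerE.
rewrite E /heat gt_eqF// /Rintegral; congr fine.
apply: ae_eq_integral => //.
- by apply/measurable_EFinP; exact: measurable_funM.
- apply/measurable_EFinP.
  apply: (@measurable_Rintegral_param _ _ _ _ _ leb `]0%R, t[%classic (fun w => F (w.2, w.1))) => //.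
  apply: (@measurable_comp _ _ _ _ _ _ (`]0%R, t[ `*` [set: Rn R N]) F _ (fun w => (w.2, w.1))) => //.
  + exact: measurableX.
  + by move=> _ [[y z] [_ /= zD] <-].
  + by apply: measurable_funTS; exact: (@measurable_swap _ _ (Rn R N) (measurableTypeR R)).
apply: filterS (ueq t Jt) => y [_ iu uy] _; congr EFin.
have iu' : leb.-integrable `]0, t[ (EFin \o (fun z => h z y)).
  by apply: integrableS iu => //; apply: subset_itv; rewrite bnd_simp.
rewrite -/(Rintegral _ _ _) /F/= RintegralZl// /Dt uy addrC addKr; congr (_ * _).
rewrite /duhamel; rewrite /Rintegral integral_itv_bndoo//.
by case/integrableP: iu'.
Qed.

End restart.

Section interval_integrals.
Context {R : realType}.
Local Notation leb := (@lebesgue_measure R).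
Implicit Types (f : R -> R) (a b c : R).

Lemma integrable_itv_oo_cc f a b : leb.-integrable `]a, b[ (EFin \o f) ->
  leb.-integrable `[a, b] (EFin \o f).
Proof.
move=> /integrableP[/measurable_EFinP mf foo]; apply/integrableP; split.
  by apply/measurable_EFinP; exact: measurable_fun_itv_cc mf.
rewrite (integral_itv_bndoo true false)//.
by apply/measurable_EFinP; exact: measurableT_comp.
Qed.

Lemma integrable_itv_cat f a b c : a <= b -> b <= c ->
  leb.-integrable `[a, b] (EFin \o f) -> leb.-integrable `[b, c] (EFin \o f) ->
  leb.-integrable `[a, c] (EFin \o f).
Proof.
move=> ab bc /integrableP[m1 f1] ibc.
have /integrableP[m2 f2] : leb.-integrable `]b, c] (EFin \o f).
  by apply: integrableS ibc => //; apply: subset_itv; rewrite bnd_simp.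
have E : `[a, c]%classic = `[a, b] `|` `]b, c].
  apply/seteqP; split => x /=; rewrite !in_itv/=.
    by move=> /andP[ax xc]; case: (leP x b) => xb; [left|right]; rewrite ?ax ?xc.
  by move=> [/andP[-> xb]|/andP[bx ->]]; rewrite ?(le_trans xb)// (le_trans ab)// ltW.
have mU : measurable_fun (`[a, b] `|` `]b, c]) (EFin \o f) by exact/measurable_funU.
rewrite E; apply/integrableP; split => //.
rewrite ge0_integral_setU//=.
- exact: lte_add_pinfty.
- by apply/measurable_EFinP; apply: measurableT_comp => //; exact/measurable_EFinP.
apply/disj_setPS => x [] /=; rewrite !in_itv/= => /andP[_ xb] /andP[bx _].
by move: (le_lt_trans xb bx); rewrite ltxx.
Qed.

Lemma Rintegral_translate f a b c : leb.-integrable `[a, b] (EFin \o f) ->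
  leb.-integrable `[a - c, b - c] (EFin \o (fun x => f (x + c))) /\
  \int[leb]_(x in `[a - c, b - c]) f (x + c) = \int[leb]_(x in `[a, b]) f x.
Proof.
move=> /integrableP[mf foo].
have pre : (fun x => x + c) @^-1` `[a, b] = `[(a - c), (b - c)]%classic.
  by apply/seteqP; split => x /=; rewrite !in_itv/= => /andP[? ?]; apply/andP; split; lra.
have shift (h : R -> \bar R) : measurable_fun `[a, b] h -> (forall x, `[a, b]%classic x -> 0 <= h x)%E ->
    (\int[leb]_(x in `[(a - c)%R, (b - c)%R]) h (x + c)%R = \int[leb]_(x in `[a, b]) h x)%E.
  by move=> mh h0; rewrite -(integral_shift c (measurable_itv _) mh h0) pre.
split.
  apply/integrableP; split; last first.
    rewrite (shift (fun x => `|(f x)%:E|%E))//; exact: measurableT_comp.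
  have mp : measurable_fun `[a - c, b - c] (fun x : R => x + c).
    by apply: measurable_funD => //; exact: measurable_id.
  apply: (measurable_comp _ _ mf mp) => //.
  by rewrite -pre => _ [x xab <-].
rewrite /Rintegral; congr fine; rewrite integralE [RHS]integralE.
congr (_ - _)%E.
  have Hp := shift _ (measurable_funepos mf) (fun x _ => funepos_ge0 _ x).
  by rewrite -Hp; apply: eq_integral => x _; rewrite !funeposE.
have Hn := shift _ (measurable_funeneg mf) (fun x _ => funeneg_ge0 _ x).
by rewrite -Hn; apply: eq_integral => x _; rewrite !funenegE.
Qed.

End interval_integrals.

Section mild_solutions.
Context {R : realType} {N : nat}.
Local Notation mu := (@lebesgue_Rn R N).
Local Notation leb := (@lebesgue_measure R).
Implicit Types (alpha g t T : R) (q : \bar R) (u v : R -> Rn R N -> R).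

Definition smoothing_exponent alpha g q : R := (g - g / (alpha + 1)) / 2 +
  N%:R / 2 * (fine q^-1%E - fine ((alpha + 1)%:E * q)^-1%E).

Definition mild_bound alpha g q T u := exists2 M : R, 0 < M & forall t, 0 < t <= T ->
  (wnorm (g / (alpha + 1)) ((alpha + 1)%:E * q) (EFin \o u t) <=
    (M * t `^ (- smoothing_exponent alpha g q))%:E)%E.

(** The working class for restriction, time shift and gluing: only measurable slices, the bound near
    time 0 and the equation are carried along. Continuity in norm is recovered afterwards by
    [mild_solution_bounded]. *)
Definition mild_solution alpha g q (u0 : Rn R N -> R) T u :=
  [/\ forall t, 0 <= t <= T -> measurable_fun [set: _] (u t), mild_bound alpha g q T u
    & integral_equation alpha u0 `[0, T] u].

Context (alpha g : R) (q : \bar R) (N0 : (0 < N)%N) (al0 : 0 < alpha) (gN : 0 < g < N%:R)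
  (qN : ((N%:R / (N%:R - g))%:E < q)%E) (b1 : smoothing_exponent alpha g q * (alpha + 1) < 1).

Let gN' : 0 <= g < N%:R. Proof. by case/andP: gN => /ltW -> ->. Qed.
Let q1 : (1 <= q)%E. Proof. by case/andP: gN' => g0 gN''; exact: gt1_exponent qN. Qed.
Let a0 : 0 <= smoothing_exponent alpha g q.
Proof. by case/andP: gN' => g0 _; exact: smoothing_exponent_ge0. Qed.

Lemma mild_solution_bounded (u0 : Rn R N -> R) T u : weighted_Lq g q u0 -> 0 < T ->
  mild_solution alpha g q u0 T u -> bounded_solution alpha g q u0 `[0, T] u.
Proof.
move=> u0L T0 [mu_ [M M0 uM] ueq].
apply: (@mild_bounded_solution R N alpha g q `[0, T]%classic T) => //.
- by move=> t /=; rewrite in_itv/= => /andP[].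
- move=> s t /andP[s0 st]; rewrite /= !in_itv/= => /andP[_ tT].
  by rewrite s0 (le_trans st).
- by rewrite /= in_itv/= lexx ltW.
move=> T' /=; rewrite in_itv/= => /andP[_ T'T] _; exists M => // t /andP[t0 tT'].
by apply: uM; rewrite t0 (le_trans tT').
Qed.

Lemma mild_solution_le (u0 : Rn R N -> R) T T' u : T' <= T ->
  mild_solution alpha g q u0 T u -> mild_solution alpha g q u0 T' u.
Proof.
move=> T'T [mu_ [M M0 uM] ueq]; split.
- by move=> t /andP[t0 tT]; apply: mu_; rewrite t0 (le_trans tT).
- by exists M => // t /andP[t0 tT]; apply: uM; rewrite t0 (le_trans tT).
by move=> t /=; rewrite in_itv/= => /andP[t0 tT]; apply: ueq; rewrite /= in_itv/= t0 (le_trans tT).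
Qed.

Lemma integral_equation_time0 (u0 : Rn R N -> R) (J : set R) u : J 0 ->
  integral_equation alpha u0 J u -> {ae mu, forall x, u 0 x = u0 x}.
Proof.
by move=> J0 ueq; apply: filterS (ueq 0 J0) => x [_ _ ->]; rewrite heat0 duhamel_time0 addr0.
Qed.

Lemma mild_solution_unique (u0 : Rn R N -> R) T u v :
  (forall t, 0 < t <= T -> measurable_fun [set: _] (u t)) -> mild_bound alpha g q T u ->
  integral_equation alpha u0 `[0, T] u ->
  (forall t, 0 < t <= T -> measurable_fun [set: _] (v t)) -> mild_bound alpha g q T v ->
  integral_equation alpha u0 `[0, T] v -> eq_on `[0, T] u v.
Proof.
move=> mu_ [M M0 uM] ueq mv [L L0 vL] veq t; rewrite /= in_itv/= => /andP[].
rewrite le_eqVlt => /predU1P[<- T0|t0 tT].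
  have J0 : `[0, T]%classic 0 by rewrite /= in_itv/= lexx.
  apply: filterS2 (integral_equation_time0 J0 ueq) (integral_equation_time0 J0 veq).
  by move=> x -> ->.
have T0 : 0 < T by exact: lt_le_trans tT.
have sub (w : R -> Rn R N -> R) : integral_equation alpha u0 `[0, T] w ->
    integral_equation alpha u0 `]0, T] w.
  move=> weq s /=; rewrite in_itv/= => /andP[s0 sT]; apply: weq.
  by rewrite /= in_itv/= sT ltW.
have bnd (w : R -> Rn R N -> R) K : K <= M + L -> (forall t, 0 < t <= T ->
    (wnorm (g / (alpha + 1)) ((alpha + 1)%:E * q) (EFin \o w t) <=
    (K * t `^ (- smoothing_exponent alpha g q))%:E)%E) -> forall t, 0 < t <= T ->
    (wnorm (g / (alpha + 1)) ((alpha + 1)%:E * q) (EFin \o w t) <=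
    ((M + L) * t `^ (- smoothing_exponent alpha g q))%:E)%E.
  move=> KM H s sT; apply: le_trans (H s sT) _.
  by rewrite lee_fin ler_wpM2r ?powR_ge0.
apply: (@integral_equation_unique R N alpha g (smoothing_exponent alpha g q) T (M + L) q u0) => //.
- by have := b1; rewrite mulrDr mulr1 addrC.
- exact: addr_gt0.
- by apply: bnd uM; rewrite lerDl ltW.
- by apply: bnd vL; rewrite lerDr ltW.
- exact: sub.
- exact: sub.
- by rewrite t0.
Qed.

Lemma source_lty T u : (forall t, 0 < t <= T -> measurable_fun [set: _] (u t)) ->
  mild_bound alpha g q T u -> forall t, 0 < t <= T ->
  (wnorm g q (EFin \o nonlinearity alpha (u t)) < +oo)%E.
Proof.
move=> mu_ [M M0 uM] t tT; have t0 : 0 < t by case/andP: tT.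
have Mt0 : 0 < M * t `^ (- smoothing_exponent alpha g q) by rewrite mulr_gt0 ?powR_gt0.
by apply: le_lt_trans (wnorm_nonlinearity al0 q1 Mt0 (mu_ t tT) (uM t tT)) (ltry _).
Qed.

Lemma kernel_source_integrable T u t x : (forall t, 0 < t <= T -> measurable_fun [set: _] (u t)) ->
  mild_bound alpha g q T u -> t <= T ->
  {ae leb, forall s : R, 0 < s < t -> mu.-integrable [set: Rn R N] (fun y =>
    (heat_kernel (t - s) x y * nonlinearity alpha (u s) y)%:E)}.
Proof.
move=> mu_ uM tT; apply: aeW => s /andP[s0 st].
have sT : 0 < s <= T by rewrite s0 (le_trans (ltW st)).
have mF : measurable_fun [set: _] (nonlinearity alpha (u s)).
  by apply: measurable_nonlinearity; exact: mu_.
apply/heat_abs_integrableP => //; apply: (heat_abs_lty_norm _ gN' qN) => //.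
  by rewrite subr_gt0.
exact: (source_lty mu_ uM sT).
Qed.

Lemma integral_equation_at0 (u0 : Rn R N -> R) u : {ae mu, forall x, u 0 x = u0 x} ->
  integral_equation alpha u0 [set 0] u.
Proof.
move=> uu0 _ ->; apply: filterS uu0 => x ->; split.
- by apply: aeW => s /andP[s0] /(lt_trans s0); rewrite ltxx.
- rewrite set_itv1; apply/integrableP; split; first exact: measurable_fun_set1.
  by rewrite integral_set1.
by rewrite heat0 duhamel_time0 addr0.
Qed.

Lemma mild_solution_restart (u0 : Rn R N -> R) T u t s x : weighted_Lq g q u0 -> 0 < t <= T ->
  0 < s -> mild_solution alpha g q u0 T u ->
  leb.-integrable `]0, t[ (fun z => (heat (t + s - z) (nonlinearity alpha (u z)) x)%:E) /\
  heat s (u t) x = heat (t + s) u0 x +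
    \int[leb]_(z in `]0, t[) heat (t + s - z) (nonlinearity alpha (u z)) x.
Proof.
move=> u0L tT s0 usol; case/andP: (tT) => t0 tleT; have T0 := lt_le_trans t0 tleT.
have [[[uL _] _ _] _] := mild_solution_bounded u0L T0 usol.
have utoo : (wnorm g q (EFin \o u t) < +oo)%E.
  suff Jt : (if q == +oo%E then `[0, T]%classic `\ 0 else `[0, T]%classic) t by have [] := uL t Jt.
  have tI : `[0, T]%classic t by rewrite /= in_itv/= ltW.
  by case: ifP => // _; split => //= t00; rewrite t00 ltxx in t0.
have [mu_ [M M0 uM] ueq] := usol.
apply: (@heat_restart R N alpha g q t s M `[0, T]%classic u0 u) => //.
- by rewrite /= in_itv/= ltW.
- by move=> z /andP[z0 zt]; apply: mu_; rewrite (ltW z0) (le_trans zt).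
- by move=> z /andP[z0 zt]; apply: uM; rewrite z0 (le_trans zt).
Qed.

Lemma mild_solution_shift (u0 : Rn R N -> R) T u t : weighted_Lq g q u0 -> 0 < t < T ->
  mild_solution alpha g q u0 T u ->
  mild_solution alpha g q (u t) (T - t) (fun s => u (t + s)).
Proof.
move=> u0L /andP[t0 tT] usol; have [mu_ [M M0 uM] ueq] := usol.
have shiftI s : 0 <= s <= T - t -> 0 <= t + s <= T.
  by move=> /andP[s0 sT]; rewrite addr_ge0 ?(ltW t0)//= addrC -lerBrDr.
have mus s : 0 <= s <= T - t -> measurable_fun [set: Rn R N] (u (t + s)).
  by move=> /shiftI; exact: mu_.
have uMs : mild_bound alpha g q (T - t) (fun s => u (t + s)).
  exists M => // s /andP[s0 sT].
  have /andP[_ tsT] := shiftI s (introT andP (conj (ltW s0) sT)).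
  apply: le_trans (uM (t + s) _) _; first by rewrite addr_gt0.
  by rewrite lee_fin ler_wpM2l ?(ltW M0)// ge0_powRN_le// s0 lerDr ltW.
split => // s; rewrite /= in_itv/= => /andP[].
rewrite le_eqVlt => /predU1P[<- _|s0 sT].
  by apply: (@integral_equation_at0 (u t) (fun s => u (t + s))) => //; apply: aeW => x; rewrite addr0.
have /andP[ts0 tsT] := shiftI s (introT andP (conj (ltW s0) sT)).
have tsI : `[0, T]%classic (t + s) by rewrite /= in_itv/= ts0.
have musp s' : 0 < s' <= T - t -> measurable_fun [set: Rn R N] (u (t + s')).
  by move=> /andP[s'0 s'T]; apply: mus; rewrite (ltW s'0).
apply: filterS (ueq _ tsI) => x [_ iu ux].
have tleT : 0 < t <= T by rewrite t0 ltW.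
have [ir ->] := mild_solution_restart x u0L tleT s0 usol.
have tts : t <= t + s by rewrite lerDl ltW.
pose f z := heat (t + s - z) (nonlinearity alpha (u z)) x.
have if1 : leb.-integrable `[t, t + s] (EFin \o f).
  by apply: integrableS iu => //; apply: subset_itv; rewrite bnd_simp// ltW.
have if2 : leb.-integrable `]t, t + s] (EFin \o f).
  by apply: integrableS if1 => //; apply: subset_itv; rewrite bnd_simp.
have [ish Esh] := Rintegral_translate t if1.
have fE z : f (z + t) = heat (s - z) (nonlinearity alpha (u (t + z))) x.
  by rewrite /f [z + t]addrC (_ : t + s - (t + z) = s - z)//; ring.
rewrite subrr (_ : t + s - t = s) in ish Esh; last by ring.
split.
- exact: (kernel_source_integrable x musp uMs sT).
- by apply: eq_integrable ish => // z _; rewrite /= fE.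
rewrite ux -addrA; congr (_ + _).
have -> : duhamel alpha (fun s' => u (t + s')) s x = \int[leb]_(z in `[t, (t + s)]) f z.
  by rewrite -Esh /duhamel; apply: eq_Rintegral => z _; rewrite fE.
rewrite -(Rintegral_itv_obnd_cbnd if2) /duhamel.
rewrite -(Rintegral_itvB (f := f) (x := t) iu); [|by rewrite bnd_simp ltW|by rewrite bnd_simp].
have -> : \int[leb]_(z in `]0, t[) heat (t + s - z) (nonlinearity alpha (u z)) x =
    \int[leb]_(z in `[0, t]) f z.
  rewrite /Rintegral [in RHS]integral_itv_bndoo//.
  by case/integrableP: ir.
rewrite addrC subrK; reflexivity.
Qed.

(** The restarted solution [v] overlaps [u] on [[t, T]], where uniqueness identifies them. Hence [v]
    is used only after [T], away from its own singularity at [t], and the glued function keeps a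
    bound that is singular at time 0 alone. *)
Lemma mild_solution_extend (u0 : Rn R N -> R) T tau u v t : weighted_Lq g q u0 -> 0 < t < T ->
  T < t + tau -> mild_solution alpha g q u0 T u -> mild_solution alpha g q (u t) tau v ->
  exists w, mild_solution alpha g q u0 (t + tau) w.
Proof.
move=> u0L tT Ttau usol mv; case/andP: (tT) => t0 tltT.
have Tt0 : 0 < T - t by rewrite subr_gt0.
have [msh bsh esh] := mild_solution_shift u0L tT usol.
have Ttt : T - t <= tau by rewrite lerBlDl ltW.
have tau0 : 0 < tau by exact: lt_le_trans Ttt.
have [mv_ [L L0 vL] veq] := mv; have [mu_ [M M0 uM] ueq] := usol.
have [mvT bvT evT] := mild_solution_le Ttt mv.
pose w z := if z <= T then u z else v (z - t).
have mvp s : 0 < s <= tau -> measurable_fun [set: Rn R N] (v s).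
  by move=> /andP[s0 st]; apply: mv_; rewrite (ltW s0).
(* After time [t] the glued function is [v] up to null sets: by definition beyond [T], by uniqueness
   for the shifted equation on the overlap. *)
have wv s : 0 < s <= tau -> {ae mu, forall x, w (t + s) x = v s x}.
  move=> /andP[s0 stau]; rewrite /w; case: ifPn => [tsT|_]; last first.
    by apply: aeW => x; rewrite (_ : t + s - t = s)//; ring.
  apply: (@mild_solution_unique (u t) (T - t) (fun s => u (t + s)) v) => //.
  - by move=> z /andP[z0 zT]; apply: msh; rewrite (ltW z0).
  - by move=> z /andP[z0 zT]; apply: mvT; rewrite (ltW z0).
  - by rewrite /= in_itv/= (ltW s0) lerBrDl.
have mw z : 0 <= z <= t + tau -> measurable_fun [set: Rn R N] (w z).
  move=> /andP[z0 zt]; rewrite /w; case: ifPn => [zT|]; first by apply: mu_; rewrite z0.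
  rewrite -ltNge => Tz; apply: mv_; rewrite subr_ge0 (le_trans (ltW tltT) (ltW Tz))/=.
  by rewrite lerBlDl.
have mwp z : 0 < z <= t + tau -> measurable_fun [set: Rn R N] (w z).
  by move=> /andP[z0 zt]; apply: mw; rewrite (ltW z0).
have bw : mild_bound alpha g q (t + tau) w.
  pose a := smoothing_exponent alpha g q.
  (* Beyond [T], [v] is bounded by [L (T - t) ^ (- a)]; the factor [(t + tau) ^ a] turns this
     constant into a multiple of [z ^ (- a)] on the whole interval. *)
  exists (M + L * (T - t) `^ (- a) * (t + tau) `^ a).
    by rewrite ltr_wpDr// !mulr_ge0 ?powR_ge0 ?(ltW L0).
  move=> z /andP[z0 zt]; rewrite /w; case: ifPn => [zT|].
    apply: le_trans (uM z _) _; first by rewrite z0.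
    by rewrite lee_fin ler_wpM2r ?powR_ge0// lerDl !mulr_ge0 ?powR_ge0 ?(ltW L0).
  rewrite -ltNge => Tz.
  apply: le_trans (vL (z - t) _) _.
    by rewrite subr_gt0 (lt_trans tltT Tz) lerBlDl.
  rewrite lee_fin -/a; apply: (@le_trans _ _ (L * (T - t) `^ (- a))).
    by rewrite ler_wpM2l ?(ltW L0)// ge0_powRN_le// Tt0 lerB// ltW.
  have B0 : 0 <= L * (T - t) `^ (- a) by rewrite mulr_ge0 ?powR_ge0 ?(ltW L0).
  rewrite mulrDl (le_trans (_ : _ <= L * (T - t) `^ (- a) * (t + tau) `^ a * z `^ (- a)))//; last first.
    by rewrite lerDr mulr_ge0 ?powR_ge0 ?(ltW M0).
  rewrite -[leRHS]mulrA ler_peMr//.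
  apply: (@le_trans _ _ (z `^ a * z `^ (- a))); first by rewrite -gt0_powRD// subrr powRr0.
  by rewrite ler_wpM2r ?powR_ge0// ge0_ler_powR ?nnegrE ?(ltW z0)// addr_ge0 ?ltW.
exists w; split => // z; rewrite /= in_itv/= => /andP[z0 zt].
have [zT|Tz] := leP z T.
  have zI : `[0, T]%classic z by rewrite /= in_itv/= z0.
  have wu s : `[0, z]%classic s -> w s = u s.
    by rewrite /= in_itv/= => /andP[s0 sz]; rewrite /w (le_trans sz zT).
  apply: filterS (ueq z zI) => x [_ iu ux]; split.
  - exact: (kernel_source_integrable x mwp bw zt).
  - by apply: eq_integrable iu => // s; rewrite inE => /wu ->.
  have zz : `[0, z]%classic z by rewrite /= in_itv/= z0 lexx.
  rewrite (wu z zz) ux; congr (_ + _); apply: eq_Rintegral => s; rewrite inE => /wu ->; reflexivity.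
pose s := z - t; have zE : z = t + s by rewrite /s; ring.
have s0 : 0 < s by rewrite subr_gt0 (lt_trans tltT).
have stau : s <= tau by rewrite /s lerBlDl.
have sI : `[0, tau]%classic s by rewrite /= in_itv/= (ltW s0).
have tleT : 0 < t <= T by rewrite t0 ltW.
pose f y x := heat (z - y) (nonlinearity alpha (w y)) x.
apply: filterS2 (veq s sI) (wv s (introT andP (conj s0 stau))) => x [_ iv vx] wx.
have [ir Er] := mild_solution_restart x u0L tleT s0 usol; rewrite -zE in ir Er wx.
have f1 y : 0 < y < t -> heat (z - y) (nonlinearity alpha (u y)) x = f y x.
  by move=> /andP[y0 yt]; rewrite /f /w (le_trans (ltW yt) (ltW tltT)).
have f2 y : 0 < y < s -> heat (s - y) (nonlinearity alpha (v y)) x = f (y + t) x.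
  move=> /andP[y0 ys].
  have y0t : 0 < y <= tau by rewrite y0 (le_trans (ltW ys)).
  rewrite /f (_ : z - (y + t) = s - y); last by rewrite /s; ring.
  apply: eq_heat_ae.
  - by rewrite subr_eq0 gt_eqF.
  - by apply: measurable_nonlinearity; exact: mvp.
  - apply: measurable_nonlinearity; apply: mwp.
    by rewrite addr_gt0//= addrC lerD2l; case/andP: y0t.
  by apply: filterS (wv y y0t) => y'; rewrite addrC /nonlinearity => ->.
have if1o : leb.-integrable `]0, t[ (EFin \o f ^~ x).
  by apply: eq_integrable ir => // y; rewrite inE/= in_itv/= => yt; rewrite /= f1.
have ivo : leb.-integrable `]0, s[ (EFin \o (fun y => f (y + t) x)).
  have ivs : leb.-integrable `]0, s[ (fun y => (heat (s - y) (nonlinearity alpha (v y)) x)%:E).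
    apply: (integrableS _ _ _ iv); [exact: measurable_itv..|by apply: subset_itv; rewrite bnd_simp].
  by apply: eq_integrable ivs => // y; rewrite inE/= in_itv/= => ys; rewrite /= f2.
have ivc := integrable_itv_oo_cc ivo.
have [if2 E2] := Rintegral_translate (- t) ivc.
have E3 : (fun y => f (y - t + t) x) = f ^~ x by apply/funext => y; rewrite subrK.
rewrite E3 opprK add0r in if2; have sz : s + t = z by rewrite /s subrK.
rewrite sz in if2.
have if1 := integrable_itv_oo_cc if1o.
have tz : t <= z by exact: le_trans (ltW tltT) (ltW Tz).
have ift := integrable_itv_cat (ltW t0) tz if1 if2.
split.
- exact: (kernel_source_integrable x mwp bw zt).
- exact: ift.
rewrite wx vx Er -addrA; congr (_ + _).
have -> : \int[leb]_(y in `]0, t[) heat (z - y) (nonlinearity alpha (u y)) x =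
    \int[leb]_(y in `[0, t]) f y x.
  rewrite /Rintegral [in RHS]integral_itv_bndoo; last by case/integrableP: if1o.
  by congr fine; apply: eq_integral => y; rewrite inE/= in_itv/= => yt; exact: (congr1 EFin (f1 y yt)).
have -> : duhamel alpha v s x = \int[leb]_(y in `[t, z]) f y x.
  have -> : \int[leb]_(y in `[t, z]) f y x = \int[leb]_(y in `[0, s]) f (y + t) x.
    by rewrite -E2 opprK add0r sz; apply: eq_Rintegral => y _; rewrite subrK.
  have ivs : leb.-integrable `]0, s[ (fun y => (heat (s - y) (nonlinearity alpha (v y)) x)%:E).
    apply: (integrableS _ _ _ iv); [exact: measurable_itv..|by apply: subset_itv; rewrite bnd_simp].
  rewrite /duhamel /Rintegral [in LHS]integral_itv_bndoo; last by case/integrableP: ivs.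
  rewrite [in RHS]integral_itv_bndoo; last by case/integrableP: ivo.
  by congr fine; apply: eq_integral => y; rewrite inE/= in_itv/= => ys; exact: (congr1 EFin (f2 y ys)).
have if2' : leb.-integrable `]t, z] (EFin \o f ^~ x).
  apply: (integrableS _ _ _ if2); [exact: measurable_itv..|by apply: subset_itv; rewrite bnd_simp].
rewrite -(Rintegral_itv_obnd_cbnd if2') /duhamel.
rewrite -(Rintegral_itvB (f := f ^~ x) (x := t) ift); [|by rewrite bnd_simp ltW|by rewrite bnd_simp].
rewrite addrC subrK; reflexivity.
Qed.

End mild_solutions.

(** * The maximal solution and its rate of blow-up *)

Section maximal_solution.
Context {R : realType} {N : nat}.
Local Notation mu := (@lebesgue_Rn R N).
Local Notation leb := (@lebesgue_measure R).
Local Notation smoothing_exponent := (@smoothing_exponent R N).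
Implicit Types (t T : R) (u v w : R -> Rn R N -> R).

Context (alpha g : R) (q : \bar R) (N0 : (0 < N)%N) (al0 : 0 < alpha) (gN : 0 < g < N%:R)
  (qN : ((N%:R / (N%:R - g))%:E < q)%E) (b1 : smoothing_exponent alpha g q * (alpha + 1) < 1).

Let gN' : 0 <= g < N%:R. Proof. by case/andP: gN => /ltW -> ->. Qed.
Let q1 : (1 <= q)%E. Proof. by case/andP: gN' => g0 gN''; exact: gt1_exponent qN. Qed.

Lemma mild_solution_ae (u0 : Rn R N -> R) T u w : mild_solution alpha g q u0 T u ->
  (forall t, 0 <= t <= T -> measurable_fun [set: _] (w t)) -> eq_on `[0, T] w u ->
  mild_solution alpha g q u0 T w.
Proof.
move=> [mu_ [M M0 uM] ueq] mw wu.
have wu' t : 0 <= t <= T -> {ae mu, forall x, w t x = u t x}.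
  by move=> tT; apply: wu; rewrite /= in_itv.
have wM t : 0 < t <= T -> (wnorm (g / (alpha + 1)) ((alpha + 1)%:E * q) (EFin \o w t) <=
    (M * t `^ (- smoothing_exponent alpha g q))%:E)%E.
  move=> tT; have tT' : 0 <= t <= T by case/andP: tT => /ltW -> ->.
  rewrite (@eq_wnorm_ae _ _ _ _ _ (EFin \o u t)); first exact: uM.
  - by apply: ge1_mule => //; rewrite lerDr ltW.
  - by apply/measurable_EFinP; exact: mw.
  - by apply/measurable_EFinP; exact: mu_.
  - by apply: filterS (wu' t tT') => x /= ->.
have bw : mild_bound alpha g q T w by exists M.
have mwp t : 0 < t <= T -> measurable_fun [set: Rn R N] (w t).
  by move=> /andP[t0 tT]; apply: mw; rewrite (ltW t0).
split; [exact: mw|exact: bw|] => t tI; have := tI; rewrite /= in_itv/= => tT; case/andP: (tT) => t0 tleT.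
apply: filterS2 (ueq t tI) (wu' t tT) => x [_ iu ux] wx.
have E s : `[0, t]%classic s -> heat (t - s) (nonlinearity alpha (w s)) x =
    heat (t - s) (nonlinearity alpha (u s)) x.
  (* At [s = t] the flow is the identity, so the equality of [w] and [u] at the point [x] itself is
     used; for [s < t] the kernel ignores null sets. *)
  rewrite /= in_itv/= => /andP[s0]; rewrite le_eqVlt => /predU1P[->|st].
    by rewrite subrr !heat0 /nonlinearity wx.
  have sT : 0 <= s <= T by rewrite s0 (le_trans (ltW st)).
  apply: eq_heat_ae.
  - by rewrite subr_eq0 gt_eqF.
  - by apply: measurable_nonlinearity; exact: mw.
  - by apply: measurable_nonlinearity; exact: mu_.
  - by apply: filterS (wu' s sT) => y; rewrite /nonlinearity => ->.
split.
- exact: (kernel_source_integrable al0 gN qN x mwp bw tleT).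
- by apply: eq_integrable iu => // s; rewrite inE => /E ->.
rewrite wx ux; congr (_ + _); apply: eq_Rintegral => s; rewrite inE => /E ->; reflexivity.
Qed.

Lemma mild_solution_exists : exists2 c : R, 0 < c & forall A T (u0 : Rn R N -> R),
  0 < A -> 0 < T -> measurable_fun [set: _] u0 -> (wnorm g q (EFin \o u0) <= A%:E)%E ->
  T `^ (1 - smoothing_exponent alpha g q * (alpha + 1)) * A `^ alpha <= c ->
  exists u, mild_solution alpha g q u0 T u.
Proof.
have [c c0 H] := @local_existence R N alpha g q N0 al0 gN' qN b1.
exists c => // A T u0 A0 T0 mu0 u0A small.
have [u [M [M0 mu_ uM ueq]]] := H A T u0 A0 T0 mu0 u0A small.
exists u; split => //; last by exists M.
by move=> t _; exact: jointly_measurable_slice.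
Qed.

(* Restarting at time [t] gives existence on an interval of length [tau] as soon as
   [tau^theta |u(t)|^alpha <= c]; maximality therefore forces [(Tm - t)^theta |u(t)|^alpha >= c]. *)
Lemma maximal_mild_solution : exists2 C : R, 0 < C & forall u0 : Rn R N -> R, weighted_Lq g q u0 ->
  exists (Tmax : \bar R) w, [/\ (0 < Tmax)%E,
    forall T, (T%:E < Tmax)%E -> mild_solution alpha g q u0 T w
  & forall Tm : R, Tmax = Tm%:E -> forall t, 0 <= t < Tm ->
    ((C * (Tm - t) `^ (- ((1 - smoothing_exponent alpha g q * (alpha + 1)) / alpha)))%:E
      <= wnorm g q (EFin \o w t))%E].
Proof.
have [c c0 LE] := mild_solution_exists.
set th := 1 - smoothing_exponent alpha g q * (alpha + 1) in LE *.
have th0 : 0 < th by rewrite subr_gt0.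
exists (c `^ alpha^-1); first by rewrite powR_gt0.
move=> u0 u0L; have [mu0 u0oo] := u0L.
pose E : set R := [set T | 0 < T /\ exists u, mild_solution alpha g q u0 T u].
pose Tmax := ereal_sup (EFin @` E).
have [A A0 u0A] := wnorm_lty_bound u0oo.
have [T0 ET0] : exists T0, E T0.
  have A1 : 0 < A `^ alpha by rewrite powR_gt0.
  have [d d0 Hd] := powR_small A1 th0 c0.
  exists d; split => //; apply: (LE A d u0) => //.
  by rewrite mulrC; apply: Hd; rewrite (ltW d0) lexx.
have T0max : (T0%:E <= Tmax)%E by apply: ereal_sup_ubound; exists T0.
have Tmax0 : (0 < Tmax)%E by apply: lt_le_trans T0max; rewrite lte_fin; case: ET0.
have below T : (T%:E < Tmax)%E -> exists u, mild_solution alpha g q u0 T u.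
  move=> /ereal_sup_gt[_ [T' [_ [u uT']] <-]]; rewrite lte_fin => TT'.
  by exists u; exact: mild_solution_le (ltW TT') uT'.
(* [w t] is the value at [t] of some solution on [[0, t]]. Uniqueness makes these values coherent up
   to null sets, and [mild_solution_ae] then makes [w] a solution. *)
have /choice[w wP] : forall t, exists f, (t%:E < Tmax)%E ->
    exists2 u, mild_solution alpha g q u0 t u & f = u t.
  move=> t; have [tT|tT] := pselect (t%:E < Tmax)%E; last by exists u0.
  by have [u uP] := below t tT; exists (u t) => _; exists u.
have wsol T : (T%:E < Tmax)%E -> mild_solution alpha g q u0 T w.
  move=> TT; have [u uP] := below T TT; have [mu_ _ _] := uP.
  have ltT t : 0 <= t <= T -> (t%:E < Tmax)%E.
    by move=> /andP[_ tT]; apply: le_lt_trans TT; rewrite lee_fin.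
  have mw t : 0 <= t <= T -> measurable_fun [set: Rn R N] (w t).
    move=> tT; have [v [mv _ _] ->] := wP t (ltT t tT).
    by apply: mv; case/andP: tT => -> _ /=.
  apply: (mild_solution_ae uP mw) => t; rewrite /= in_itv/= => tT.
  have [v [mv bv ev] ->] := wP t (ltT t tT).
  have [mu' bu eu] := mild_solution_le (proj2 (andP tT)) uP.
  apply: (mild_solution_unique N0 al0 gN qN b1 (u0 := u0) (T := t)) => //.
  - by move=> s /andP[s0 st]; apply: mv; rewrite (ltW s0).
  - by move=> s /andP[s0 st]; apply: mu'; rewrite (ltW s0).
  - by rewrite /= in_itv/= lexx andbT; case/andP: tT.
exists Tmax, w; split => // Tm TmE t /andP[t0 tTm].
have tTm0 : 0 < Tm - t by rewrite subr_gt0.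
have notE T : Tm < T -> ~ E T.
  move=> TmT ET; have : (T%:E <= Tmax)%E by apply: ereal_sup_ubound; exists T.
  by rewrite TmE lee_fin leNgt TmT.
have ltTm T : T < Tm -> mild_solution alpha g q u0 T w by move=> ?; apply: wsol; rewrite TmE lte_fin.
have wL : weighted_Lq g q (w t).
  have := ltTm _ tTm; move: t0; rewrite le_eqVlt => /predU1P[<-|t0] wt.
    have [mw _ ew] := wt; have m0 : measurable_fun [set: _] (w 0) by apply: mw; rewrite lexx.
    split => //; apply: le_lt_trans u0oo.
    have I0 : `[0, 0]%classic (0 : R) by rewrite /= in_itv/= lexx.
    suff wu0 : wnorm g q (EFin \o u0) = wnorm g q (EFin \o w 0).
      by have := lexx (wnorm g q (EFin \o w 0)); rewrite -{2}wu0.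
    apply: eq_wnorm_ae => //; [exact/measurable_EFinP|exact/measurable_EFinP|].
    by apply: filterS (integral_equation_time0 I0 ew) => x /= ->.
  have [[[wLq _] _ _] _] := mild_solution_bounded al0 gN qN b1 u0L t0 wt.
  apply: wLq; have tI : `[0, t]%classic t by rewrite /= in_itv/= lexx ltW.
  by case: ifP => // _; split => //= t00; rewrite t00 ltxx in t0.
have [mwt wtoo] := wL.
rewrite leNgt; apply/negP => small.
pose B := fine (wnorm g q (EFin \o w t)).
have BE : wnorm g q (EFin \o w t) = B%:E by rewrite fineK// ge0_fin_numE ?wnorm_ge0.
have B0 : 0 <= B by rewrite fine_ge0// wnorm_ge0.
rewrite BE lte_fin in small.
set X := c `^ alpha^-1 * (Tm - t) `^ (- (th / alpha)) in small.
(* A bound strictly between the norm and the threshold: positive even if the norm is 0, as local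
   existence requires, and small enough for the existence time [tau] to exceed [Tm - t]. *)
pose A' := (B + X) / 2.
have BA' : B < A' by rewrite /A'; lra.
have A'X : A' < X by rewrite /A'; lra.
have A'0 : 0 < A' by exact: le_lt_trans BA'.
have A'al : 0 < A' `^ alpha by rewrite powR_gt0.
have XA : A' `^ alpha < c * (Tm - t) `^ (- th).
  have -> : c * (Tm - t) `^ (- th) = X `^ alpha.
    rewrite /X powRM ?powR_ge0// -!powRrM mulVf ?gt_eqF// powRr1 ?(ltW c0)//.
    by rewrite mulNr divfK ?gt_eqF.
  by rewrite gt0_ltr_powR ?nnegrE ?(ltW A'0)// (le_trans (ltW A'0)) ?ltW.
pose tau := (c / A' `^ alpha) `^ th^-1.
have cA0 : 0 < c / A' `^ alpha by rewrite divr_gt0.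
have tau0 : 0 < tau by rewrite powR_gt0.
have tauE : tau `^ th = c / A' `^ alpha by rewrite -powRrM mulVf ?gt_eqF// powRr1// ltW.
have Tmtau : Tm - t < tau.
  rewrite ltNge; apply/negP => tau_le.
  have : tau `^ th <= (Tm - t) `^ th by rewrite ge0_ler_powR ?nnegrE ?(ltW th0) ?(ltW tau0) ?(ltW tTm0).
  rewrite tauE ler_pdivrMr// leNgt => /negP; apply.
  have := XA; rewrite -(ltr_pM2l (powR_gt0 th tTm0)) => /lt_le_trans; apply.
  by rewrite mulrCA -gt0_powRD// subrr powRr0 mulr1.
have tauA : tau `^ th * A' `^ alpha <= c by rewrite tauE divfK// gt_eqF.
have wA' : (wnorm g q (EFin \o w t) <= A'%:E)%E by rewrite BE lee_fin ltW.
move: t0; rewrite le_eqVlt => /predU1P[t00|t0].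
  have I0 : `[0, 0]%classic (0 : R) by rewrite /= in_itv/= lexx.
  rewrite -t00 in wA' mwt wL Tmtau tTm; have [_ _ ew] := ltTm _ tTm.
  have u0A' : (wnorm g q (EFin \o u0) <= A'%:E)%E.
    rewrite (@eq_wnorm_ae _ _ g q (EFin \o u0) (EFin \o w 0))//; try exact/measurable_EFinP.
    by apply: filterS (integral_equation_time0 I0 ew) => x /= ->.
  have [v vP] := LE A' tau u0 A'0 tau0 mu0 u0A' tauA.
  by rewrite subr0 in Tmtau; apply: (notE tau Tmtau); split => //; exists v.
have [v vP] := LE A' tau (w t) A'0 tau0 mwt wA' tauA.
(* Gluing needs a solution on an interval that ends after [t], and [w] is known to be one only
   strictly before [Tm]. *)
have midT : (t + Tm) / 2 < Tm by lra.
have tmid : 0 < t < (t + Tm) / 2 by rewrite t0/=; lra.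
have midtau : (t + Tm) / 2 < t + tau by lra.
have [z zP] := mild_solution_extend N0 al0 gN qN b1 u0L tmid midtau (ltTm _ midT) vP.
by apply: (notE (t + tau)); [rewrite -ltrBlDl|split; [rewrite addr_gt0|exists z]].
Qed.

End maximal_solution.

(** * Blow-up and well-posedness *)

Section solutions.
Context {R : realType} {N : nat}.
Local Notation mu := (@lebesgue_Rn R N).
Implicit Types (alpha g t T : R) (q : \bar R) (u v w : R -> Rn R N -> R).

(** Continuity in the space makes the norm a continuous real function, by the reverse triangle
    inequality, and it attains a maximum on the compact interval. *)
Lemma continuous_norm_bounded g q (J : set R) a b v : (1 <= q)%E -> a <= b ->
  (forall t, a <= t <= b -> J t) -> continuous_in_weighted_Lq g q J v ->
  exists M : R, forall t, a <= t <= b -> (wnorm g q (EFin \o v t) <= M%:E)%E.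
Proof.
move=> q1 ab abJ [vL vc]; pose phi t := fine (wnorm g q (EFin \o v t)).
have phiE t : J t -> wnorm g q (EFin \o v t) = (phi t)%:E.
  by move=> /vL[_ voo]; rewrite fineK// ge0_fin_numE ?wnorm_ge0.
have mv t : J t -> measurable_fun [set: Rn R N] (EFin \o v t).
  by move=> /vL[mvt _]; exact/measurable_EFinP.
have phi0 t : 0 <= phi t by rewrite fine_ge0// wnorm_ge0.
have le_phi s t e : J s -> J t -> 0 <= e ->
    (wnorm g q (EFin \o (fun x => v t x - v s x)%R) <= e%:E)%E -> `|phi s - phi t| <= e.
  move=> Js Jt e0 d; rewrite ler_distlC; apply/andP; split.
    rewrite lerBlDr -lee_fin -phiE//.
    apply: (wnorm_le_add q1 (phi0 t) e0 (mv t Jt) _ _ _ d); last by rewrite phiE.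
      by apply/measurable_EFinP; apply: measurable_funB; [case: (vL t Jt)|case: (vL s Js)].
    move=> x; rewrite !abse_EFin -EFinD lee_fin.
    by apply: le_trans (ler_normB _ _); rewrite opprB addrC subrK.
  rewrite -lee_fin -phiE//.
  apply: (wnorm_le_add q1 (phi0 s) e0 (mv s Js) _ _ _ d); last by rewrite phiE.
    by apply/measurable_EFinP; apply: measurable_funB; [case: (vL t Jt)|case: (vL s Js)].
  move=> x; rewrite !abse_EFin -EFinD lee_fin.
  by apply: le_trans (ler_normD _ _); rewrite addrC subrK.
have cphi : {within `[a, b], continuous phi}.
  apply/subspace_continuousP => s; rewrite /= in_itv/= => sI.
  have Js := abJ s sI; apply/cvgrPdist_le => e e0.
  have /fine_cvgP[fin /cvgrPdist_le/(_ e e0) le] := vc s Js.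
  have near_J : \forall t \near within J (nbhs s), `|phi s - phi t| <= e.
    have JJ : \forall t \near within J (nbhs s), J t by apply: withinT.
    near=> t; apply: le_phi => //; [by near: t|exact: ltW|].
    have f : weighted_norm g q (v t \- v s)%R \is a fin_num by near: t.
    have h : `|0 - fine (weighted_norm g q (v t \- v s)%R)| <= e by near: t.
    have -> : wnorm g q (EFin \o (fun x => v t x - v s x)%R) =
        (fine (weighted_norm g q (v t \- v s)%R))%:E by rewrite fineK.
    rewrite lee_fin; apply: le_trans h; by rewrite sub0r normrN ler_norm.
  have near_J' : \forall t \near nbhs s, J t -> `|phi s - phi t| <= e by [].
  suff : \forall t \near nbhs s, `[a, b]%classic t -> `|phi s - phi t| <= e by [].
  by apply: filterS near_J' => t Ht tI; apply: Ht; apply: abJ; move: tI; rewrite /= in_itv.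
have [c _ Hc] := EVT_max ab cphi.
exists (phi c) => t tI; rewrite phiE ?lee_fin; last exact: abJ.
by apply: Hc; rewrite in_itv.
Unshelve. all: by end_near. Qed.

(** For [q = +oo] continuity is missing at time 0: near 0 the solution is within distance 1 of the
    bounded free flow, and the rest of the interval is compact. *)
Lemma solution_norm_bounded alpha g q T (u0 : Rn R N -> R) v : 0 <= g < N%:R ->
  ((N%:R / (N%:R - g))%:E < q)%E -> 0 < T -> weighted_Lq g q u0 ->
  solution alpha g q u0 `[0, T] v ->
  exists2 M : R, 0 < M & forall t, 0 < t <= T -> (wnorm g q (EFin \o v t) <= M%:E)%E.
Proof.
move=> gN qN T0 [mu0 u0oo] [vc v0 _]; case/andP: (gN) => g0 gN'.
have q1 : (1 <= q)%E by exact: gt1_exponent qN.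
have [qoo|qoo] := eqVneq q +oo%E; last first.
  rewrite (negbTE qoo) in vc.
  have [M HM] := continuous_norm_bounded q1 (ltW T0)
    (fun t (tI : 0 <= t <= T) => (tI : `[0, T]%classic t)) vc.
  exists (`|M| + 1); first by rewrite ltr_wpDl.
  move=> t /andP[t0 tT]; apply: le_trans (HM t _) _; first by rewrite (ltW t0).
  by rewrite lee_fin (le_trans (ler_norm _))// lerDl.
rewrite qoo eqxx -qoo in vc.
have gg : 0 <= g <= g by rewrite g0 lexx.
have [C C0 HC] := wnorm_heat gg gN' (lexx 1) qN.
have [A A0 u0A] := wnorm_lty_bound u0oo.
have heatA t : 0 < t -> (wnorm g q (EFin \o heat t u0) <= (C * A)%:E)%E.
  move=> t0; have := HC t A u0 t0 A0 mu0 u0A.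
  by rewrite mul1e !subrr mulr0 mul0r addr0 oppr0 powRr0 mulr1.
have /fine_cvgP[fin /cvgrPdist_le/(_ 1 ltr01) le] := v0 qoo.
have near0 : \forall t \near (0 : R)^'+, (weighted_norm g q (v t \- heat t u0)%R <= 1)%E.
  near=> t; have f : weighted_norm g q (v t \- heat t u0)%R \is a fin_num by near: t.
  have h : `|0 - fine (weighted_norm g q (v t \- heat t u0)%R)| <= 1 by near: t.
  rewrite -(fineK f) lee_fin; apply: le_trans h; by rewrite sub0r normrN ler_norm.
have [d d0 Hd] : exists2 d, 0 < d & forall t, 0 < t < d ->
    (weighted_norm g q (v t \- heat t u0)%R <= 1)%E.
  have /nbhs_ballP[d /= d0 H] := near0; exists d => // t /andP[t0 td].
  by apply: H => //=; rewrite /ball/= sub0r normrN gtr0_norm.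
pose c := Num.min d T / 2.
have m0 : 0 < Num.min d T by rewrite lt_min d0.
have c0 : 0 < c by rewrite divr_gt0.
have cm : c < Num.min d T by rewrite /c; lra.
have /andP[cd cT] : (c < d) && (c < T) by rewrite -lt_min.
have cI t : c <= t <= T -> (`[0, T]%classic `\ 0) t.
  move=> /andP[ct tT]; have t0 := lt_le_trans c0 ct.
  by split => /=; [rewrite in_itv/= ltW|move=> t00; rewrite t00 ltxx in t0].
have [M HM] := continuous_norm_bounded q1 (ltW cT) cI vc.
exists (`|M| + (1 + C * A)); first by rewrite ltr_wpDl// addr_gt0// mulr_gt0.
have CA0 : 0 <= C * A by rewrite mulr_ge0 ?ltW.
move=> t /andP[t0 tT]; have [tc|ct] := ltP t c; last first.
  apply: le_trans (HM t _) _; first by rewrite ct.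
  by rewrite lee_fin (le_trans (ler_norm _))// lerDl addr_ge0.
have td : 0 < t < d by rewrite t0 (lt_trans tc).
have tI : (`[0, T]%classic `\ 0) t.
  by split => /=; [rewrite in_itv/= ltW|move=> t00; rewrite t00 ltxx in t0].
have [mvt _] := vc.1 t tI.
apply: (@le_trans _ _ (1 + C * A)%:E); last by rewrite lee_fin lerDr.
have Hd' : (wnorm g q (EFin \o (fun x => v t x - heat t u0 x)%R) <= 1%:E)%E by exact: Hd.
apply: (wnorm_le_add q1 ler01 CA0 _ _ _ Hd' (heatA t t0)).
- by apply/measurable_EFinP; apply: measurable_funB => //; exact: measurable_heat.
- by apply/measurable_EFinP; exact: measurable_heat.
move=> x; rewrite !abse_EFin -EFinD lee_fin.
by apply: le_trans (ler_normD _ _); rewrite subrK.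
Unshelve. all: by end_near. Qed.

Lemma lower_bound_blowup (phi : R -> \bar R) (C k Tm : R) : 0 < C -> 0 < k -> 0 < Tm ->
  (forall t, 0 <= t < Tm -> ((C * (Tm - t) `^ (- k))%:E <= phi t)%E) ->
  phi t @[t --> Tm^'-] --> +oo%E.
Proof.
move=> C0 k0 Tm0 H; apply/cvgeyPge => A.
have A0 : 0 < (`|A| + 1) / C by rewrite divr_gt0// ltr_wpDl.
have [d d0 Hd] := powR_small A0 k0 ltr01.
near=> t.
have tTm : t < Tm by near: t; exact: nbhs_left_lt.
have t0 : 0 <= t by near: t; exact: nbhs_left_ge.
have td : Tm - d <= t by near: t; apply: nbhs_left_ge; rewrite gtrBl.
apply: le_trans (H t _); last by rewrite t0.
have Tt0 : 0 < Tm - t by rewrite subr_gt0.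
rewrite lee_fin; apply: (@le_trans _ _ (`|A| + 1)).
  by rewrite (le_trans (ler_norm _))// lerDl.
have := Hd (Tm - t); rewrite (ltW Tt0)/= lerBlDr -lerBlDl => /(_ td).
rewrite -ler_pdivlMr ?powR_gt0// div1r -powRN ler_pdivrMr// mulrC.
Unshelve. all: by end_near. Qed.

(** A continuation that includes time [Tm] would be continuous in norm there, hence bounded just
    before it, against the blow-up. *)
Lemma blowup_no_extension g q (J : set R) Tm v w : (1 <= q)%E -> J Tm ->
  (\forall t \near Tm^'-, J t) -> continuous_in_weighted_Lq g q J v ->
  (\forall t \near Tm^'-, weighted_norm g q (v t) = weighted_norm g q (w t)) ->
  weighted_norm g q (w t) @[t --> Tm^'-] --> +oo%E -> False.
Proof.
move=> q1 JTm nearJ [vL vc] vw blow.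
have [mvT vToo] := vL Tm JTm; have [B B0 vB] := wnorm_lty_bound vToo.
have /fine_cvgP[fin /cvgrPdist_le/(_ 1 ltr01) le] := vc Tm JTm.
have nearL (P : R -> Prop) : (\forall t \near within J (nbhs Tm), P t) -> \forall t \near Tm^'-, P t.
  move=> HP; have HP' : \forall t \near nbhs Tm, J t -> P t by [].
  have HP'' : \forall t \near Tm^'-, J t -> P t by exact: cvg_within HP'.
  by apply: filterS2 HP'' nearJ => t; apply.
have /cvgeyPge/(_ (1 + B + 1)) big := blow.
suff : \forall t \near Tm^'-, False by move/filter_ex => [].
near=> t.
have Jt : J t by near: t.
have f : weighted_norm g q (v t \- v Tm)%R \is a fin_num by near: t; exact: nearL.
have h : `|0 - fine (weighted_norm g q (v t \- v Tm)%R)| <= 1 by near: t; exact: nearL.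
have d : (wnorm g q (EFin \o (fun x => v t x - v Tm x)%R) <= 1%:E)%E.
  suff : (weighted_norm g q (v t \- v Tm)%R <= 1%:E)%E by [].
  rewrite -(fineK f) lee_fin; apply: le_trans h; by rewrite sub0r normrN ler_norm.
have [mvt _] := vL t Jt.
have vt : (weighted_norm g q (v t) <= (1 + B)%:E)%E.
  suff : (wnorm g q (EFin \o v t) <= (1 + B)%:E)%E by [].
  apply: (wnorm_le_add q1 ler01 (ltW B0) _ _ _ d vB).
  - by apply/measurable_EFinP; exact: measurable_funB.
  - exact/measurable_EFinP.
  by move=> x; rewrite !abse_EFin -EFinD lee_fin; apply: le_trans (ler_normD _ _); rewrite subrK.
have : ((1 + B + 1)%:E <= weighted_norm g q (w t))%E by near: t.
have <- : weighted_norm g q (v t) = weighted_norm g q (w t) by near: t.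
by move=> /le_trans/(_ vt); rewrite lee_fin; lra.
Unshelve. all: by end_near. Qed.

End solutions.

Section well_posedness.
Context {R : realType} {N : nat}.
Local Notation mu := (@lebesgue_Rn R N).
Implicit Types (t T : R) (u v w : R -> Rn R N -> R).

(** The parameters [r] and [nu] disappear, and [q > q_c] is visibly the statement that this number
    is less than 1. *)
Lemma smoothing_exponentE (alpha g : R) (q : \bar R) : 0 < alpha -> (1 <= q)%E ->
  smoothing_exponent (N := N) alpha g q * (alpha + 1) =
  alpha * g / 2 + N%:R / 2 * alpha * fine q^-1%E.
Proof.
move=> al0 q1; have al1 : 0 < alpha + 1 by rewrite addr_gt0.
rewrite /smoothing_exponent fine_inve_mul//.
by field; exact: lt0r_neq0.
Qed.

Lemma subcritical_smoothing (alpha g : R) (q : \bar R) : (0 < N)%N -> 0 < alpha -> g * alpha < 2 ->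
  (1 <= q)%E -> ((N%:R * alpha / (2 - g * alpha))%:E < q)%E ->
  smoothing_exponent (N := N) alpha g q * (alpha + 1) < 1.
Proof.
move=> N0 al0 ga2 q1 qcq; rewrite smoothing_exponentE//.
have d0 : 0 < 2 - g * alpha by rewrite subr_gt0.
case: q q1 qcq => [q| |]// q1 qcq; last by rewrite invey /= mulr0 addr0; lra.
rewrite lte_fin ltr_pdivrMr// in qcq; rewrite lee_fin in q1.
have q0 : 0 < q by exact: lt_le_trans q1.
rewrite inver (gt_eqF q0)/=.
have : N%:R * alpha / q < 2 - g * alpha by rewrite ltr_pdivrMr// [ltRHS]mulrC.
have -> : N%:R / 2 * alpha / q = N%:R * alpha / q / 2 by ring.
by move: (N%:R * alpha / q) => z; lra.
Qed.

Context (alpha g : R) (q : \bar R) (N0 : (0 < N)%N) (al0 : 0 < alpha) (gN : 0 < g < N%:R)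
  (qN : ((N%:R / (N%:R - g))%:E < q)%E) (b1 : smoothing_exponent (N := N) alpha g q * (alpha + 1) < 1).

Let gN' : 0 <= g < N%:R. Proof. by case/andP: gN => /ltW -> ->. Qed.
Let q1 : (1 <= q)%E. Proof. by case/andP: gN' => g0 gN''; exact: gt1_exponent qN. Qed.

Lemma solution_measurable (u0 : Rn R N -> R) T v : solution alpha g q u0 `[0, T] v ->
  forall t, 0 < t <= T -> measurable_fun [set: _] (v t).
Proof.
move=> [[vL _] _ _] t /andP[t0 tT].
suff /vL[] : (if q == +oo%E then `[0, T]%classic `\ 0 else `[0, T]%classic) t by [].
have tI : `[0, T]%classic t by rewrite /= in_itv/= tT ltW.
by case: ifP => // _; split => // t00; rewrite t00 ltxx in t0.
Qed.

Lemma bounded_solution_mild_bound (u0 : Rn R N -> R) T v : 0 < T ->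
  bounded_solution alpha g q u0 `[0, T] v -> mild_bound alpha g q T v.
Proof.
move=> T0 [_ vM]; have TI : `[0, T]%classic T by rewrite /= in_itv/= lexx ltW.
have [M HM] := vM T TI; exists (`|M| + 1); first by rewrite ltr_wpDl.
move=> t tT; have t0 : 0 < t by case/andP: tT.
have := HM t tT; rewrite auxiliary_exponentE// -/(smoothing_exponent (N := N) alpha g q).
set z := weighted_norm _ _ _ => h.
suff : (z <= ((`|M| + 1) * t `^ (- smoothing_exponent (N := N) alpha g q))%:E)%E by [].
rewrite powRN EFinM lee_pdivlMr ?powR_gt0// muleC.
by apply: le_trans h _; rewrite lee_fin (le_trans (ler_norm _))// lerDl.
Qed.

Lemma bounded_solution_unique (u0 : Rn R N -> R) T u v : 0 < T -> bounded_solution alpha g q u0 `[0, T] u ->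
  bounded_solution alpha g q u0 `[0, T] v -> eq_on `[0, T] u v.
Proof.
move=> T0 usol vsol; have [uS _] := usol; have [vS _] := vsol.
have [_ _ ueq] := uS; have [_ _ veq] := vS.
exact: (mild_solution_unique N0 al0 gN qN b1
  (solution_measurable uS) (bounded_solution_mild_bound T0 usol) ueq
  (solution_measurable vS) (bounded_solution_mild_bound T0 vsol) veq).
Qed.

Lemma mild_interval_to (u0 : Rn R N -> R) (Tmax : \bar R) w : weighted_Lq g q u0 -> (0 < Tmax)%E ->
  (forall T, (T%:E < Tmax)%E -> mild_solution alpha g q u0 T w) ->
  exists2 T, 0 < T & (T%:E < Tmax)%E /\ bounded_solution alpha g q u0 (interval_to Tmax) w.
Proof.
move=> u0L Tm0 wsol.
have [T0 T00 T0m] : exists2 T : R, 0 < T & (T%:E < Tmax)%E.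
  case: Tmax Tm0 {wsol} => [Tm| |]// Tm0; last by exists 1 => //; exact: ltry.
  rewrite lte_fin in Tm0; exists (Tm / 2); first by rewrite divr_gt0.
  by rewrite lte_fin; lra.
exists T0 => //; split => //.
apply: (@mild_bounded_solution R N alpha g q _ T0) => //.
- by move=> t [].
- by move=> s t /andP[s0 st] [_ tT]; split => //; apply: le_lt_trans tT; rewrite lee_fin.
- by split => //; exact: ltW.
- by move=> t [t0 tT]; have [m _ _] := wsol t tT; apply: m; rewrite t0 lexx.
- by move=> T [_ TT] _; have [_ b _] := wsol T TT.
move=> t [t0 tT]; have [_ _ e] := wsol t tT; apply: e.
by rewrite /= in_itv/= t0 lexx.
Qed.

(** The class [P] ranges between bounded solutions and all solutions, so that one proof gives
    maximality in both senses: the extension itself is a bounded solution, while no continuation of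
    either kind survives the blow-up of its norm. *)
Lemma maximal_bounded_solution : exists2 C : R, 0 < C & forall u0 : Rn R N -> R, weighted_Lq g q u0 ->
  exists T (Tmax : \bar R) w, [/\ 0 < T, bounded_solution alpha g q u0 `[0, T] w,
    forall P : set R -> (R -> Rn R N -> R) -> Prop,
      (forall J v, bounded_solution alpha g q u0 J v -> P J v) ->
      (forall J v, P J v -> solution alpha g q u0 J v) -> maximal_extension P T w Tmax w,
    blowup_alternative g q Tmax w
  & forall Tm : R, Tmax = Tm%:E -> forall t, 0 <= t < Tm ->
    ((C * (Tm - t) `^ (N%:R / 2 * fine q^-1%E - (2 - g * alpha) / (2 * alpha)))%:E
      <= weighted_norm g q (w t))%E].
Proof.
have [C C0 HC] := maximal_mild_solution N0 al0 gN qN b1.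
pose k := (1 - smoothing_exponent (N := N) alpha g q * (alpha + 1)) / alpha.
have k0 : 0 < k by rewrite divr_gt0// subr_gt0.
have kE : N%:R / 2 * fine q^-1%E - (2 - g * alpha) / (2 * alpha) = - k.
  by rewrite /k smoothing_exponentE//; field; exact: lt0r_neq0.
exists C => // u0 u0L; have [Tmax [w [Tm0 wsol low]]] := HC u0 u0L.
have [T T0 [TTm wJ]] := mild_interval_to u0L Tm0 wsol.
have blow Tm : Tmax = Tm%:E -> weighted_norm g q (w t) @[t --> Tm^'-] --> +oo%E.
  move=> E; apply: (lower_bound_blowup C0 k0 _ (low Tm E)).
  by rewrite E lte_fin in Tm0.
exists T, Tmax, w; split => //.
- by apply: mild_solution_bounded => //; exact: wsol.
- move=> P bP Ps; split => //; [exact: bP|by move=> t _; exact: aeW|].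
  move=> T' v TmT' /Ps vsol vw; have [vc _ _] := vsol.
  case: Tmax Tm0 wsol low TTm wJ blow TmT' vw => [Tm| |]// Tm0 wsol _ TTm wJ blow TmT' vw.
  rewrite lte_fin in Tm0; rewrite lee_fin in TmT'.
  have JI t : 0 < t <= T' -> (if q == +oo%E then `[0, T']%classic `\ 0 else `[0, T']%classic) t.
    move=> /andP[t0 tT]; have tI : `[0, T']%classic t by rewrite /= in_itv/= tT ltW.
    by case: ifP => // _; split => // t00; rewrite t00 ltxx in t0.
  have near0 : \forall t \near Tm^'-, 0 < t < Tm.
    by near=> t; apply/andP; split; near: t; [exact: nbhs_left_gt|exact: nbhs_left_lt].
  apply: (@blowup_no_extension R N g q _ Tm v w q1 _ _ vc _ (blow Tm erefl)).
  + by apply: JI; rewrite Tm0.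
  + by apply: filterS near0 => t /andP[t0 tTm]; apply: JI; rewrite t0 (le_trans (ltW tTm)).
  apply: filterS near0 => t /andP[t0 tTm].
  suff : wnorm g q (EFin \o v t) = wnorm g q (EFin \o w t) by [].
  apply: eq_wnorm_ae => //.
  + by apply/measurable_EFinP; apply: (solution_measurable vsol); rewrite t0 (le_trans (ltW tTm)).
  + have [m _ _] := wsol t tTm.
    by apply/measurable_EFinP; apply: m; rewrite lexx ltW.
  have : interval_to Tm%:E t by split; [exact: ltW|rewrite lte_fin].
  by move=> /vw; apply: filterS => x /= ->.
- case: Tmax Tm0 blow {HC wsol low TTm wJ} => [Tm| |]// Tm0 blow; last by left.
  by right; exists Tm => //; exact: blow.
- by move=> Tm E t tT; rewrite kE; exact: low.
Unshelve. all: by end_near. Qed.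

(* With the weight [g (alpha + 1)] and the exponent [q / (alpha + 1)] as source space, the
   auxiliary norm is that of [L^q_g] itself, which every solution controls down to time 0. *)
Lemma solution_unique (u0 : Rn R N -> R) T u v : g * (alpha + 1) < N%:R ->
  ((N%:R * (alpha + 1) / (N%:R - g * (alpha + 1)))%:E < q)%E -> 0 < T -> weighted_Lq g q u0 ->
  solution alpha g q u0 `[0, T] u -> solution alpha g q u0 `[0, T] v -> eq_on `[0, T] u v.
Proof.
move=> gaN qaN T0 u0L usol vsol; have al1 : 0 < alpha + 1 by rewrite addr_gt0.
have al10 := lt0r_neq0 al1; have g0 : 0 < g by case/andP: gN.
have d0 : 0 < N%:R - g * (alpha + 1) by rewrite subr_gt0.
have [M M0 uM] := solution_norm_bounded gN' qN T0 u0L usol.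
have [L L0 vL] := solution_norm_bounded gN' qN T0 u0L vsol.
have [_ _ ueq] := usol; have [_ _ veq] := vsol.
have [p pq pN] : exists2 p : \bar R, ((alpha + 1)%:E * p)%E = q &
    ((N%:R / (N%:R - g * (alpha + 1)))%:E < p)%E.
  move: qaN; case: q {u0L usol vsol uM vL} q1 => [q'| |]// _ h.
    exists (q' / (alpha + 1))%:E; first by rewrite -EFinM mulrC divfK.
    by rewrite lte_fin ltr_pdivlMr//; rewrite lte_fin in h; apply: le_lt_trans h; rewrite mulrAC.
  by exists +oo%E; rewrite ?ltry// gt0_muley.
have p1 : (1 <= p)%E by apply: gt1_exponent pN => //; rewrite mulr_ge0 ?ltW.
have gE : g * (alpha + 1) / (alpha + 1) = g by rewrite mulfK.
have gaI : 0 <= g * (alpha + 1) < N%:R by rewrite gaN mulr_ge0 ?ltW.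
(* The smoothing exponent of the new pair of spaces is again [alpha g / 2 + N alpha / (2 q)], so
   subcriticality is the same condition. *)
have a1 : (g * (alpha + 1) - g * (alpha + 1) / (alpha + 1)) / 2 +
    N%:R / 2 * (fine p^-1%E - fine ((alpha + 1)%:E * p)^-1%E) + 0 * alpha < 1.
  apply: le_lt_trans b1; rewrite smoothing_exponentE// -pq fine_inve_mul// gE.
  by rewrite le_eqVlt; apply/orP; left; apply/eqP; field.
have HM (z : \bar R) A : 0 < A -> A <= M + L -> (z <= A%:E)%E ->
    forall t, 0 < t -> (z <= ((M + L) * t `^ (- 0))%:E)%E.
  by move=> A0 AM zA t t0; apply: le_trans zA _; rewrite oppr0 powRr0 mulr1 lee_fin.
have ML0 : 0 < M + L by rewrite addr_gt0.
move=> t; rewrite /= in_itv/= => /andP[]; rewrite le_eqVlt => /predU1P[<- _|t0 tT].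
  have J0 : `[0, T]%classic 0 by rewrite /= in_itv/= lexx ltW.
  apply: filterS2 (integral_equation_time0 J0 ueq) (integral_equation_time0 J0 veq).
  by move=> x -> ->.
have k1 : (0 : R) * (alpha + 1) < 1 by rewrite mul0r.
apply: (@integral_equation_unique R N alpha (g * (alpha + 1)) 0 T (M + L) p u0 u v
  N0 al0 gaI pN (lexx 0) k1 a1 ML0 T0 (solution_measurable usol) (solution_measurable vsol)).
- move=> s sT; rewrite gE pq; apply: (HM _ M) (uM s sT) _ _ => //; first by rewrite lerDl ltW.
  by case/andP: sT.
- move=> s sT; rewrite gE pq; apply: (HM _ L) (vL s sT) _ _ => //; first by rewrite lerDr ltW.
  by case/andP: sT.
- by move=> s sT; apply: ueq; move: sT; rewrite /= !in_itv/= => /andP[/ltW -> ->].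
- by move=> s sT; apply: veq; move: sT; rewrite /= !in_itv/= => /andP[/ltW -> ->].
- by rewrite t0.
Qed.

End well_posedness.

Theorem theorem4p1 (R : realType) (N : nat) (alpha gamma : R)
    (N_ge1 : (1 <= N)%N) (alpha_gt0 : 0 < alpha)
    (gamma_gt0 : 0 < gamma) (gamma_ltN : gamma < N%:R)
    (gamma_lt : gamma < 2 / alpha) :
  let qc : R := N%:R * alpha / (2 - gamma * alpha) in
  (forall q : \bar R,
    gamma * (alpha + 1) < N%:R ->
    ((N%:R * (alpha + 1) / (N%:R - gamma * (alpha + 1)))%:E < q)%E ->
    (qc%:E < q)%E ->
    forall u0 : Rn R N -> R, weighted_Lq gamma q u0 ->
    exists (T : R) (u : R -> Rn R N -> R),
      [/\ 0 < T,
          solution alpha gamma q u0 `[0, T] u,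
          (forall v, solution alpha gamma q u0 `[0, T] v ->
            eq_on `[0, T] v u)
        & exists (Tmax : \bar R) (w : R -> Rn R N -> R),
            maximal_extension (solution alpha gamma q u0) T u Tmax w /\
            blowup_alternative gamma q Tmax w]) /\
  (forall q : \bar R,
    (qc%:E < q)%E ->
    ((N%:R / (N%:R - gamma))%:E < q)%E ->
    exists2 C : R, 0 < C &
    forall u0 : Rn R N -> R, weighted_Lq gamma q u0 ->
    exists (T : R) (u : R -> Rn R N -> R),
      [/\ 0 < T,
          bounded_solution alpha gamma q u0 `[0, T] u,
          (forall v, bounded_solution alpha gamma q u0 `[0, T] v ->
            eq_on `[0, T] v u)
        & exists (Tmax : \bar R) (w : R -> Rn R N -> R),
            [/\ maximal_extension (bounded_solution alpha gamma q u0)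
                  T u Tmax w,
                blowup_alternative gamma q Tmax w
              & forall Tm : R, Tmax = Tm%:E -> forall t : R, 0 <= t < Tm ->
                  ((C * (Tm - t) `^ (N%:R / 2 * fine q^-1%E
                            - (2 - gamma * alpha) / (2 * alpha)))%:E
                    <= weighted_norm gamma q (w t))%E]]).
Proof.
move=> qc; have ga2 : gamma * alpha < 2 by rewrite -ltr_pdivlMr.
have gN : 0 < gamma < N%:R by rewrite gamma_gt0.
have gN' : 0 <= gamma < N%:R by rewrite ltW.
have Ng : 0 < N%:R - gamma by rewrite subr_gt0.
have al1 : 0 < alpha + 1 by rewrite addr_gt0.
have b1 (q : \bar R) : (qc%:E < q)%E -> ((N%:R / (N%:R - gamma))%:E < q)%E ->
    smoothing_exponent (N := N) alpha gamma q * (alpha + 1) < 1.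
  move=> qcq qN; apply: subcritical_smoothing => //.
  by apply: gt1_exponent qN => //; exact: ltW.
split=> [q gaN qaN qcq|q qcq qN].
- have d0 : 0 < N%:R - gamma * (alpha + 1) by rewrite subr_gt0.
  (* The bound on [q] in (i) implies that in (ii): after clearing denominators the comparison reads
     [N <= (alpha + 1) N]. *)
  have qN : ((N%:R / (N%:R - gamma))%:E < q)%E.
    apply: le_lt_trans qaN; rewrite lee_fin ler_pdivrMr// mulrAC ler_pdivlMr//.
    rewrite -mulrA ler_wpM2l// mulrBr mulrC [leRHS]addrC.
    have := ler0n R N; have := mulr_gt0 gamma_gt0 alpha_gt0; nra.
  have [C _ H] := maximal_bounded_solution N_ge1 alpha_gt0 gN qN (b1 q qcq qN).
  move=> u0 u0L; have [T [Tmax [w [T0 [wsol wb] wmax wblow _]]]] := H u0 u0L.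
  exists T, w; split => //.
    move=> v vsol.
    (* The competitor [v] carries no auxiliary bound, so the uniqueness based on the [L^q_g] norm
       alone is the one that applies. *)
    exact: (solution_unique N_ge1 alpha_gt0 gN qN (b1 q qcq qN) gaN qaN T0 u0L vsol wsol).
  exists Tmax, w; split => //; apply: wmax => //.
  by move=> J v [].
have [C C0 H] := maximal_bounded_solution N_ge1 alpha_gt0 gN qN (b1 q qcq qN).
exists C => // u0 u0L; have [T [Tmax [w [T0 wsol wmax wblow wlow]]]] := H u0 u0L.
exists T, w; split => //.
  move=> v vsol.
  exact: (bounded_solution_unique N_ge1 alpha_gt0 gN qN (b1 q qcq qN) T0 vsol wsol).
exists Tmax, w; split => //; apply: wmax => //.
by move=> J v [].
Qed.
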